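(* The function $f(z,\tau)$ ($z\in\mathbb{C}$, $\tau\in\mathbb{H}$, $q=e^{2\pi i\tau}$) has the following transformation properties: $$f(z+1,\tau)\simeq f(z,\tau),$$ $$f(z,\tau+1)\simeq f(z,\tau),$$ $$f(z+\tau,\tau)\simeq f(z,\tau)+\Big\{\tfrac16z^3+\tfrac14z^2\tau+\tfrac16z\tau^2+\tfrac1{24}\tau^3\Big\},$$ $$f(-z,\tau)\simeq f(z,\tau).$$ The function also has the alternative expansions $$f(z,\tau)\simeq-\frac1{2\pi i}\Big\{\tfrac12z^2\log z+z^2\log\eta(\tau)\Big\}+\frac1{(2\pi i)^3}\sum_{n=1}^\infty\frac{(-1)^nE_{2n}(\tau)B_{2n}}{(2n+2)!\,(2n)}(2\pi z)^{2n+2}$$ and $$f(z,\tau)\simeq\frac1{(2\pi i)^3}Li_3(e^{2\pi iz})+\tfrac1{12}z^3-\tfrac1{24}z^2\tau-\frac4{(2\pi i)^3}\sum_{r=1}^\infty\Big\{\frac{q^r}{1-q^r}\Big\}\frac{\sin^2(\pi rz)}{r^3}.$$ Furthermore, $$f\Big(\frac z\tau,-\frac1\tau\Big)\simeq\frac1{\tau^2}f(z,\tau)-\frac1{\tau^3}\frac{z^4}{4!}.$$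
   Context: $\mathbb{H}$ is the upper half plane. $Li_3(x)=\sum_{n\ge1}x^n/n^3$ for $|x|<1$, continued analytically as a multivalued function; $B_n$ are the Bernoulli numbers, $x/(e^x-1)=\sum_{n\ge0} B_nx^n/n!$; $E_k(\tau)=1-\frac{2k}{B_k}\sum_{n\ge1}\sigma_{k-1}(n)q^n$ for even $k\ge2$, with $\sigma_k(n)=\sum_{d|n}d^k$; $\eta(\tau)=q^{1/24}\prod_{n\ge1}(1-q^n)$. The elliptic trilogarithm is $$\mathcal{L}i_3(\zeta,q)=\sum_{n=0}^\infty Li_3(q^n\zeta)+\sum_{n=1}^\infty Li_3(q^n\zeta^{-1})-\sum_{j=0}^3\frac{B_{j+1}}{(3-j)!(j+1)!}(\log\zeta)^{3-j}(\log q)^j,$$ where for $\zeta=e^{2\pi iz}$ one takes $\log\zeta=2\pi iz$ and $\log q=2\pi i\tau$, and $$f(z,\tau)=\frac1{(2\pi i)^3}\{\mathcal{L}i_3(e^{2\pi iz},q)-\mathcal{L}i_3(1,q)\}.$$ Notation: $F\simeq G$ means that the functions $F$ and $G$ differ by a quadratic function (a polynomial of degree at most two) in the variables $\{u,\mathbf{z},\tau\}$ (the flat coordinates of the prepotentials of the WDVV equations in which $f$ is used); for functions of $z$ and $\tau$ alone, as here, this means a quadratic function in $z$ and $\tau$.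
   Formalization: In the last formula, ≃ means equality up to a quadratic polynomial in z/τ and −1/τ, not in z and τ: with z and τ it is false, since the two sides differ by a function containing (1/8+k/2)z²/τ², k an integer. *)

(* Defs.v *)
From Stdlib Require Export Reals ZArith List.
From Coquelicot Require Export Coquelicot.
From Stdlib Require Import Lra Lia.

Section Bernoulli.

Local Open Scope R_scope.

(** [bern_coef n] is [B_n / n!]: these are the coefficients of the formal
    inverse of [(e^x - 1) / x = sum_k x^k / (k+1)!].  The auxiliary
    [bern_coef_upto n] agrees with [bern_coef] on the indices up to [n]. *)
Fixpoint bern_coef_upto (n k : nat) : R :=
  match n with
  | O => 1
  | S m =>
      if (k <=? m)%nat then bern_coef_upto m k
      else (- sum_f_R0 (fun j => bern_coef_upto m j / INR (fact (S (S m) - j))) m)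
  end.

Definition bern_coef (n : nat) : R := bern_coef_upto n n.

Definition bernoulli (n : nat) : R := (INR (fact n) * bern_coef n).

Lemma bern_coef_upto_le n k : (k <= n)%nat -> bern_coef_upto n k = bern_coef k.
Proof.
induction n as [|n IH]; intros Hk.
- now replace k with 0%nat by lia.
- destruct (Nat.eq_dec k (S n)) as [->|Hne]; [reflexivity|].
  cbn [bern_coef_upto]; destruct (Nat.leb_spec k n); [apply IH; lia | lia].
Qed.

Lemma bern_coef_S n :
  bern_coef (S n) = - sum_f_R0 (fun j => bern_coef j / INR (fact (S (S n) - j))) n.
Proof.
unfold bern_coef at 1; cbn [bern_coef_upto].
destruct (Nat.leb_spec (S n) n); [lia|].
f_equal; apply sum_eq; intros j Hj; now rewrite bern_coef_upto_le.
Qed.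

Lemma fact_ge_pow2 n : 2 ^ n <= INR (fact (S n)).
Proof.
induction n as [|n IH]; [simpl; lra|].
change (fact (S (S n))) with (S (S n) * fact (S n))%nat.
rewrite mult_INR; cbn [pow].
assert (2 <= INR (S (S n))) by (rewrite !S_INR; pose proof (pos_INR n); lra).
assert (0 < 2 ^ n) by (apply pow_lt; lra).
apply Rmult_le_compat; lra.
Qed.

Lemma sum_half n : sum_f_R0 (fun j => / 2 ^ (S n - j)) n = 1 - / 2 ^ (S n).
Proof.
induction n as [|n IH]; [simpl; lra|].
rewrite tech5, (sum_eq _ (fun j => / 2 ^ (S n - j) * / 2)).
- rewrite <- scal_sum, IH.
  replace (S (S n) - S n)%nat with 1%nat by lia.
  cbn [pow]; field; apply pow_nonzero; lra.
- intros j Hj; replace (S (S n) - j)%nat with (S (S n - j)) by lia.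
  cbn [pow]; field; apply pow_nonzero; lra.
Qed.

Lemma bern_coef_bound n : Rabs (bern_coef n) <= 1.
Proof.
induction n as [n IH] using (well_founded_induction Wf_nat.lt_wf).
destruct n as [|n]; [unfold bern_coef; simpl; rewrite Rabs_R1; lra|].
rewrite bern_coef_S, Rabs_Ropp.
apply Rle_trans with (sum_f_R0 (fun j => / 2 ^ (S n - j)) n).
- eapply Rle_trans; [apply Rsum_abs|].
  apply sum_Rle; intros j Hj.
  replace (S (S n) - j)%nat with (S (S n - j)) by lia.
  pose proof (fact_ge_pow2 (S n - j)) as Hf.
  assert (Hp : 0 < 2 ^ (S n - j)) by (apply pow_lt; lra).
  unfold Rdiv; rewrite Rabs_mult, (Rabs_pos_eq (/ _)).
  2: left; apply Rinv_0_lt_compat; lra.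
  rewrite <- (Rmult_1_l (/ 2 ^ _)).
  apply Rmult_le_compat; [apply Rabs_pos| |apply IH; lia|].
  + left; apply Rinv_0_lt_compat; lra.
  + apply Rinv_le_contravar; lra.
- rewrite sum_half.
  assert (0 < / 2 ^ S n) by (apply Rinv_0_lt_compat, pow_lt; lra); lra.
Qed.

Lemma bernoulli_generating_function x : 0 < Rabs x < 1 ->
  is_pseries (fun n => bernoulli n / INR (fact n)) x (x / (exp x - 1)).
Proof.
intros [Hx0 Hx1].
assert (Hx : x <> 0) by (intros ->; rewrite Rabs_R0 in Hx0; lra).
assert (He : exp x - 1 <> 0).
{ intros H; apply Hx, exp_inv; rewrite exp_0; lra. }
set (a := PS_decr_1 (fun n => / INR (fact n))).
assert (Ha : is_pseries a x ((exp x - 1) / x)).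
{ pose proof (is_pseries_decr_1 (K := R_AbsRing) (V := R_NormedModule)
    _ x (/ x) _ (Rinv_l x Hx) (is_exp_Reals x)) as H.
  replace ((exp x - 1) / x) with (/ x * (exp x + - / INR (fact 0))); [exact H|].
  simpl; field; exact Hx. }
assert (Hbound : forall b : nat -> R, (forall n, Rabs (b n) <= 1) ->
  Rbar_lt (Rabs x) (CV_radius b)).
{ intros b Hb; apply Rbar_lt_le_trans with 1; [exact Hx1|].
  apply (proj1 (CV_radius_bounded b)); exists 1; intros n.
  rewrite pow1, Rmult_1_r; apply Hb. }
assert (Hra : Rbar_lt (Rabs x) (CV_radius a)).
{ apply Hbound; intros n; unfold a, PS_decr_1.
  assert (1 <= INR (fact (S n))).
  { change 1 with (INR 1); apply le_INR, lt_O_fact. }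
  rewrite Rabs_pos_eq; [|left; apply Rinv_0_lt_compat; lra].
  rewrite <- Rinv_1; apply Rinv_le_contravar; lra. }
assert (Hrt : Rbar_lt (Rabs x) (CV_radius bern_coef)) by apply Hbound, bern_coef_bound.
assert (Ht : is_pseries bern_coef x (PSeries bern_coef x)).
{ apply PSeries_correct, CV_radius_inside, Hrt. }
assert (Hprod : PSeries bern_coef x * ((exp x - 1) / x) = 1).
{ rewrite <- (is_pseries_unique _ _ _ (is_pseries_mult _ _ _ _ _ Ht Ha Hrt Hra)).
  rewrite (PSeries_ext _ (fun n => match n with O => 1 | S _ => 0 end)).
  - apply is_pseries_unique.
    apply filterlim_ext with (fun _ => 1); [|apply filterlim_const].
    intros n; induction n as [|n IH].
    + rewrite sum_O; change (1 = 1 * 1); ring.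
    + rewrite sum_Sn, <- IH; change (1 = 1 + pow_n (K := R_Ring) x (S n) * 0); ring.
  - intros [|n]; unfold PS_mult.
    + unfold bern_coef, a, PS_decr_1; simpl; field.
    + rewrite tech5, bern_coef_S; unfold a, PS_decr_1.
      replace (S n - S n)%nat with 0%nat by lia.
      rewrite (sum_eq (fun k => bern_coef k * _) (fun j => bern_coef j / INR (fact (S (S n) - j)))).
      * simpl (INR (fact 1)); field.
      * intros j Hj; now replace (S (S n) - j)%nat with (S (S n - j)) by lia. }
replace (x / (exp x - 1)) with (PSeries bern_coef x).
- apply is_pseries_ext with bern_coef; [|exact Ht].
  intros n; change (bern_coef n = INR (fact n) * bern_coef n / INR (fact n)); field; apply INR_fact_neq_0.
- apply (Rmult_eq_reg_r ((exp x - 1) / x)); [rewrite Hprod; field; auto|].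
  apply Rmult_integral_contrapositive; split; [exact He | now apply Rinv_neq_0_compat].
Qed.

End Bernoulli.

Local Open Scope C_scope.

Definition Cexp (w : C) : C :=
  ((exp (Re w) * cos (Im w))%R, (exp (Re w) * sin (Im w))%R).

Definition Csin (w : C) : C := (Cexp (Ci * w) - Cexp (- (Ci * w))) / (2 * Ci).

Definition twopi_i : C := 2 * PI * Ci.

Definition e2pi (w : C) : C := Cexp (twopi_i * w).

Definition natC (n : nat) : C := RtoC (INR n).

Definition factC (n : nat) : C := natC (fact n).

Definition bernC (n : nat) : C := RtoC (bernoulli n).

(** [CLim] and [CSeries] are total, and only applied below to sequences that
    converge. *)
Definition CLim (u : nat -> C) : C :=
  (real (Lim_seq (fun n => Re (u n))), real (Lim_seq (fun n => Im (u n)))).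

Definition CSeries (u : nat -> C) : C :=
  (Series (fun n => Re (u n)), Series (fun n => Im (u n))).

Definition is_Cseries (u : nat -> C) (l : C) : Prop :=
  @is_series C_AbsRing C_NormedModule u l.

Definition ex_Cseries (u : nat -> C) : Prop :=
  @ex_series C_AbsRing C_NormedModule u.

Definition sigma (k n : nat) : nat :=
  list_sum (map (fun d => Nat.pow d k)
                (filter (fun d => Nat.eqb (Nat.modulo n d) 0) (seq 1 n))).

(** [sum_(n >= 1) a_n] is written [CSeries (fun n => a_(S n))], here and in the
    other series starting at [1]. *)
Definition Eisenstein (k : nat) (tau : C) : C :=
  1 - 2 * natC k / bernC k *
      CSeries (fun n => natC (sigma (k - 1) (S n)) * e2pi tau ^ S n).

Fixpoint eta_prod (q : C) (N : nat) : C :=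
  match N with
  | O => 1
  | S n => eta_prod q n * (1 - q ^ S n)
  end.

Definition eta (tau : C) : C := e2pi (tau / 24) * CLim (eta_prod (e2pi tau)).

(** A multivalued function of [p = (z, tau)] is given by its single-valued
    branches: [A Om F] means that [F] is a branch of [A] on the open set [Om].
    Only the values of [F] on [Om] matter. *)

Definition mvfun : Type := (C * C -> Prop) -> (C * C -> C) -> Prop.

(** The pointwise combination of a multivalued function with a single-valued
    one: if [F] is a branch of [A], then [p |-> h p (F p)] is a branch of
    [mv_map h A]. *)
Definition mv_map (h : C * C -> C -> C) (A : mvfun) : mvfun :=
  fun Om G => exists F, A Om F /\ forall p, Om p -> G p = h p (F p).

Definition mv_log (h : C * C -> C) : mvfun :=
  fun Om l => forall p, Om p -> continuous l p /\ Cexp (l p) = h p.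

(** Points where the elliptic trilogarithm is not ramified: [tau] is in the
    upper half plane and [z] is not in [Z + Z tau]. *)
Definition regular_point (p : C * C) : Prop :=
  (0 < Im (snd p))%R /\
  forall m n : Z, fst p <> RtoC (IZR m) + RtoC (IZR n) * snd p.

Definition connected_set (Om : C * C -> Prop) : Prop :=
  forall U V : C * C -> Prop, open U -> open V ->
  (forall p, Om p -> U p \/ V p) ->
  (exists p, Om p /\ U p) -> (exists p, Om p /\ V p) ->
  exists p, Om p /\ U p /\ V p.

(** [A] and [B] differ by a polynomial of degree at most two in the variables
    [x p] and [y p]: on every connected open set, any branch of [A] and any
    branch of [B] do.  For the inversion [(z, tau) |-> (z / tau, - 1 / tau)],
    [x] and [y] are the transformed coordinates: the difference there contains
    [(1/8 + k/2) (z / tau)^2], [k] an integer, which is quadratic in these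
    coordinates but is not a polynomial in [z] and [tau]. *)
Definition differ_by_quadratic (x y : C * C -> C) (A B : mvfun) : Prop :=
  forall Om : C * C -> Prop,
  open Om -> connected_set Om -> (forall p, Om p -> regular_point p) ->
  forall F G : C * C -> C, A Om F -> B Om G ->
  exists c00 c10 c01 c20 c11 c02 : C, forall p, Om p ->
    F p - G p = c00 + c10 * x p + c01 * y p
                + c20 * x p ^ 2 + c11 * x p * y p + c02 * y p ^ 2.

(** The series, for [|x| < 1] and for [x = 1]. *)
Definition Li3_disc (x : C) : C := CSeries (fun n => x ^ S n / natC (S n) ^ 3).

(** [Li3_element c r g]: the germ of [g] on the disc of centre [c] and radius
    [r] is obtained from the series of [Li3] on the unit disc by analytic
    continuation along a finite chain of overlapping discs, on each of which
    the function is the sum of a power series. *)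
Inductive Li3_element : C -> R -> (C -> C) -> Prop :=
| Li3_element_disc : Li3_element 0 1 Li3_disc
| Li3_element_step (c c' : C) (r r' : R) (g g' : C -> C) (a : nat -> C) :
    Li3_element c r g ->
    (0 < r')%R ->
    (forall x, (Cmod (x - c') < r')%R ->
       @is_pseries C_AbsRing C_NormedModule a (x - c') (g' x)) ->
    (exists x, (Cmod (x - c) < r)%R /\ (Cmod (x - c') < r')%R) ->
    (forall x, (Cmod (x - c) < r)%R -> (Cmod (x - c') < r')%R -> g' x = g x) ->
    Li3_element c' r' g'.

(** The multivalued function [Li3 (h p)]: locally, a branch is the composition
    of [h] with a continuation of the series. *)
Definition mv_Li3 (h : C * C -> C) : mvfun :=
  fun Om L => forall p, Om p ->
  exists c r g, Li3_element c r g /\ (Cmod (h p - c) < r)%R /\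
    locally p (fun p' => L p' = g (h p')).

(** The polynomial part, with [lz] for [log zeta] and [lq] for [log q]. *)
Definition ellLi3_poly (lz lq : C) : C :=
  sum_n (fun j => bernC (j + 1) / (factC (3 - j) * factC (j + 1))
                  * lz ^ (3 - j) * lq ^ j) 3.

(** The multivalued function [Li3(zeta, q)] with [zeta = e2pi (z p)] and
    [q = e2pi (tau p)]: a branch is obtained by choosing a branch of each
    summand in such a way that the series converge. *)
Definition mv_ellLi3 (z tau : C * C -> C) : mvfun :=
  fun Om F => exists L M : nat -> C * C -> C,
    (forall n, mv_Li3 (fun p => e2pi (tau p) ^ n * e2pi (z p)) Om (L n)) /\
    (forall n, mv_Li3 (fun p => e2pi (tau p) ^ S n * / e2pi (z p)) Om (M n)) /\
    forall p, Om p -> exists SL SM,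
      is_Cseries (fun n => L n p) SL /\ is_Cseries (fun n => M n p) SM /\
      F p = SL + SM - ellLi3_poly (twopi_i * z p) (twopi_i * tau p).

(** [Li3(1, q)], where [log 1 = 0] and every argument [q^n] is in the closed
    unit disc. *)
Definition ellLi3_one (tau : C) : C :=
  CSeries (fun n => Li3_disc (e2pi tau ^ n))
  + CSeries (fun n => Li3_disc (e2pi tau ^ S n))
  - ellLi3_poly 0 (twopi_i * tau).

Definition mv_f (z tau : C * C -> C) : mvfun :=
  mv_map (fun p w => / twopi_i ^ 3 * (w - ellLi3_one (tau p)))
         (mv_ellLi3 z tau).

(** The term of index [n = S m] of the expansion at [z = 0]. *)
Definition taylor_term (z tau : C) (m : nat) : C :=
  let n := S m in
  (- (1)) ^ n * Eisenstein (2 * n) tau * bernC (2 * n)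
  / (factC (2 * n + 2) * natC (2 * n)) * (2 * PI * z) ^ (2 * n + 2).

Definition mv_taylor : mvfun :=
  fun Om F => exists logz logeta,
    mv_log fst Om logz /\ mv_log (fun p => eta (snd p)) Om logeta /\
    forall p, Om p -> let (z, tau) := p in exists s,
      is_Cseries (taylor_term z tau) s /\
      F p = - / twopi_i * (/ 2 * z ^ 2 * logz p + z ^ 2 * logeta p)
            + / twopi_i ^ 3 * s.

(** The term of index [r = S m] of the expansion in powers of [q]. *)
Definition fourier_term (z tau : C) (m : nat) : C :=
  let r := S m in
  e2pi tau ^ r / (1 - e2pi tau ^ r) * (Csin (PI * natC r * z) ^ 2 / natC r ^ 3).

Definition mv_fourier : mvfun :=
  fun Om F => exists L,
    mv_Li3 (fun p => e2pi (fst p)) Om L /\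
    forall p, Om p -> let (z, tau) := p in exists s,
      is_Cseries (fourier_term z tau) s /\
      F p = / twopi_i ^ 3 * L p + / 12 * z ^ 3 - / 24 * z ^ 2 * tau
            - 4 / twopi_i ^ 3 * s.

(* Main.v *)
(** The trilogarithm satisfies [(1 - x) (d/dx) (x d/dx)^2 Li3 = 1], and this is
    preserved by analytic continuation.  Hence every branch of [Li3 (e2pi w)] has
    the third derivative [(2 pi i)^3 x / (1 - x)], [x = e2pi w], in [w], and any two
    branches differ by a quadratic polynomial in [w].  A branch of [f] is a sum of
    branches of [Li3 (q^n zeta)], of [Li3 (q^(n+1) / zeta)] and of a cubic
    polynomial, and limits of quadratic polynomials are quadratic, so on a
    connected open set [f] is determined up to quadratic polynomials in [z] and
    [tau].  The substitutions [z + 1], [tau + 1], [z + tau], [- z] permute the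
    summands, up to replacing [Li3 (1 / x)] by [Li3 x], which costs a cubic
    polynomial; where it converges, the Fourier expansion is the sum of the
    summands given by the series on the unit disc.

    Inversion.  The third [z]-derivative [K] of [f] satisfies
    [K (z / tau, - 1 / tau) = tau K (z, tau) - z]: by the partial fractions of
    [x / (1 - x)^2], both sides have the same derivative up to a constant, and their
    difference is doubly periodic, odd and affine.  So the defect of the
    transformation law of [f] is quadratic in [z], with coefficients depending on
    [tau]; these are read off at the three corners [0], [- 1], [tau] of a
    parallelogram in which the series on the closed unit disc converge.

    Expansion at [z = 0].  By partial fractions, [x / (1 - x)] is the sum of a power
    series around each point [n tau].  Integrating three times yields a branch of
    [f] of the form [- (1 / 2 pi i) z^2 log z / 2] plus a power series in [z], valid
    up to the nearest lattice point.  Its coefficients are computed for small [z]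
    from the Fourier expansion, where Lambert series become Eisenstein series.  The
    power series does not converge beyond the nearest lattice point because [K] has
    a pole there. *)

Require Import Defs.
From Stdlib Require Import Lra Lia Classical ClassicalEpsilon FunctionalExtensionality.

Local Open Scope C_scope.

(** * Series of complex numbers *)

(** The cubics in the translation laws are bookkeeping. [z^3/12 - z^2 tau/24] is what the Bernoulli
    polynomial leaves after division by [(2 pi i)^3]; its term in [tau^3] cancels against the one in
    [Li3(1, q)]. Turning the argument [1/x] of a summand into [x] costs [z^3/6]. Inversion permutes
    no summands, hence the detour through lattice sums of inverse squares. There the order of
    summation matters: only the difference of the sums at two points may be interchanged, which
    leaves an unknown constant that periodicity removes. The expression studied is [tau^2 f(z/tau,
    -1/tau) - f(z, tau) + z^4/(24 tau)], because multiplication by [tau^2] turns quadratic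
    polynomials in [z/tau] and [-1/tau] into quadratic polynomials in [z] and [tau]. Branches live
    on arbitrary connected open sets without a base point, so every comparison is local and is glued
    by the fact that a quadratic polynomial is determined by its values near any point. *)

Lemma C_ext (a b : C) : Re a = Re b -> Im a = Im b -> a = b.
Proof. destruct a, b; simpl; intros -> ->; reflexivity. Qed.

Lemma im_le_Cmod (c : C) : (Rabs (Im c) <= Cmod c)%R.
Proof.
eapply Rle_trans; [apply Rmax_r | apply Rmax_Cmod].
Qed.

Lemma Cmod_le_add (c : C) : (Cmod c <= Rabs (Re c) + Rabs (Im c))%R.
Proof.
pose proof (Rabs_pos (Re c)); pose proof (Rabs_pos (Im c)).
pose proof (pow2_abs (Re c)) as H1; pose proof (pow2_abs (Im c)) as H2.
rewrite <- (sqrt_pow2 (Rabs (Re c) + Rabs (Im c))) by lra.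
apply sqrt_le_1_alt; unfold Re, Im in *; nra.
Qed.

Lemma re_sum_n (u : nat -> C) n : Re (sum_n u n) = sum_n (fun k => Re (u k)) n.
Proof.
induction n as [|n IH]; [now rewrite !sum_O|].
rewrite !sum_Sn; change (Re (sum_n u n + u (S n)) = (sum_n (fun k => Re (u k)) n + Re (u (S n)))%R).
now rewrite <- IH.
Qed.

Lemma im_sum_n (u : nat -> C) n : Im (sum_n u n) = sum_n (fun k => Im (u k)) n.
Proof.
induction n as [|n IH]; [now rewrite !sum_O|].
rewrite !sum_Sn; change (Im (sum_n u n + u (S n)) = (sum_n (fun k => Im (u k)) n + Im (u (S n)))%R).
now rewrite <- IH.
Qed.

Lemma is_Cseries_iff u l : is_Cseries u l <->
  is_series (fun n => Re (u n)) (Re l) /\ is_series (fun n => Im (u n)) (Im l).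
Proof.
unfold is_Cseries, is_series; split.
- intros H; split; apply filterlim_locally; intros eps;
    generalize (proj1 (filterlim_locally (U := C_UniformSpace) _ _) H eps); apply filter_imp; intros n [H1 H2].
  + rewrite <- re_sum_n; exact H1.
  + rewrite <- im_sum_n; exact H2.
- intros [H1 H2]; apply (filterlim_locally (U := C_UniformSpace)); intros eps.
  generalize (filter_and _ _ (proj1 (filterlim_locally _ _) H1 eps) (proj1 (filterlim_locally _ _) H2 eps)).
  apply filter_imp; intros n [K1 K2]; split.
  + change (ball (Re l) eps (Re (sum_n u n))); now rewrite re_sum_n.
  + change (ball (Im l) eps (Im (sum_n u n))); now rewrite im_sum_n.
Qed.

Lemma is_Cseries_unique u l : is_Cseries u l -> CSeries u = l.
Proof.
intros [H1 H2]%is_Cseries_iff; unfold CSeries.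
apply C_ext; cbn [Re Im fst snd]; now apply is_series_unique.
Qed.

Lemma is_Cseries_ext u v l : (forall n, u n = v n) -> is_Cseries u l -> is_Cseries v l.
Proof. intros H; now apply is_series_ext. Qed.

Lemma CSeries_ext u v : (forall n, u n = v n) -> CSeries u = CSeries v.
Proof. intros H; f_equal; now apply functional_extensionality. Qed.

Lemma is_Cseries_plus u v a b :
  is_Cseries u a -> is_Cseries v b -> is_Cseries (fun n => u n + v n) (a + b).
Proof. apply @is_series_plus. Qed.

Lemma is_Cseries_opp u a : is_Cseries u a -> is_Cseries (fun n => - u n) (- a).
Proof. apply @is_series_opp. Qed.

Lemma is_Cseries_minus u v a b :
  is_Cseries u a -> is_Cseries v b -> is_Cseries (fun n => u n - v n) (a - b).
Proof. apply @is_series_minus. Qed.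

Lemma is_Cseries_scal c u a : is_Cseries u a -> is_Cseries (fun n => c * u n) (c * a).
Proof. apply (is_series_scal (K := C_AbsRing) (V := C_NormedModule)). Qed.

Lemma is_Cseries_zero : is_Cseries (fun _ => 0) 0.
Proof.
apply is_Cseries_iff; split; cbn; unfold is_series;
  (apply filterlim_ext with (fun _ => 0%R); [intros n; now rewrite sum_n_const, Rmult_0_r | apply filterlim_const]).
Qed.

Lemma is_Cseries_incr u a : is_Cseries (fun n => u (S n)) a <-> is_Cseries u (u 0%nat + a).
Proof.
rewrite !is_Cseries_iff; split; intros [H1 H2]; split.
- apply is_series_decr_1; change (is_series (fun n => Re (u (S n))) ((Re (u 0%nat) + Re a) + - Re (u 0%nat))%R).
  replace (Re (u 0%nat) + Re a + - Re (u 0%nat))%R with (Re a) by ring; exact H1.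
- apply is_series_decr_1; change (is_series (fun n => Im (u (S n))) ((Im (u 0%nat) + Im a) + - Im (u 0%nat))%R).
  replace (Im (u 0%nat) + Im a + - Im (u 0%nat))%R with (Im a) by ring; exact H2.
- apply (is_series_incr_1 (fun n => Re (u n))); change (is_series (fun n => Re (u n)) (Re a + Re (u 0%nat))%R).
  rewrite Rplus_comm; exact H1.
- apply (is_series_incr_1 (fun n => Im (u n))); change (is_series (fun n => Im (u n)) (Im a + Im (u 0%nat))%R).
  rewrite Rplus_comm; exact H2.
Qed.

Lemma is_Cseries_incr_n u N a :
  is_Cseries (fun n => u (n + S N)%nat) a <-> is_Cseries u (sum_n u N + a).
Proof.
revert u a; induction N as [|N IH]; intros u a.
- rewrite sum_O, <- is_Cseries_incr; split; apply is_Cseries_ext; intros n; now rewrite Nat.add_1_r.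
- rewrite sum_Sn. change (plus (sum_n u N) (u (S N)) + a) with (sum_n u N + u (S N) + a).
  replace (sum_n u N + u (S N) + a) with (sum_n u N + (u (S N) + a)) by ring.
  rewrite <- IH. rewrite <- (is_Cseries_incr (fun n => u (n + S N)%nat) a).
  split; apply is_Cseries_ext; intros n; f_equal; lia.
Qed.

Lemma is_Cseries_lim0 u l : is_Cseries u l ->
  forall eps, (0 < eps)%R -> exists N, forall n, (N <= n)%nat -> (Cmod (u n) < eps)%R.
Proof.
intros [H1 H2]%is_Cseries_iff eps He.
apply (ex_intro _ (Re l)), ex_series_lim_0 in H1; apply (ex_intro _ (Im l)), ex_series_lim_0 in H2.
apply is_lim_seq_spec in H1, H2.
destruct (H1 (mkposreal (eps / 2) ltac:(simpl; lra))) as [N1 K1].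
destruct (H2 (mkposreal (eps / 2) ltac:(simpl; lra))) as [N2 K2].
exists (max N1 N2); intros n Hn.
specialize (K1 n ltac:(lia)); specialize (K2 n ltac:(lia)); simpl in K1, K2.
rewrite Rminus_0_r in K1, K2.
pose proof (Cmod_le_add (u n)); lra.
Qed.

(** Absolute summability: on such sequences the total function [CSeries] is the sum, is linear, and
    may be rearranged. *)
Definition asum (u : nat -> C) : Prop := ex_series (fun n => Cmod (u n)).

Lemma asum_le u (b : nat -> R) : (forall n, (Cmod (u n) <= b n)%R) -> ex_series b -> asum u.
Proof.
intros H Hb; apply (ex_series_le (K := R_AbsRing) (V := R_CompleteNormedModule)) with b; [|exact Hb].
intros n; change (Rabs (Cmod (u n)) <= b n)%R; rewrite Rabs_pos_eq; [apply H | apply Cmod_ge_0].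
Qed.

Lemma asum_Re u : asum u -> ex_series (fun n => Rabs (Re (u n))).
Proof.
intros H; apply (ex_series_le (K := R_AbsRing) (V := R_CompleteNormedModule)) with (2 := H).
intros n; change (Rabs (Rabs (Re (u n))) <= Cmod (u n))%R; rewrite Rabs_Rabsolu; apply re_le_Cmod.
Qed.

Lemma asum_Im u : asum u -> ex_series (fun n => Rabs (Im (u n))).
Proof.
intros H; apply (ex_series_le (K := R_AbsRing) (V := R_CompleteNormedModule)) with (2 := H).
intros n; change (Rabs (Rabs (Im (u n))) <= Cmod (u n))%R; rewrite Rabs_Rabsolu; apply im_le_Cmod.
Qed.

Lemma asum_is u : asum u -> is_Cseries u (CSeries u).
Proof.
intros H; apply is_Cseries_iff; split; cbn [Re Im fst snd CSeries]; apply Series_correct, ex_series_Rabs.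
- now apply asum_Re.
- now apply asum_Im.
Qed.

Lemma asum_ex u : asum u -> ex_Cseries u.
Proof. intros H; eexists; apply (asum_is u H). Qed.

Lemma asum_plus u v : asum u -> asum v -> asum (fun n => u n + v n).
Proof.
intros Hu Hv; apply asum_le with (fun n => Cmod (u n) + Cmod (v n))%R.
- intros n; apply Cmod_triangle.
- now apply (ex_series_plus (K := R_AbsRing) (V := R_NormedModule)).
Qed.

Lemma asum_scal c u : asum u -> asum (fun n => c * u n).
Proof.
intros Hu; apply asum_le with (fun n => Cmod c * Cmod (u n))%R.
- intros n; rewrite Cmod_mult; lra.
- now apply (ex_series_scal (K := R_AbsRing) (V := R_NormedModule)).
Qed.

Lemma asum_opp u : asum u -> asum (fun n => - u n).
Proof. intros Hu; apply asum_le with (fun n => Cmod (u n)); [intros n; rewrite Cmod_opp; lra | exact Hu]. Qed.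

Lemma asum_minus u v : asum u -> asum v -> asum (fun n => u n - v n).
Proof. intros Hu Hv; apply asum_plus; [exact Hu | now apply asum_opp]. Qed.

Lemma asum_ext u v : (forall n, u n = v n) -> asum u -> asum v.
Proof. intros H; apply ex_series_ext; intros n; now rewrite H. Qed.

Lemma asum_incr u : asum (fun n => u (S n)) <-> asum u.
Proof. unfold asum; symmetry; apply (ex_series_incr_1 (fun n => Cmod (u n))). Qed.

Lemma asum_incr_n u N : asum (fun n => u (n + N)%nat) <-> asum u.
Proof.
revert u; induction N as [|N IH]; intros u.
- split; apply asum_ext; intros n; f_equal; lia.
- rewrite <- (IH u), <- (asum_incr (fun n => u (n + N)%nat)).
  split; apply asum_ext; intros n; f_equal; lia.
Qed.

Lemma CSeries_plus u v : asum u -> asum v -> CSeries (fun n => u n + v n) = CSeries u + CSeries v.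
Proof. intros; apply is_Cseries_unique, is_Cseries_plus; now apply asum_is. Qed.

Lemma CSeries_minus u v : asum u -> asum v -> CSeries (fun n => u n - v n) = CSeries u - CSeries v.
Proof. intros; apply is_Cseries_unique, is_Cseries_minus; now apply asum_is. Qed.

Lemma CSeries_scal c u : asum u -> CSeries (fun n => c * u n) = c * CSeries u.
Proof. intros; apply is_Cseries_unique, is_Cseries_scal; now apply asum_is. Qed.

Lemma CSeries_opp u : asum u -> CSeries (fun n => - u n) = - CSeries u.
Proof. intros; apply is_Cseries_unique, is_Cseries_opp; now apply asum_is. Qed.

Lemma CSeries_incr u : asum u -> CSeries u = u 0%nat + CSeries (fun n => u (S n)).
Proof. intros; apply is_Cseries_unique, is_Cseries_incr, asum_is; now apply asum_incr. Qed.

Lemma CSeries_zero : CSeries (fun _ => 0) = 0.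
Proof. apply is_Cseries_unique, is_Cseries_zero. Qed.

Lemma Cmod_sum_n u n : (Cmod (sum_n u n) <= sum_n (fun k => Cmod (u k)) n)%R.
Proof. apply (norm_sum_n_m (K := C_AbsRing) (V := C_NormedModule) u 0 n). Qed.

Lemma sum_n_le_Series (b : nat -> R) n : (forall k, (0 <= b k)%R) -> ex_series b -> (sum_n b n <= Series b)%R.
Proof.
intros Hb He.
rewrite (Series_incr_n b (S n)) by (lia || exact He).
rewrite <- sum_n_Reals; simpl pred.
assert (0 <= Series (fun k => b (S n + k)%nat))%R; [|lra].
rewrite <- (Rmult_0_l (Series (fun k => b (S n + k)%nat))), <- Series_scal_l.
apply Series_le; [intros k; specialize (Hb (S n + k)%nat); lra | now apply -> (ex_series_incr_n b (S n))].
Qed.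

Lemma ex_series_bounded (b : nat -> R) M :
  (forall k, (0 <= b k)%R) -> (forall n, (sum_n b n <= M)%R) -> ex_series b.
Proof.
intros Hb HM.
destruct (ex_finite_lim_seq_incr (sum_n b) M) as [l Hl].
- intros n; rewrite sum_Sn; change (sum_n b n <= sum_n b n + b (S n))%R; specialize (Hb (S n)); lra.
- exact HM.
- exists l; exact Hl.
Qed.

Lemma CSeries_bound u M :
  asum u -> (forall n, (Cmod (sum_n u n) <= M)%R) -> (Cmod (CSeries u) <= M)%R.
Proof.
intros Hu HM; apply le_epsilon; intros eps He.
assert (H := asum_is u Hu).
unfold is_Cseries, is_series in H.
assert (He' : (0 < eps / 2)%R) by lra.
destruct (proj1 (filterlim_locally (U := C_UniformSpace) _ _) H (mkposreal _ He')) as [N HN].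
destruct (HN N (le_n N)) as [K1 K2].
set (s := sum_n u N) in *.
assert (Cmod (CSeries u - s) <= eps)%R.
{ eapply Rle_trans; [apply Cmod_le_add|].
  change (Rabs (Re s - Re (CSeries u)) < eps / 2)%R in K1.
  change (Rabs (Im s - Im (CSeries u)) < eps / 2)%R in K2.
  rewrite Rabs_minus_sym in K1, K2.
  change (Rabs (Re (CSeries u) - Re s) + Rabs (Im (CSeries u) - Im s) <= eps)%R. lra. }
replace (CSeries u) with ((CSeries u - s) + s) by ring.
eapply Rle_trans; [apply Cmod_triangle|]. specialize (HM N); fold s in HM; lra.
Qed.

Lemma CSeries_le u (b : nat -> R) :
  (forall n, (Cmod (u n) <= b n)%R) -> ex_series b -> (Cmod (CSeries u) <= Series b)%R.
Proof.
intros H Hb; apply CSeries_bound; [now apply asum_le with b|].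
intros n; eapply Rle_trans; [apply Cmod_sum_n|].
eapply Rle_trans; [apply sum_n_m_le; exact H|].
apply sum_n_le_Series; [|exact Hb].
intros k; eapply Rle_trans; [apply Cmod_ge_0 | apply H].
Qed.

(** Dominated convergence along an arbitrary filter: beyond some [N] both series are bounded by the
    tail of [b], and finitely many terms remain. It serves for limits over indices and for limits at
    a point. *)
Lemma Tannery {T} (F : (T -> Prop) -> Prop) {FF : Filter F} (u : T -> nat -> C) (l : nat -> C) (b : nat -> R) :
  ex_series b ->
  F (fun t => forall n, (Cmod (u t n) <= b n)%R) ->
  (forall n, (Cmod (l n) <= b n)%R) ->
  (forall n eps, (0 < eps)%R -> F (fun t => (Cmod (u t n - l n) < eps)%R)) ->
  forall eps, (0 < eps)%R -> F (fun t => (Cmod (CSeries (u t) - CSeries l) < eps)%R).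
Proof.
intros Hb Hu Hl Hlim eps He.
assert (Hb0 : forall n, (0 <= b n)%R) by (intros n; eapply Rle_trans; [apply Cmod_ge_0 | apply Hl]).
assert (Htail : exists N, (Series (fun k => b (S N + k)%nat) < eps / 4)%R).
{ assert (H : is_lim_seq (sum_n b) (Series b)) by exact (Series_correct b Hb).
  apply is_lim_seq_spec in H.
  destruct (H (mkposreal (eps / 4) ltac:(simpl; lra))) as [N HN].
  exists N. specialize (HN N (le_n N)); simpl in HN.
  rewrite (Series_incr_n b (S N)) in HN by (lia || exact Hb).
  rewrite <- sum_n_Reals in HN; simpl pred in HN.
  apply Rabs_def2 in HN. cbn [Nat.add] in *; lra. }
destruct Htail as [N HN].
assert (Hbt : ex_series (fun k => b (S N + k)%nat)) by now apply -> (ex_series_incr_n b (S N)).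
assert (Hfin : forall m, forall d, (0 < d)%R -> F (fun t => (sum_n (fun k => Cmod (u t k - l k)) m < d)%R)).
{ induction m as [|m IH]; intros d Hd.
  - refine (filter_imp _ _ _ (Hlim 0%nat d Hd)); intros t; rewrite sum_O; auto.
  - generalize (filter_and (F := F) _ _ (IH (d/2)%R ltac:(lra)) (Hlim (S m) (d/2)%R ltac:(lra))).
    apply filter_imp; intros t [H1 H2]; rewrite sum_Sn.
    change (sum_n (fun k => Cmod (u t k - l k)) m + Cmod (u t (S m) - l (S m)) < d)%R; lra. }
generalize (filter_and (F := F) _ _ Hu (Hfin N (eps / 4)%R ltac:(lra))); apply filter_imp; intros t [H1 H2].
assert (Hau : asum (u t)) by now apply asum_le with b.
assert (Hal : asum l) by now apply asum_le with b.
rewrite <- CSeries_minus by assumption.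
(* Majorant of the differences: exact up to [N], then [2 b]. The tail of [b] is below [eps / 4], so
   the whole sum is below [3 eps / 4]. *)
set (c := fun n => if (n <=? N)%nat then Cmod (u t n - l n) else (2 * b n)%R).
assert (Hc : ex_series c).
{ apply (ex_series_incr_n c (S N)).
  apply ex_series_ext with (fun k => 2 * b (S N + k)%nat)%R.
  - intros k; unfold c; destruct (Nat.leb_spec (S N + k) N); [lia | reflexivity].
  - now apply (ex_series_scal (K := R_AbsRing) (V := R_NormedModule) 2%R (fun k => b (S N + k)%nat)). }
eapply Rle_lt_trans; [apply (CSeries_le _ c)|].
- intros n; unfold c; destruct (Nat.leb_spec n N); [lra|].
  eapply Rle_trans; [apply Cmod_triangle|]; rewrite Cmod_opp; specialize (H1 n); specialize (Hl n); lra.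
- exact Hc.
- rewrite (Series_incr_n c (S N)) by (lia || exact Hc).
  rewrite <- sum_n_Reals; simpl pred.
  rewrite (sum_n_ext_loc c (fun k => Cmod (u t k - l k)) N).
  2: { intros k Hk; unfold c; destruct (Nat.leb_spec k N); [reflexivity | lia]. }
  rewrite (Series_ext (fun k => c (S N + k)%nat) (fun k => 2 * b (S N + k)%nat)%R).
  2: { intros k; unfold c; destruct (Nat.leb_spec (S N + k) N); [lia | reflexivity]. }
  rewrite Series_scal_l. lra.
Qed.

Lemma Cseq_unique (u : nat -> C) a b :
  (forall eps, (0 < eps)%R -> eventually (fun n => (Cmod (u n - a) < eps)%R)) ->
  (forall eps, (0 < eps)%R -> eventually (fun n => (Cmod (u n - b) < eps)%R)) -> a = b.
Proof.
intros Ha Hb.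
destruct (Req_dec (Cmod (a - b)) 0) as [H|H].
- apply Cmod_eq_0 in H. replace a with ((a - b) + b) by ring; rewrite H; ring.
- assert (Hp : (0 < Cmod (a - b) / 2)%R) by (pose proof (Cmod_ge_0 (a - b)); lra).
  destruct (filter_and _ _ (Ha _ Hp) (Hb _ Hp)) as [N HN].
  destruct (HN N (le_n N)) as [H1 H2].
  exfalso. replace (a - b) with (- (u N - a) + (u N - b)) in * by ring.
  pose proof (Cmod_triangle (- (u N - a)) (u N - b)) as H3; rewrite Cmod_opp in H3.
  replace (- (u N - a) + (u N - b)) with (a - b) in * by ring. lra.
Qed.

Lemma is_Cseries_lim u l : is_Cseries u l <->
  (forall eps, (0 < eps)%R -> eventually (fun n => (Cmod (sum_n u n - l) < eps)%R)).
Proof.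
unfold is_Cseries, is_series; split.
- intros H eps He.
  assert (He' : (0 < eps / 2)%R) by lra.
  generalize (proj1 (filterlim_locally (U := C_UniformSpace) _ _) H (mkposreal _ He')).
  apply filter_imp; intros n [K1 K2].
  change (Rabs (Re (sum_n u n) - Re l) < eps / 2)%R in K1.
  change (Rabs (Im (sum_n u n) - Im l) < eps / 2)%R in K2.
  eapply Rle_lt_trans; [apply Cmod_le_add|].
  change (Rabs (Re (sum_n u n) - Re l) + Rabs (Im (sum_n u n) - Im l) < eps)%R. lra.
- intros H; apply (filterlim_locally (U := C_UniformSpace)); intros eps.
  generalize (H eps (cond_pos eps)); apply filter_imp; intros n Hn; split.
  + eapply Rle_lt_trans; [|exact Hn]; apply (re_le_Cmod (sum_n u n - l)).
  + eapply Rle_lt_trans; [|exact Hn]; apply (im_le_Cmod (sum_n u n - l)).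
Qed.

Lemma is_Cseries_fun_unique u a b : is_Cseries u a -> is_Cseries u b -> a = b.
Proof. intros Ha Hb; rewrite <- (is_Cseries_unique _ _ Ha); now apply is_Cseries_unique. Qed.

Lemma CSeries_sum_n (u : nat -> nat -> C) m : (forall k, asum (fun n => u n k)) ->
  asum (fun n => sum_n (u n) m) /\
  CSeries (fun n => sum_n (u n) m) = sum_n (fun k => CSeries (fun n => u n k)) m.
Proof.
intros H; induction m as [|m [IH1 IH2]].
- split; [apply asum_ext with (2 := H 0%nat) | rewrite sum_O; apply CSeries_ext]; intros n; now rewrite sum_O.
- split.
  + apply asum_ext with (fun n => sum_n (u n) m + u n (S m)); [intros n; now rewrite sum_Sn|].
    now apply asum_plus.
  + rewrite sum_Sn, <- IH2, (CSeries_ext _ (fun n => sum_n (u n) m + u n (S m))) by (intros n; now rewrite sum_Sn).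
    now apply CSeries_plus.
Qed.

(** Summability of the double series of moduli, row by row; [dsum_swap] shows that rows and columns
    play the same role. *)
Definition dsum (u : nat -> nat -> C) : Prop :=
  (forall n, asum (u n)) /\ ex_series (fun n => Series (fun m => Cmod (u n m))).

Lemma Series_nonneg (b : nat -> R) : (forall n, (0 <= b n)%R) -> ex_series b -> (0 <= Series b)%R.
Proof.
intros Hb He; eapply Rle_trans; [|apply (sum_n_le_Series b 0 Hb He)]; rewrite sum_O; apply Hb.
Qed.

Lemma dsum_term u n m : dsum u -> (Cmod (u n m) <= Series (fun m => Cmod (u n m)))%R.
Proof.
intros [H1 H2].
eapply Rle_trans; [|apply (sum_n_le_Series (fun m => Cmod (u n m)) m); [intros; apply Cmod_ge_0 | apply H1]].
destruct m; [rewrite sum_O; lra|].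
rewrite sum_Sn; change (Cmod (u n (S m)) <= sum_n (fun m => Cmod (u n m)) m + Cmod (u n (S m)))%R.
assert (0 <= sum_n (fun m => Cmod (u n m)) m)%R; [|lra].
rewrite sum_n_Reals; apply cond_pos_sum; intros; apply Cmod_ge_0.
Qed.

Lemma dsum_col u m : dsum u -> asum (fun n => u n m).
Proof. intros H; apply asum_le with (2 := proj2 H); intros n; now apply dsum_term. Qed.

(** A finite sum of column sums is the sum of the truncated rows, hence at most the sum of the full
    rows. *)
Lemma dsum_swap u : dsum u -> dsum (fun m n => u n m).
Proof.
intros H; split; [intros m; now apply dsum_col|].
apply ex_series_bounded with (Series (fun n => Series (fun m => Cmod (u n m)))).
{ intros k; apply Series_nonneg; [intros; apply Cmod_ge_0 | now apply dsum_col]. }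
intros M.
(* The moduli are viewed as complex numbers so that [CSeries_sum_n] exchanges the finite sum with
   the series. *)
set (v := fun n m => RtoC (Cmod (u n m))).
assert (Hv : forall k, asum (fun n => v n k)).
{ intros k; apply asum_ext with (u := fun n => RtoC (Cmod (u n k))); [reflexivity|].
  apply asum_le with (fun n => Cmod (u n k)); [|now apply dsum_col].
  intros n; rewrite Cmod_R, Rabs_pos_eq; [lra | apply Cmod_ge_0]. }
destruct (CSeries_sum_n v M Hv) as [_ E].
apply (f_equal Re) in E; rewrite re_sum_n in E; cbn [CSeries Re fst] in E.
assert (E2 : sum_n (fun m => Series (fun n => Cmod (u n m))) M = Series (fun n => sum_n (fun m => Cmod (u n m)) M)).
{ symmetry; etransitivity; [|exact E].
  apply Series_ext; intros n; change (fst (sum_n (v n) M)) with (Re (sum_n (v n) M)).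
  rewrite re_sum_n; reflexivity. }
rewrite E2; apply Series_le; [|exact (proj2 H)].
intros n; split.
- rewrite sum_n_Reals; apply cond_pos_sum; intros; apply Cmod_ge_0.
- apply sum_n_le_Series; [intros; apply Cmod_ge_0 | apply (proj1 H)].
Qed.

Lemma dsum_rows u : dsum u -> asum (fun n => CSeries (u n)).
Proof.
intros H; apply asum_le with (2 := proj2 H); intros n; apply CSeries_le; [intros; lra | apply (proj1 H)].
Qed.

(** Truncating every row at [M] gives the [M]-th partial sum of the column sums. As [M] grows,
    dominated convergence with the row sums of moduli as majorant identifies the limit. *)
Lemma Fubini u : dsum u ->
  CSeries (fun n => CSeries (u n)) = CSeries (fun m => CSeries (fun n => u n m)).
Proof.
intros H.
apply Cseq_unique with (fun M => CSeries (fun n => sum_n (u n) M)).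
- apply Tannery with (b := fun n => Series (fun m => Cmod (u n m))).
  + apply eventually_filter.
  + exact (proj2 H).
  + exists 0%nat; intros M _ n.
    eapply Rle_trans; [apply Cmod_sum_n|].
    apply sum_n_le_Series; [intros; apply Cmod_ge_0 | apply (proj1 H)].
  + intros n; apply CSeries_le; [intros; lra | apply (proj1 H)].
  + intros n; apply is_Cseries_lim, asum_is, (proj1 H).
- intros eps He.
  destruct (proj1 (is_Cseries_lim _ _) (asum_is _ (dsum_rows _ (dsum_swap _ H))) eps He) as [N HN].
  exists N; intros M HM. destruct (CSeries_sum_n u M (fun k => dsum_col u k H)) as [_ ->].
  now apply HN.
Qed.

Lemma dsum_prod u (A B : nat -> R) :
  (forall n m, (Cmod (u n m) <= A n * B m)%R) ->
  ex_series A -> ex_series B -> dsum u.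
Proof.
intros H HA HB.
assert (HB' : forall n, ex_series (fun m => A n * B m)%R) by (intros n; now apply (ex_series_scal (K := R_AbsRing) (V := R_NormedModule))).
split.
- intros n; apply asum_le with (1 := H n); apply HB'.
- apply (ex_series_le (K := R_AbsRing) (V := R_CompleteNormedModule)) with (fun n => A n * Series B)%R.
  + intros n; change (Rabs (Series (fun m => Cmod (u n m))) <= A n * Series B)%R.
    rewrite Rabs_pos_eq.
    * rewrite <- Series_scal_l; apply Series_le; [|apply HB'].
      intros m; split; [apply Cmod_ge_0 | apply H].
    * apply Series_nonneg; [intros; apply Cmod_ge_0|].
      apply asum_le with (1 := H n); apply HB'.
  + apply (ex_series_scal_r (Series B) A HA).
Qed.

Lemma dsum_le u (b : nat -> nat -> R) :
  (forall n m, (Cmod (u n m) <= b n m)%R) ->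
  (forall n, ex_series (b n)) -> ex_series (fun n => Series (b n)) -> dsum u.
Proof.
intros H H1 H2; split.
- intros n; apply asum_le with (1 := H n); apply H1.
- apply (ex_series_le (K := R_AbsRing) (V := R_CompleteNormedModule)) with (2 := H2).
  intros n; change (Rabs (Series (fun m => Cmod (u n m))) <= Series (b n))%R.
  rewrite Rabs_pos_eq.
  + apply Series_le; [intros m; split; [apply Cmod_ge_0 | apply H] | apply H1].
  + apply Series_nonneg; [intros; apply Cmod_ge_0|]; apply asum_le with (1 := H n); apply H1.
Qed.

Lemma asum_geom x : (Cmod x < 1)%R -> asum (fun n => x ^ n).
Proof.
intros H; apply ex_series_ext with (fun n => Cmod x ^ n)%R; [intros n; now rewrite Cmod_pow|].
apply ex_series_geom; rewrite Rabs_pos_eq; [exact H | apply Cmod_ge_0].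
Qed.

Lemma CSeries_geom x : (Cmod x < 1)%R -> CSeries (fun n => x ^ n) = / (1 - x).
Proof.
intros H.
assert (Hx : 1 - x <> 0).
{ intros E. assert (x = 1) as -> by (replace x with (1 - (1 - x)) by ring; rewrite E; ring).
  rewrite Cmod_1 in H; lra. }
assert (E := CSeries_incr _ (asum_geom x H)); cbv beta in E.
rewrite (CSeries_ext (fun n => x ^ S n) (fun n => x * x ^ n)) in E by reflexivity.
rewrite CSeries_scal in E by now apply asum_geom.
set (s := CSeries (fun n => x ^ n)) in *. cbn [Cpow] in E.
transitivity ((1 - x) * s / (1 - x)); [field; exact Hx|].
replace ((1 - x) * s) with (s - x * s) by ring. rewrite E at 1. field; exact Hx.
Qed.

Lemma exR_ext (u v : nat -> R) : (forall n, u n = v n) -> ex_series u -> ex_series v.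
Proof. apply @ex_series_ext. Qed.

Lemma exR_scal (c : R) (u : nat -> R) : ex_series u -> ex_series (fun n => c * u n)%R.
Proof. apply (ex_series_scal (K := R_AbsRing) (V := R_NormedModule)). Qed.

Lemma exR_plus (u v : nat -> R) : ex_series u -> ex_series v -> ex_series (fun n => u n + v n)%R.
Proof. apply (ex_series_plus (K := R_AbsRing) (V := R_NormedModule)). Qed.

(** * Complex derivatives *)

(** The remainder form covers [y = x] without a division. *)
Definition Cder (f : C -> C) (x l : C) : Prop :=
  forall eps, (0 < eps)%R -> exists delta, (0 < delta)%R /\
    forall y, (Cmod (y - x) < delta)%R -> (Cmod (f y - f x - l * (y - x)) <= eps * Cmod (y - x))%R.

Definition Ccont (f : C -> C) (x : C) : Prop :=
  forall eps, (0 < eps)%R -> exists delta, (0 < delta)%R /\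
    forall y, (Cmod (y - x) < delta)%R -> (Cmod (f y - f x) < eps)%R.

Lemma Cmod_sub_sym a b : Cmod (a - b) = Cmod (b - a).
Proof. rewrite <- Cmod_opp; f_equal; ring. Qed.

Lemma Cmod_sub_triangle a b c : (Cmod (a - c) <= Cmod (a - b) + Cmod (b - c))%R.
Proof. replace (a - c) with ((a - b) + (b - c)) by ring; apply Cmod_triangle. Qed.

Lemma Cmod_triangle_rev a b : (Cmod a - Cmod b <= Cmod (a - b))%R.
Proof.
replace (Cmod a) with (Cmod ((a - b) + b)) by (f_equal; ring).
pose proof (Cmod_triangle (a - b) b); lra.
Qed.

Lemma Cder_cont f x l : Cder f x l -> Ccont f x.
Proof.
intros H eps He.
destruct (H 1%R ltac:(lra)) as [d [Hd K]].
set (m := (Cmod l + 2)%R).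
assert (Hm : (0 < m)%R) by (pose proof (Cmod_ge_0 l); unfold m; lra).
exists (Rmin d (eps / m)); split; [apply Rmin_pos; [lra | now apply Rdiv_lt_0_compat]|].
intros y Hy.
assert (H1 : (Cmod (y - x) < d)%R) by (eapply Rlt_le_trans; [exact Hy | apply Rmin_l]).
assert (H2 : (Cmod (y - x) < eps / m)%R) by (eapply Rlt_le_trans; [exact Hy | apply Rmin_r]).
specialize (K y H1).
replace (f y - f x) with ((f y - f x - l * (y - x)) + l * (y - x)) by ring.
eapply Rle_lt_trans; [apply Cmod_triangle|]; rewrite Cmod_mult.
apply Rle_lt_trans with ((Cmod l + 1) * Cmod (y - x))%R; [lra|].
apply Rle_lt_trans with (m * Cmod (y - x))%R.
- pose proof (Cmod_ge_0 (y - x)); unfold m; nra.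
- apply (Rmult_lt_compat_l m) in H2; [|exact Hm]. replace (m * (eps / m))%R with eps in H2 by (field; lra). exact H2.
Qed.

(** A quadratic remainder is what explicit formulas provide for the inverse, the exponential and
    power series. *)
Lemma Cder_quadratic_bound (f : C -> C) (x l : C) (M d : R) : (0 < d)%R ->
  (forall v, (Cmod v < d)%R -> (Cmod (f (x + v)%C - f x - l * v) <= M * Cmod v ^ 2)%R) -> Cder f x l.
Proof.
intros Hd H eps He.
set (m := (Rabs M + 1)%R).
assert (Hm : (0 < m)%R) by (pose proof (Rabs_pos M); unfold m; lra).
exists (Rmin d (eps / m)); split; [apply Rmin_pos; [lra | now apply Rdiv_lt_0_compat]|].
intros y Hy.
assert (H1 : (Cmod (y - x) < d)%R) by (eapply Rlt_le_trans; [exact Hy | apply Rmin_l]).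
assert (H2 : (Cmod (y - x) < eps / m)%R) by (eapply Rlt_le_trans; [exact Hy | apply Rmin_r]).
specialize (H _ H1); replace (x + (y - x)) with y in H by ring.
eapply Rle_trans; [exact H|].
pose proof (Cmod_ge_0 (y - x)).
apply (Rmult_lt_compat_l m) in H2; [|exact Hm]. replace (m * (eps / m))%R with eps in H2 by (field; lra).
pose proof (Rle_abs M). unfold m in *.
apply Rle_trans with ((Rabs M + 1) * Cmod (y - x) * Cmod (y - x))%R; [nra|].
apply Rmult_le_compat_r; lra.
Qed.

Lemma Cder_const c x : Cder (fun _ => c) x 0.
Proof.
intros eps He; exists 1%R; split; [lra|]; intros y _.
replace (c - c - 0 * (y - x)) with (RtoC 0) by ring; rewrite Cmod_0.
pose proof (Cmod_ge_0 (y - x)); nra.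
Qed.

Lemma Cder_id x : Cder (fun y => y) x 1.
Proof.
intros eps He; exists 1%R; split; [lra|]; intros y _.
replace (y - x - 1 * (y - x)) with (RtoC 0) by ring; rewrite Cmod_0.
pose proof (Cmod_ge_0 (y - x)); nra.
Qed.

Lemma Cder_eq f x l l' : Cder f x l -> l = l' -> Cder f x l'.
Proof. now intros H <-. Qed.

Lemma Cder_plus (f g : C -> C) (x a b : C) : Cder f x a -> Cder g x b -> Cder (fun y => f y + g y) x (a + b).
Proof.
intros Hf Hg eps He.
destruct (Hf (eps / 2)%R ltac:(lra)) as [d1 [Hd1 K1]], (Hg (eps / 2)%R ltac:(lra)) as [d2 [Hd2 K2]].
exists (Rmin d1 d2); split; [now apply Rmin_pos|]; intros y Hy.
specialize (K1 y (Rlt_le_trans _ _ _ Hy (Rmin_l _ _))); specialize (K2 y (Rlt_le_trans _ _ _ Hy (Rmin_r _ _))).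
replace (f y + g y - (f x + g x) - (a + b) * (y - x))
  with ((f y - f x - a * (y - x)) + (g y - g x - b * (y - x))) by ring.
eapply Rle_trans; [apply Cmod_triangle | lra].
Qed.

Lemma Cder_mult (f g : C -> C) (x a b : C) : Cder f x a -> Cder g x b -> Cder (fun y => f y * g y) x (a * g x + f x * b).
Proof.
intros Hf Hg eps He.
set (m := (Cmod (f x) + Cmod a + Cmod (g x) + 1 + 1)%R).
assert (Hm : (2 <= m)%R).
{ pose proof (Cmod_ge_0 (f x)); pose proof (Cmod_ge_0 (g x)); pose proof (Cmod_ge_0 a); unfold m; lra. }
set (e := (eps / (3 * m))%R).
assert (He' : (0 < e)%R) by (apply Rdiv_lt_0_compat; lra).
assert (Hem : (3 * (e * m) = eps)%R) by (unfold e; field; lra).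
destruct (Hf e He') as [d1 [Hd1 K1]].
destruct (Hg e He') as [d2 [Hd2 K2]].
destruct (Cder_cont _ _ _ Hg (Rmin e 1)) as [d3 [Hd3 K3]]; [apply Rmin_pos; lra|].
exists (Rmin d1 (Rmin d2 d3)); split; [repeat apply Rmin_pos; assumption|]; intros y Hy.
assert (Hy1 := Rlt_le_trans _ _ _ Hy (Rmin_l _ _)).
assert (Hy2 := Rlt_le_trans _ _ _ Hy (Rle_trans _ _ _ (Rmin_r _ _) (Rmin_l _ _))).
assert (Hy3 := Rlt_le_trans _ _ _ Hy (Rle_trans _ _ _ (Rmin_r _ _) (Rmin_r _ _))).
specialize (K1 y Hy1); specialize (K2 y Hy2); specialize (K3 y Hy3).
assert (K3a := Rlt_le_trans _ _ _ K3 (Rmin_l _ _)); assert (K3b := Rlt_le_trans _ _ _ K3 (Rmin_r _ _)).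
replace (f y * g y - f x * g x - (a * g x + f x * b) * (y - x))
  with ((f y - f x - a * (y - x)) * g y + a * (y - x) * (g y - g x) + f x * (g y - g x - b * (y - x))) by ring.
assert (Hgy : (Cmod (g y) <= m)%R).
{ replace (g y) with (g x + (g y - g x)) by ring. eapply Rle_trans; [apply Cmod_triangle|].
  pose proof (Cmod_ge_0 (f x)); pose proof (Cmod_ge_0 a); unfold m; lra. }
assert (Ha : (Cmod a <= m)%R) by (pose proof (Cmod_ge_0 (f x)); pose proof (Cmod_ge_0 (g x)); unfold m; lra).
assert (Hfx : (Cmod (f x) <= m)%R) by (pose proof (Cmod_ge_0 a); pose proof (Cmod_ge_0 (g x)); unfold m; lra).
pose proof (Cmod_ge_0 (y - x)) as H0.
eapply Rle_trans; [apply Cmod_triangle|]; eapply Rle_trans; [apply Rplus_le_compat_r, Cmod_triangle|].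
rewrite !Cmod_mult.
assert (T1 : (Cmod (f y - f x - a * (y - x)) * Cmod (g y) <= (e * Cmod (y - x)) * m)%R)
  by (apply Rmult_le_compat; try apply Cmod_ge_0; assumption).
assert (T2 : (Cmod a * Cmod (y - x) * Cmod (g y - g x) <= (m * Cmod (y - x)) * e)%R).
{ apply Rmult_le_compat; try apply Cmod_ge_0; [apply Rmult_le_pos; apply Cmod_ge_0 | | lra].
  apply Rmult_le_compat_r; assumption. }
assert (T3 : (Cmod (f x) * Cmod (g y - g x - b * (y - x)) <= m * (e * Cmod (y - x)))%R)
  by (apply Rmult_le_compat; try apply Cmod_ge_0; assumption).
replace (eps * Cmod (y - x))%R with ((e * Cmod (y - x)) * m + (m * Cmod (y - x)) * e + m * (e * Cmod (y - x)))%R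
  by (rewrite <- Hem; ring).
repeat apply Rplus_le_compat; assumption.
Qed.

Lemma Cder_scal c f x a : Cder f x a -> Cder (fun y => c * f y) x (c * a).
Proof.
intros H; apply Cder_eq with (0 * f x + c * a); [|ring].
apply (Cder_mult (fun _ => c) f); [apply Cder_const | exact H].
Qed.

Lemma Cder_opp f x a : Cder f x a -> Cder (fun y => - f y) x (- a).
Proof.
intros H eps He; destruct (H eps He) as [d [Hd K]]; exists d; split; [exact Hd|]; intros y Hy.
rewrite <- Cmod_opp. replace (- (- f y - - f x - - a * (y - x))) with (f y - f x - a * (y - x)) by ring; auto.
Qed.

Lemma Cder_minus f g x a b : Cder f x a -> Cder g x b -> Cder (fun y => f y - g y) x (a - b).
Proof. intros Hf Hg; apply (Cder_plus f (fun y => - g y)); [exact Hf | now apply Cder_opp]. Qed.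

Lemma Cder_comp f g x a b : Cder f x a -> Cder g (f x) b -> Cder (fun y => g (f y)) x (b * a).
Proof.
intros Hf Hg eps He.
set (m := (Cmod a + Cmod b + 2)%R).
assert (Hm : (2 <= m)%R) by (pose proof (Cmod_ge_0 a); pose proof (Cmod_ge_0 b); unfold m; lra).
set (e := Rmin 1 (eps / (2 * m))).
assert (He' : (0 < e)%R) by (apply Rmin_pos; [lra | apply Rdiv_lt_0_compat; lra]).
assert (Hem : (2 * (e * m) <= eps)%R).
{ apply Rle_trans with (2 * ((eps / (2 * m)) * m))%R; [|right; field; lra].
  apply Rmult_le_compat_l; [lra|]; apply Rmult_le_compat_r; [lra | apply Rmin_r]. }
assert (He1 : (e <= 1)%R) by apply Rmin_l.
destruct (Hg e He') as [d1 [Hd1 K1]].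
destruct (Hf e He') as [d2 [Hd2 K2]].
destruct (Cder_cont _ _ _ Hf d1 Hd1) as [d3 [Hd3 K3]].
exists (Rmin d2 d3); split; [now apply Rmin_pos|]; intros y Hy.
specialize (K2 y (Rlt_le_trans _ _ _ Hy (Rmin_l _ _))); specialize (K3 y (Rlt_le_trans _ _ _ Hy (Rmin_r _ _))).
specialize (K1 _ K3).
pose proof (Cmod_ge_0 (y - x)) as H0.
assert (Hfy : (Cmod (f y - f x) <= m * Cmod (y - x))%R).
{ replace (f y - f x) with ((f y - f x - a * (y - x)) + a * (y - x)) by ring.
  eapply Rle_trans; [apply Cmod_triangle|]; rewrite Cmod_mult.
  pose proof (Cmod_ge_0 b); unfold m; nra. }
replace (g (f y) - g (f x) - b * a * (y - x))
  with ((g (f y) - g (f x) - b * (f y - f x)) + b * (f y - f x - a * (y - x))) by ring.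
eapply Rle_trans; [apply Cmod_triangle|]; rewrite Cmod_mult.
assert (T1 : (Cmod (g (f y) - g (f x) - b * (f y - f x)) <= e * (m * Cmod (y - x)))%R).
{ eapply Rle_trans; [exact K1|]; apply Rmult_le_compat_l; lra. }
assert (T2 : (Cmod b * Cmod (f y - f x - a * (y - x)) <= m * (e * Cmod (y - x)))%R).
{ apply Rmult_le_compat; try apply Cmod_ge_0; [|exact K2]. pose proof (Cmod_ge_0 a); unfold m; lra. }
apply Rle_trans with (2 * (e * m) * Cmod (y - x))%R; [nra|].
apply Rmult_le_compat_r; lra.
Qed.

Lemma Cder_inv (x : C) : x <> 0 -> Cder (fun y => / y) x (- / (x * x)).
Proof.
intros Hx.
assert (Hp : (0 < Cmod x)%R) by (apply (proj1 (Cmod_gt_0 x)); exact Hx).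
apply Cder_quadratic_bound with (M := (2 / Cmod x ^ 3)%R) (d := (Cmod x / 2)%R); [lra|].
intros v Hv.
assert (Hxv : (Cmod x / 2 <= Cmod (x + v))%R).
{ replace (x + v) with (x - - v) by ring; pose proof (Cmod_triangle_rev x (- v)) as H; rewrite Cmod_opp in H; lra. }
assert (Hxv0 : x + v <> 0) by (apply (proj2 (Cmod_gt_0 _)); lra).
replace (/ (x + v) - / x - - / (x * x) * v) with (v * v / (x * x * (x + v))).
2: { field; split; assumption. }
rewrite Cmod_div by (apply Cmult_neq_0; [apply Cmult_neq_0|]; assumption).
rewrite !Cmod_mult.
assert (H1 : (0 < Cmod x * Cmod x)%R) by nra.
assert (H2 : (/ (Cmod x * Cmod x * Cmod (x + v)) <= 2 / Cmod x ^ 3)%R).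
{ replace (2 / Cmod x ^ 3)%R with (/ (Cmod x * Cmod x * (Cmod x / 2)))%R by (field; lra).
  apply Rinv_le_contravar; [apply Rmult_lt_0_compat; lra|]. apply Rmult_le_compat_l; lra. }
unfold Rdiv; rewrite Rmult_comm.
replace (Cmod v * Cmod v)%R with (Cmod v ^ 2)%R by ring.
apply Rmult_le_compat_r; [apply pow2_ge_0 | exact H2].
Qed.

Lemma Cder_ext (f g : C -> C) (x l : C) (d : R) : (0 < d)%R -> (forall y, (Cmod (y - x) < d)%R -> f y = g y) -> Cder f x l -> Cder g x l.
Proof.
intros Hd E H eps He; destruct (H eps He) as [d' [Hd' K]].
exists (Rmin d d'); split; [now apply Rmin_pos|]; intros y Hy.
rewrite <- !E.
- apply K; eapply Rlt_le_trans; [exact Hy | apply Rmin_r].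
- replace (x - x) with (RtoC 0) by ring; rewrite Cmod_0; exact Hd.
- eapply Rlt_le_trans; [exact Hy | apply Rmin_l].
Qed.

Lemma Cder_ext_all (f g : C -> C) (x l : C) : (forall y, f y = g y) -> Cder f x l -> Cder g x l.
Proof. intros E; apply Cder_ext with 1%R; [lra | auto]. Qed.

Lemma Cder_unique f x a b : Cder f x a -> Cder f x b -> a = b.
Proof.
intros Ha Hb.
destruct (Req_dec (Cmod (a - b)) 0) as [H|H].
{ apply Cmod_eq_0 in H; replace a with ((a - b) + b) by ring; rewrite H; ring. }
exfalso.
assert (Hp : (0 < Cmod (a - b))%R) by (pose proof (Cmod_ge_0 (a - b)); lra).
set (e := (Cmod (a - b) / 4)%R).
destruct (Ha e ltac:(unfold e; lra)) as [d1 [Hd1 K1]], (Hb e ltac:(unfold e; lra)) as [d2 [Hd2 K2]].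
set (r := (Rmin d1 d2 / 2)%R).
assert (Hr : (0 < r)%R) by (unfold r; pose proof (Rmin_pos _ _ Hd1 Hd2); lra).
assert (Hr1 : (r < d1)%R) by (unfold r in *; pose proof (Rmin_l d1 d2); lra).
assert (Hr2 : (r < d2)%R) by (unfold r in *; pose proof (Rmin_r d1 d2); lra).
assert (E : Cmod (x + RtoC r - x) = r).
{ replace (x + RtoC r - x) with (RtoC r) by ring; rewrite Cmod_R, Rabs_pos_eq; lra. }
specialize (K1 (x + RtoC r) ltac:(lra)); specialize (K2 (x + RtoC r) ltac:(lra)).
rewrite E in K1, K2. replace (x + RtoC r - x) with (RtoC r) in K1, K2 by ring.
assert (K3 : (Cmod ((a - b) * RtoC r) <= 2 * e * r)%R).
{ replace ((a - b) * RtoC r) with (- (f (x + RtoC r) - f x - a * RtoC r) + (f (x + RtoC r) - f x - b * RtoC r)) by ring.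
  eapply Rle_trans; [apply Cmod_triangle|]; rewrite Cmod_opp; lra. }
rewrite Cmod_mult, Cmod_R, (Rabs_pos_eq r) in K3 by lra. unfold e in K3; nra.
Qed.

Lemma Cder_affine al be x : Cder (fun y => al * y + be) x al.
Proof.
apply Cder_eq with (al * 1 + 0); [|ring].
apply Cder_plus; [apply Cder_scal, Cder_id | apply Cder_const].
Qed.

Lemma Cder_pow n x : Cder (fun y => y ^ S n) x (natC (S n) * x ^ n).
Proof.
induction n as [|n IH].
- apply Cder_ext_all with (fun y => y); [intros y; simpl; ring|].
  apply Cder_eq with (RtoC 1); [apply Cder_id | unfold natC; simpl; ring].
- apply Cder_ext_all with (fun y => y * y ^ S n); [reflexivity|].
  apply Cder_eq with (1 * x ^ S n + x * (natC (S n) * x ^ n)).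
  + apply (Cder_mult (fun y => y)); [apply Cder_id | exact IH].
  + unfold natC; rewrite (S_INR (S n)), RtoC_plus; simpl Cpow; ring.
Qed.

Lemma Ccont_zero (f : C -> C) (x : C) : Ccont f x ->
  (forall d, (0 < d)%R -> exists y, (Cmod (y - x) < d)%R /\ f y = 0) -> f x = 0.
Proof.
intros H K; apply NNPP; intros Hn.
apply (proj1 (Cmod_gt_0 _)) in Hn.
destruct (H _ Hn) as [d [Hd H1]]; destruct (K d Hd) as [y [Hy E]].
specialize (H1 y Hy); rewrite E in H1.
replace (0 - f x) with (- f x) in H1 by ring; rewrite Cmod_opp in H1; lra.
Qed.

(** * Constancy on convex sets and third derivatives *)

Definition Cconvex (U : C -> Prop) : Prop :=
  forall a b t, U a -> U b -> (0 <= t <= 1)%R -> U (a + RtoC t * (b - a)).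

Definition disc (c : C) (r : R) (w : C) : Prop := (Cmod (w - c) < r)%R.

Definition Copen (U : C -> Prop) : Prop :=
  forall w, U w -> exists d, (0 < d)%R /\ forall v, disc w d v -> U v.

Lemma disc_convex c r : Cconvex (disc c r).
Proof.
intros a b t Ha Hb [Ht0 Ht1]; unfold disc in *.
replace (a + RtoC t * (b - a) - c) with (RtoC (1 - t) * (a - c) + RtoC t * (b - c)) by (rewrite RtoC_minus; ring).
eapply Rle_lt_trans; [apply Cmod_triangle|]; rewrite !Cmod_mult, !Cmod_R, !Rabs_pos_eq by lra.
destruct (Req_dec t 0) as [->|]; [lra|]; nra.
Qed.

Lemma disc_open c r : Copen (disc c r).
Proof.
intros w Hw; exists (r - Cmod (w - c))%R; unfold disc in *; split; [lra|].
intros v Hv; pose proof (Cmod_sub_triangle v w c); lra.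
Qed.

Lemma disc_center c r : (0 < r)%R -> disc c r c.
Proof. intros Hr; unfold disc; replace (c - c) with (RtoC 0) by ring; now rewrite Cmod_0. Qed.

(** Along a segment the real part becomes a differentiable real function, to which the mean value
    theorem applies. *)
Lemma Cder_path_Re (f : C -> C) (a b l : C) (t : R) : Cder f (a + RtoC t * b) l ->
  is_derive (fun s => Re (f (a + RtoC s * b))) t (Re (l * b)).
Proof.
intros H; apply is_derive_Reals; intros eps He.
set (m := (Cmod b + 1)%R).
assert (Hm : (0 < m)%R) by (pose proof (Cmod_ge_0 b); unfold m; lra).
destruct (H (eps / (2 * m))%R) as [d [Hd K]]; [apply Rdiv_lt_0_compat; lra|].
assert (Hdm : (0 < d / m)%R) by now apply Rdiv_lt_0_compat.
exists (mkposreal _ Hdm); intros h Hh Hlt; simpl in Hlt.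
assert (E : Cmod (a + RtoC (t + h) * b - (a + RtoC t * b)) = (Rabs h * Cmod b)%R).
{ rewrite RtoC_plus. replace (a + (RtoC t + RtoC h) * b - (a + RtoC t * b)) with (RtoC h * b) by ring.
  now rewrite Cmod_mult, Cmod_R. }
assert (Hab : (0 < Rabs h)%R) by now apply Rabs_pos_lt.
assert (Hlt2 : (Rabs h * m < d)%R).
{ apply (Rmult_lt_compat_r m) in Hlt; [|exact Hm]. replace (d / m * m)%R with d in Hlt by (field; lra). exact Hlt. }
assert (Hb : (Rabs h * Cmod b <= Rabs h * m)%R) by (unfold m; nra).
specialize (K (a + RtoC (t + h) * b) ltac:(lra)). rewrite E in K.
replace (a + RtoC (t + h) * b - (a + RtoC t * b)) with (RtoC h * b) in K by (rewrite RtoC_plus; ring).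
pose proof (re_le_Cmod (f (a + RtoC (t + h) * b) - f (a + RtoC t * b) - l * (RtoC h * b))) as H2.
set (y1 := f (a + RtoC (t + h) * b)) in *; set (y0 := f (a + RtoC t * b)) in *.
assert (E3 : Re (y1 - y0 - l * (RtoC h * b)) = (Re y1 - Re y0 - Re (l * b) * h)%R).
{ replace (l * (RtoC h * b)) with (RtoC h * (l * b)) by ring.
  transitivity (Re y1 - Re y0 - Re (RtoC h * (l * b)))%R; [unfold Re, Cminus, Cplus, Copp; simpl; ring|].
  rewrite re_scal_l; ring. }
rewrite E3 in H2.
replace ((Re y1 - Re y0) / h - Re (l * b))%R
  with ((Re y1 - Re y0 - Re (l * b) * h) / h)%R by (field; exact Hh).
unfold Rdiv at 1; rewrite Rabs_mult, Rabs_inv.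
apply (Rmult_lt_reg_r (Rabs h)); [exact Hab|]. rewrite Rmult_assoc, Rinv_l, Rmult_1_r by lra.
eapply Rle_lt_trans; [exact H2|]; eapply Rle_lt_trans; [exact K|].
apply Rle_lt_trans with (eps / (2 * m) * (Rabs h * m))%R.
- apply Rmult_le_compat_l; [left; apply Rdiv_lt_0_compat; lra | exact Hb].
- replace (eps / (2 * m) * (Rabs h * m))%R with (eps * Rabs h / 2)%R by (field; lra). nra.
Qed.

Lemma Cder_zero_Re (f : C -> C) (a b : C) : (forall t, (0 <= t <= 1)%R -> Cder f (a + RtoC t * (b - a)) 0) -> Re (f b) = Re (f a).
Proof.
intros H.
set (phi := fun t => Re (f (a + RtoC t * (b - a)))).
destruct (MVT_gen phi 0 1 (fun _ => 0%R)) as [c [_ E]].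
- rewrite Rmin_left, Rmax_right by lra; intros x Hx.
  replace 0%R with (Re (0 * (b - a))) by (rewrite Cmult_0_l; reflexivity).
  apply Cder_path_Re, H; lra.
- rewrite Rmin_left, Rmax_right by lra; intros x Hx; apply continuity_pt_filterlim.
  apply (ex_derive_continuous (K := R_AbsRing) (V := R_NormedModule) phi).
  exists (Re (0 * (b - a))); apply Cder_path_Re, H; lra.
- unfold phi in E.
  replace (a + RtoC 1 * (b - a)) with b in E by ring.
  replace (a + RtoC 0 * (b - a)) with a in E by ring. lra.
Qed.

(** The imaginary part of [f] is the real part of [- Ci * f]. *)
Lemma Cder_zero_segment (f : C -> C) (a b : C) : (forall t, (0 <= t <= 1)%R -> Cder f (a + RtoC t * (b - a)) 0) -> f b = f a.
Proof.
intros H; apply C_ext; [now apply Cder_zero_Re|].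
assert (E : Re (- Ci * f b) = Re (- Ci * f a)).
{ apply (Cder_zero_Re (fun y => - Ci * f y)); intros t Ht.
  apply Cder_eq with (- Ci * 0); [now apply Cder_scal, H | ring]. }
unfold Re, Im, Ci, Cmult, Copp in *; simpl in E; lra.
Qed.

Lemma Cder_zero_const U f : Cconvex U -> (forall w, U w -> Cder f w 0) -> forall a b, U a -> U b -> f b = f a.
Proof. intros HU H a b Ha Hb; apply Cder_zero_segment; intros t Ht; now apply H, HU. Qed.

(** The intermediate derivatives exist on all of [U] but stay hidden: they depend on the branch, the
    third derivative does not. *)
Definition D3on (U : C -> Prop) (f g : C -> C) : Prop :=
  exists f1 f2, forall w, U w -> Cder f w (f1 w) /\ Cder f1 w (f2 w) /\ Cder f2 w (g w).

Lemma D3on_mono U V f g : (forall w, U w -> V w) -> D3on V f g -> D3on U f g.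
Proof. intros H [f1 [f2 K]]; exists f1, f2; auto. Qed.

Lemma D3on_plus U f f' g g' : D3on U f g -> D3on U f' g' -> D3on U (fun w => f w + f' w) (fun w => g w + g' w).
Proof.
intros [f1 [f2 K]] [f1' [f2' K']]; exists (fun w => f1 w + f1' w), (fun w => f2 w + f2' w).
intros w Hw; destruct (K w Hw) as [A1 [A2 A3]], (K' w Hw) as [B1 [B2 B3]].
repeat split; now apply Cder_plus.
Qed.

Lemma D3on_scal U c f g : D3on U f g -> D3on U (fun w => c * f w) (fun w => c * g w).
Proof.
intros [f1 [f2 K]]; exists (fun w => c * f1 w), (fun w => c * f2 w).
intros w Hw; destruct (K w Hw) as [A1 [A2 A3]]; repeat split; now apply Cder_scal.
Qed.

Lemma D3on_ext (U : C -> Prop) (f f' g g' : C -> C) : Copen U -> (forall w, U w -> f w = f' w) -> (forall w, U w -> g w = g' w) ->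
  D3on U f g -> D3on U f' g'.
Proof.
intros HU E1 E2 [f1 [f2 K]]; exists f1, f2; intros w Hw; destruct (K w Hw) as [A1 [A2 A3]].
repeat split; [|assumption | now rewrite <- E2].
destruct (HU w Hw) as [d [Hd Hd']]; apply Cder_ext with f d; auto.
Qed.

Lemma D3on_opp U f g : D3on U f g -> D3on U (fun w => - f w) (fun w => - g w).
Proof.
intros [f1 [f2 K]]; exists (fun w => - f1 w), (fun w => - f2 w).
intros w Hw; destruct (K w Hw) as [A1 [A2 A3]]; repeat split; now apply Cder_opp.
Qed.

Lemma D3on_minus U f f' g g' : D3on U f g -> D3on U f' g' -> D3on U (fun w => f w - f' w) (fun w => g w - g' w).
Proof. intros H H'; apply (D3on_plus U f (fun w => - f' w) g (fun w => - g' w)); [exact H | now apply D3on_opp]. Qed.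

Lemma D3on_affine U al be f g : D3on U f g ->
  D3on (fun z => U (al * z + be)) (fun z => f (al * z + be)) (fun z => al ^ 3 * g (al * z + be)).
Proof.
intros [f1 [f2 K]]; exists (fun z => al * f1 (al * z + be)), (fun z => al ^ 2 * f2 (al * z + be)).
intros w Hw; destruct (K _ Hw) as [A1 [A2 A3]]; repeat split.
- apply Cder_eq with (f1 (al * w + be) * al); [|ring].
  apply (Cder_comp (fun z => al * z + be)); [apply Cder_affine | exact A1].
- apply Cder_eq with (al * (f2 (al * w + be) * al)); [|ring].
  apply Cder_scal, (Cder_comp (fun z => al * z + be)); [apply Cder_affine | exact A2].
- apply Cder_eq with (al ^ 2 * (g (al * w + be) * al)); [|ring].
  apply Cder_scal, (Cder_comp (fun z => al * z + be)); [apply Cder_affine | exact A3].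
Qed.

Lemma D3on_cubic U a b c d : D3on U (fun w => a + b * w + c * w ^ 2 + d * w ^ 3) (fun _ => 6 * d).
Proof.
exists (fun w => b + 2 * c * w + 3 * d * w ^ 2), (fun w => 2 * c + 6 * d * w).
assert (H2 : forall w, Cder (fun w => w ^ 2) w (2 * w)).
{ intros w; apply Cder_eq with (1 := Cder_pow 1 w); unfold natC; simpl; rewrite RtoC_plus; ring. }
assert (H3 : forall w, Cder (fun w => w ^ 3) w (3 * w ^ 2)).
{ intros w; apply Cder_eq with (1 := Cder_pow 2 w); unfold natC; simpl; rewrite !RtoC_plus; ring. }
assert (HL : forall al be w, Cder (fun w => al + be * w) w be).
{ intros al be w; apply Cder_ext_all with (fun w => be * w + al); [intros; ring | apply Cder_affine]. }
intros w _; repeat split.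
- apply Cder_eq with (b + c * (2 * w) + d * (3 * w ^ 2)); [|ring].
  repeat apply Cder_plus; [apply HL | apply Cder_scal, H2 | apply Cder_scal, H3].
- apply Cder_eq with (2 * c + 3 * d * (2 * w)); [|ring].
  apply Cder_plus; [apply HL | apply Cder_scal, H2].
- apply HL.
Qed.

(** Three integrations: [f2] is constant, hence [f1] affine, hence [f] quadratic, each by constancy
    on the convex set. *)
Lemma D3on_zero U f : Cconvex U -> D3on U f (fun _ => 0) ->
  exists a b c, forall w, U w -> f w = a + b * w + c * w ^ 2.
Proof.
intros HU [f1 [f2 K]].
destruct (classic (exists w0, U w0)) as [[w0 H0]|Hn].
2: { exists 0, 0, 0; intros w Hw; exfalso; apply Hn; now exists w. }
assert (E2 : forall w, U w -> f2 w = f2 w0).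
{ intros w Hw; apply (Cder_zero_const U f2 HU); auto; intros v Hv; apply (K v Hv). }
assert (E1 : forall w, U w -> f1 w - f2 w0 * w = f1 w0 - f2 w0 * w0).
{ intros w Hw; apply (Cder_zero_const U (fun w => f1 w - f2 w0 * w) HU); auto; intros v Hv.
  apply Cder_eq with (f2 v - f2 w0 * 1); [|rewrite E2 by exact Hv; ring].
  apply Cder_minus; [apply (K v Hv) | apply Cder_scal, Cder_id]. }
set (b := f1 w0 - f2 w0 * w0) in *. set (c := f2 w0) in *.
assert (E0 : forall w, U w -> f w - (b * w + c / 2 * w ^ 2) = f w0 - (b * w0 + c / 2 * w0 ^ 2)).
{ intros w Hw; apply (Cder_zero_const U (fun w => f w - (b * w + c / 2 * w ^ 2)) HU); auto; intros v Hv.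
  apply Cder_eq with (f1 v - (b * 1 + c / 2 * (natC 2 * v ^ 1))).
  - apply Cder_minus; [apply (K v Hv)|]. apply Cder_plus; [apply Cder_scal, Cder_id | apply Cder_scal, (Cder_pow 1)].
  - specialize (E1 v Hv). replace (f1 v) with (b + c * v) by (rewrite <- E1; ring).
    unfold natC; simpl INR; rewrite RtoC_plus; simpl; field. }
exists (f w0 - (b * w0 + c / 2 * w0 ^ 2)), b, (c / 2); intros w Hw.
rewrite <- (E0 w Hw); ring.
Qed.

Lemma D3on_unique (U : C -> Prop) (f f' g : C -> C) : Cconvex U -> D3on U f g -> D3on U f' g ->
  exists a b c, forall w, U w -> f w - f' w = a + b * w + c * w ^ 2.
Proof.
intros HU H H'; apply D3on_zero; [exact HU|].
destruct (D3on_minus _ _ _ _ _ H H') as [f1 [f2 K]]; exists f1, f2; intros w Hw.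
destruct (K w Hw) as [A1 [A2 A3]]; repeat split; auto.
apply Cder_eq with (1 := A3); ring.
Qed.

(** The derivative is a function of the point, so local third derivatives patch together. *)
Lemma D3on_local (U : C -> Prop) (f g : C -> C) :
  (forall w, U w -> exists d h, (0 < d)%R /\ D3on (disc w d) f h /\ h w = g w) -> D3on U f g.
Proof.
intros H.
(* A derivative is chosen at each point; by uniqueness it agrees with every local one. *)
set (dd := fun (h : C -> C) w => epsilon (inhabits (RtoC 0)) (Cder h w)).
assert (Hdd : forall h w l, Cder h w l -> dd h w = l).
{ intros h w l Hl; apply Cder_unique with h w; [|exact Hl].
  apply (epsilon_spec (inhabits (RtoC 0)) (Cder h w)); now exists l. }
exists (dd f), (dd (dd f)); intros w Hw; destruct (H w Hw) as [d [h [Hd [[f1 [f2 K]] Eh]]]].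
assert (E1 : forall v, disc w d v -> f1 v = dd f v) by (intros v Hv; symmetry; apply Hdd, (K v Hv)).
assert (K2 : forall v, disc w d v -> Cder (dd f) v (f2 v)).
{ intros v Hv; destruct (disc_open w d v Hv) as [e [He He']].
  apply Cder_ext with f1 e; auto; apply (K v Hv). }
assert (E2 : forall v, disc w d v -> f2 v = dd (dd f) v) by (intros v Hv; symmetry; apply Hdd, K2, Hv).
assert (Hc := disc_center w d Hd).
repeat split.
- rewrite <- E1 by exact Hc; apply (K w Hc).
- rewrite <- E2 by exact Hc; now apply K2.
- rewrite <- Eh; apply Cder_ext with f2 d; auto; apply (K w Hc).
Qed.

(** * Power series and the identity theorem *)

(** Radius of convergence at least [r], phrased as absolute convergence at every smaller radius. *)
Definition cvr (a : nat -> C) (r : R) : Prop :=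
  forall rho, (0 <= rho < r)%R -> ex_series (fun n => Cmod (a n) * rho ^ n)%R.

Definition Pser (a : nat -> C) (u : C) : C := CSeries (fun n => a n * u ^ n).

Definition der (a : nat -> C) (n : nat) : C := natC (S n) * a (S n).

Lemma cvr_asum a r u : cvr a r -> (Cmod u < r)%R -> asum (fun n => a n * u ^ n).
Proof.
intros H Hu; apply exR_ext with (fun n => Cmod (a n) * Cmod u ^ n)%R.
- intros n; now rewrite Cmod_mult, Cmod_pow.
- apply H; split; [apply Cmod_ge_0 | exact Hu].
Qed.

Lemma cvr_le a b r : (forall n, (Cmod (a n) <= Cmod (b n))%R) -> cvr b r -> cvr a r.
Proof.
intros H K rho Hr; apply (ex_series_le (K := R_AbsRing) (V := R_CompleteNormedModule)) with (2 := K rho Hr).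
intros n; change (Rabs (Cmod (a n) * rho ^ n) <= Cmod (b n) * rho ^ n)%R.
assert (Hp : (0 <= rho ^ n)%R) by (apply pow_le; lra).
rewrite Rabs_pos_eq by (apply Rmult_le_pos; [apply Cmod_ge_0 | exact Hp]).
now apply Rmult_le_compat_r.
Qed.

Lemma cvr_mono a r r' : (r' <= r)%R -> cvr a r -> cvr a r'.
Proof. intros H K rho Hr; apply K; lra. Qed.

Lemma ex_series_eventually_le (u v : nat -> R) N :
  (forall n, (N <= n)%nat -> (0 <= u n <= v n)%R) -> ex_series v -> ex_series u.
Proof.
intros H Hv; apply (ex_series_incr_n u N).
apply (ex_series_le (K := R_AbsRing) (V := R_CompleteNormedModule)) with (fun k => v (N + k)%nat).
- intros n; change (Rabs (u (N + n)%nat) <= v (N + n)%nat)%R.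
  rewrite Rabs_pos_eq; apply H; lia.
- now apply -> (ex_series_incr_n v N).
Qed.

Lemma cvr_bounded a r M : (forall n, (Cmod (a n) * r ^ n <= M)%R) -> cvr a r.
Proof.
intros H rho [Hr0 Hr].
assert (Hq : (0 <= rho / r < 1)%R).
{ split; [apply Rmult_le_pos; [lra | left; apply Rinv_0_lt_compat; lra]|].
  apply (Rmult_lt_reg_r r); [lra|]. unfold Rdiv; rewrite Rmult_assoc, Rinv_l, Rmult_1_r; lra. }
apply ex_series_eventually_le with (N := 0%nat) (v := fun n => (M * (rho / r) ^ n)%R).
- intros n _; split; [apply Rmult_le_pos; [apply Cmod_ge_0 | now apply pow_le]|].
  replace (rho ^ n)%R with (r ^ n * (rho / r) ^ n)%R by (rewrite <- Rpow_mult_distr; f_equal; field; lra).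
  rewrite <- Rmult_assoc; apply Rmult_le_compat_r; [apply pow_le; lra | apply H].
- apply (exR_scal M (fun n => (rho / r) ^ n)%R).
  apply ex_series_geom; rewrite Rabs_pos_eq; lra.
Qed.

(** Abel's lemma: convergence at a real point between [rho] and [r] bounds the terms there, and a
    geometric series takes over at [rho]. *)
Lemma cvr_conv a r :
  (forall u, (Cmod u < r)%R -> ex_Cseries (fun n => a n * u ^ n)) -> cvr a r.
Proof.
intros H rho [Hr0 Hr].
set (s := ((rho + r) / 2)%R).
assert (Hs : (rho < s < r)%R) by (unfold s; lra).
destruct (H (RtoC s)) as [l Hl]; [rewrite Cmod_R, Rabs_pos_eq; lra|].
destruct (is_Cseries_lim0 _ _ Hl 1%R ltac:(lra)) as [N HN].
assert (Hq : (0 <= rho / s < 1)%R).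
{ split; [apply Rmult_le_pos; [lra | left; apply Rinv_0_lt_compat; lra]|].
  apply (Rmult_lt_reg_r s); [lra|]. unfold Rdiv; rewrite Rmult_assoc, Rinv_l, Rmult_1_r; lra. }
apply ex_series_eventually_le with (N := N) (v := fun n => ((rho / s) ^ n)%R).
- intros n Hn; split; [apply Rmult_le_pos; [apply Cmod_ge_0 | apply pow_le; lra]|].
  specialize (HN n Hn); rewrite Cmod_mult, Cmod_pow, Cmod_R, Rabs_pos_eq in HN by lra.
  replace (rho ^ n)%R with (s ^ n * (rho / s) ^ n)%R by (rewrite <- Rpow_mult_distr; f_equal; field; lra).
  rewrite <- Rmult_assoc. pose proof (pow_le _ n (proj1 Hq)); nra.
- apply ex_series_geom; rewrite Rabs_pos_eq; lra.
Qed.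

Lemma cvr_plus a b r : cvr a r -> cvr b r -> cvr (fun n => a n + b n) r.
Proof.
intros Ha Hb rho Hr.
apply ex_series_eventually_le with (N := 0%nat) (v := fun n => (Cmod (a n) * rho ^ n + Cmod (b n) * rho ^ n)%R).
- intros n _; pose proof (pow_le rho n (proj1 Hr)); pose proof (Cmod_triangle (a n) (b n)).
  pose proof (Cmod_ge_0 (a n + b n)); split; nra.
- apply exR_plus; [now apply Ha | now apply Hb].
Qed.

Lemma cvr_scal c a r : cvr a r -> cvr (fun n => c * a n) r.
Proof.
intros Ha rho Hr.
apply exR_ext with (fun n => (Cmod c * (Cmod (a n) * rho ^ n))%R).
- intros n; rewrite Cmod_mult; ring.
- apply (exR_scal (Cmod c)); now apply Ha.
Qed.

Lemma cvr_shift a r : cvr (fun n => a (S n)) r -> cvr a r.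
Proof.
intros H rho Hr; apply (ex_series_incr_1 (fun n => (Cmod (a n) * rho ^ n)%R)).
apply exR_ext with (fun n => (rho * (Cmod (a (S n)) * rho ^ n))%R); [intros n; simpl; ring|].
apply (exR_scal rho); now apply H.
Qed.

(** Dividing by [rho] would fail at [rho = 0], so the division is by an intermediate positive
    radius. *)
Lemma cvr_unshift a r : cvr a r -> cvr (fun n => a (S n)) r.
Proof.
intros H rho Hr.
set (s := ((rho + r) / 2)%R).
assert (Hs : (0 < s < r)%R) by (unfold s; lra).
specialize (H s ltac:(lra)). apply (ex_series_incr_1 (fun n => (Cmod (a n) * s ^ n)%R)) in H.
apply ex_series_eventually_le with (N := 0%nat) (v := fun n => (/ s * (Cmod (a (S n)) * s ^ S n))%R).
- intros n _; pose proof (pow_le rho n (proj1 Hr)); pose proof (Cmod_ge_0 (a (S n))).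
  split; [now apply Rmult_le_pos|].
  replace (/ s * (Cmod (a (S n)) * s ^ S n))%R with (Cmod (a (S n)) * s ^ n)%R by (simpl; field; lra).
  apply Rmult_le_compat_l; [assumption|]. apply pow_incr; unfold s; lra.
- now apply (exR_scal (/ s)%R).
Qed.

Lemma Pser_plus a b r u : cvr a r -> cvr b r -> (Cmod u < r)%R ->
  Pser (fun n => a n + b n) u = Pser a u + Pser b u.
Proof.
intros Ha Hb Hu; unfold Pser; rewrite <- CSeries_plus by (apply cvr_asum with r; assumption).
apply CSeries_ext; intros n; ring.
Qed.

Lemma Pser_scal c a r u : cvr a r -> (Cmod u < r)%R -> Pser (fun n => c * a n) u = c * Pser a u.
Proof.
intros Ha Hu; unfold Pser; rewrite <- CSeries_scal by (apply cvr_asum with r; assumption).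
apply CSeries_ext; intros n; ring.
Qed.

Lemma Pser_incr a r u : cvr a r -> (Cmod u < r)%R -> Pser a u = a 0%nat + u * Pser (fun n => a (S n)) u.
Proof.
intros Ha Hu; unfold Pser; rewrite CSeries_incr by (apply cvr_asum with r; assumption).
rewrite <- CSeries_scal by (apply cvr_asum with r; [now apply cvr_unshift | assumption]).
f_equal; [simpl; ring | apply CSeries_ext; intros n; simpl; ring].
Qed.

Lemma Pser_0 a : Pser a 0 = a 0%nat.
Proof.
apply is_Cseries_unique. replace (a 0%nat) with (a 0%nat * 0 ^ 0 + 0) by (simpl; ring).
apply (is_Cseries_incr (fun n => a n * 0 ^ n)).
apply is_Cseries_ext with (fun _ => RtoC 0); [intros n; simpl; ring | apply is_Cseries_zero].
Qed.

(** [binom_coef u n k] is the coefficient of [v ^ k] in [(u + v) ^ n]. *)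
Fixpoint binom_coef (u : C) (n k : nat) : C :=
  match n with
  | O => match k with O => 1 | S _ => 0 end
  | S n => u * binom_coef u n k + match k with O => 0 | S k => binom_coef u n k end
  end.

Lemma binom_coef_0 u n : binom_coef u n 0 = u ^ n.
Proof. induction n as [|n IH]; simpl; [reflexivity | rewrite IH; ring]. Qed.

Lemma binom_coef_1 u n : binom_coef u (S n) 1 = natC (S n) * u ^ n.
Proof.
induction n as [|n IH]; [simpl; unfold natC; simpl; ring|].
change (u * binom_coef u (S n) 1 + binom_coef u (S n) 0 = natC (S (S n)) * u ^ S n).
rewrite IH, binom_coef_0; unfold natC; rewrite (S_INR (S n)), RtoC_plus; simpl Cpow; ring.
Qed.

(** The binomial theorem, each finite row being read as a series in [k]; the last clause bounds the
    row of moduli for the exchange of sums. *)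
Lemma binom_coef_row u v n :
  asum (fun k => binom_coef u n k * v ^ k) /\ CSeries (fun k => binom_coef u n k * v ^ k) = (u + v) ^ n /\
  (Series (fun k => Cmod (binom_coef u n k * v ^ k)%C) <= (Cmod u + Cmod v) ^ n)%R.
Proof.
induction n as [|n [IH1 [IH2 IH3]]].
- assert (H : is_series (fun k => Cmod (binom_coef u 0 k * v ^ k)) 1).
  { apply is_series_decr_1.
    match goal with |- is_series _ ?l => replace l with 0%R end.
    2: { change (0 = 1 + - Cmod (1 * 1))%R; rewrite Cmult_1_l, Cmod_1; ring. }
    unfold is_series; apply filterlim_ext with (fun _ => 0%R); [|apply filterlim_const].
    intros m; rewrite (sum_n_ext _ (fun _ => 0%R)), sum_n_const; [ring|].
    intros k; simpl binom_coef; now rewrite Cmult_0_l, Cmod_0. }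
  split; [now exists 1%R|]; split.
  + apply is_Cseries_unique. replace ((u + v) ^ 0) with (binom_coef u 0 0 * v ^ 0 + 0) by (simpl; ring).
    apply (is_Cseries_incr (fun k => binom_coef u 0 k * v ^ k)).
    apply is_Cseries_ext with (fun _ => RtoC 0); [intros k; simpl; ring | apply is_Cseries_zero].
  + rewrite (is_series_unique _ _ H); simpl; lra.
- set (s := fun k => match k with O => RtoC 0 | S k' => v * (binom_coef u n k' * v ^ k') end).
  assert (Hs : asum s) by (apply asum_incr; now apply asum_scal).
  assert (Hus : asum (fun k => u * (binom_coef u n k * v ^ k))) by now apply asum_scal.
  assert (E : forall k, binom_coef u (S n) k * v ^ k = u * (binom_coef u n k * v ^ k) + s k)
    by (intros [|k]; simpl; ring).
  split; [|split].
  + apply asum_ext with (fun k => u * (binom_coef u n k * v ^ k) + s k); [intros k; now rewrite E | now apply asum_plus].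
  + rewrite (CSeries_ext _ _ E), CSeries_plus, CSeries_scal, IH2 by assumption.
    rewrite (CSeries_incr s) by assumption; unfold s; rewrite CSeries_scal, IH2 by assumption; simpl; ring.
  + assert (Hs' : (Series (fun k => Cmod (s k)) <= Cmod v * (Cmod u + Cmod v) ^ n)%R).
    { rewrite (Series_incr_1 (fun k => Cmod (s k))) by exact Hs; unfold s at 1; rewrite Cmod_0, Rplus_0_l.
      rewrite (Series_ext _ (fun k => Cmod v * Cmod (binom_coef u n k * v ^ k)%C)%R).
      2: { intros k; unfold s; now rewrite Cmod_mult. }
      rewrite Series_scal_l; apply Rmult_le_compat_l; [apply Cmod_ge_0 | exact IH3]. }
    assert (Hu' : (Series (fun k => Cmod (u * (binom_coef u n k * v ^ k))%C) <= Cmod u * (Cmod u + Cmod v) ^ n)%R).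
    { rewrite (Series_ext _ (fun k => Cmod u * Cmod (binom_coef u n k * v ^ k)%C)%R) by (intros k; now rewrite Cmod_mult).
      rewrite Series_scal_l; apply Rmult_le_compat_l; [apply Cmod_ge_0 | exact IH3]. }
    apply Rle_trans with (Series (fun k => Cmod (u * (binom_coef u n k * v ^ k))%C + Cmod (s k))%R).
    * apply Series_le.
      -- intros k; split; [apply Cmod_ge_0 | rewrite E; apply Cmod_triangle].
      -- now apply exR_plus.
    * rewrite Series_plus by assumption. simpl pow; lra.
Qed.

(** Taylor coefficients at [u]: the columns of the double series obtained by expanding
    [(u + v) ^ n]. *)
Definition recenter (a : nat -> C) (u : C) (k : nat) : C := CSeries (fun n => a n * binom_coef u n k).

Section Recenter.

Variables (a : nat -> C) (r : R) (u : C).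
Hypothesis (Ha : cvr a r).

Lemma recenter_dsum v : (Cmod u + Cmod v < r)%R -> dsum (fun n k => a n * (binom_coef u n k * v ^ k)).
Proof.
intros Hv; split.
- intros n; apply asum_scal, (binom_coef_row u v n).
- apply ex_series_eventually_le with (N := 0%nat) (v := fun n => (Cmod (a n) * (Cmod u + Cmod v) ^ n)%R).
  + intros n _.
    assert (E : Series (fun m => Cmod (a n * (binom_coef u n m * v ^ m))%C) = (Cmod (a n) * Series (fun m => Cmod (binom_coef u n m * v ^ m)%C))%R).
    { rewrite <- Series_scal_l; apply Series_ext; intros m; now rewrite Cmod_mult. }
    split.
    * apply Series_nonneg; [intros; apply Cmod_ge_0|]. apply asum_scal, (binom_coef_row u v n).
    * change (Series (fun m => Cmod (a n * (binom_coef u n m * v ^ m))%C) <= Cmod (a n) * (Cmod u + Cmod v) ^ n)%R.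
      rewrite E; apply Rmult_le_compat_l; [apply Cmod_ge_0 | apply (binom_coef_row u v n)].
  + apply Ha; split; [|exact Hv]. pose proof (Cmod_ge_0 u); pose proof (Cmod_ge_0 v); lra.
Qed.

Hypothesis (Hu : (Cmod u < r)%R).

Lemma recenter_asum k : asum (fun n => a n * binom_coef u n k).
Proof.
set (v := RtoC ((r - Cmod u) / 2)).
assert (Hv : Cmod v = ((r - Cmod u) / 2)%R) by (unfold v; rewrite Cmod_R, Rabs_pos_eq; lra).
assert (Hv0 : v <> 0) by (apply (proj2 (Cmod_gt_0 v)); lra).
assert (H := dsum_col _ k (recenter_dsum v ltac:(lra))).
apply asum_ext with (fun n => / v ^ k * (a n * (binom_coef u n k * v ^ k))).
- intros n; field; now apply Cpow_nz.
- now apply asum_scal.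
Qed.

Lemma recenter_cvr : cvr (recenter a u) (r - Cmod u).
Proof.
intros rho [Hr0 Hr].
assert (Hv : Cmod (RtoC rho) = rho) by (rewrite Cmod_R, Rabs_pos_eq; lra).
assert (H := dsum_swap _ (recenter_dsum (RtoC rho) ltac:(lra))).
apply ex_series_eventually_le with (N := 0%nat) (2 := proj2 H).
intros k _; split; [apply Rmult_le_pos; [apply Cmod_ge_0 | now apply pow_le]|].
replace (Cmod (recenter a u k) * rho ^ k)%R with (Cmod (CSeries (fun n => a n * (binom_coef u n k * RtoC rho ^ k)))).
- apply CSeries_le; [intros; lra | apply (proj1 H)].
- assert (Ep : (rho ^ k)%R = Cmod (RtoC rho ^ k)) by (rewrite Cmod_pow, Hv; reflexivity).
  rewrite Ep, <- Cmod_mult; f_equal.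
  rewrite Cmult_comm; unfold recenter; rewrite <- CSeries_scal by apply recenter_asum.
  apply CSeries_ext; intros n; ring.
Qed.

Lemma Pser_recenter v : (Cmod u + Cmod v < r)%R -> Pser a (u + v) = Pser (recenter a u) v.
Proof.
intros Hv; unfold Pser.
rewrite (CSeries_ext _ (fun n => CSeries (fun k => a n * (binom_coef u n k * v ^ k)))).
2: { intros n; destruct (binom_coef_row u v n) as [H1 [H2 _]]. rewrite CSeries_scal by exact H1. now rewrite H2. }
rewrite (Fubini _ (recenter_dsum v Hv)).
apply CSeries_ext; intros k; rewrite Cmult_comm; unfold recenter.
rewrite <- CSeries_scal by apply recenter_asum. apply CSeries_ext; intros n; ring.
Qed.

Lemma recenter_0 : recenter a u 0 = Pser a u.
Proof. apply CSeries_ext; intros n; now rewrite binom_coef_0. Qed.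

Lemma recenter_1 : recenter a u 1 = Pser (der a) u.
Proof.
unfold recenter; rewrite CSeries_incr by apply recenter_asum.
replace (a 0%nat * binom_coef u 0 1) with (RtoC 0) by (simpl; ring); rewrite Cplus_0_l.
apply CSeries_ext; intros n; rewrite binom_coef_1; unfold der; ring.
Qed.

End Recenter.

(** The differentiated series at [rho] is the column [k = 1] of the double series for the centre
    [rho], hence converges absolutely. *)
Lemma cvr_der a r : cvr a r -> cvr (der a) r.
Proof.
intros Ha rho Hr.
assert (E : Cmod (RtoC rho) = rho) by (rewrite Cmod_R, Rabs_pos_eq; lra).
assert (H := recenter_asum a r (RtoC rho) Ha ltac:(lra) 1).
apply asum_incr in H; apply exR_ext with (2 := H); intros n.
rewrite binom_coef_1; unfold der; rewrite !Cmod_mult, Cmod_pow, E; ring.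
Qed.

(** After recentring at [u], the first-order remainder is [v ^ 2] times a power series that stays
    bounded on half the available radius. *)
Lemma Pser_Cder a r u : cvr a r -> (Cmod u < r)%R -> Cder (Pser a) u (Pser (der a) u).
Proof.
intros Ha Hu.
set (b := recenter a u). set (d := ((r - Cmod u) / 2)%R).
assert (Hb := recenter_cvr a r u Ha Hu); fold b in Hb.
assert (Hb2 := cvr_unshift _ _ (cvr_unshift _ _ Hb)); cbv beta in Hb2.
set (M := Series (fun k => Cmod (b (S (S k))) * d ^ k)%R).
apply Cder_quadratic_bound with M d; [unfold d; lra|].
intros v Hv.
assert (Hv' : (Cmod v < r - Cmod u)%R) by (unfold d in Hv; lra).
rewrite (Pser_recenter a r u Ha Hu v) by lra; fold b.
rewrite (Pser_incr b (r - Cmod u)) by assumption.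
rewrite (Pser_incr (fun n => b (S n)) (r - Cmod u)) by (assumption || now apply cvr_unshift).
unfold b at 1 2; rewrite (recenter_1 a r u Ha Hu), recenter_0.
replace (Pser a u + v * (Pser (der a) u + v * Pser (fun n => b (S (S n))) v) - Pser a u - Pser (der a) u * v)
  with (v ^ 2 * Pser (fun n => b (S (S n))) v) by ring.
rewrite Cmod_mult, Cmod_pow, Rmult_comm; apply Rmult_le_compat_r; [apply pow2_ge_0|].
apply CSeries_le.
- intros k; rewrite Cmod_mult, Cmod_pow; apply Rmult_le_compat_l; [apply Cmod_ge_0|].
  apply pow_incr; split; [apply Cmod_ge_0 | lra].
- apply Hb2; unfold d; lra.
Qed.

Lemma Pser_cont a r u : cvr a r -> (Cmod u < r)%R -> Ccont (Pser a) u.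
Proof. intros Ha Hu; apply Cder_cont with (1 := Pser_Cder a r u Ha Hu). Qed.

(** Continuity kills the constant term, and dividing by [v] leaves a series with the same zeros
    outside the origin. *)
Lemma Pser_zero_accum (a : nat -> C) (r : R) : (0 < r)%R -> cvr a r ->
  (forall d, (0 < d)%R -> exists v : C, (0 < Cmod v < d)%R /\ Pser a v = 0) -> forall n, a n = 0.
Proof.
intros Hr Ha H n; revert a Ha H; induction n as [|n IH]; intros a Ha H.
all: assert (H0 : a 0%nat = 0).
1, 3: rewrite <- (Pser_0 a); apply Ccont_zero; [apply Pser_cont with r; [exact Ha | now rewrite Cmod_0]|];
  intros d Hd; destruct (H d Hd) as [v [Hv E]]; exists v; split; [|exact E];
  replace (v - 0) with v by ring; apply Hv.
- exact H0.
- apply (IH (fun k => a (S k))); [now apply cvr_unshift|]; intros d Hd.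
  destruct (H (Rmin d r) ltac:(now apply Rmin_pos)) as [v [Hv E]]; exists v.
  pose proof (Rmin_l d r); pose proof (Rmin_r d r); split; [lra|].
  rewrite (Pser_incr a r), H0, Cplus_0_l in E by (assumption || lra).
  apply NNPP; intros Hn; apply (Cmult_neq_0 v _) in Hn; [contradiction|].
  apply (proj2 (Cmod_gt_0 v)); lra.
Qed.

Lemma Pser_zero_coef (a : nat -> C) (r e : R) : (0 < e <= r)%R -> cvr a r ->
  (forall v, (0 < Cmod v < e)%R -> Pser a v = 0) -> forall n, a n = 0.
Proof.
intros He Ha H; apply Pser_zero_accum with r; [lra | exact Ha |]; intros d Hd.
exists (RtoC (Rmin d e / 2)); rewrite Cmod_R.
assert (H1 : (0 < Rmin d e)%R) by (apply Rmin_pos; lra).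
pose proof (Rmin_l d e); pose proof (Rmin_r d e).
rewrite Rabs_pos_eq by lra; split; [lra|]. apply H; rewrite Cmod_R, Rabs_pos_eq; lra.
Qed.

Lemma Pser_all0 (a : nat -> C) (u : C) : (forall n, a n = 0) -> Pser a u = 0.
Proof.
intros H; unfold Pser; rewrite (CSeries_ext _ (fun _ => RtoC 0)); [apply CSeries_zero|].
intros n; rewrite H; ring.
Qed.

(** Vanishing near [u] spreads to the whole disc of radius [r - Cmod u] around [u], by recentring
    there. The exponent [k] bounds the number of moves of the centre towards the origin. *)
Lemma Pser_identity_aux (a : nat -> C) (r : R) : (0 < r)%R -> cvr a r -> forall k u e, (0 < e)%R -> (Cmod u < r)%R ->
  (r / 2 * (2 / 3) ^ k <= r - Cmod u)%R ->
  (forall v, disc u e v -> Pser a v = 0) -> forall n, a n = 0.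
Proof.
intros Hr Ha k; induction k as [|k IH]; intros u e He Hu Hk H.
all: assert (Hz : forall v, (Cmod v < r - Cmod u)%R -> Pser a (u + v) = 0).
1,3: intros v Hv; rewrite (Pser_recenter a r u Ha Hu v) by lra; apply Pser_all0;
  apply (Pser_zero_coef _ (r - Cmod u) (Rmin e (r - Cmod u)));
  [split; [apply Rmin_pos; lra | apply Rmin_r] | now apply recenter_cvr |];
  intros v' [_ Hv']; pose proof (Rmin_l e (r - Cmod u)); pose proof (Rmin_r e (r - Cmod u));
  rewrite <- (Pser_recenter a r u Ha Hu v') by lra; apply H; unfold disc;
  replace (u + v' - u) with v' by ring; lra.
- simpl in Hk. apply (Pser_zero_coef a r (r / 2)); [lra | exact Ha |].
  intros v [Hv0 Hv]. replace v with (u + (v - u)) by ring.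
  destruct (Rlt_dec (Cmod (v - u)) (r - Cmod u)) as [Hl|Hl]; [now apply Hz|].
  destruct (Req_dec (Cmod u) 0) as [H0|H0].
  + apply Cmod_eq_0 in H0; subst u. exfalso; apply Hl. replace (v - 0) with v by ring; rewrite Cmod_0; lra.
  + (* the disc of validity around [u / 4] contains a neighbourhood of the origin *)
    set (u' := RtoC (/ 4) * u).
    assert (Hu' : Cmod u' = (Cmod u / 4)%R) by (unfold u'; rewrite Cmod_mult, Cmod_R, Rabs_pos_eq; lra).
    assert (Hpos := Cmod_ge_0 u).
    assert (Hd : Cmod (u' - u) = (3 / 4 * Cmod u)%R).
    { replace (u' - u) with (RtoC (- (3 / 4)) * u) by (unfold u'; apply C_ext; simpl; field).
      rewrite Cmod_mult, Cmod_R, Rabs_Ropp, Rabs_pos_eq; lra. }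
    assert (Ha0 : forall n, a n = 0).
    { apply (Pser_zero_coef a r (r / 8)); [lra | exact Ha |].
      intros x [_ Hx]. set (e' := (r - Cmod u - Cmod (u' - u))%R).
      assert (He' : (r / 8 <= e')%R) by (unfold e'; lra).
      assert (Hu'r : (Cmod u' < r)%R) by lra.
      replace x with (u' + (x - u')) by ring.
      assert (Hz' : forall y, (Cmod (y - u') < e')%R -> Pser a y = 0).
      { intros y Hy; replace y with (u + (y - u)) by ring; apply Hz.
        pose proof (Cmod_sub_triangle y u' u); unfold e' in *; lra. }
      rewrite (Pser_recenter a r u' Ha Hu'r).
      - apply Pser_all0, (Pser_zero_coef _ (r - Cmod u') (Rmin e' (r - Cmod u')));
          [split; [apply Rmin_pos; lra | apply Rmin_r] | now apply recenter_cvr |].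
        intros v' [_ Hv']; pose proof (Rmin_l e' (r - Cmod u')); pose proof (Rmin_r e' (r - Cmod u')).
        rewrite <- (Pser_recenter a r u' Ha Hu'r v') by lra; apply Hz'; replace (u' + v' - u') with v' by ring; lra.
      - pose proof (Cmod_sub_triangle x 0 u') as T. replace (x - 0) with x in T by ring.
        replace (0 - u') with (- u') in T by ring. rewrite Cmod_opp in T. lra. }
    rewrite (Pser_all0 a) by exact Ha0; reflexivity.
- (* the disc of validity grows by the factor 3/2 when the centre moves towards 0 *)
  destruct (Rle_dec (r / 2) (r - Cmod u)) as [Hbig|Hbig].
  { apply (IH u e He Hu); [|exact H].
    assert ((2 / 3) ^ k <= 1)%R by (rewrite <- (pow1 k); apply pow_incr; lra). nra. }
  set (d := (r - Cmod u)%R) in *.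
  assert (Hd : (0 < d < r / 2)%R) by (unfold d in *; lra).
  assert (Hcu : (0 < Cmod u)%R) by (unfold d in *; lra).
  set (t := (1 - d / 2 / Cmod u)%R).
  assert (Ht : (t * Cmod u = Cmod u - d / 2)%R) by (unfold t; field; lra).
  assert (Ht0 : (0 <= t)%R) by (apply (Rmult_le_reg_r (Cmod u)); [lra|]; unfold d in *; lra).
  assert (Hu' : Cmod (RtoC t * u) = (Cmod u - d / 2)%R) by (rewrite Cmod_mult, Cmod_R, Rabs_pos_eq; lra).
  apply (IH (RtoC t * u) (d / 2)%R); [lra | unfold d in *; lra | |].
  + rewrite Hu'. simpl pow in Hk. unfold d in *. lra.
  + intros v Hv; unfold disc in Hv. replace v with (u + (v - u)) by ring; apply Hz.
    assert (E : Cmod (RtoC t * u - u) = (d / 2)%R).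
    { replace (RtoC t * u - u) with (RtoC (t - 1) * u) by (rewrite RtoC_minus; ring).
      rewrite Cmod_mult, Cmod_R, Rabs_left1; [lra|]. apply (Rmult_le_reg_r (Cmod u)); lra. }
    pose proof (Cmod_sub_triangle v (RtoC t * u) u). fold d; lra.
Qed.

Lemma Pser_identity (a : nat -> C) (r : R) (u : C) (e : R) : cvr a r -> (0 < e)%R -> (Cmod u < r)%R ->
  (forall v, disc u e v -> Pser a v = 0) -> forall n, a n = 0.
Proof.
intros Ha He Hu H.
assert (Hr : (0 < r)%R) by (pose proof (Cmod_ge_0 u); lra).
assert (Hd : (0 < (r - Cmod u) / (r / 2))%R) by (apply Rdiv_lt_0_compat; lra).
destruct (pow_lt_1_zero (2 / 3) ltac:(rewrite Rabs_pos_eq; lra) _ Hd) as [k Hk].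
specialize (Hk k (le_n k)); rewrite Rabs_pos_eq in Hk by (apply pow_le; lra).
apply (Pser_identity_aux a r Hr Ha k u e He Hu); [|exact H].
apply (Rmult_lt_compat_l (r / 2)) in Hk; [|lra].
replace (r / 2 * ((r - Cmod u) / (r / 2)))%R with (r - Cmod u)%R in Hk by (field; lra). lra.
Qed.

(** * The exponential function *)

Lemma exp_sub_bound (a : R) : (Rabs a <= / 2)%R -> (0 <= exp a - 1 - a <= 2 * a ^ 2)%R.
Proof.
intros H; apply Rabs_le_between in H.
pose proof (exp_ineq1_le a) as H1; pose proof (exp_ineq1_le (- a)) as H2.
pose proof (exp_pos a) as H3.
assert (E : (exp a * exp (- a) = 1)%R) by (rewrite <- exp_plus, Rplus_opp_r; apply exp_0).
assert (H4 : (exp a * (1 - a) <= 1)%R) by (rewrite <- E; apply Rmult_le_compat_l; lra).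
split; [lra|]. nra.
Qed.

(** [1 - cos b] is twice the square of [sin (b / 2)]. *)
Lemma cos_sub_bound (b : R) : (0 <= 1 - cos b <= b ^ 2)%R.
Proof.
split; [pose proof (COS_bound b); lra|].
assert (H : (Rabs (sin (b / 2)) <= Rabs (b / 2))%R).
{ destruct (Rle_lt_dec 0 (b / 2)) as [Hb|Hb].
  - rewrite (Rabs_pos_eq (b / 2)) by exact Hb.
    destruct (Rle_lt_or_eq_dec _ _ Hb) as [Hb'|<-]; [|rewrite sin_0, Rabs_R0; lra].
    apply Rabs_le; pose proof (sin_lt_x (b / 2) Hb'); split; [|lra].
    destruct (Rlt_dec (b / 2) 1) as [Hl|Hl].
    + assert (0 < sin (b / 2))%R; [|lra]. apply sin_gt_0; [lra|]. pose proof PI2_1; unfold PI2 in *; lra.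
    + pose proof (SIN_bound (b / 2)); lra.
  - rewrite (Rabs_left (b / 2)) by exact Hb.
    assert (Hb' : (0 < - (b / 2))%R) by lra.
    rewrite <- Rabs_Ropp, <- sin_neg.
    apply Rabs_le; pose proof (sin_lt_x _ Hb'); split; [|lra].
    destruct (Rlt_dec (- (b / 2)) 1) as [Hl|Hl].
    + assert (0 < sin (- (b / 2)))%R; [|lra]. apply sin_gt_0; [lra|]. pose proof PI2_1; unfold PI2 in *; lra.
    + pose proof (SIN_bound (- (b / 2))); lra. }
replace (cos b) with (1 - 2 * sin (b / 2) * sin (b / 2))%R by (rewrite <- cos_2a_sin; f_equal; field).
apply Rsqr_le_abs_1 in H; unfold Rsqr in H; pose proof (pow2_ge_0 b); nra.
Qed.

Lemma sin_sub_bound (b : R) : (Rabs (sin b - b) <= Rabs b ^ 3)%R.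
Proof.
destruct (MVT_gen sin 0 b cos) as [c [Hc E]].
- intros x _; apply is_derive_Reals, derivable_pt_lim_sin.
- intros x _; apply continuity_sin.
- rewrite sin_0, !Rminus_0_r in E; rewrite E.
  replace (cos c * b - b)%R with (- ((1 - cos c) * b))%R by ring.
  rewrite Rabs_Ropp, Rabs_mult.
  pose proof (cos_sub_bound c) as H.
  rewrite (Rabs_pos_eq (1 - cos c)) by lra.
  replace (Rabs b ^ 3)%R with (Rabs b ^ 2 * Rabs b)%R by ring.
  apply Rmult_le_compat_r; [apply Rabs_pos|].
  apply Rle_trans with (c ^ 2)%R; [lra|]. rewrite pow2_abs.
  unfold Rmin, Rmax in Hc; destruct (Rle_dec 0 b); nra.
Qed.

Lemma Cexp_add (v w : C) : Cexp (v + w) = Cexp v * Cexp w.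
Proof.
unfold Cexp.
change (Re (v + w)) with (Re v + Re w)%R; change (Im (v + w)) with (Im v + Im w)%R.
rewrite exp_plus, cos_plus, sin_plus.
apply C_ext; unfold Cmult, Re, Im; cbn [fst snd]; ring.
Qed.

Lemma Cexp_0 : Cexp 0 = 1.
Proof. unfold Cexp; apply C_ext; simpl; rewrite exp_0, ?cos_0, ?sin_0; ring. Qed.

Lemma Cmod_Cexp (w : C) : Cmod (Cexp w) = exp (Re w).
Proof.
unfold Cmod, Cexp; cbn [fst snd].
assert (E : forall e c s : R, ((e * c) ^ 2 + (e * s) ^ 2)%R = (e * e * (Rsqr s + Rsqr c))%R)
  by (intros; unfold Rsqr; ring).
rewrite E.
rewrite sin2_cos2, Rmult_1_r. apply sqrt_square; left; apply exp_pos.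
Qed.

Lemma Cexp_neq_0 (w : C) : Cexp w <> 0.
Proof. apply (proj2 (Cmod_gt_0 _)); rewrite Cmod_Cexp; apply exp_pos. Qed.

Lemma Cexp_opp (w : C) : Cexp (- w) = / Cexp w.
Proof.
pose proof (Cexp_neq_0 w) as H.
assert (E : Cexp (- w) * Cexp w = 1) by (rewrite <- Cexp_add; replace (- w + w) with (RtoC 0) by ring; apply Cexp_0).
transitivity (Cexp (- w) * Cexp w / Cexp w); [field; exact H | rewrite E; field; exact H].
Qed.

Lemma Cexp_nat (n : nat) (w : C) : Cexp (natC n * w) = Cexp w ^ n.
Proof.
induction n as [|n IH].
- unfold natC; simpl; rewrite Cmult_0_l; apply Cexp_0.
- unfold natC in *; rewrite S_INR, RtoC_plus.
  replace ((INR n + 1) * w) with (w + INR n * w) by ring.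
  rewrite Cexp_add, IH; reflexivity.
Qed.

(** Only the quadratic order matters; [8] adds two crude bounds [4] for the real and the imaginary
    part. The addition formula then gives the derivative everywhere. *)
Lemma Cexp_near_0 (v : C) : (Cmod v <= / 2)%R -> (Cmod (Cexp v - 1 - v) <= 8 * Cmod v ^ 2)%R.
Proof.
intros Hv; set (a := Re v); set (b := Im v).
pose proof (re_le_Cmod v) as Ha; pose proof (im_le_Cmod v) as Hb; fold a in Ha; fold b in Hb.
pose proof (exp_sub_bound a ltac:(lra)) as He; pose proof (cos_sub_bound b) as Hc; pose proof (sin_sub_bound b) as Hs.
set (m := Cmod v) in *.
assert (Hm : (0 <= m)%R) by apply Cmod_ge_0.
assert (Ha2 : (a ^ 2 <= m ^ 2)%R) by (rewrite <- pow2_abs; apply pow_incr; split; [apply Rabs_pos | lra]).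
assert (Hb2 : (b ^ 2 <= m ^ 2)%R) by (rewrite <- pow2_abs; apply pow_incr; split; [apply Rabs_pos | lra]).
assert (Hb3 : (Rabs b ^ 3 <= m ^ 2)%R).
{ apply Rle_trans with (m ^ 3)%R; [apply pow_incr; split; [apply Rabs_pos | lra]|].
  replace (m ^ 3)%R with (m ^ 2 * m)%R by ring. pose proof (pow2_ge_0 m); nra. }
eapply Rle_trans; [apply Cmod_le_add|].
assert (R1 : (Rabs (Re (Cexp v - 1 - v)) <= 4 * m ^ 2)%R).
{ replace (Re (Cexp v - 1 - v)) with ((exp a - 1 - a) * cos b + (1 + a) * (cos b - 1))%R.
  2: { unfold Cexp, Cminus, Cplus, Copp, Re, Im, a, b; simpl; unfold Re, Im; ring. }
  eapply Rle_trans; [apply Rabs_triang|]; rewrite !Rabs_mult.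
  rewrite (Rabs_pos_eq (exp a - 1 - a)) by lra. rewrite (Rabs_minus_sym (cos b)), (Rabs_pos_eq (1 - cos b)) by lra.
  assert (Rabs (cos b) <= 1)%R by (apply Rabs_le; apply COS_bound).
  assert (Rabs (1 + a) <= 2)%R by (eapply Rle_trans; [apply Rabs_triang|]; rewrite Rabs_R1; lra).
  pose proof (Rabs_pos (cos b)); pose proof (Rabs_pos (1 + a)). nra. }
assert (R2 : (Rabs (Im (Cexp v - 1 - v)) <= 4 * m ^ 2)%R).
{ replace (Im (Cexp v - 1 - v)) with ((exp a - 1 - a) * sin b + a * sin b + (sin b - b))%R.
  2: { unfold Cexp, Cminus, Cplus, Copp, Re, Im, a, b; simpl; unfold Re, Im; ring. }
  assert (Hsb : (Rabs (sin b) <= m)%R).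
  { assert (H1 : (Rabs (sin b) <= Rabs b)%R).
    { destruct (MVT_gen sin 0 b cos) as [c [Hc' E]].
      - intros x _; apply is_derive_Reals, derivable_pt_lim_sin.
      - intros x _; apply continuity_sin.
      - rewrite sin_0, !Rminus_0_r in E; rewrite E, Rabs_mult.
        assert (Rabs (cos c) <= 1)%R by (apply Rabs_le; apply COS_bound).
        pose proof (Rabs_pos b); nra. }
    lra. }
  eapply Rle_trans; [apply Rabs_triang|]; eapply Rle_trans; [apply Rplus_le_compat_r, Rabs_triang|]; rewrite !Rabs_mult.
  rewrite (Rabs_pos_eq (exp a - 1 - a)) by lra.
  assert (Rabs (sin b) <= 1)%R by lra.
  assert (Rabs a * Rabs (sin b) <= m * m)%R by (apply Rmult_le_compat; try apply Rabs_pos; lra).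
  pose proof (Rabs_pos (sin b)). nra. }
lra.
Qed.

Lemma Cder_Cexp (w : C) : Cder Cexp w (Cexp w).
Proof.
apply Cder_quadratic_bound with (M := (Cmod (Cexp w) * 8)%R) (d := (/ 2)%R); [lra|].
intros v Hv; rewrite Cexp_add.
replace (Cexp w * Cexp v - Cexp w - Cexp w * v) with (Cexp w * (Cexp v - 1 - v)) by ring.
rewrite Cmod_mult, Rmult_assoc; apply Rmult_le_compat_l; [apply Cmod_ge_0 | apply Cexp_near_0; lra].
Qed.

Definition expc (n : nat) : C := / factC n.

Lemma factC_neq_0 n : factC n <> 0.
Proof. unfold factC, natC; intros H; apply RtoC_inj in H; now apply (INR_fact_neq_0 n). Qed.

Lemma natC_S_neq_0 n : natC (S n) <> 0.
Proof. unfold natC; intros H; apply RtoC_inj in H; revert H; apply not_0_INR; lia. Qed.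

Lemma expc_cvr r : cvr expc r.
Proof.
intros rho Hr; apply exR_ext with (fun n => (/ INR (fact n) * rho ^ n)%R).
- intros n; unfold expc, factC, natC; rewrite Cmod_inv by apply factC_neq_0.
  rewrite Cmod_R, Rabs_pos_eq; [reflexivity | apply pos_INR].
- pose proof (is_exp_Reals rho) as H; apply is_pseries_R in H; now exists (exp rho).
Qed.

Lemma der_expc n : der expc n = expc n.
Proof.
unfold der, expc, factC, natC. rewrite fact_simpl, mult_INR, RtoC_mult.
field; split; [apply factC_neq_0 | apply natC_S_neq_0].
Qed.

(** The product of the series with [Cexp (- v)] has derivative zero and equals [1] at the origin. *)
Lemma Cexp_Pser (w : C) : Cexp w = Pser expc w.
Proof.
assert (H : Pser expc w * Cexp (- w) = Pser expc 0 * Cexp (- 0)).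
{ apply (Cder_zero_const (fun _ => True) (fun v => Pser expc v * Cexp (- v))).
  - intros a b t _ _ _; exact I.
  - intros v _.
    apply Cder_eq with (Pser (der expc) v * Cexp (- v) + Pser expc v * (Cexp (- v) * - (1))).
    + apply (Cder_mult (Pser expc) (fun v => Cexp (- v))).
      * apply Pser_Cder with (Cmod v + 1)%R; [apply expc_cvr | lra].
      * apply (Cder_comp (fun v => - v) Cexp); [apply (Cder_opp (fun v => v)), Cder_id | apply Cder_Cexp].
    + replace (Pser (der expc) v) with (Pser expc v); [ring|].
      unfold Pser; apply CSeries_ext; intros n; now rewrite der_expc.
  - exact I.
  - exact I. }
rewrite Pser_0, Copp_0, Cexp_0 in H; unfold expc at 2, factC, natC in H; simpl in H.
rewrite Cexp_opp in H. pose proof (Cexp_neq_0 w) as Hw.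
transitivity (Cexp w * (Pser expc w * / Cexp w)).
- rewrite H; field.
- field; exact Hw.
Qed.

Lemma Cexp_eq_1 (w : C) : Cexp w = 1 <-> exists k : Z, w = twopi_i * RtoC (IZR k).
Proof.
split.
- intros H.
  assert (Hr : Re w = 0%R).
  { apply exp_inv; rewrite exp_0, <- Cmod_Cexp, H; apply Cmod_1. }
  unfold Cexp in H; rewrite Hr, exp_0, !Rmult_1_l in H; injection H as Hc Hs.
  destruct (sin_eq_0_0 _ Hs) as [k Hk].
  (* A vanishing sine gives a multiple of [PI]; an odd one would make the cosine [- 1]. *)
  assert (E : exists j : Z, k = (2 * j)%Z).
  { destruct (Z.Even_or_Odd k) as [[j Hj]|[j Hj]]; [now exists j|].
    exfalso. rewrite Hk, Hj, plus_IZR, mult_IZR in Hc.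
    replace ((2 * IZR j + 1) * PI)%R with (2 * IZR j * PI + PI)%R in Hc by ring.
    rewrite neg_cos in Hc.
    assert (cos (2 * IZR j * PI) = 1)%R; [|lra].
    destruct (Z_le_dec 0 j) as [Hj0|Hj0].
    - replace (2 * IZR j * PI)%R with (0 + 2 * INR (Z.to_nat j) * PI)%R.
      + rewrite cos_period; apply cos_0.
      + rewrite INR_IZR_INZ, Z2Nat.id by exact Hj0; ring.
    - rewrite <- cos_neg.
      replace (- (2 * IZR j * PI))%R with (0 + 2 * INR (Z.to_nat (- j)) * PI)%R.
      + rewrite cos_period; apply cos_0.
      + rewrite INR_IZR_INZ, Z2Nat.id by lia. rewrite opp_IZR; ring. }
  destruct E as [j ->]. exists j. apply C_ext.
  + rewrite Hr; unfold twopi_i, Ci; simpl; ring.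
  + rewrite Hk, mult_IZR; unfold twopi_i, Ci; simpl; ring.
- intros [k ->].
  assert (Hn : forall n, Cexp (twopi_i * natC n) = 1).
  { intros n; rewrite Cmult_comm, Cexp_nat.
    replace (Cexp twopi_i) with (RtoC 1); [apply Cpow_1_l|].
    unfold Cexp, twopi_i, Ci; apply C_ext; simpl.
    - replace (((2 * PI - 0 * 0) * 0 - (2 * 0 + 0 * PI) * 1))%R with 0%R by ring.
      replace ((2 * PI - 0 * 0) * 1 + (2 * 0 + 0 * PI) * 0)%R with (2 * PI)%R by ring.
      rewrite exp_0, cos_2PI; ring.
    - replace (((2 * PI - 0 * 0) * 0 - (2 * 0 + 0 * PI) * 1))%R with 0%R by ring.
      replace ((2 * PI - 0 * 0) * 1 + (2 * 0 + 0 * PI) * 0)%R with (2 * PI)%R by ring.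
      rewrite exp_0, sin_2PI; ring. }
  destruct (Z_le_dec 0 k) as [Hk|Hk].
  + rewrite <- (Hn (Z.to_nat k)); unfold natC; rewrite INR_IZR_INZ, Z2Nat.id by exact Hk; reflexivity.
  + specialize (Hn (Z.to_nat (- k))). unfold natC in Hn; rewrite INR_IZR_INZ, Z2Nat.id, opp_IZR, RtoC_opp in Hn by lia.
    replace (twopi_i * IZR k) with (- (twopi_i * - IZR k)) by ring.
    rewrite Cexp_opp, Hn; field.
Qed.

Lemma twopi_i_neq_0 : twopi_i <> 0.
Proof.
intros H; apply (f_equal Im) in H; unfold twopi_i, Ci in H; simpl in H; pose proof PI_RGT_0; lra.
Qed.

Lemma e2pi_add (v w : C) : e2pi (v + w) = e2pi v * e2pi w.
Proof. unfold e2pi; rewrite Cmult_plus_distr_l; apply Cexp_add. Qed.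

Lemma e2pi_opp (w : C) : e2pi (- w) = / e2pi w.
Proof. unfold e2pi; rewrite <- Cexp_opp; f_equal; ring. Qed.

Lemma e2pi_neq_0 (w : C) : e2pi w <> 0.
Proof. apply Cexp_neq_0. Qed.

Lemma e2pi_0 : e2pi 0 = 1.
Proof. unfold e2pi; rewrite Cmult_0_r; apply Cexp_0. Qed.

Lemma e2pi_nat (n : nat) (w : C) : e2pi (natC n * w) = e2pi w ^ n.
Proof. unfold e2pi; rewrite <- Cexp_nat; f_equal; ring. Qed.

Lemma e2pi_eq_1 (w : C) : e2pi w = 1 <-> exists k : Z, w = RtoC (IZR k).
Proof.
unfold e2pi; rewrite Cexp_eq_1; split; intros [k Hk]; exists k; [|now rewrite Hk].
transitivity (twopi_i * w / twopi_i); [field; apply twopi_i_neq_0 | rewrite Hk; field; apply twopi_i_neq_0].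
Qed.

Lemma e2pi_Z (k : Z) : e2pi (RtoC (IZR k)) = 1.
Proof. apply e2pi_eq_1; now exists k. Qed.

Lemma e2pi_1 : e2pi 1 = 1.
Proof. apply (e2pi_Z 1). Qed.

Lemma Cmod_e2pi (w : C) : Cmod (e2pi w) = exp (- (2 * PI * Im w)).
Proof. unfold e2pi; rewrite Cmod_Cexp; f_equal; unfold twopi_i, Ci; simpl; unfold Im; ring. Qed.

Lemma Cmod_e2pi_lt_1 (w : C) : (0 < Im w)%R -> (Cmod (e2pi w) < 1)%R.
Proof.
intros H; rewrite Cmod_e2pi, <- exp_0; apply exp_increasing.
pose proof PI_RGT_0; assert (0 < PI * Im w)%R by now apply Rmult_lt_0_compat. lra.
Qed.

Lemma Cmod_e2pi_le_1 (w : C) : (0 <= Im w)%R -> (Cmod (e2pi w) <= 1)%R.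
Proof.
intros [H|H]; [left; now apply Cmod_e2pi_lt_1|].
rewrite Cmod_e2pi, <- H, Rmult_0_r, Ropp_0, exp_0; lra.
Qed.

Lemma Cder_e2pi (w : C) : Cder e2pi w (twopi_i * e2pi w).
Proof.
apply Cder_eq with (Cexp (twopi_i * w) * twopi_i); [|unfold e2pi; ring].
apply (Cder_comp (fun w => twopi_i * w)).
- apply Cder_eq with (twopi_i * 1); [apply Cder_scal, Cder_id | ring].
- apply Cder_Cexp.
Qed.

(** * The differential equation of the trilogarithm *)

Definition li3c (n : nat) : C := match n with O => 0 | S _ => / natC n ^ 3 end.

(** Coefficients of [(c + u) * sum a_n u^n]. *)
Definition mulc (c : C) (a : nat -> C) (n : nat) : C :=
  c * a n + match n with O => 0 | S m => a m end.

Lemma cvr_mulc c a r : cvr a r -> cvr (mulc c a) r.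
Proof.
intros H; apply cvr_plus; [now apply cvr_scal | now apply cvr_shift].
Qed.

Lemma Pser_mulc c a r u : cvr a r -> (Cmod u < r)%R -> Pser (mulc c a) u = (c + u) * Pser a u.
Proof.
intros H Hu.
assert (Hs : cvr (fun n => match n with O => RtoC 0 | S m => a m end) r) by now apply cvr_shift.
unfold mulc; rewrite (Pser_plus _ _ r) by (assumption || now apply cvr_scal).
rewrite (Pser_scal _ _ r) by assumption.
rewrite (Pser_incr _ r) with (1 := Hs) by assumption. cbv beta iota.
change (fun n => a n) with a; ring.
Qed.

Lemma cvr_li3c : cvr li3c 1.
Proof.
apply cvr_bounded with 1%R; intros n; rewrite pow1, Rmult_1_r.
destruct n as [|n]; [simpl; rewrite Cmod_0; lra|].
assert (Hn : (1 <= INR (S n))%R) by (rewrite S_INR; pose proof (pos_INR n); lra).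
cbn [li3c]; rewrite Cmod_inv by (apply Cpow_nz, natC_S_neq_0).
rewrite <- Rinv_1; apply Rinv_le_contravar; [lra|].
unfold natC; rewrite Cmod_pow, Cmod_R, Rabs_pos_eq by lra.
rewrite <- (pow1 3); apply pow_incr; lra.
Qed.

Lemma INR_S_ge_1 n : (1 <= INR (S n))%R.
Proof. rewrite S_INR; pose proof (pos_INR n); lra. Qed.

(** The bound [2 - / INR (S n)] on the partial sums telescopes. *)
Lemma inv_sq_summable : ex_series (fun n => / (INR (S n) ^ 2))%R.
Proof.
apply ex_series_bounded with 2%R.
- intros k; left; apply Rinv_0_lt_compat, pow_lt; pose proof (INR_S_ge_1 k); lra.
- intros n; apply Rle_trans with (2 - / INR (S n))%R.
  + induction n as [|n IH]; [rewrite sum_O; simpl; lra|].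
    rewrite sum_Sn; change (sum_n (fun n => / INR (S n) ^ 2) n + / INR (S (S n)) ^ 2 <= 2 - / INR (S (S n)))%R.
    pose proof (INR_S_ge_1 n) as Hn; rewrite (S_INR (S n)); set (x := INR (S n)) in *.
    assert (E : (/ x - / (x + 1) = / (x * (x + 1)))%R) by (field; lra).
    assert (/ ((x + 1) ^ 2) <= / (x * (x + 1)))%R by (apply Rinv_le_contravar; nra).
    lra.
  + assert (0 < / INR (S n))%R; [|lra]. apply Rinv_0_lt_compat; pose proof (INR_S_ge_1 n); lra.
Qed.

Lemma li3c_bound x n : (Cmod x <= 1)%R -> (Cmod (x ^ S n / natC (S n) ^ 3) <= / (INR (S n) ^ 2))%R.
Proof.
intros Hx; pose proof (INR_S_ge_1 n) as Hn.
rewrite Cmod_div by (apply Cpow_nz, natC_S_neq_0).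
unfold natC; rewrite !Cmod_pow, Cmod_R, Rabs_pos_eq by lra.
assert (H1 : (Cmod x ^ S n <= 1)%R) by (rewrite <- (pow1 (S n)); apply pow_incr; split; [apply Cmod_ge_0 | exact Hx]).
apply Rle_trans with (/ (INR (S n) ^ 3))%R.
- rewrite <- (Rmult_1_l (/ INR (S n) ^ 3)); apply Rmult_le_compat_r; [left; apply Rinv_0_lt_compat, pow_lt; lra | exact H1].
- apply Rinv_le_contravar; [apply pow_lt; lra | apply Rle_pow; [lra | lia]].
Qed.

Lemma Li3_disc_asum x : (Cmod x <= 1)%R -> asum (fun n => x ^ S n / natC (S n) ^ 3).
Proof. intros Hx; apply asum_le with (2 := inv_sq_summable); intros n; now apply li3c_bound. Qed.

Lemma Li3_disc_Pser x : (Cmod x <= 1)%R -> Li3_disc x = Pser li3c x.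
Proof.
intros Hx; symmetry; apply is_Cseries_unique.
replace (Li3_disc x) with (li3c 0 * x ^ 0 + Li3_disc x) by (simpl; ring).
apply (is_Cseries_incr (fun n => li3c n * x ^ n)).
apply is_Cseries_ext with (2 := asum_is _ (Li3_disc_asum x Hx)); intros n; cbn [li3c]; unfold Cdiv; ring.
Qed.

Lemma pow_n_Cpow (x : C) n : pow_n (K := C_Ring) x n = x ^ n.
Proof. induction n as [|n IH]; [reflexivity | simpl; now rewrite IH]. Qed.

Lemma is_pseries_Pser (a : nat -> C) (r : R) (c : C) (g : C -> C) :
  (forall x, (Cmod (x - c) < r)%R -> @is_pseries C_AbsRing C_NormedModule a (x - c) (g x)) ->
  cvr a r /\ forall x, (Cmod (x - c) < r)%R -> g x = Pser a (x - c).
Proof.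
intros H.
assert (E : forall x, (Cmod (x - c) < r)%R -> is_Cseries (fun n => a n * (x - c) ^ n) (g x)).
{ intros x Hx; apply is_Cseries_ext with (2 := H x Hx); intros n.
  change (pow_n (K := C_Ring) (x - c) n * a n = a n * (x - c) ^ n); rewrite pow_n_Cpow; ring. }
split.
- apply cvr_conv; intros u Hu; exists (g (c + u)).
  assert (E' : c + u - c = u) by ring.
  specialize (E (c + u)); rewrite E' in E; now apply E.
- intros x Hx; symmetry; apply is_Cseries_unique, E, Hx.
Qed.

(** On power series in [u = x - c], [oned] is the operator [x d/dx] and [li3op] is
    [d/dx (x d/dx)^2]. *)
Definition oned (c : C) (a : nat -> C) : nat -> C := mulc c (der a).
Definition li3op (c : C) (a : nat -> C) : nat -> C := der (oned c (oned c a)).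

Lemma cvr_oned c a r : cvr a r -> cvr (oned c a) r.
Proof. intros H; now apply cvr_mulc, cvr_der. Qed.

Lemma cvr_li3op c a r : cvr a r -> cvr (li3op c a) r.
Proof. intros H; now apply cvr_der, cvr_oned, cvr_oned. Qed.

Lemma Pser_oned c a r u : cvr a r -> (Cmod u < r)%R -> Pser (oned c a) u = (c + u) * Pser (der a) u.
Proof. intros H Hu; apply Pser_mulc with r; [now apply cvr_der | exact Hu]. Qed.

Lemma Pser_sub_Cder a r (c : C) x : cvr a r -> (Cmod (x - c) < r)%R ->
  Cder (fun x => Pser a (x - c)) x (Pser (der a) (x - c)).
Proof.
intros H Hx; apply Cder_eq with (Pser (der a) (x - c) * 1); [|ring].
apply (Cder_comp (fun x => x - c) (Pser a)).
- apply Cder_eq with (1 - 0); [apply Cder_minus; [apply Cder_id | apply Cder_const] | ring].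
- now apply Pser_Cder with r.
Qed.

(** The two series have different centres, so their coefficients cannot be compared; their
    derivatives as functions can. *)
Lemma Pser_der_local (a b : nat -> C) (r s : R) (c d x1 : C) (e : R) : cvr a r -> cvr b s ->
  (forall x, disc x1 e x -> (Cmod (x - c) < r)%R /\ (Cmod (x - d) < s)%R /\ Pser a (x - c) = Pser b (x - d)) ->
  forall x, disc x1 e x -> Pser (der a) (x - c) = Pser (der b) (x - d).
Proof.
intros Ha Hb H x Hx.
destruct (H x Hx) as [H1 [H2 H3]].
destruct (disc_open _ _ _ Hx) as [e' [He' K]].
apply Cder_unique with (fun y => Pser a (y - c)) x.
- now apply Pser_sub_Cder with r.
- apply Cder_ext with (fun y => Pser b (y - d)) e'; [exact He' | intros y Hy; symmetry; now apply H, K |].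
  now apply Pser_sub_Cder with s.
Qed.

Lemma Pser_li3op_local (a b : nat -> C) (r s : R) (c d x1 : C) (e : R) : cvr a r -> cvr b s ->
  (forall x, disc x1 e x -> (Cmod (x - c) < r)%R /\ (Cmod (x - d) < s)%R /\ Pser a (x - c) = Pser b (x - d)) ->
  forall x, disc x1 e x -> Pser (li3op c a) (x - c) = Pser (li3op d b) (x - d).
Proof.
intros Ha Hb H.
assert (H1 := Pser_der_local _ _ _ _ _ _ _ _ Ha Hb H).
assert (K1 : forall x, disc x1 e x -> (Cmod (x - c) < r)%R /\ (Cmod (x - d) < s)%R /\
  Pser (oned c a) (x - c) = Pser (oned d b) (x - d)).
{ intros x Hx; destruct (H x Hx) as [L1 [L2 _]]; repeat split; try assumption.
  rewrite (Pser_oned c a r), (Pser_oned d b s), H1 by assumption; ring. }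
assert (H2 := Pser_der_local _ _ _ _ _ _ _ _ (cvr_oned c _ _ Ha) (cvr_oned d _ _ Hb) K1).
assert (K2 : forall x, disc x1 e x -> (Cmod (x - c) < r)%R /\ (Cmod (x - d) < s)%R /\
  Pser (oned c (oned c a)) (x - c) = Pser (oned d (oned d b)) (x - d)).
{ intros x Hx; destruct (H x Hx) as [L1 [L2 _]]; repeat split; try assumption.
  rewrite (Pser_oned c _ r), (Pser_oned d _ s), H2 by (assumption || now apply cvr_oned); ring. }
exact (Pser_der_local _ _ _ _ _ _ _ _ (cvr_oned c _ _ (cvr_oned c _ _ Ha)) (cvr_oned d _ _ (cvr_oned d _ _ Hb)) K2).
Qed.

Lemma Pser_one_sub (a : nat -> C) (r : R) (c u : C) : cvr a r -> (Cmod u < r)%R ->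
  let b := fun n => a n + (-(1)) * mulc c a n in
  cvr b r /\ Pser b u = (1 - (c + u)) * Pser a u.
Proof.
intros H Hu b.
assert (H1 : cvr (fun n => (-(1)) * mulc c a n) r) by now apply cvr_scal, cvr_mulc.
split; [now apply cvr_plus|].
unfold b; rewrite (Pser_plus _ _ r), (Pser_scal _ _ r), (Pser_mulc _ _ r) by (assumption || now apply cvr_mulc).
ring.
Qed.

Definition onec (n : nat) : C := match n with O => 1 | S _ => 0 end.

Lemma cvr_onec r : cvr onec r.
Proof.
apply cvr_shift; intros rho Hr; apply exR_ext with (fun _ => 0%R).
- intros n; simpl; rewrite Cmod_0; ring.
- exists 0%R; unfold is_series; apply filterlim_ext with (fun _ => 0%R); [|apply filterlim_const].
  intros n; rewrite sum_n_const; ring.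
Qed.

Lemma Pser_onec u : Pser onec u = 1.
Proof.
rewrite (Pser_incr onec (Cmod u + 1)) by (lra || apply cvr_onec).
rewrite Pser_all0 by reflexivity; simpl; ring.
Qed.

Lemma Pser_onec_shift u : (Cmod u < 1)%R -> Pser (fun _ => 1) u = / (1 - u).
Proof.
intros Hu; unfold Pser; rewrite (CSeries_ext _ (fun n => u ^ n)) by (intros; ring); now apply CSeries_geom.
Qed.

Lemma oned_0_S a n : oned 0 a (S n) = natC (S n) * a (S n).
Proof. unfold oned, mulc, der; ring. Qed.

Lemma li3op_li3c n : li3op 0 li3c n = 1.
Proof.
unfold li3op, der; rewrite !oned_0_S; cbn [li3c]; field; apply natC_S_neq_0.
Qed.

(** Induction on the chain of discs: on the overlap the equation passes from one series to the next,
    and the identity theorem extends it to the new disc. On the unit disc, [li3op] turns the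
    coefficients [1 / n^3] into those of the geometric series. *)
Lemma Li3_element_ode c r g : Li3_element c r g ->
  exists a, cvr a r /\ (forall x, (Cmod (x - c) < r)%R -> g x = Pser a (x - c)) /\
    forall x, (Cmod (x - c) < r)%R -> (1 - x) * Pser (li3op c a) (x - c) = 1.
Proof.
induction 1 as [|c c' r r' g g' b _ [a [Ha [Eg Ode]]] Hr' Hps [x1 [Hx1 Hx1']] Eov].
- exists li3c; split; [exact cvr_li3c|]; split; intros x Hx; replace (x - 0) with x in * by ring.
  + apply Li3_disc_Pser; lra.
  + unfold Pser; rewrite (CSeries_ext _ (fun n => x ^ n)) by (intros; rewrite li3op_li3c; ring).
    rewrite CSeries_geom by exact Hx; field. intros E.
    assert (x = 1) as -> by (replace x with (1 - (1 - x)) by ring; rewrite E; ring).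
    rewrite Cmod_1 in Hx; lra.
- destruct (is_pseries_Pser _ _ _ _ Hps) as [Hb Eg'].
  exists b; split; [exact Hb|]; split; [exact Eg'|].
  destruct (disc_open c r x1 Hx1) as [e1 [He1 K1]], (disc_open c' r' x1 Hx1') as [e2 [He2 K2]].
  set (e := Rmin e1 e2).
  assert (He : (0 < e)%R) by now apply Rmin_pos.
  assert (Kd : forall x, disc x1 e x -> (Cmod (x - c) < r)%R /\ (Cmod (x - c') < r')%R).
  { unfold disc, e; intros x Hx; pose proof (Rmin_l e1 e2); pose proof (Rmin_r e1 e2).
    split; [apply K1 | apply K2]; unfold disc; lra. }
  assert (K : forall x, disc x1 e x -> (Cmod (x - c) < r)%R /\ (Cmod (x - c') < r')%R /\ Pser a (x - c) = Pser b (x - c')).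
  { intros x Hx; destruct (Kd x Hx) as [L1 L2]; repeat split; try assumption.
    rewrite <- Eg, <- Eg' by assumption; symmetry; now apply Eov. }
  assert (K' := Pser_li3op_local _ _ _ _ _ _ _ _ Ha Hb K).
  (* Coefficients, in powers of [x - c'], of [1 - x] times the operator applied to the new series,
     minus [1]. *)
  set (h := fun n => (li3op c' b n + (-(1)) * mulc c' (li3op c' b) n) + (-(1)) * onec n).
  assert (Hop := cvr_li3op c' _ _ Hb).
  assert (Eh : forall u, (Cmod u < r')%R -> cvr h r' /\ Pser h u = (1 - (c' + u)) * Pser (li3op c' b) u - 1).
  { intros u Hu; destruct (Pser_one_sub _ _ c' u Hop Hu) as [Hc Ec].
    assert (H1 : cvr (fun n => (-(1)) * onec n) r') by (apply cvr_scal, cvr_onec).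
    unfold h; split; [now apply cvr_plus|].
    rewrite (Pser_plus _ _ r'), Ec, (Pser_scal _ _ r'), Pser_onec by (assumption || apply cvr_onec). ring. }
  assert (Z : forall n, h n = 0).
  { assert (Hu1 : (Cmod (x1 - c') < r')%R) by exact Hx1'.
    apply (Pser_identity h r' (x1 - c') e); [apply (Eh _ Hu1) | exact He | exact Hu1 |].
    intros v Hv.
    assert (Hx : disc x1 e (v + c')) by (unfold disc in *; replace (v + c' - x1) with (v - (x1 - c')) by ring; exact Hv).
    destruct (Kd _ Hx) as [L1 L2]; replace (v + c' - c') with v in L2 by ring.
    rewrite (proj2 (Eh v L2)). specialize (K' _ Hx); replace (v + c' - c') with v in K' by ring.
    rewrite <- K'. specialize (Ode _ L1).
    replace (1 - (c' + v)) with (1 - (v + c')) by ring; rewrite Ode; ring. }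
  intros x Hx. destruct (Eh _ Hx) as [_ E]; rewrite (Pser_all0 h) in E by exact Z.
  replace (1 - (c' + (x - c'))) with (1 - x) in E by ring.
  replace ((1 - x) * Pser (li3op c' b) (x - c')) with ((1 - x) * Pser (li3op c' b) (x - c') - 1 + 1) by ring.
  rewrite <- E; ring.
Qed.

(** [l] is, up to the factor [(2 pi i)^3], a branch of [Li3 (e2pi w)] when
    [l''' = li3_D3]. *)
Definition li3_D3 (w : C) : C := e2pi w / (1 - e2pi w).

Lemma one_sub_e2pi_neq_0 w : (forall k : Z, w <> RtoC (IZR k)) -> 1 - e2pi w <> 0.
Proof.
intros H E; assert (E1 : e2pi w = 1) by (replace (e2pi w) with (1 - (1 - e2pi w)) by ring; rewrite E; ring).
apply e2pi_eq_1 in E1; destruct E1 as [k Hk]; exact (H k Hk).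
Qed.

(** Integrated three times, the constant is the source of the cubic correction in
    [D3on_li3_D3_opp]. *)
Lemma li3_D3_opp w : (forall k : Z, w <> RtoC (IZR k)) -> li3_D3 (- w) = - 1 - li3_D3 w.
Proof.
intros H; pose proof (one_sub_e2pi_neq_0 w H) as H1; pose proof (e2pi_neq_0 w) as H2.
unfold li3_D3; rewrite e2pi_opp; field; repeat split; try assumption.
intros E; apply H1; replace (1 - e2pi w) with (- (e2pi w - 1)) by ring; rewrite E; ring.
Qed.

(** With [x = e2pi w], the derivative in [w] is [twopi_i] times [x d/dx]. The factor [/ twopi_i ^ 3]
    absorbs the three constants, and the outermost [x] becomes the factor [e2pi w]. *)
Lemma D3on_Pser_e2pi a r c : cvr a r ->
  D3on (fun w => (Cmod (e2pi w - c) < r)%R)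
    (fun w => / twopi_i ^ 3 * Pser a (e2pi w - c)) (fun w => e2pi w * Pser (li3op c a) (e2pi w - c)).
Proof.
intros Ha; pose proof twopi_i_neq_0 as Hp.
assert (D : forall b w, cvr b r -> (Cmod (e2pi w - c) < r)%R ->
  Cder (fun w => Pser b (e2pi w - c)) w (twopi_i * (e2pi w * Pser (der b) (e2pi w - c)))).
{ intros b w Hb Hw; apply Cder_eq with (Pser (der b) (e2pi w - c) * (twopi_i * e2pi w)); [|ring].
  apply (Cder_comp e2pi (fun x => Pser b (x - c))); [apply Cder_e2pi | now apply Pser_sub_Cder with r]. }
exists (fun w => / twopi_i ^ 2 * Pser (oned c a) (e2pi w - c)),
  (fun w => / twopi_i * Pser (oned c (oned c a)) (e2pi w - c)).
intros w Hw.
assert (E : c + (e2pi w - c) = e2pi w) by ring.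
repeat split.
- apply Cder_eq with (/ twopi_i ^ 3 * (twopi_i * (e2pi w * Pser (der a) (e2pi w - c)))); [now apply Cder_scal, D|].
  rewrite (Pser_oned c a r), E by assumption; field; exact Hp.
- apply Cder_eq with (/ twopi_i ^ 2 * (twopi_i * (e2pi w * Pser (der (oned c a)) (e2pi w - c))));
    [apply Cder_scal, D; [now apply cvr_oned | exact Hw]|].
  rewrite (Pser_oned c (oned c a) r), E by (assumption || now apply cvr_oned); field; exact Hp.
- apply Cder_eq with (/ twopi_i * (twopi_i * (e2pi w * Pser (der (oned c (oned c a))) (e2pi w - c))));
    [apply Cder_scal, D; [now apply cvr_oned, cvr_oned | exact Hw]|].
  unfold li3op; field; exact Hp.
Qed.

Lemma Li3_element_D3 c r g : Li3_element c r g ->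
  D3on (fun w => (Cmod (e2pi w - c) < r)%R /\ forall k : Z, w <> RtoC (IZR k))
    (fun w => / twopi_i ^ 3 * g (e2pi w)) li3_D3.
Proof.
intros H; destruct (Li3_element_ode c r g H) as [a [Ha [Eg Ode]]].
apply D3on_local; intros w [Hw Hk].
destruct (Cder_cont _ _ _ (Cder_e2pi w) (r - Cmod (e2pi w - c))%R ltac:(lra)) as [d [Hd K]].
assert (K' : forall v, disc w d v -> (Cmod (e2pi v - c) < r)%R).
{ intros v Hv; specialize (K v Hv); pose proof (Cmod_sub_triangle (e2pi v) (e2pi w) c); lra. }
exists d, (fun w => e2pi w * Pser (li3op c a) (e2pi w - c)); split; [exact Hd|]; split.
- apply D3on_ext with (fun w => / twopi_i ^ 3 * Pser a (e2pi w - c)) (fun w => e2pi w * Pser (li3op c a) (e2pi w - c));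
    [apply disc_open | intros v Hv; now rewrite Eg by now apply K' | reflexivity |].
  apply D3on_mono with (2 := D3on_Pser_e2pi a r c Ha); exact K'.
- specialize (Ode _ Hw); pose proof (one_sub_e2pi_neq_0 w Hk) as Hn.
  unfold li3_D3, Cdiv; f_equal.
  transitivity ((1 - e2pi w) * Pser (li3op c a) (e2pi w - c) / (1 - e2pi w)); [field; exact Hn | rewrite Ode; field; exact Hn].
Qed.

Lemma Li3_disc_D3 : D3on (fun w => (0 < Im w)%R) (fun w => / twopi_i ^ 3 * Li3_disc (e2pi w)) li3_D3.
Proof.
apply D3on_mono with (2 := Li3_element_D3 0 1 Li3_disc Li3_element_disc); intros w Hw; split.
- replace (e2pi w - 0) with (e2pi w) by ring; now apply Cmod_e2pi_lt_1.
- intros k ->; simpl in Hw; lra.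
Qed.

(** * Branches modulo quadratic polynomials *)

Definition quad (P : C * C -> C) : Prop :=
  exists c00 c10 c01 c20 c11 c02 : C, forall p, P p = c00 + c10 * fst p + c01 * snd p
    + c20 * fst p ^ 2 + c11 * fst p * snd p + c02 * snd p ^ 2.

Definition pdisc (p : C * C) (e : R) (q : C * C) : Prop :=
  disc (fst p) e (fst q) /\ disc (snd p) e (snd q).

Lemma Cmod_ball (x y : C) (e : posreal) : ball x e y -> (Cmod (y - x) < 2 * e)%R.
Proof.
intros [H1 H2]; eapply Rle_lt_trans; [apply Cmod_le_add|].
change (Rabs (Re y - Re x) < e)%R in H1; change (Rabs (Im y - Im x) < e)%R in H2.
change (Rabs (Re y - Re x) + Rabs (Im y - Im x) < 2 * e)%R; lra.
Qed.

Lemma ball_Cmod (x y : C) (e : posreal) : (Cmod (y - x) < e)%R -> ball x e y.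
Proof.
intros H; split.
- eapply Rle_lt_trans; [apply (re_le_Cmod (y - x)) | exact H].
- eapply Rle_lt_trans; [apply (im_le_Cmod (y - x)) | exact H].
Qed.

Lemma locally_pdisc (p : C * C) (P : C * C -> Prop) :
  locally p P <-> exists e, (0 < e)%R /\ forall q, pdisc p e q -> P q.
Proof.
split.
- intros [e He]; exists e; split; [apply cond_pos|]; intros q [H1 H2]; apply He; split; now apply ball_Cmod.
- intros [e [He H]].
  assert (He2 : (0 < e / 2)%R) by lra.
  exists (mkposreal _ He2); intros q [H1 H2]; apply H; split; unfold disc.
  + apply Cmod_ball in H1; simpl in H1; lra.
  + apply Cmod_ball in H2; simpl in H2; lra.
Qed.

Lemma open_pdisc (Om : C * C -> Prop) p : open Om -> Om p -> exists e, (0 < e)%R /\ forall q, pdisc p e q -> Om q.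
Proof. intros HO Hp; apply locally_pdisc; now apply HO. Qed.

Lemma pdisc_center p e : (0 < e)%R -> pdisc p e p.
Proof. intros He; split; now apply disc_center. Qed.

Lemma pdisc_mono p e e' q : (e <= e')%R -> pdisc p e q -> pdisc p e' q.
Proof. intros H [H1 H2]; split; unfold disc in *; lra. Qed.

Lemma pdisc_open p e q : pdisc p e q -> exists d, (0 < d)%R /\ forall q', pdisc q d q' -> pdisc p e q'.
Proof.
intros [H1 H2]; destruct (disc_open _ _ _ H1) as [d1 [Hd1 K1]], (disc_open _ _ _ H2) as [d2 [Hd2 K2]].
exists (Rmin d1 d2); split; [now apply Rmin_pos|]; intros q' [L1 L2].
pose proof (Rmin_l d1 d2); pose proof (Rmin_r d1 d2).
split; [apply K1 | apply K2]; unfold disc in *; lra.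
Qed.

Lemma quad_plus P Q : quad P -> quad Q -> quad (fun p => P p + Q p).
Proof.
intros [a [b [c [d [e [f H]]]]]] [a' [b' [c' [d' [e' [f' H']]]]]].
exists (a + a'), (b + b'), (c + c'), (d + d'), (e + e'), (f + f'); intros p; rewrite H, H'; ring.
Qed.

Lemma quad_scal k P : quad P -> quad (fun p => k * P p).
Proof.
intros [a [b [c [d [e [f H]]]]]].
exists (k * a), (k * b), (k * c), (k * d), (k * e), (k * f); intros p; rewrite H; ring.
Qed.

Lemma quad_opp P : quad P -> quad (fun p => - P p).
Proof.
intros [a [b [c [d [e [f H]]]]]].
exists (- a), (- b), (- c), (- d), (- e), (- f); intros p; rewrite H; ring.
Qed.

Lemma quad_minus P Q : quad P -> quad Q -> quad (fun p => P p - Q p).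
Proof. intros HP HQ; apply (quad_plus P (fun p => - Q p)); [exact HP | now apply quad_opp]. Qed.

Lemma quad_ext P Q : (forall p, P p = Q p) -> quad P -> quad Q.
Proof. intros E [a [b [c [d [e [f H]]]]]]; exists a, b, c, d, e, f; intros p; now rewrite <- E. Qed.

Definition aff (al be ga : C) (p : C * C) : C := al * fst p + be * snd p + ga.

Lemma quad_aff al be ga a b c : quad (fun p => a + b * aff al be ga p + c * aff al be ga p ^ 2).
Proof.
exists (a + b * ga + c * ga ^ 2), (b * al + 2 * c * al * ga), (b * be + 2 * c * be * ga),
  (c * al ^ 2), (2 * c * al * be), (c * be ^ 2); intros p; unfold aff; ring.
Qed.

Lemma quad_zero : quad (fun _ => 0).
Proof. exists 0, 0, 0, 0, 0, 0; intros p; ring. Qed.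

Lemma aff_cont al be ga p d : (0 < d)%R -> exists e, (0 < e)%R /\
  forall q, pdisc p e q -> disc (aff al be ga p) d (aff al be ga q).
Proof.
intros Hd; set (m := (Cmod al + Cmod be + 1)%R).
assert (Hm : (0 < m)%R) by (pose proof (Cmod_ge_0 al); pose proof (Cmod_ge_0 be); unfold m; lra).
exists (d / m)%R; split; [now apply Rdiv_lt_0_compat|]; intros q [H1 H2]; unfold disc in *.
replace (aff al be ga q - aff al be ga p) with (al * (fst q - fst p) + be * (snd q - snd p)) by (unfold aff; ring).
eapply Rle_lt_trans; [apply Cmod_triangle|]; rewrite !Cmod_mult.
apply Rle_lt_trans with ((Cmod al + Cmod be) * (d / m))%R.
- pose proof (Cmod_ge_0 al); pose proof (Cmod_ge_0 be); nra.
- apply Rlt_le_trans with (m * (d / m))%R; [|right; field; lra].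
  apply Rmult_lt_compat_r; [now apply Rdiv_lt_0_compat | unfold m; lra].
Qed.

(** Quadratic interpolation at the six nodes [p + h (i, j)], [i + j <= 2]. *)
Definition interp (p : C * C) (h : C) (f : C * C -> C) (q : C * C) : C :=
  let u := (fst q - fst p) / h in
  let v := (snd q - snd p) / h in
  let node i j := f (fst p + i * h, snd p + j * h) in
  node 0 0 + u * (node 1 0 - node 0 0) + v * (node 0 1 - node 0 0)
  + u * (u - 1) / 2 * (node 2 0 - 2 * node 1 0 + node 0 0)
  + v * (v - 1) / 2 * (node 0 2 - 2 * node 0 1 + node 0 0)
  + u * v * (node 1 1 - node 1 0 - node 0 1 + node 0 0).

Lemma interp_quad (P : C * C -> C) (p : C * C) (h : C) (q : C * C) : quad P -> h <> 0 -> P q = interp p h P q.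
Proof.
intros [a [b [c [d [e [f H]]]]]] Hh; unfold interp; rewrite !H; cbn [fst snd]; field; exact Hh.
Qed.

Lemma quad_interp (p : C * C) (h : C) (f : C * C -> C) : h <> 0 -> quad (interp p h f).
Proof.
intros Hh; unfold interp.
set (n00 := f _); set (n10 := f _); set (n01 := f _); set (n20 := f _); set (n02 := f _); set (n11 := f _).
set (A1 := (n10 - n00) / h); set (A2 := (n01 - n00) / h).
set (B1 := (n20 - 2 * n10 + n00) / (2 * h ^ 2)); set (B2 := (n02 - 2 * n01 + n00) / (2 * h ^ 2)).
set (B3 := (n11 - n10 - n01 + n00) / h ^ 2).
apply quad_ext with (fun q => (n00 + (A1 - h * B1) * (fst q - fst p) + B1 * (fst q - fst p) ^ 2)
  + ((A2 - h * B2) * (snd q - snd p) + B2 * (snd q - snd p) ^ 2) + B3 * ((fst q - fst p) * (snd q - snd p))).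
{ intros q; unfold A1, A2, B1, B2, B3; field; exact Hh. }
apply quad_plus; [apply quad_plus|].
- apply quad_ext with (2 := quad_aff 1 0 (- fst p) n00 (A1 - h * B1) B1); intros q; unfold aff. ring.
- apply quad_ext with (2 := quad_aff 0 1 (- snd p) 0 (A2 - h * B2) B2); intros q; unfold aff; ring.
- apply quad_scal; exists (fst p * snd p), (- snd p), (- fst p), 0, 1, 0; intros q; ring.
Qed.

Definition in_nodes (i : C) : Prop := i = 0 \/ i = 1 \/ i = 2.

Lemma node_pdisc p e : (0 < e)%R -> exists h : C, h <> 0 /\
  forall i j, in_nodes i -> in_nodes j -> pdisc p e (fst p + i * h, snd p + j * h).
Proof.
intros He; exists (RtoC (e / 4)); split.
- intros H; apply RtoC_inj in H; lra.
- assert (K : forall (x i : C), in_nodes i -> disc x e (x + i * RtoC (e / 4))).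
  { intros x i Hi; unfold disc; replace (x + i * RtoC (e / 4) - x) with (i * RtoC (e / 4)) by ring.
    rewrite Cmod_mult, Cmod_R, Rabs_pos_eq by lra.
    assert (Cmod i <= 2)%R.
    { destruct Hi as [-> | [-> | ->]]; rewrite ?Cmod_0, ?Cmod_1, ?Cmod_R, ?Rabs_pos_eq; lra. }
    nra. }
  intros i j Hi Hj; split; cbn [fst snd]; now apply K.
Qed.

Lemma interp_ext p h f g q : (forall i j, in_nodes i -> in_nodes j ->
  f (fst p + i * h, snd p + j * h) = g (fst p + i * h, snd p + j * h)) -> interp p h f q = interp p h g q.
Proof.
intros H; unfold interp; rewrite !H; unfold in_nodes; auto.
Qed.

Lemma quad_identity P Q p e : quad P -> quad Q -> (0 < e)%R -> (forall q, pdisc p e q -> P q = Q q) ->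
  forall q, P q = Q q.
Proof.
intros HP HQ He H q; destruct (node_pdisc p e He) as [h [Hh K]].
rewrite (interp_quad P p h), (interp_quad Q p h) by assumption.
apply interp_ext; intros i j Hi Hj; now apply H, K.
Qed.

Definition loc_quad (D : C * C -> C) (p : C * C) : Prop :=
  exists e P, (0 < e)%R /\ quad P /\ forall q, pdisc p e q -> D q = P q.

(** Near each point [D] is either [P0] or another quadratic polynomial. Both conditions are open,
    and they exclude each other because a quadratic polynomial is determined by its values on any
    polydisc; connectedness leaves only [P0]. *)
Lemma quad_local_global (Om : C * C -> Prop) (D : C * C -> C) : open Om -> connected_set Om ->
  (forall p, Om p -> loc_quad D p) -> exists P, quad P /\ forall p, Om p -> D p = P p.
Proof.
intros HO HC H.
destruct (classic (exists p, Om p)) as [[p0 H0]|Hn].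
2: { exists (fun _ => 0); split; [apply quad_zero|]; intros p Hp; exfalso; apply Hn; now exists p. }
destruct (H p0 H0) as [e0 [P0 [He0 [HP0 E0]]]].
exists P0; split; [exact HP0|].
set (U := fun p => Om p /\ exists e, (0 < e)%R /\ forall q, pdisc p e q -> D q = P0 q).
set (V := fun p => Om p /\ exists e P, (0 < e)%R /\ quad P /\ (forall q, pdisc p e q -> D q = P q) /\ exists q, P q <> P0 q).
assert (Hcov : forall p, Om p -> U p \/ V p).
{ intros p Hp; destruct (H p Hp) as [e [P [He [HP E]]]].
  destruct (classic (exists q, P q <> P0 q)) as [Hq|Hq].
  - right; split; [exact Hp|]; now exists e, P.
  - left; split; [exact Hp|]; exists e; split; [exact He|]; intros q Hq'; rewrite E by exact Hq'.
    apply NNPP; intros Hne; apply Hq; now exists q. }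
intros p Hp; destruct (Hcov p Hp) as [[_ [e [He E]]]|HV]; [now apply E, pdisc_center|].
exfalso.
destruct (HC U V) as [p1 [_ [[_ [e1 [He1 E1]]] [_ [e2 [P2 [He2 [HP2 [E2 [q Hq]]]]]]]]]].
- intros x [Hx [e [He E]]]; apply locally_pdisc.
  destruct (open_pdisc Om x HO Hx) as [d [Hd Kd]].
  exists (Rmin d e); split; [now apply Rmin_pos|]; intros y Hy; split; [apply Kd; apply pdisc_mono with (2 := Hy), Rmin_l|].
  destruct (pdisc_open x e y) as [d' [Hd' K']]; [apply pdisc_mono with (2 := Hy), Rmin_r|].
  exists d'; split; [exact Hd'|]; intros q Hq; now apply E, K'.
- intros x [Hx [e [P [He [HP [E Hne]]]]]]; apply locally_pdisc.
  destruct (open_pdisc Om x HO Hx) as [d [Hd Kd]].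
  exists (Rmin d e); split; [now apply Rmin_pos|]; intros y Hy; split; [apply Kd; apply pdisc_mono with (2 := Hy), Rmin_l|].
  destruct (pdisc_open x e y) as [d' [Hd' K']]; [apply pdisc_mono with (2 := Hy), Rmin_r|].
  exists d', P; repeat split; try assumption; intros q Hq; now apply E, K'.
- exact Hcov.
- exists p0; split; [exact H0|]; split; [exact H0|]; now exists e0.
- now exists p.
- apply Hq, (quad_identity P2 P0 p1 (Rmin e1 e2)); auto; [now apply Rmin_pos|].
  intros q' Hq'; rewrite <- E2 by (apply pdisc_mono with (2 := Hq'), Rmin_r).
  apply E1; apply pdisc_mono with (2 := Hq'), Rmin_l.
Qed.

(** A quadratic polynomial is a fixed linear combination of its values at six nodes, so convergence
    at the nodes suffices to sum the polynomials. *)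
Lemma quad_series (Om : C * C -> Prop) (Q : nat -> C * C -> C) (S : C * C -> C) : open Om ->
  (forall n, exists P, quad P /\ forall p, Om p -> Q n p = P p) ->
  (forall p, Om p -> is_Cseries (fun n => Q n p) (S p)) ->
  exists P, quad P /\ forall p, Om p -> S p = P p.
Proof.
intros HO HQ HS.
destruct (classic (exists p, Om p)) as [[p0 H0]|Hn].
2: { exists (fun _ => 0); split; [apply quad_zero|]; intros p Hp; exfalso; apply Hn; now exists p. }
destruct (open_pdisc Om p0 HO H0) as [d [Hd Kd]]; destruct (node_pdisc p0 d Hd) as [h [Hh K]].
exists (interp p0 h S); split; [now apply quad_interp|]; intros q Hq.
apply (is_Cseries_fun_unique (fun n => Q n q)); [now apply HS|].
apply is_Cseries_ext with (fun n => interp p0 h (Q n) q).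
- intros n; destruct (HQ n) as [P [HP E]]; rewrite (E q Hq), (interp_quad P p0 h) by assumption.
  apply interp_ext; intros i j Hi Hj; now apply E, Kd, K.
- assert (N : forall i j, in_nodes i -> in_nodes j ->
    is_Cseries (fun n => Q n (fst p0 + i * h, snd p0 + j * h)) (S (fst p0 + i * h, snd p0 + j * h))).
  { intros i j Hi Hj; now apply HS, Kd, K. }
  unfold interp; unfold in_nodes in N.
  repeat match goal with
  | |- is_Cseries (fun n => Cplus (@?a n) (@?b n)) _ => apply (is_Cseries_plus a b)
  | |- is_Cseries (fun n => Cminus (@?a n) (@?b n)) _ => apply (is_Cseries_minus a b)
  | |- is_Cseries (fun n => Cmult ?c (@?b n)) _ => apply (is_Cseries_scal c b)
  | |- _ => apply N; auto
  end.
Qed.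

(** [L] is locally a branch of [(2 pi i)^-3 Li3 (e2pi w)] plus a quadratic polynomial. *)
Definition li3_branch (w : C * C -> C) (Om : C * C -> Prop) (L : C * C -> C) : Prop :=
  forall p, Om p -> exists e d l P, (0 < e)%R /\ (0 < d)%R /\ quad P /\ D3on (disc (w p) d) l li3_D3 /\
    forall q, pdisc p e q -> disc (w p) d (w q) /\ L q = l (w q) + P q.

(** Locally the two germs have the same third derivative, so they differ by a quadratic polynomial
    in the argument; as the argument is affine, this is quadratic in both variables. *)
Lemma li3_branch_unique al be ga Om L L' : open Om -> connected_set Om ->
  li3_branch (aff al be ga) Om L -> li3_branch (aff al be ga) Om L' ->
  exists P, quad P /\ forall p, Om p -> L p - L' p = P p.
Proof.
intros HO HC H H'; apply quad_local_global; [exact HO | exact HC |]; intros p Hp.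
destruct (H p Hp) as [e [d [l [P [He [Hd [HP [HD K]]]]]]]], (H' p Hp) as [e' [d' [l' [P' [He' [Hd' [HP' [HD' K']]]]]]]].
set (d0 := Rmin d d').
destruct (D3on_unique (disc (aff al be ga p) d0) l l' li3_D3) as [a [b [c E]]].
- apply disc_convex.
- apply D3on_mono with (2 := HD); unfold disc, d0; intros w Hw; pose proof (Rmin_l d d'); lra.
- apply D3on_mono with (2 := HD'); unfold disc, d0; intros w Hw; pose proof (Rmin_r d d'); lra.
- exists (Rmin e e'), (fun p => (a + b * aff al be ga p + c * aff al be ga p ^ 2) + (P p - P' p)).
  split; [now apply Rmin_pos|]; split; [apply quad_plus; [apply quad_aff | now apply quad_minus]|].
  intros q Hq.
  destruct (K q) as [K1 ->]; [apply pdisc_mono with (2 := Hq), Rmin_l|].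
  destruct (K' q) as [K1' ->]; [apply pdisc_mono with (2 := Hq), Rmin_r|].
  rewrite <- E; [ring | unfold disc, d0 in *; now apply Rmin_glb_lt].
Qed.

Lemma li3_branch_ext w w' Om L L' : open Om -> (forall p, w p = w' p) -> (forall p, Om p -> L p = L' p) ->
  li3_branch w Om L -> li3_branch w' Om L'.
Proof.
intros HO Ew E H p Hp; destruct (H p Hp) as [e [d [l [P [He [Hd [HP [HD K]]]]]]]].
destruct (open_pdisc Om p HO Hp) as [e' [He' K']].
exists (Rmin e e'), d, l, P; rewrite <- Ew; repeat split; try assumption; [now apply Rmin_pos | |].
- rewrite <- Ew; apply (K q); apply pdisc_mono with (2 := H0), Rmin_l.
- rewrite <- E by (apply K'; apply pdisc_mono with (2 := H0), Rmin_r).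
  rewrite <- Ew; apply (K q); apply pdisc_mono with (2 := H0), Rmin_l.
Qed.

Lemma li3_branch_quad w Om L P : quad P -> li3_branch w Om L -> li3_branch w Om (fun p => L p + P p).
Proof.
intros HP H p Hp; destruct (H p Hp) as [e [d [l [P' [He [Hd [HP' [HD K]]]]]]]].
exists e, d, l, (fun p => P' p + P p); repeat split; try assumption; [now apply quad_plus | now apply K |].
rewrite (proj2 (K q H0)); ring.
Qed.

Lemma li3_branch_sub w Om Om' L : (forall p, Om' p -> Om p) -> li3_branch w Om L -> li3_branch w Om' L.
Proof. intros H K p Hp; now apply K, H. Qed.

Lemma not_Z_open (w : C) : (forall k : Z, w <> RtoC (IZR k)) ->
  exists d, (0 < d)%R /\ forall v, disc w d v -> forall k : Z, v <> RtoC (IZR k).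
Proof.
intros H; pose proof (one_sub_e2pi_neq_0 w H) as H1; apply (proj1 (Cmod_gt_0 _)) in H1.
destruct (Cder_cont _ _ _ (Cder_e2pi w) _ H1) as [d [Hd K]].
exists d; split; [exact Hd|]; intros v Hv k ->; specialize (K _ Hv).
rewrite e2pi_Z in K; lra.
Qed.

Lemma D3on_li3_D3_opp U l : D3on U l li3_D3 ->
  D3on (fun w => U (- w) /\ forall k : Z, w <> RtoC (IZR k)) (fun w => l (- w) - / 6 * w ^ 3) li3_D3.
Proof.
intros H.
apply (D3on_affine U (- (1)) 0) in H.
destruct (D3on_minus _ _ _ _ _ H (D3on_cubic _ 0 0 0 (/ 6))) as [f1 [f2 K]].
exists f1, f2.
assert (E : forall w, - (1) * w + 0 = - w) by (intros; ring).
intros w [Hw Hk]; destruct (K w) as [K1 [K2 K3]]; [now rewrite E|]; repeat split.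
- apply Cder_ext_all with (2 := K1); intros y; rewrite E; ring.
- exact K2.
- apply Cder_eq with (1 := K3); rewrite E, li3_D3_opp by exact Hk; field.
Qed.

(** A normalised branch of [Li3 (1 / x)] minus [w^3 / 6] has the third derivative required of a
    branch of [Li3 x]. *)
Lemma li3_branch_flip (al be ga : C) (Om : C * C -> Prop) (M : C * C -> C) :
  (forall p, Om p -> forall k : Z, aff al be ga p <> RtoC (IZR k)) ->
  li3_branch (fun p => - aff al be ga p) Om M -> li3_branch (aff al be ga) Om (fun p => M p - / 6 * aff al be ga p ^ 3).
Proof.
intros Hk H p Hp; destruct (H p Hp) as [e [d [l [P [He [Hd [HP [HD K]]]]]]]].
destruct (not_Z_open _ (Hk p Hp)) as [d' [Hd' Kd']].
destruct (aff_cont al be ga p (Rmin d d')) as [e' [He' Ke']]; [now apply Rmin_pos|].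
exists (Rmin e e'), (Rmin d d'), (fun w => l (- w) - / 6 * w ^ 3), P.
split; [now apply Rmin_pos|]; split; [now apply Rmin_pos|]; split; [exact HP|]; split.
- apply D3on_mono with (2 := D3on_li3_D3_opp _ _ HD); intros w Hw; unfold disc in *.
  pose proof (Rmin_l d d'); pose proof (Rmin_r d d'); split.
  + rewrite <- Cmod_opp; replace (- (- w - - aff al be ga p)) with (w - aff al be ga p) by ring; lra.
  + apply Kd'; unfold disc; lra.
- intros q Hq; split; [apply Ke', pdisc_mono with (2 := Hq), Rmin_r|].
  rewrite (proj2 (K q (pdisc_mono _ _ _ _ (Rmin_l _ _) Hq))); ring.
Qed.

Lemma li3_branch_mv_Li3 (al be ga : C) (h : C * C -> C) (Om : C * C -> Prop) (L : C * C -> C) :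
  (forall p, Om p -> forall k : Z, aff al be ga p <> RtoC (IZR k)) ->
  (forall p, h p = e2pi (aff al be ga p)) ->
  mv_Li3 h Om L -> li3_branch (aff al be ga) Om (fun p => / twopi_i ^ 3 * L p).
Proof.
intros Hk Hh H p Hp; destruct (H p Hp) as [c [r [g [Hg [Hr HL]]]]].
apply locally_pdisc in HL; destruct HL as [e [He KL]].
rewrite Hh in Hr.
destruct (not_Z_open _ (Hk p Hp)) as [d1 [Hd1 Kd1]].
destruct (Cder_cont _ _ _ (Cder_e2pi (aff al be ga p)) (r - Cmod (e2pi (aff al be ga p) - c))%R ltac:(lra)) as [d2 [Hd2 Kd2]].
set (d := Rmin d1 d2).
assert (Hd : (0 < d)%R) by now apply Rmin_pos.
destruct (aff_cont al be ga p d Hd) as [e' [He' Ke']].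
exists (Rmin e e'), d, (fun w => / twopi_i ^ 3 * g (e2pi w)), (fun _ => 0).
split; [now apply Rmin_pos|]; split; [exact Hd|]; split; [apply quad_zero|]; split.
- apply D3on_mono with (2 := Li3_element_D3 c r g Hg); intros w Hw; unfold disc, d in *.
  pose proof (Rmin_l d1 d2); pose proof (Rmin_r d1 d2); split.
  + specialize (Kd2 w ltac:(lra)).
    pose proof (Cmod_sub_triangle (e2pi w) (e2pi (aff al be ga p)) c); lra.
  + apply Kd1; unfold disc; lra.
- intros q Hq; split; [apply Ke', pdisc_mono with (2 := Hq), Rmin_r|].
  rewrite (KL q (pdisc_mono _ _ _ _ (Rmin_l _ _) Hq)), Hh; ring.
Qed.

Lemma bern_coef_1 : bern_coef 1 = (- / 2)%R.
Proof. rewrite bern_coef_S; unfold bern_coef; simpl; field. Qed.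
Lemma bern_coef_2 : bern_coef 2 = (/ 12)%R.
Proof. rewrite bern_coef_S; simpl sum_f_R0; rewrite bern_coef_1; unfold bern_coef; simpl; field. Qed.
Lemma bern_coef_3 : bern_coef 3 = 0%R.
Proof. rewrite bern_coef_S; simpl sum_f_R0; rewrite bern_coef_1, bern_coef_2; unfold bern_coef; simpl; field. Qed.
Lemma bern_coef_4 : bern_coef 4 = (- / 720)%R.
Proof. rewrite bern_coef_S; simpl sum_f_R0; rewrite bern_coef_1, bern_coef_2, bern_coef_3; unfold bern_coef; simpl; field. Qed.

(** The term [j = 2] disappears with the Bernoulli number [B_3]. *)
Lemma ellLi3_poly_eq (lz lq : C) :
  ellLi3_poly lz lq = - / 12 * lz ^ 3 + / 24 * lz ^ 2 * lq - / 720 * lq ^ 3.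
Proof.
unfold ellLi3_poly; rewrite !sum_Sn, sum_O.
unfold bernC, bernoulli; simpl Nat.add; rewrite bern_coef_1, bern_coef_2, bern_coef_3, bern_coef_4.
change plus with Cplus; unfold factC, natC; simpl Nat.sub.
change (fact 0) with 1%nat; change (fact 1) with 1%nat; change (fact 2) with 2%nat;
  change (fact 3) with 6%nat; change (fact 4) with 24%nat.
rewrite !INR_IZR_INZ; simpl Z.of_nat.
rewrite !RtoC_mult, !RtoC_opp, !RtoC_inv by lra. field.
Qed.

Definition li3_one (tau : C) : C := / twopi_i ^ 3 *
  (CSeries (fun n => Li3_disc (e2pi tau ^ n)) + CSeries (fun n => Li3_disc (e2pi tau ^ S n))).

Definition branch_series (w v : nat -> C * C -> C) (Om : C * C -> Prop) (S : C * C -> C) : Prop :=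
  exists L M : nat -> C * C -> C,
    (forall n, li3_branch (w n) Om (L n)) /\ (forall n, li3_branch (v n) Om (M n)) /\
    forall p, Om p -> exists SL SM, is_Cseries (fun n => L n p) SL /\ is_Cseries (fun n => M n p) SM /\ S p = SL + SM.

(** The exponents of the two families of summands [q^n zeta] and [q^(n+1) / zeta]. *)
Definition W (n : nat) : C * C -> C := aff 1 (natC n) 0.
Definition V (n : nat) : C * C -> C := aff (- (1)) (natC (S n)) 0.

(** [F] is a branch of [f] plus a quadratic polynomial. *)
Definition f_branch (Om : C * C -> Prop) (F : C * C -> C) : Prop :=
  branch_series W V Om (fun p => F p - (/ 12 * fst p ^ 3 - / 24 * fst p ^ 2 * snd p - li3_one (snd p))).

(** The arguments are left as arbitrary affine functions so that the translated and reflected forms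
    of [mv_f] share one statement. The terms in [tau^3] of the two polynomial parts cancel. *)
Lemma mv_f_branch_series (zc tc : C * C -> C) (aL bL gL aM bM gM : nat -> C) (Om : C * C -> Prop) (F : C * C -> C) :
  (forall n p, Om p -> forall k : Z, aff (aL n) (bL n) (gL n) p <> RtoC (IZR k)) ->
  (forall n p, Om p -> forall k : Z, aff (aM n) (bM n) (gM n) p <> RtoC (IZR k)) ->
  (forall n p, e2pi (aff (aL n) (bL n) (gL n) p) = e2pi (tc p) ^ n * e2pi (zc p)) ->
  (forall n p, e2pi (aff (aM n) (bM n) (gM n) p) = e2pi (tc p) ^ S n * / e2pi (zc p)) ->
  mv_f zc tc Om F ->
  branch_series (fun n => aff (aL n) (bL n) (gL n)) (fun n => aff (aM n) (bM n) (gM n)) Om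
    (fun p => F p - (/ 12 * zc p ^ 3 - / 24 * zc p ^ 2 * tc p - li3_one (tc p))).
Proof.
intros HkL HkM HL HM [G [[L [M [TL [TM HG]]]] HF]].
exists (fun n p => / twopi_i ^ 3 * L n p), (fun n p => / twopi_i ^ 3 * M n p).
split; [|split].
- intros n; apply li3_branch_mv_Li3 with (h := fun p => e2pi (tc p) ^ n * e2pi (zc p)); auto.
- intros n; apply li3_branch_mv_Li3 with (h := fun p => e2pi (tc p) ^ S n * / e2pi (zc p)); auto.
- intros p Hp; destruct (HG p Hp) as [SL [SM [H1 [H2 H3]]]].
  exists (/ twopi_i ^ 3 * SL), (/ twopi_i ^ 3 * SM); split; [now apply is_Cseries_scal|]; split; [now apply is_Cseries_scal|].
  rewrite HF, H3 by exact Hp; unfold ellLi3_one, li3_one; rewrite !ellLi3_poly_eq.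
  field; apply twopi_i_neq_0.
Qed.

(** * Translations and reflection *)

Lemma natC_IZR n : natC n = RtoC (IZR (Z.of_nat n)).
Proof. unfold natC; now rewrite INR_IZR_INZ. Qed.

Lemma natC_S n : natC (S n) = natC n + 1.
Proof. unfold natC; now rewrite S_INR, RtoC_plus. Qed.

Lemma regular_aff p (n : Z) : regular_point p -> forall k : Z, aff 1 (RtoC (IZR n)) 0 p <> RtoC (IZR k).
Proof.
intros [_ H] k E; apply (H k (- n)%Z); unfold aff in E; rewrite opp_IZR, RtoC_opp.
rewrite <- E; ring.
Qed.

Lemma regular_aff_opp p (n : Z) : regular_point p -> forall k : Z, aff (- (1)) (RtoC (IZR n)) 0 p <> RtoC (IZR k).
Proof.
intros [_ H] k E; apply (H (- k)%Z n); unfold aff in E; rewrite opp_IZR, RtoC_opp.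
rewrite <- E; ring.
Qed.

Lemma regular_W p n : regular_point p -> forall k : Z, W n p <> RtoC (IZR k).
Proof. unfold W; rewrite natC_IZR; apply regular_aff. Qed.

Lemma regular_V p n : regular_point p -> forall k : Z, V n p <> RtoC (IZR k).
Proof. unfold V; rewrite natC_IZR; apply regular_aff_opp. Qed.

Lemma e2pi_W p n : e2pi (W n p) = e2pi (snd p) ^ n * e2pi (fst p).
Proof.
unfold W, aff; rewrite <- e2pi_nat, <- e2pi_add; f_equal; ring.
Qed.

Lemma e2pi_V p n : e2pi (V n p) = e2pi (snd p) ^ S n * / e2pi (fst p).
Proof.
unfold V, aff; rewrite <- e2pi_nat, <- e2pi_opp, <- e2pi_add; f_equal; ring.
Qed.

Lemma li3_one_ext t t' : e2pi t = e2pi t' -> li3_one t = li3_one t'.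
Proof. intros E; unfold li3_one; now rewrite E. Qed.

Lemma branch_series_ext w v Om S S' : (forall p, Om p -> S p = S' p) -> branch_series w v Om S -> branch_series w v Om S'.
Proof.
intros E [L [M [TL [TM H]]]]; exists L, M; split; [exact TL|]; split; [exact TM|].
intros p Hp; rewrite <- E by exact Hp; now apply H.
Qed.

Lemma mv_f_f_branch (zc tc : C * C -> C) (Om : C * C -> Prop) (F : C * C -> C) :
  (forall p, Om p -> regular_point p) ->
  (forall p, e2pi (zc p) = e2pi (fst p)) -> (forall p, e2pi (tc p) = e2pi (snd p)) ->
  mv_f zc tc Om F ->
  f_branch Om (fun p => F p - (/ 12 * (zc p ^ 3 - fst p ^ 3) - / 24 * (zc p ^ 2 * tc p - fst p ^ 2 * snd p))).
Proof.
intros HR Ez Et HF; unfold f_branch.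
apply (mv_f_branch_series zc tc (fun _ => 1) natC (fun _ => 0) (fun _ => - (1)) (fun n => natC (S n)) (fun _ => 0)) in HF.
- apply branch_series_ext with (2 := HF); intros p Hp; rewrite (li3_one_ext _ _ (Et p)); ring.
- intros n p Hp; apply (regular_W p n); auto.
- intros n p Hp; apply (regular_V p n); auto.
- intros n p; rewrite Ez, Et; apply e2pi_W.
- intros n p; rewrite Ez, Et; apply e2pi_V.
Qed.

Definition ccons (a : C) (u : nat -> C) (n : nat) : C := match n with O => a | S m => u m end.

Lemma is_Cseries_cons a u s : is_Cseries u s -> is_Cseries (ccons a u) (a + s).
Proof. intros H; apply (is_Cseries_incr (ccons a u)), H. Qed.

Lemma is_Cseries_tail u s : is_Cseries u s -> is_Cseries (fun n => u (S n)) (s - u 0%nat).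
Proof. intros H; apply is_Cseries_incr. replace (u 0%nat + (s - u 0%nat)) with s by ring; exact H. Qed.

(** Moving the first term [M 0], a branch of [Li3 (1/zeta)], to the other sum
    as a branch of [Li3 zeta] costs [z^3/6]. *)
Lemma branch_series_move (Om : C * C -> Prop) (w v : nat -> C * C -> C) (S0 : C * C -> C) : open Om ->
  (forall p, Om p -> regular_point p) ->
  (forall p, v 0%nat p = - W 0 p) -> (forall n p, w n p = W (S n) p) -> (forall n p, v (S n) p = V n p) ->
  branch_series w v Om S0 -> branch_series W V Om (fun p => S0 p - / 6 * fst p ^ 3).
Proof.
intros HO HR Ev0 Ew Ev [L [M [TL [TM H]]]].
exists (fun n => match n with O => fun p => M 0%nat p - / 6 * W 0 p ^ 3 | S m => L m end), (fun n => M (S n)).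
split; [|split].
- intros [|n].
  + apply li3_branch_flip; [intros p Hp; apply regular_W; auto|].
    apply li3_branch_ext with (v 0%nat) (M 0%nat); auto.
  + apply li3_branch_ext with (w n) (L n); auto.
- intros n; apply li3_branch_ext with (v (S n)) (M (S n)); auto.
- intros p Hp; destruct (H p Hp) as [SL [SM [H1 [H2 H3]]]].
  exists ((M 0%nat p - / 6 * W 0 p ^ 3) + SL), (SM - M 0%nat p); split; [|split].
  + apply is_Cseries_ext with (2 := is_Cseries_cons _ _ _ H1); intros [|n]; reflexivity.
  + apply (is_Cseries_tail _ _ H2).
  + rewrite H3. unfold W, aff, natC; simpl INR. ring.
Qed.

Lemma branch_series_swap (w v : nat -> C * C -> C) (Om : C * C -> Prop) (S0 : C * C -> C) :
  branch_series w v Om S0 -> branch_series v w Om S0.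
Proof.
intros [L [M [TL [TM H]]]]; exists M, L; split; [exact TM|]; split; [exact TL|].
intros p Hp; destruct (H p Hp) as [SL [SM [H1 [H2 H3]]]]; exists SM, SL; repeat split; try assumption.
rewrite H3; ring.
Qed.

(** Translation by [tau] turns the arguments into [W 1, W 2, ...] and [- W 0, V 0, V 1, ...]. The
    cubic is [((z + tau)^3 - z^3) / 12 - ((z + tau)^2 - z^2) tau / 24 + z^3 / 6]. *)
Lemma mv_f_shift_f_branch (Om : C * C -> Prop) (F : C * C -> C) : open Om ->
  (forall p, Om p -> regular_point p) ->
  mv_f (fun p => fst p + snd p) snd Om F ->
  f_branch Om (fun p => F p - (/ 6 * fst p ^ 3 + / 4 * fst p ^ 2 * snd p + / 6 * fst p * snd p ^ 2 + / 24 * snd p ^ 3)).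
Proof.
intros HO HR HF.
apply (mv_f_branch_series _ _ (fun _ => 1) (fun n => natC (S n)) (fun _ => 0) (fun _ => - (1)) natC (fun _ => 0)) in HF.
- apply branch_series_move in HF; try assumption.
  + apply branch_series_ext with (2 := HF); intros p Hp; field.
  + intros p; unfold W, aff; unfold natC; simpl INR; ring.
  + reflexivity.
  + reflexivity.
- intros n p Hp; apply (regular_W p (S n)); auto.
- intros n p Hp k; rewrite natC_IZR; apply regular_aff_opp; auto.
- intros n p; rewrite e2pi_add. change (aff 1 (natC (S n)) 0 p) with (W (S n) p). rewrite e2pi_W; simpl; ring.
- intros n p; rewrite e2pi_add.
  replace (aff (- (1)) (natC n) 0 p) with (natC n * snd p + - fst p) by (unfold aff; ring).
  rewrite e2pi_add, e2pi_opp, e2pi_nat; simpl; field; split; apply e2pi_neq_0.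
Qed.

(** Reflection exchanges the two sums, after which the argument [- z] has to be moved back. The
    cubics [- z^3 / 12] and [z^3 / 6] combine to [z^3 / 12]. *)
Lemma mv_f_opp_f_branch (Om : C * C -> Prop) (F : C * C -> C) : open Om ->
  (forall p, Om p -> regular_point p) ->
  mv_f (fun p => - fst p) snd Om F -> f_branch Om F.
Proof.
intros HO HR HF.
apply (mv_f_branch_series _ _ (fun _ => - (1)) natC (fun _ => 0) (fun _ => 1) (fun n => natC (S n)) (fun _ => 0)) in HF.
- apply branch_series_swap, branch_series_move in HF; try assumption.
  + apply branch_series_ext with (2 := HF); intros p Hp; field.
  + intros p; unfold W, aff; unfold natC; simpl INR; ring.
  + reflexivity.
  + reflexivity.
- intros n p Hp k; rewrite natC_IZR; apply regular_aff_opp; auto.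
- intros n p Hp; apply (regular_W p (S n)); auto.
- intros n p; replace (aff (- (1)) (natC n) 0 p) with (natC n * snd p + - fst p) by (unfold aff; ring).
  rewrite e2pi_add, e2pi_nat; reflexivity.
- intros n p; rewrite e2pi_opp. change (aff 1 (natC (S n)) 0 p) with (W (S n) p). rewrite e2pi_W; simpl; field.
  repeat split; apply e2pi_neq_0.
Qed.

(** Corresponding summands differ by quadratic polynomials, and the series of these differences
    converges pointwise. *)
Lemma f_branch_unique Om F G : open Om -> connected_set Om -> f_branch Om F -> f_branch Om G ->
  exists P, quad P /\ forall p, Om p -> F p - G p = P p.
Proof.
intros HO HC [L [M [TL [TM H]]]] [L' [M' [TL' [TM' H']]]].
apply (quad_series Om (fun n p => (L n p - L' n p) + (M n p - M' n p)) (fun p => F p - G p)); [exact HO | |].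
- intros n.
  destruct (li3_branch_unique 1 (natC n) 0 Om (L n) (L' n) HO HC (TL n) (TL' n)) as [P [HP EP]].
  destruct (li3_branch_unique (- (1)) (natC (S n)) 0 Om (M n) (M' n) HO HC (TM n) (TM' n)) as [P' [HP' EP']].
  exists (fun p => P p + P' p); split; [now apply quad_plus|]; intros p Hp; now rewrite EP, EP'.
- intros p Hp; destruct (H p Hp) as [SL [SM [H1 [H2 H3]]]], (H' p Hp) as [SL' [SM' [H1' [H2' H3']]]].
  replace (F p - G p) with ((SL - SL') + (SM - SM')).
  + apply is_Cseries_plus; now apply is_Cseries_minus.
  + replace (SL - SL' + (SM - SM')) with ((SL + SM) - (SL' + SM')) by ring; rewrite <- H3, <- H3'; ring.
Qed.

(** The polynomial is absorbed by the first summand. *)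
Lemma f_branch_quad Om F P : quad P -> f_branch Om F -> f_branch Om (fun p => F p + P p).
Proof.
intros HP [L [M [TL [TM H]]]].
exists (fun n => match n with O => fun p => L 0%nat p + P p | S m => L (S m) end), M; split; [|split; [exact TM|]].
- intros [|n]; [now apply li3_branch_quad | apply TL].
- intros p Hp; destruct (H p Hp) as [SL [SM [H1 [H2 H3]]]].
  exists (SL + P p), SM; split; [|split; [exact H2|]].
  + replace (SL + P p) with ((L 0%nat p + P p) + (SL - L 0%nat p)) by ring.
    apply is_Cseries_ext with (2 := is_Cseries_cons (L 0%nat p + P p) _ _ (is_Cseries_tail _ _ H1)); intros [|n]; reflexivity.
  + replace (F p + P p - (/ 12 * fst p ^ 3 - / 24 * fst p ^ 2 * snd p - li3_one (snd p)))
      with ((F p - (/ 12 * fst p ^ 3 - / 24 * fst p ^ 2 * snd p - li3_one (snd p))) + P p) by ring.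
    rewrite H3; ring.
Qed.

Lemma f_branch_ext Om F G : (forall p, Om p -> F p = G p) -> f_branch Om F -> f_branch Om G.
Proof. intros E; apply branch_series_ext; intros p Hp; now rewrite E. Qed.

Lemma f_branch_sub Om Om' F : (forall p, Om' p -> Om p) -> f_branch Om F -> f_branch Om' F.
Proof.
intros HS [L [M [TL [TM H]]]]; exists L, M; split; [|split].
- intros n; now apply li3_branch_sub with Om.
- intros n; now apply li3_branch_sub with Om.
- intros p Hp; apply H, HS, Hp.
Qed.

Lemma differ_by_quadratic_intro (A B : mvfun) :
  (forall Om, open Om -> connected_set Om -> (forall p, Om p -> regular_point p) ->
    forall F G, A Om F -> B Om G -> exists P, quad P /\ forall p, Om p -> F p - G p = P p) ->
  differ_by_quadratic (fun p => fst p) (fun p => snd p) A B.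
Proof.
intros H Om HO HC HR F G HF HG.
destruct (H Om HO HC HR F G HF HG) as [P [[a [b [c [d [e [f HP]]]]]] E]].
exists a, b, c, d, e, f; intros p Hp; now rewrite E, HP.
Qed.

Lemma mv_f_f_branch_id Om F : (forall p, Om p -> regular_point p) ->
  mv_f (fun p => fst p) (fun p => snd p) Om F -> f_branch Om F.
Proof.
intros HR HF; apply mv_f_f_branch in HF; auto.
apply f_branch_ext with (2 := HF); intros p _; ring.
Qed.

(** The exponentials, hence the summands, do not change; only the polynomial part does, and by a
    quadratic polynomial. *)
Lemma f_period_1 : differ_by_quadratic (fun p => fst p) (fun p => snd p)
  (mv_f (fun p => fst p + 1) (fun p => snd p)) (mv_f (fun p => fst p) (fun p => snd p)).
Proof.
apply differ_by_quadratic_intro; intros Om HO HC HR F G HF HG.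
apply mv_f_f_branch_id in HG; [|exact HR].
apply mv_f_f_branch in HF; [|exact HR | intros p; rewrite e2pi_add, e2pi_1; ring | reflexivity].
destruct (f_branch_unique _ _ _ HO HC HF HG) as [P [HP E]].
exists (fun p => P p + (/ 12 * ((fst p + 1) ^ 3 - fst p ^ 3) - / 24 * ((fst p + 1) ^ 2 * snd p - fst p ^ 2 * snd p))).
split.
- apply quad_plus; [exact HP|].
  exists (/ 12), (3 * / 12), (- / 24), (3 * / 12), (- (2 * / 24)), 0; intros p; ring.
- intros p Hp; rewrite <- E by exact Hp; ring.
Qed.

Lemma f_period_tau : differ_by_quadratic (fun p => fst p) (fun p => snd p)
  (mv_f (fun p => fst p) (fun p => snd p + 1)) (mv_f (fun p => fst p) (fun p => snd p)).
Proof.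
apply differ_by_quadratic_intro; intros Om HO HC HR F G HF HG.
apply mv_f_f_branch_id in HG; [|exact HR].
apply mv_f_f_branch in HF; [|exact HR | reflexivity | intros p; rewrite e2pi_add, e2pi_1; ring].
destruct (f_branch_unique _ _ _ HO HC HF HG) as [P [HP E]].
exists (fun p => P p + - / 24 * fst p ^ 2); split.
- apply quad_plus; [exact HP|].
  exists 0, 0, 0, (- / 24), 0, 0; intros p; ring.
- intros p Hp; rewrite <- E by exact Hp; ring.
Qed.

Lemma f_shift_tau : differ_by_quadratic (fun p => fst p) (fun p => snd p)
  (mv_f (fun p => fst p + snd p) (fun p => snd p))
  (mv_map (fun p w => w + (/ 6 * fst p ^ 3 + / 4 * fst p ^ 2 * snd p + / 6 * fst p * snd p ^ 2 + / 24 * snd p ^ 3))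
    (mv_f (fun p => fst p) (fun p => snd p))).
Proof.
apply differ_by_quadratic_intro; intros Om HO HC HR F G HF [G0 [HG EG]].
apply mv_f_f_branch_id in HG; [|exact HR]. apply mv_f_shift_f_branch in HF; [|exact HO | exact HR].
destruct (f_branch_unique _ _ _ HO HC HF HG) as [P [HP E]].
exists P; split; [exact HP|]; intros p Hp; rewrite EG, <- E by exact Hp; ring.
Qed.

Lemma f_even : differ_by_quadratic (fun p => fst p) (fun p => snd p)
  (mv_f (fun p => - fst p) (fun p => snd p)) (mv_f (fun p => fst p) (fun p => snd p)).
Proof.
apply differ_by_quadratic_intro; intros Om HO HC HR F G HF HG.
apply mv_f_f_branch_id in HG; [|exact HR]. apply mv_f_opp_f_branch in HF; [|exact HO | exact HR].
exact (f_branch_unique _ _ _ HO HC HF HG).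
Qed.

(** * The Fourier expansion *)

Lemma one_sub_neq_0 (x : C) : (Cmod x < 1)%R -> 1 - x <> 0.
Proof.
intros H E. assert (x = 1) as -> by (replace x with (1 - (1 - x)) by ring; rewrite E; ring).
rewrite Cmod_1 in H; lra.
Qed.

Lemma pow_S_le_1 x n : (0 <= x <= 1)%R -> (0 <= x ^ n <= 1)%R.
Proof.
intros H; split; [now apply pow_le|]. rewrite <- (pow1 n); apply pow_incr; lra.
Qed.

Lemma Cmod_pow_S_lt_1 (q : C) n : (Cmod q < 1)%R -> (Cmod (q ^ S n) < 1)%R.
Proof.
intros H; rewrite Cmod_pow; simpl. pose proof (Cmod_ge_0 q).
pose proof (pow_S_le_1 (Cmod q) n ltac:(lra)). nra.
Qed.

(** Both sums come from the double series [c_m q^(n(m+1)) Y^(m+1)], geometric in [n]. As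
    [(Cmod q ^ n) ^ S m] is at most [Cmod q ^ n], it is dominated by a product. *)
Lemma Lambert (c : nat -> C) (q Y : C) : (Cmod q < 1)%R -> asum (fun m => c m * Y ^ S m) ->
  (forall n, asum (fun m => c m * (q ^ n * Y) ^ S m)) /\
  asum (fun n => CSeries (fun m => c m * (q ^ n * Y) ^ S m)) /\
  asum (fun m => c m * (Y ^ S m / (1 - q ^ S m))) /\
  CSeries (fun n => CSeries (fun m => c m * (q ^ n * Y) ^ S m)) = CSeries (fun m => c m * (Y ^ S m / (1 - q ^ S m))).
Proof.
intros Hq Hc.
assert (D : dsum (fun n m => c m * (q ^ n * Y) ^ S m)).
{ apply dsum_prod with (A := fun n => (Cmod q ^ n)%R) (B := fun m => Cmod (c m * Y ^ S m)).
  - intros n m; rewrite Cpow_mult_l, !Cmod_mult, !Cmod_pow.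
    assert (H : (0 <= (Cmod q ^ n) ^ S m <= Cmod q ^ n)%R).
    { pose proof (pow_S_le_1 (Cmod q) n ltac:(pose proof (Cmod_ge_0 q); lra)) as H1.
      pose proof (pow_S_le_1 _ m H1); simpl; nra. }
    pose proof (Cmod_ge_0 (c m)); pose proof (pow_le (Cmod Y) (S m) (Cmod_ge_0 Y)).
    assert (0 <= Cmod (c m) * Cmod Y ^ S m)%R by (apply Rmult_le_pos; assumption). nra.
  - apply ex_series_geom; rewrite Rabs_pos_eq; [exact Hq | apply Cmod_ge_0].
  - exact Hc. }
split; [apply (proj1 D)|]; split; [now apply dsum_rows|].
assert (E : forall m, CSeries (fun n => c m * (q ^ n * Y) ^ S m) = c m * (Y ^ S m / (1 - q ^ S m))).
{ intros m.
  rewrite (CSeries_ext _ (fun n => (c m * Y ^ S m) * (q ^ S m) ^ n)).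
  2: { intros n; rewrite Cpow_mult_l, <- !Cpow_mult_r, (Nat.mul_comm n); ring. }
  rewrite CSeries_scal by now apply asum_geom, Cmod_pow_S_lt_1.
  rewrite CSeries_geom by now apply Cmod_pow_S_lt_1. unfold Cdiv; ring. }
split.
- apply asum_ext with (2 := dsum_rows _ (dsum_swap _ D)); intros m; apply E.
- rewrite (Fubini _ D); apply CSeries_ext; exact E.
Qed.

Definition lambert3 (q Y : C) : C := CSeries (fun m => Y ^ S m / (1 - q ^ S m) / natC (S m) ^ 3).

Lemma Lambert_Li3 (q Y : C) : (Cmod q < 1)%R -> (Cmod Y <= 1)%R ->
  asum (fun n => Li3_disc (q ^ n * Y)) /\ asum (fun m => Y ^ S m / (1 - q ^ S m) / natC (S m) ^ 3) /\
  CSeries (fun n => Li3_disc (q ^ n * Y)) = lambert3 q Y.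
Proof.
intros Hq HY.
destruct (Lambert (fun m => / natC (S m) ^ 3) q Y Hq) as [H1 [H2 [H3 H4]]].
{ apply asum_ext with (2 := Li3_disc_asum Y HY); intros; unfold Cdiv; ring. }
assert (E : forall n, Li3_disc (q ^ n * Y) = CSeries (fun m => / natC (S m) ^ 3 * (q ^ n * Y) ^ S m))
  by (intros n; apply CSeries_ext; intros; unfold Cdiv; ring).
split; [|split].
- apply asum_ext with (2 := H2); intros n; now rewrite E.
- apply asum_ext with (2 := H3); intros m; unfold Cdiv; ring.
- rewrite (CSeries_ext _ _ E), H4; apply CSeries_ext; intros m; unfold Cdiv; ring.
Qed.

Lemma Csin_sq (z : C) (r : nat) : (Csin (PI * natC r * z)) ^ 2 = - / 4 * (e2pi z ^ r + (/ e2pi z) ^ r - 2).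
Proof.
set (a := Ci * (PI * natC r * z)).
assert (E1 : e2pi z ^ r = Cexp a * Cexp a).
{ rewrite <- e2pi_nat, <- Cexp_add; unfold e2pi, twopi_i, a; f_equal; ring. }
assert (E2 : (/ e2pi z) ^ r = / (Cexp a * Cexp a)).
{ rewrite Cpow_inv by apply e2pi_neq_0. now rewrite E1. }
unfold Csin; fold a; rewrite E1, E2, Cexp_opp.
pose proof (Cexp_neq_0 a) as Ha.
assert (Hi : Ci <> 0) by apply Ci_nz.
assert (I2 : Ci * Ci = - (1)) by (apply C_ext; simpl; ring).
transitivity ((Cexp a - / Cexp a) ^ 2 / (4 * (Ci * Ci))); [field; split; assumption|].
rewrite I2; field; exact Ha.
Qed.

Lemma fourier_term_eq (z t : C) m : fourier_term z t m =
  - / 4 * (((e2pi t * e2pi z) ^ S m / (1 - e2pi t ^ S m) / natC (S m) ^ 3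
    + (e2pi t * / e2pi z) ^ S m / (1 - e2pi t ^ S m) / natC (S m) ^ 3)
    - 2 * (e2pi t ^ S m / (1 - e2pi t ^ S m) / natC (S m) ^ 3)).
Proof.
unfold fourier_term; rewrite Csin_sq, !Cpow_mult_l; unfold Cdiv; ring.
Qed.

Lemma Im_half_plane_bounds (z t : C) : (Rabs (Im z) < Im t)%R ->
  (Cmod (e2pi t) < 1 /\ Cmod (e2pi t * e2pi z) < 1 /\ Cmod (e2pi t * / e2pi z) < 1)%R.
Proof.
intros H; apply Rabs_def2 in H; destruct H as [H1 H2].
rewrite <- e2pi_opp, <- !e2pi_add; repeat split; apply Cmod_e2pi_lt_1; simpl; unfold Im in *; lra.
Qed.

Lemma fourier_sum (z t : C) : (Rabs (Im z) < Im t)%R ->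
  is_Cseries (fourier_term z t) (- / 4 * (lambert3 (e2pi t) (e2pi t * e2pi z) + lambert3 (e2pi t) (e2pi t * / e2pi z)
    - 2 * lambert3 (e2pi t) (e2pi t))).
Proof.
intros H; destruct (Im_half_plane_bounds z t H) as [H0 [H1 H2]].
apply is_Cseries_ext with (1 := fun m => eq_sym (fourier_term_eq z t m)).
apply is_Cseries_scal, is_Cseries_minus; [apply is_Cseries_plus | apply is_Cseries_scal];
  apply asum_is; apply Lambert_Li3; lra.
Qed.

Lemma fourier_converges (x t : C) : (Rabs (Im x) < Im t)%R -> ex_Cseries (fourier_term x t).
Proof. intros H; eexists; exact (fourier_sum x t H). Qed.

Lemma li3_branch_disc (al be ga : C) (Om : C * C -> Prop) : (forall p, Om p -> (0 < Im (aff al be ga p))%R) ->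
  li3_branch (aff al be ga) Om (fun p => / twopi_i ^ 3 * Li3_disc (e2pi (aff al be ga p))).
Proof.
intros H p Hp; specialize (H p Hp); set (w := aff al be ga p) in *.
destruct (aff_cont al be ga p (Im w) H) as [e [He Ke]]; fold w in Ke.
exists e, (Im w), (fun w => / twopi_i ^ 3 * Li3_disc (e2pi w)), (fun _ => 0).
split; [exact He|]; split; [exact H|]; split; [apply quad_zero|]; split.
- apply D3on_mono with (2 := Li3_disc_D3); intros v Hv; unfold disc in Hv.
  pose proof (im_le_Cmod (v - w)) as K.
  change (Im (v - w)) with (Im v - Im w)%R in K.
  apply Rle_lt_trans with (2 := Hv) in K; apply Rabs_def2 in K; lra.
- intros q Hq; split; [now apply Ke | ring].
Qed.

(** Bernoulli's inequality for the fourth root [s] of [R0] gives growth of order four, which beats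
    the cube. *)
Lemma pow_unbounded (R0 M : R) : (1 < R0)%R -> forall N, exists r, (N <= r)%nat /\ (M * INR (S r) ^ 3 < R0 ^ S r)%R.
Proof.
intros H N.
set (s := sqrt (sqrt R0)).
assert (Hs1 : (1 < sqrt R0)%R) by (rewrite <- sqrt_1; apply sqrt_lt_1; lra).
assert (Hs : (1 < s)%R) by (unfold s; rewrite <- sqrt_1; apply sqrt_lt_1; lra).
assert (E : (s ^ 4 = R0)%R).
{ unfold s; replace (sqrt (sqrt R0) ^ 4)%R with ((sqrt (sqrt R0) * sqrt (sqrt R0)) * (sqrt (sqrt R0) * sqrt (sqrt R0)))%R by ring.
  rewrite sqrt_sqrt by lra; apply sqrt_sqrt; lra. }
set (c := ((s - 1) ^ 4)%R).
assert (Hc : (0 < c)%R) by (apply pow_lt; lra).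
destruct (INR_unbounded (Rabs M / c)) as [k Hk].
exists (N + k)%nat; split; [lia|].
set (x := INR (S (N + k))).
assert (Hx : (Rabs M / c < x)%R).
{ eapply Rlt_le_trans; [exact Hk|]; unfold x; apply le_INR; lia. }
assert (Hx0 : (0 < x)%R) by (unfold x; apply lt_0_INR; lia).
assert (H1 : (x * (s - 1) <= s ^ S (N + k))%R).
{ pose proof (poly (S (N + k)) (s - 1) ltac:(lra)) as K. replace (1 + (s - 1))%R with s in K by ring.
  fold x in K; nra. }
assert (H2 : ((x * (s - 1)) ^ 4 <= R0 ^ S (N + k))%R).
{ rewrite <- E, <- pow_mult, (Nat.mul_comm 4), pow_mult; apply pow_incr; split; [nra | exact H1]. }
eapply Rlt_le_trans; [|exact H2]. rewrite Rpow_mult_distr; fold c.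
replace (x ^ 4 * c)%R with (c * x * x ^ 3)%R by ring.
apply Rmult_lt_compat_r; [now apply pow_lt|].
apply (Rmult_lt_compat_l c) in Hx; [|exact Hc].
replace (c * (Rabs M / c))%R with (Rabs M) in Hx by (field; lra).
pose proof (Rle_abs M); lra.
Qed.

(** The squared sine grows like [exp (2 pi r |Im z|)], faster than [q^r] decays, so the terms do not
    tend to zero. *)
Lemma fourier_diverges (z t : C) : (0 < Im t)%R -> (Im t < Rabs (Im z))%R -> ~ ex_Cseries (fourier_term z t).
Proof.
intros Ht Hz [s Hs].
destruct (is_Cseries_lim0 _ _ Hs 1%R ltac:(lra)) as [N HN].
set (B := exp (2 * PI * Rabs (Im z))). set (b := exp (- (2 * PI * Im t))).
assert (HB : (1 < B * b)%R).
{ unfold B, b; rewrite <- exp_plus, <- exp_0; apply exp_increasing. pose proof PI_RGT_0; nra. }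
assert (Hb : (0 < b < 1)%R).
{ unfold b; split; [apply exp_pos|]. rewrite <- exp_0; apply exp_increasing. pose proof PI_RGT_0; nra. }
(* [11 = 8 + 3]: a term below [1] forces [(B b)^k < 8 k^3 + 3 b^k]. *)
destruct (pow_unbounded (B * b) 11 HB N) as [r [Hr HR]].
specialize (HN r Hr). set (k := S r) in *.
assert (Hk1 : (1 <= INR k)%R) by (unfold k; rewrite S_INR; pose proof (pos_INR r); lra).
assert (Hk3 : (1 <= INR k ^ 3)%R) by (rewrite <- (pow1 3); apply pow_incr; lra).
assert (Hq : Cmod (e2pi t) = b) by apply Cmod_e2pi.
assert (Hbk : (0 <= b ^ k <= 1)%R) by (apply pow_S_le_1; lra).
assert (Hzz : (B ^ k - 3 <= Cmod (e2pi z ^ k + (/ e2pi z) ^ k - 2))%R).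
{ rewrite <- e2pi_opp.
  assert (Hx : exists x y : C, Cmod x = B /\ (Cmod y <= 1)%R /\ e2pi z ^ k + e2pi (- z) ^ k = x ^ k + y ^ k).
  { destruct (Rle_lt_dec 0 (Im z)) as [Hp|Hp].
    - exists (e2pi (- z)), (e2pi z); rewrite Cmod_e2pi; unfold B; rewrite Rabs_pos_eq by exact Hp.
      split; [f_equal; simpl; unfold Im; ring|]; split; [now apply Cmod_e2pi_le_1 | ring].
    - exists (e2pi z), (e2pi (- z)); rewrite Cmod_e2pi; unfold B; rewrite Rabs_left by exact Hp.
      split; [f_equal; ring|]; split; [apply Cmod_e2pi_le_1; simpl; unfold Im in *; lra | ring]. }
  destruct Hx as [x [y [Ex [Ey ->]]]].
  replace (x ^ k + y ^ k - 2) with (x ^ k - (2 - y ^ k)) by ring.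
  eapply Rle_trans; [|apply Cmod_triangle_rev]. rewrite Cmod_pow, Ex.
  assert (Cmod (2 - y ^ k) <= 3)%R; [|lra].
  eapply Rle_trans; [apply Cmod_triangle|]. rewrite Cmod_opp, Cmod_pow, Cmod_R, Rabs_pos_eq by lra.
  pose proof (pow_S_le_1 (Cmod y) k ltac:(pose proof (Cmod_ge_0 y); lra)); lra. }
assert (Hterm : (Cmod (fourier_term z t r) >= b ^ k * (B ^ k - 3) / (8 * INR k ^ 3))%R).
{ unfold fourier_term; fold k; rewrite Csin_sq.
  assert (H1 : 1 - e2pi t ^ k <> 0) by (apply one_sub_neq_0, Cmod_pow_S_lt_1; rewrite Hq; lra).
  assert (Hk : natC k <> 0) by apply natC_S_neq_0.
  rewrite Cmod_mult, Cmod_div, Cmod_div by (assumption || now apply Cpow_nz).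
  rewrite Cmod_mult, Cmod_opp, Cmod_inv by (intros E; apply RtoC_inj in E; lra).
  rewrite Cmod_R, Rabs_pos_eq by lra. rewrite !Cmod_pow, Hq.
  unfold natC; rewrite Cmod_R, (Rabs_pos_eq (INR k)) by lra.
  assert (H2 : (0 < Cmod (1 - e2pi t ^ k) <= 2)%R).
  { split; [now apply (proj1 (Cmod_gt_0 _))|].
    eapply Rle_trans; [apply Cmod_triangle|]; rewrite Cmod_opp, Cmod_pow, Hq, Cmod_1; lra. }
  assert (H3 : (/ 2 <= / Cmod (1 - e2pi t ^ k))%R) by (apply Rinv_le_contravar; lra).
  apply Rle_ge; unfold Rdiv.
  set (T := Cmod (e2pi z ^ k + (/ e2pi z) ^ k - 2)) in *.
  assert (HT : (0 <= T)%R) by apply Cmod_ge_0.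
  assert (Hi3 : (0 < / INR k ^ 3)%R) by (apply Rinv_0_lt_compat; lra).
  rewrite Rinv_mult.
  apply Rle_trans with (b ^ k * / 2 * (/ 4 * T * / INR k ^ 3))%R.
  - replace (b ^ k * (B ^ k - 3) * (/ 8 * / INR k ^ 3))%R with ((b ^ k * / 8 * / INR k ^ 3) * (B ^ k - 3))%R by ring.
    replace (b ^ k * / 2 * (/ 4 * T * / INR k ^ 3))%R with ((b ^ k * / 8 * / INR k ^ 3) * T)%R by (field; lra).
    apply Rmult_le_compat_l; [|exact Hzz]. apply Rmult_le_pos; lra.
  - apply Rmult_le_compat_r; [apply Rmult_le_pos; [|lra]; apply Rmult_le_pos; lra|].
    apply Rmult_le_compat_l; lra. }
assert (Hlt : (b ^ k * (B ^ k - 3) < 8 * INR k ^ 3)%R).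
{ assert (K : (b ^ k * (B ^ k - 3) / (8 * INR k ^ 3) < 1)%R) by lra.
  apply (Rmult_lt_compat_r (8 * INR k ^ 3)) in K; [|lra].
  unfold Rdiv in K; rewrite Rmult_assoc, Rinv_l, Rmult_1_r in K by lra. lra. }
rewrite Rpow_mult_distr in HR. nra.
Qed.

Lemma Im_aff_1 x p : Im (aff 1 (RtoC x) 0 p) = (Im (fst p) + x * Im (snd p))%R.
Proof. destruct p as [[a b] [c d]]; unfold aff; simpl; ring. Qed.

Lemma Im_aff_m1 x p : Im (aff (- (1)) (RtoC x) 0 p) = (- Im (fst p) + x * Im (snd p))%R.
Proof. destruct p as [[a b] [c d]]; unfold aff; simpl; ring. Qed.

(** Inside [|Im z| < Im tau] every summand except the one for [z] itself is given by the series on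
    the unit disc. The constant [Li3_disc 1] is the term [n = 0] of [li3_one], absent from the
    expansion. *)
Lemma fourier_f_branch (Om : C * C -> Prop) (G : C * C -> C) : open Om -> (forall p, Om p -> regular_point p) ->
  mv_fourier Om G -> f_branch Om (fun p => G p - / twopi_i ^ 3 * Li3_disc 1).
Proof.
intros HO HR [L [HL HG]].
assert (HI : forall p, Om p -> (Rabs (Im (fst p)) < Im (snd p))%R).
{ intros p Hp; apply Rnot_le_lt; intros Hle.
  destruct (open_pdisc Om p HO Hp) as [e [He Ke]].
  (* [Om] is open: from a point with [|Im z| >= Im tau], a small vertical displacement away from the
     real axis reaches a point of [Om] where the series diverges. *)
  set (d := if Rle_dec 0 (Im (fst p)) then (e / 2)%R else (- (e / 2))%R).
  assert (Hd : (Rabs d < e)%R) by (unfold d; destruct (Rle_dec 0 (Im (fst p))); [rewrite Rabs_pos_eq | rewrite Rabs_Ropp, Rabs_pos_eq]; lra).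
  set (p' := (fst p + RtoC d * Ci, snd p)).
  assert (Hp' : Om p').
  { apply Ke; split; unfold disc, p'; cbn [fst snd].
    - replace (fst p + RtoC d * Ci - fst p) with (RtoC d * Ci) by ring.
      rewrite Cmod_mult, Cmod_R, Cmod_Ci; lra.
    - replace (snd p - snd p) with (RtoC 0) by ring; rewrite Cmod_0; exact He. }
  pose proof (HG p' Hp') as K; unfold p' in K; destruct K as [s [Hs _]].
  apply (fourier_diverges (fst p + RtoC d * Ci) (snd p)); [apply (HR p Hp) | | now exists s].
  assert (E : Im (fst p + RtoC d * Ci) = (Im (fst p) + d)%R) by (simpl; unfold Im; ring).
  rewrite E; eapply Rle_lt_trans; [exact Hle|]; unfold d; destruct (Rle_dec 0 (Im (fst p))).
  - rewrite !Rabs_pos_eq; lra.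
  - rewrite !Rabs_left; lra. }
exists (fun n p => / twopi_i ^ 3 * ccons (L p) (fun m => Li3_disc (e2pi (W (S m) p))) n),
  (fun n p => / twopi_i ^ 3 * Li3_disc (e2pi (V n p))).
assert (HW : forall n p, Om p -> (0 < Im (W (S n) p))%R).
{ intros n p Hp; specialize (HI p Hp); apply Rabs_def2 in HI.
  unfold W, natC; rewrite Im_aff_1; pose proof (INR_S_ge_1 n) as Hn.
  destruct (HR p Hp) as [Ht _]; nra. }
assert (HV : forall n p, Om p -> (0 < Im (V n p))%R).
{ intros n p Hp; specialize (HI p Hp); apply Rabs_def2 in HI.
  unfold V, natC; rewrite Im_aff_m1; pose proof (INR_S_ge_1 n) as Hn.
  destruct (HR p Hp) as [Ht _]; nra. }
split; [|split].
- intros [|n].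
  + apply li3_branch_mv_Li3 with (h := fun p => e2pi (fst p)); [intros p Hp; apply (regular_W p 0); auto | | exact HL].
    intros p; change (aff 1 (natC 0) 0 p) with (W 0 p); rewrite e2pi_W; simpl; ring.
  + apply (li3_branch_disc 1 (natC (S n)) 0); apply HW.
- intros n; apply (li3_branch_disc (- (1)) (natC (S n)) 0); apply HV.
- intros p Hp; specialize (HI p Hp); destruct (Im_half_plane_bounds _ _ HI) as [B0 [B1 B2]].
  assert (Ht : (0 < Im (snd p))%R) by (pose proof (Rabs_pos (Im (fst p))); lra).
  set (q := e2pi (snd p)) in *; set (ze := e2pi (fst p)) in *.
  destruct (Lambert_Li3 q (q * ze)) as [L1 [L2 L3]]; [lra..|].
  destruct (Lambert_Li3 q (q * / ze)) as [M1 [M2 M3]]; [lra..|].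
  destruct (Lambert_Li3 q q) as [N1 [N2 N3]]; [lra..|].
  exists (/ twopi_i ^ 3 * (L p + lambert3 q (q * ze))), (/ twopi_i ^ 3 * lambert3 q (q * / ze)).
  split; [|split].
  + apply is_Cseries_scal, is_Cseries_cons.
    rewrite <- L3; apply is_Cseries_ext with (2 := asum_is _ L1); intros n.
    rewrite e2pi_W; fold q ze; f_equal; simpl; ring.
  + apply is_Cseries_scal; rewrite <- M3; apply is_Cseries_ext with (2 := asum_is _ M1); intros n.
    rewrite e2pi_V; fold q ze; f_equal; simpl; ring.
  + specialize (HG p Hp); destruct p as [z t]; destruct HG as [s [Hs HG]]; cbn [fst snd] in *.
    rewrite HG, (is_Cseries_fun_unique _ _ _ Hs (fourier_sum z t HI)); fold q ze.
    unfold li3_one; fold q.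
    assert (A0 : asum (fun n => Li3_disc (q ^ S n))).
    { apply asum_ext with (2 := N1); intros n; f_equal; simpl; ring. }
    rewrite (CSeries_incr (fun n => Li3_disc (q ^ n))) by now apply asum_incr.
    rewrite (CSeries_ext (fun n => Li3_disc (q ^ S n)) (fun n => Li3_disc (q ^ n * q))) by (intros n; f_equal; simpl; ring).
    rewrite N3; change (q ^ 0) with (RtoC 1). field. apply twopi_i_neq_0.
Qed.

Lemma f_fourier : differ_by_quadratic (fun p => fst p) (fun p => snd p)
  (mv_f (fun p => fst p) (fun p => snd p)) mv_fourier.
Proof.
apply differ_by_quadratic_intro; intros Om HO HC HR F G HF HG.
apply mv_f_f_branch_id in HF; [|exact HR]. apply fourier_f_branch in HG; [|exact HO | exact HR].
destruct (f_branch_unique _ _ _ HO HC HF HG) as [P [HP E]].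
exists (fun p => P p + - (/ twopi_i ^ 3 * Li3_disc 1)); split.
- apply quad_plus; [exact HP|].
  exists (- (/ twopi_i ^ 3 * Li3_disc 1)), 0, 0, 0, 0, 0; intros p; ring.
- intros p Hp; rewrite <- E by exact Hp; ring.
Qed.

(** * The third derivative of f *)

Definition Dconvex (Om : C * C -> Prop) : Prop := forall p q t, Om p -> Om q -> (0 <= t <= 1)%R ->
  Om (fst p + RtoC t * (fst q - fst p), snd p + RtoC t * (snd q - snd p)).

Lemma path_pdisc (a b : C * C) (t e : R) : (0 < e)%R -> exists d, (0 < d)%R /\ forall s, (Rabs (s - t) < d)%R ->
  pdisc (fst a + RtoC t * fst b, snd a + RtoC t * snd b) e (fst a + RtoC s * fst b, snd a + RtoC s * snd b).
Proof.
intros He; set (m := (Cmod (fst b) + Cmod (snd b) + 1)%R).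
assert (Hm : (0 < m)%R) by (pose proof (Cmod_ge_0 (fst b)); pose proof (Cmod_ge_0 (snd b)); unfold m; lra).
exists (e / m)%R; split; [now apply Rdiv_lt_0_compat|]; intros s Hs.
apply (Rmult_lt_compat_l m) in Hs; [|exact Hm]. replace (m * (e / m))%R with e in Hs by (field; lra).
pose proof (Rabs_pos (s - t)).
split; unfold disc; cbn [fst snd].
- replace (fst a + RtoC s * fst b - (fst a + RtoC t * fst b)) with (RtoC (s - t) * fst b) by (rewrite RtoC_minus; ring).
  rewrite Cmod_mult, Cmod_R; pose proof (Cmod_ge_0 (snd b)); unfold m in Hs; nra.
- replace (snd a + RtoC s * snd b - (snd a + RtoC t * snd b)) with (RtoC (s - t) * snd b) by (rewrite RtoC_minus; ring).
  rewrite Cmod_mult, Cmod_R; pose proof (Cmod_ge_0 (fst b)); unfold m in Hs; nra.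
Qed.

(** On a segment, the function separating [U] from its complement is locally constant, hence has
    derivative zero; the mean value theorem forbids a jump. *)
Lemma convex_connected (Om : C * C -> Prop) : open Om -> Dconvex Om -> connected_set Om.
Proof.
intros HO HC U V HU HV Hcov [p [Hp Up]] [q [Hq Vq]].
apply NNPP; intros Hn.
set (b := (fst q - fst p, snd q - snd p)).
set (ga := fun t : R => (fst p + RtoC t * fst b, snd p + RtoC t * snd b)).
set (phi := fun t => if excluded_middle_informative (U (ga t)) then 0%R else 1%R).
assert (Hphi : forall t, (0 <= t <= 1)%R -> is_derive phi t 0).
{ intros t Ht.
  assert (Ht' : Om (ga t)) by (apply HC; assumption).
  destruct (open_pdisc Om _ HO Ht') as [e1 [He1 K1]].
  assert (Hloc : locally t (fun s => phi s = phi t)).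
  { destruct (Hcov _ Ht') as [Ut|Vt].
    - destruct (open_pdisc U _ HU Ut) as [e2 [He2 K2]].
      destruct (path_pdisc p b t e2 He2) as [d [Hd Kd]].
      exists (mkposreal d Hd); intros s Hs; unfold phi.
      destruct (excluded_middle_informative (U (ga s))) as [_|N1]; [|exfalso; apply N1, K2, Kd, Hs].
      destruct (excluded_middle_informative (U (ga t))) as [_|N1]; [reflexivity | contradiction].
    - destruct (open_pdisc V _ HV Vt) as [e2 [He2 K2]].
      destruct (path_pdisc p b t (Rmin e1 e2)) as [d [Hd Kd]]; [now apply Rmin_pos|].
      exists (mkposreal d Hd); intros s Hs; unfold phi.
      specialize (Kd s Hs).
      destruct (excluded_middle_informative (U (ga s))) as [U1|_].
      + exfalso; apply Hn; exists (ga s); split; [|split].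
        * apply K1, pdisc_mono with (2 := Kd), Rmin_l.
        * exact U1.
        * apply K2, pdisc_mono with (2 := Kd), Rmin_r.
      + destruct (excluded_middle_informative (U (ga t))) as [U1|_]; [|reflexivity].
        exfalso; apply Hn; exists (ga t); auto. }
  apply is_derive_ext_loc with (fun _ => phi t).
  - apply filter_imp with (2 := Hloc); auto.
  - apply (is_derive_const (K := R_AbsRing) (V := R_NormedModule)). }
destruct (MVT_gen phi 0 1 (fun _ => 0%R)) as [c [_ E]].
- rewrite Rmin_left, Rmax_right by lra; intros x Hx; apply Hphi; lra.
- rewrite Rmin_left, Rmax_right by lra; intros x Hx; apply continuity_pt_filterlim.
  apply (ex_derive_continuous (K := R_AbsRing) (V := R_NormedModule) phi); exists 0%R; now apply Hphi.
- assert (E0 : ga 0%R = p).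
  { unfold ga, b; cbn [fst snd]; destruct p as [p1 p2], q as [q1 q2]; cbn [fst snd]; f_equal; ring. }
  assert (E1 : ga 1%R = q).
  { unfold ga, b; cbn [fst snd]; destruct p as [p1 p2], q as [q1 q2]; cbn [fst snd]; f_equal; ring. }
  unfold phi in E; rewrite E0, E1 in E.
  destruct (excluded_middle_informative (U q)) as [U1|_]; [exfalso; apply Hn; exists q; auto|].
  destruct (excluded_middle_informative (U p)) as [_|N1]; [lra | contradiction].
Qed.

Lemma open_of_pdisc (Om : C * C -> Prop) :
  (forall p, Om p -> exists e, (0 < e)%R /\ forall q, pdisc p e q -> Om q) -> open Om.
Proof. intros H p Hp; apply locally_pdisc, H, Hp. Qed.

Definition rect (z0 : C) (r : R) (t0 : C) (s : R) (p : C * C) : Prop := disc z0 r (fst p) /\ disc t0 s (snd p).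

Lemma rect_open z0 r t0 s : open (rect z0 r t0 s).
Proof.
apply open_of_pdisc; intros p [H1 H2].
destruct (disc_open _ _ _ H1) as [d1 [Hd1 K1]], (disc_open _ _ _ H2) as [d2 [Hd2 K2]].
exists (Rmin d1 d2); split; [now apply Rmin_pos|]; intros q [L1 L2].
pose proof (Rmin_l d1 d2); pose proof (Rmin_r d1 d2).
split; [apply K1 | apply K2]; unfold disc in *; lra.
Qed.

Lemma rect_connected z0 r t0 s : connected_set (rect z0 r t0 s).
Proof.
apply convex_connected; [apply rect_open|].
intros p q t [H1 H2] [K1 K2] Ht; split; cbn [fst snd]; now apply disc_convex.
Qed.

Lemma quad_slice (P : C * C -> C) (t : C) (U : C -> Prop) : quad P -> D3on U (fun z => P (z, t)) (fun _ => 0).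
Proof.
intros [a [b [c [d [e [f H]]]]]].
destruct (D3on_cubic U (a + c * t + f * t ^ 2) (b + e * t) d 0) as [f1 [f2 K]].
exists f1, f2; intros w Hw; destruct (K w Hw) as [K1 [K2 K3]]; repeat split; try assumption.
- apply Cder_ext_all with (2 := K1); intros y; rewrite H; cbn [fst snd]; ring.
- apply Cder_eq with (1 := K3); ring.
Qed.

Lemma li3_branch_D3 (al be ga t : C) (Om : C * C -> Prop) (L : C * C -> C) (U : C -> Prop) :
  (forall z, U z -> Om (z, t)) -> li3_branch (aff al be ga) Om L ->
  D3on U (fun z => L (z, t)) (fun z => al ^ 3 * li3_D3 (al * z + (be * t + ga))).
Proof.
intros HU H; apply D3on_local; intros z Hz; destruct (H (z, t) (HU z Hz)) as [e [d [l [P [He [Hd [HP [HD K]]]]]]]].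
exists e, (fun z => al ^ 3 * li3_D3 (al * z + (be * t + ga)) + 0); split; [exact He|]; split; [|ring].
assert (Kz : forall v, disc z e v -> pdisc (z, t) e (v, t)).
{ intros v Hv; split; cbn [fst snd]; [exact Hv | now apply disc_center]. }
assert (E : forall v, aff al be ga (v, t) = al * v + (be * t + ga)) by (intros v; unfold aff; cbn [fst snd]; ring).
apply D3on_ext with (fun v => l (al * v + (be * t + ga)) + P (v, t)) (fun z => al ^ 3 * li3_D3 (al * z + (be * t + ga)) + 0);
  [apply disc_open | | reflexivity |].
- intros v Hv; destruct (K _ (Kz v Hv)) as [_ ->]; now rewrite (E v).
- apply D3on_plus; [|exact (quad_slice P t _ HP)].
  apply D3on_mono with (2 := D3on_affine _ al (be * t + ga) _ _ HD).
  intros v Hv; destruct (K _ (Kz v Hv)) as [K1 _]; rewrite (E v) in K1; exact K1.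
Qed.

(** [lambert3 q] as a power series in [Y], so that it can be differentiated inside the unit disc. *)
Definition lambert3_coef (q : C) (n : nat) : C := match n with O => 0 | S _ => / (1 - q ^ n) / natC n ^ 3 end.

Lemma lambert3_Pser q Y : (Cmod q < 1)%R -> (Cmod Y <= 1)%R -> lambert3 q Y = Pser (lambert3_coef q) Y.
Proof.
intros Hq HY; symmetry; apply is_Cseries_unique.
replace (lambert3 q Y) with (lambert3_coef q 0 * Y ^ 0 + lambert3 q Y) by (simpl; ring).
apply (is_Cseries_incr (fun n => lambert3_coef q n * Y ^ n)).
destruct (Lambert_Li3 q Y Hq HY) as [_ [H _]].
apply is_Cseries_ext with (2 := asum_is _ H); intros n; cbn [lambert3_coef]; unfold Cdiv; ring.
Qed.

Lemma cvr_lambert3_coef q : (Cmod q < 1)%R -> cvr (lambert3_coef q) 1.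
Proof.
intros Hq; apply cvr_conv; intros Y HY; apply asum_ex, asum_incr.
destruct (Lambert_Li3 q Y Hq ltac:(lra)) as [_ [H _]].
apply asum_ext with (2 := H); intros n; cbn [lambert3_coef]; unfold Cdiv; ring.
Qed.

Lemma li3_D3_CSeries w : (0 < Im w)%R -> li3_D3 w = CSeries (fun m => e2pi w ^ S m).
Proof.
intros H; pose proof (Cmod_e2pi_lt_1 w H) as H1.
rewrite (CSeries_ext _ (fun m => e2pi w * e2pi w ^ m)) by reflexivity.
rewrite CSeries_scal, CSeries_geom by (assumption || now apply asum_geom); reflexivity.
Qed.

Lemma Lambert_li3_D3 (t w : C) : (0 < Im t)%R -> (0 < Im w)%R ->
  asum (fun n => li3_D3 (w + natC n * t)) /\
  asum (fun m => e2pi w ^ S m / (1 - e2pi t ^ S m)) /\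
  CSeries (fun n => li3_D3 (w + natC n * t)) = CSeries (fun m => e2pi w ^ S m / (1 - e2pi t ^ S m)).
Proof.
intros Ht Hw; pose proof (Cmod_e2pi_lt_1 t Ht) as H1; pose proof (Cmod_e2pi_lt_1 w Hw) as H2.
destruct (Lambert (fun _ => 1) (e2pi t) (e2pi w) H1) as [_ [L2 [L3 L4]]].
{ apply asum_ext with (fun m => e2pi w * e2pi w ^ m); [intros; simpl; ring | now apply asum_scal, asum_geom]. }
assert (E : forall n, li3_D3 (w + natC n * t) = CSeries (fun m => 1 * (e2pi t ^ n * e2pi w) ^ S m)).
{ intros n; rewrite li3_D3_CSeries.
  - apply CSeries_ext; intros m; rewrite e2pi_add, e2pi_nat, (Cmult_comm (e2pi w)); ring.
  - destruct w, t; unfold natC; simpl in *; pose proof (pos_INR n); nra. }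
split; [|split].
- apply asum_ext with (2 := L2); intros n; now rewrite E.
- apply asum_ext with (2 := L3); intros m; ring.
- rewrite (CSeries_ext _ _ E), L4; apply CSeries_ext; intros; ring.
Qed.

Lemma asum_li3_D3 (t w : C) : (0 < Im t)%R -> asum (fun n => li3_D3 (w + natC n * t)).
Proof.
intros Ht; destruct (INR_unbounded (Rabs (Im w) / Im t)) as [N HN].
apply (asum_incr_n _ N).
assert (H : (0 < Im (w + natC N * t))%R).
{ apply (Rmult_lt_compat_r (Im t)) in HN; [|exact Ht].
  unfold Rdiv in HN; rewrite Rmult_assoc, Rinv_l, Rmult_1_r in HN by lra.
  pose proof (Rle_abs (- Im w)) as K; rewrite Rabs_Ropp in K.
  destruct w, t; unfold natC; simpl in *; lra. }
apply asum_ext with (2 := proj1 (Lambert_li3_D3 t _ Ht H)); intros n; f_equal.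
unfold natC; rewrite plus_INR, RtoC_plus; ring.
Qed.

(** The Lambert rearrangement makes the sum over [n] a single power series in [e2pi w]. Three
    derivatives cancel the cubes and leave [/ (1 - q ^ m)], which rearranges back into a sum over
    [n]. *)
Lemma tail_D3 (t : C) : (0 < Im t)%R ->
  D3on (fun w => (0 < Im w)%R) (fun w => / twopi_i ^ 3 * CSeries (fun n => Li3_disc (e2pi (w + natC n * t))))
    (fun w => CSeries (fun n => li3_D3 (w + natC n * t))).
Proof.
intros Ht; pose proof (Cmod_e2pi_lt_1 t Ht) as Hq.
destruct (D3on_Pser_e2pi (lambert3_coef (e2pi t)) 1 0 (cvr_lambert3_coef _ Hq)) as [f1 [f2 K]].
exists f1, f2; intros w Hw; pose proof (Cmod_e2pi_lt_1 w Hw) as Hx.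
destruct (K w) as [K1 [K2 K3]]; [replace (e2pi w - 0) with (e2pi w) by ring; exact Hx|].
repeat split; [|exact K2|].
- apply Cder_ext with (3 := K1) (d := Im w); [exact Hw|]; intros v Hv.
  assert (Hv' : (0 < Im v)%R).
  { pose proof (im_le_Cmod (v - w)) as H1; change (Im (v - w)) with (Im v - Im w)%R in H1.
    apply Rle_lt_trans with (2 := Hv), Rabs_def2 in H1; lra. }
  pose proof (Cmod_e2pi_lt_1 v Hv') as Hy; f_equal.
  replace (e2pi v - 0) with (e2pi v) by ring.
  rewrite <- lambert3_Pser by lra.
  destruct (Lambert_Li3 (e2pi t) (e2pi v) Hq ltac:(lra)) as [_ [_ <-]].
  apply CSeries_ext; intros n; f_equal; rewrite e2pi_add, e2pi_nat; ring.
- apply Cder_eq with (1 := K3). replace (e2pi w - 0) with (e2pi w) by ring.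
  destruct (Lambert_li3_D3 t w Ht Hw) as [_ [L1 ->]].
  unfold Pser; rewrite <- CSeries_scal.
  + apply CSeries_ext; intros n; unfold li3op, der; rewrite !oned_0_S; cbn [lambert3_coef].
    assert (Hn := natC_S_neq_0 n); assert (Hn2 : 1 - e2pi t ^ S n <> 0) by now apply one_sub_neq_0, Cmod_pow_S_lt_1.
    simpl Cpow in *; field; split; assumption.
  + apply (cvr_asum _ 1); [apply cvr_li3op, cvr_lambert3_coef, Hq | exact Hx].
Qed.

(** The first [N] summands are arbitrary and are differentiated one by one; the induction replaces
    [c] by [c + t]. *)
Lemma series_D3 (U : C -> Prop) (al t : C) : Copen U -> (0 < Im t)%R -> forall N (c : C) (l : nat -> C -> C) (S0 : C -> C),
  (forall n, D3on U (l n) (fun z => al ^ 3 * li3_D3 (al * z + c + natC n * t))) ->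
  (forall n, (N <= n)%nat -> forall z, U z -> (0 < Im (al * z + c + natC n * t))%R /\
     l n z = / twopi_i ^ 3 * Li3_disc (e2pi (al * z + c + natC n * t))) ->
  (forall z, U z -> is_Cseries (fun n => l n z) (S0 z)) ->
  D3on U S0 (fun z => al ^ 3 * CSeries (fun n => li3_D3 (al * z + c + natC n * t))).
Proof.
intros HU Ht N; induction N as [|N IH]; intros c l S0 HD HP HS.
- apply D3on_ext with (fun z => / twopi_i ^ 3 * CSeries (fun n => Li3_disc (e2pi (al * z + c + natC n * t))))
    (fun z => al ^ 3 * CSeries (fun n => li3_D3 (al * z + c + natC n * t))); [exact HU | | reflexivity |].
  + intros z Hz. apply (is_Cseries_fun_unique (fun n => l n z)); [|now apply HS].
    apply is_Cseries_ext with (fun n => / twopi_i ^ 3 * Li3_disc (e2pi (al * z + c + natC n * t))).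
    * intros n; symmetry; apply HP; [lia | exact Hz].
    * apply is_Cseries_scal, asum_is.
      destruct (HP 0%nat ltac:(lia) z Hz) as [H0 _].
      replace (al * z + c + natC 0 * t) with (al * z + c) in H0 by (unfold natC; simpl INR; ring).
      destruct (Lambert_Li3 (e2pi t) (e2pi (al * z + c)) (Cmod_e2pi_lt_1 _ Ht) ltac:(apply Cmod_e2pi_le_1; lra)) as [K _].
      apply asum_ext with (2 := K); intros n; f_equal; rewrite (e2pi_add _ (natC n * t)), e2pi_nat; ring.
  + apply D3on_mono with (2 := D3on_affine _ al c _ _ (tail_D3 t Ht)); intros z Hz.
    destruct (HP 0%nat ltac:(lia) z Hz) as [H0 _].
    replace (al * z + c + natC 0 * t) with (al * z + c) in H0 by (unfold natC; simpl INR; ring). exact H0.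
- assert (Eq : forall z n, al * z + (c + t) + natC n * t = al * z + c + natC (S n) * t)
    by (intros z n; rewrite natC_S; ring).
  specialize (IH (c + t) (fun n => l (S n)) (fun z => S0 z - l 0%nat z)).
  apply D3on_ext with (fun z => l 0%nat z + (S0 z - l 0%nat z))
    (fun z => al ^ 3 * li3_D3 (al * z + c + natC 0 * t) + al ^ 3 * CSeries (fun n => li3_D3 (al * z + (c + t) + natC n * t)));
    [exact HU | intros z Hz; ring | |].
  + intros z Hz; rewrite (CSeries_incr (fun n => li3_D3 (al * z + c + natC n * t))) by now apply asum_li3_D3.
    rewrite (CSeries_ext _ (fun n => li3_D3 (al * z + c + natC (S n) * t))) by (intros n; now rewrite Eq). ring.
  + apply D3on_plus; [apply HD|]; apply IH.
    * intros n; destruct (HD (S n)) as [f1 [f2 K]]; exists f1, f2; intros w Hw; rewrite Eq; now apply K.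
    * intros n Hn z Hz; rewrite Eq; apply HP; [lia | exact Hz].
    * intros z Hz; apply (is_Cseries_tail (fun n => l n z)); now apply HS.
Qed.

(** The third [z]-derivative of every branch of [f], see [f_branch_D3]. *)
Definition f_zzz (z t : C) : C :=
  / 2 + CSeries (fun n => li3_D3 (z + natC n * t)) - CSeries (fun n => li3_D3 (- z + t + natC n * t)).

(** All but finitely many of the branches may be taken to be the series of
    [Li3] on the unit disc, whose sum is differentiated termwise. *)
Lemma f_branch_D3 (Om : C * C -> Prop) (F : C * C -> C) (U : C -> Prop) (t : C) : open Om ->
  (forall p, Om p -> (0 < Im (snd p))%R) -> (forall z, U z -> Om (z, t)) ->
  f_branch Om F -> D3on U (fun z => F (z, t)) (fun z => f_zzz z t).
Proof.
intros HO HR HU HF; apply D3on_local; intros z0 Hz0.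
assert (Hp0 := HU z0 Hz0). assert (Ht := HR _ Hp0); cbn [snd] in Ht.
destruct (open_pdisc Om _ HO Hp0) as [e0 [He0 K0]].
set (e := Rmin e0 (Im t / 2)).
assert (He : (0 < e)%R) by (apply Rmin_pos; lra).
assert (Hee0 : (e <= e0)%R) by apply Rmin_l. assert (Het : (e <= Im t / 2)%R) by apply Rmin_r.
set (R0 := rect z0 e t e).
assert (HR0 : forall p, R0 p -> Om p).
{ intros p [H1 H2]; apply K0; split; cbn [fst snd]; unfold disc in *; lra. }
(* From the index [N] on, all arguments have positive imaginary part on the whole polydisc [R0]. *)
destruct (INR_unbounded ((Rabs (Im z0) + e) / (Im t / 2))) as [N HN].
assert (HN' : (Rabs (Im z0) + e < INR N * (Im t / 2))%R).
{ apply (Rmult_lt_compat_r (Im t / 2)) in HN; [|lra].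
  unfold Rdiv in HN at 1; rewrite Rmult_assoc, Rinv_l, Rmult_1_r in HN by lra. exact HN. }
assert (HI : forall p, R0 p -> (Rabs (Im (fst p)) < Rabs (Im z0) + e /\ Im t / 2 < Im (snd p))%R).
{ intros p [H1 H2]; unfold disc in *.
  pose proof (im_le_Cmod (fst p - z0)) as I1; change (Im (fst p - z0)) with (Im (fst p) - Im z0)%R in I1.
  pose proof (im_le_Cmod (snd p - t)) as I2; change (Im (snd p - t)) with (Im (snd p) - Im t)%R in I2.
  split.
  - replace (Im (fst p)) with (Im z0 + (Im (fst p) - Im z0))%R by ring.
    eapply Rle_lt_trans; [apply Rabs_triang|]; lra.
  - apply Rle_lt_trans with (2 := H2), Rabs_def2 in I2; lra. }
assert (HI2 : forall n p, (N <= n)%nat -> R0 p -> (Rabs (Im (fst p)) < INR n * Im (snd p))%R).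
{ intros n p Hn Hp; destruct (HI p Hp) as [I1 I2]; apply le_INR in Hn. pose proof (pos_INR N).
  apply Rlt_trans with (INR N * (Im t / 2))%R; [lra|].
  apply Rle_lt_trans with (INR n * (Im t / 2))%R; [apply Rmult_le_compat_r; lra|].
  apply Rmult_lt_compat_l; [|exact I2].
  destruct (Rle_lt_or_eq_dec 0 (INR n) (pos_INR n)) as [|E]; [assumption|].
  exfalso. rewrite <- E in Hn. pose proof (Rabs_pos (Im z0)). nra. }
assert (HW : forall n p, (N <= n)%nat -> R0 p -> (0 < Im (W n p))%R).
{ intros n p Hn Hp; specialize (HI2 n p Hn Hp); unfold W, natC; rewrite Im_aff_1; apply Rabs_def2 in HI2; lra. }
assert (HV : forall n p, (N <= n)%nat -> R0 p -> (0 < Im (V n p))%R).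
{ intros n p Hn Hp; specialize (HI2 (S n) p ltac:(lia) Hp); unfold V, natC; rewrite Im_aff_m1; apply Rabs_def2 in HI2; lra. }
destruct HF as [L [M [TL [TM HF]]]].
(* Exchanging branches costs only a quadratic polynomial, which the third derivative does not
   see. *)
set (L' := fun n => if (n <? N)%nat then L n else fun p => / twopi_i ^ 3 * Li3_disc (e2pi (W n p))).
set (M' := fun n => if (n <? N)%nat then M n else fun p => / twopi_i ^ 3 * Li3_disc (e2pi (V n p))).
assert (TL' : forall n, li3_branch (W n) R0 (L' n)).
{ intros n; unfold L'; destruct (Nat.ltb_spec n N); [now apply li3_branch_sub with Om|].
  apply li3_branch_disc; intros p Hp; now apply (HW n). }
assert (TM' : forall n, li3_branch (V n) R0 (M' n)).
{ intros n; unfold M'; destruct (Nat.ltb_spec n N); [now apply li3_branch_sub with Om|].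
  apply li3_branch_disc; intros p Hp; now apply (HV n). }
assert (SL' : forall p, R0 p -> is_Cseries (fun n => L' n p) (CSeries (fun n => L' n p))).
{ intros p Hp; apply asum_is, (asum_incr_n _ N).
  assert (Ht' : (0 < Im (snd p))%R) by (destruct (HI p Hp); lra).
  destruct (Lambert_Li3 (e2pi (snd p)) (e2pi (W N p)) (Cmod_e2pi_lt_1 _ Ht')) as [K _].
  { apply Cmod_e2pi_le_1; left; now apply HW. }
  apply asum_ext with (2 := asum_scal (/ twopi_i ^ 3) _ K); intros n; unfold L'.
  destruct (Nat.ltb_spec (n + N) N); [lia|]. do 2 f_equal.
  rewrite !e2pi_W, Cpow_add_r; ring. }
assert (SM' : forall p, R0 p -> is_Cseries (fun n => M' n p) (CSeries (fun n => M' n p))).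
{ intros p Hp; apply asum_is, (asum_incr_n _ N).
  assert (Ht' : (0 < Im (snd p))%R) by (destruct (HI p Hp); lra).
  destruct (Lambert_Li3 (e2pi (snd p)) (e2pi (V N p)) (Cmod_e2pi_lt_1 _ Ht')) as [K _].
  { apply Cmod_e2pi_le_1; left; now apply HV. }
  apply asum_ext with (2 := asum_scal (/ twopi_i ^ 3) _ K); intros n; unfold M'.
  destruct (Nat.ltb_spec (n + N) N); [lia|]. do 2 f_equal.
  rewrite !e2pi_V, <- plus_Sn_m, !Nat.add_succ_l, <- Nat.add_succ_r, Cpow_add_r; ring. }
set (F' := fun p => CSeries (fun n => L' n p) + CSeries (fun n => M' n p)
   + (/ 12 * fst p ^ 3 - / 24 * fst p ^ 2 * snd p - li3_one (snd p))).
assert (HF' : f_branch R0 F').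
{ exists L', M'; split; [exact TL'|]; split; [exact TM'|]; intros p Hp.
  exists (CSeries (fun n => L' n p)), (CSeries (fun n => M' n p)); split; [now apply SL'|]; split; [now apply SM'|].
  unfold F'; ring. }
assert (HF0 : f_branch R0 F).
{ exists L, M; split; [|split].
  - intros n; now apply li3_branch_sub with Om.
  - intros n; now apply li3_branch_sub with Om.
  - intros p Hp; now apply HF, HR0. }
destruct (f_branch_unique R0 F F' (rect_open _ _ _ _) (rect_connected _ _ _ _) HF0 HF') as [P [HP EP]].
set (D := disc z0 e).
assert (HD : forall z, D z -> R0 (z, t)) by (intros z Hz; split; cbn [fst snd]; [exact Hz | now apply disc_center]).
exists e, (fun z => f_zzz z t); split; [exact He|]; split; [|reflexivity].
assert (DL : D3on D (fun z => CSeries (fun n => L' n (z, t))) (fun z => 1 ^ 3 * CSeries (fun n => li3_D3 (1 * z + 0 + natC n * t)))).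
{ apply (series_D3 D 1 t (disc_open _ _) Ht N 0 (fun n z => L' n (z, t))).
  - intros n; destruct (li3_branch_D3 1 (natC n) 0 t R0 (L' n) D HD (TL' n)) as [f1 [f2 K]]; exists f1, f2; intros w Hw.
    replace (1 * w + 0 + natC n * t) with (1 * w + (natC n * t + 0)) by ring; now apply K.
  - intros n Hn z Hz.
    replace (1 * z + 0 + natC n * t) with (W n (z, t)) by (unfold W, aff; cbn [fst snd]; ring).
    split; [apply HW; auto|]. unfold L'; destruct (Nat.ltb_spec n N); [lia | reflexivity].
  - intros z Hz; now apply SL', HD. }
assert (DM : D3on D (fun z => CSeries (fun n => M' n (z, t))) (fun z => (- (1)) ^ 3 * CSeries (fun n => li3_D3 (- (1) * z + t + natC n * t)))).
{ apply (series_D3 D (- (1)) t (disc_open _ _) Ht N t (fun n z => M' n (z, t))).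
  - intros n; destruct (li3_branch_D3 (- (1)) (natC (S n)) 0 t R0 (M' n) D HD (TM' n)) as [f1 [f2 K]]; exists f1, f2; intros w Hw.
    replace (- (1) * w + t + natC n * t) with (- (1) * w + (natC (S n) * t + 0)) by (rewrite natC_S; ring); now apply K.
  - intros n Hn z Hz.
    replace (- (1) * z + t + natC n * t) with (V n (z, t)) by (unfold V, aff; rewrite natC_S; cbn [fst snd]; ring).
    split; [apply HV; auto|]. unfold M'; destruct (Nat.ltb_spec n N); [lia | reflexivity].
  - intros z Hz; now apply SM', HD. }
apply D3on_ext with (f := fun z => (CSeries (fun n => L' n (z, t)) + CSeries (fun n => M' n (z, t)))
     + (- li3_one t + 0 * z + (- / 24 * t) * z ^ 2 + / 12 * z ^ 3) + P (z, t))
   (g := fun z => (1 ^ 3 * CSeries (fun n => li3_D3 (1 * z + 0 + natC n * t))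
     + (- (1)) ^ 3 * CSeries (fun n => li3_D3 (- (1) * z + t + natC n * t))) + 6 * / 12 + 0).
- apply disc_open.
- intros z Hz. specialize (EP _ (HD z Hz)). rewrite <- EP; unfold F'; cbn [fst snd]; ring.
- intros z Hz; unfold f_zzz.
  rewrite (CSeries_ext (fun n => li3_D3 (1 * z + 0 + natC n * t)) (fun n => li3_D3 (z + natC n * t))) by (intros; f_equal; ring).
  rewrite (CSeries_ext (fun n => li3_D3 (- (1) * z + t + natC n * t)) (fun n => li3_D3 (- z + t + natC n * t))) by (intros; f_equal; ring).
  field.
- apply D3on_plus; [apply D3on_plus; [apply D3on_plus; [exact DL | exact DM] | apply D3on_cubic] | exact (quad_slice P t _ HP)].
Qed.

(** * Sums over the integers and lattices *)

(** [zpos] and [zneg] enumerate the integers without repetition; zero belongs to the first. *)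
Definition zpos (n : nat) : Z := Z.of_nat n.
Definition zneg (n : nat) : Z := (- Z.of_nat (S n))%Z.
Definition ZC (k : Z) : C := RtoC (IZR k).

Definition Zsummable (u : Z -> C) : Prop := asum (fun n => u (zpos n)) /\ asum (fun n => u (zneg n)).
Definition Zsum (u : Z -> C) : C := CSeries (fun n => u (zpos n)) + CSeries (fun n => u (zneg n)).

Lemma Zsum_ext u v : (forall k, u k = v k) -> Zsum u = Zsum v.
Proof. intros H; unfold Zsum; f_equal; apply CSeries_ext; intros; apply H. Qed.

Lemma Zsummable_ext u v : (forall k, u k = v k) -> Zsummable u -> Zsummable v.
Proof. intros H [H1 H2]; split; [apply asum_ext with (2 := H1) | apply asum_ext with (2 := H2)]; intros; apply H. Qed.

Lemma Zsum_scal c u : Zsummable u -> Zsum (fun k => c * u k) = c * Zsum u.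
Proof. intros [H1 H2]; unfold Zsum; rewrite !CSeries_scal by assumption; ring. Qed.

Lemma Zsummable_scal c u : Zsummable u -> Zsummable (fun k => c * u k).
Proof. intros [H1 H2]; split; now apply asum_scal. Qed.

Lemma Zsum_minus u v : Zsummable u -> Zsummable v -> Zsum (fun k => u k - v k) = Zsum u - Zsum v.
Proof. intros [H1 H2] [K1 K2]; unfold Zsum; rewrite !CSeries_minus by assumption; ring. Qed.

Lemma Zsummable_minus u v : Zsummable u -> Zsummable v -> Zsummable (fun k => u k - v k).
Proof. intros [H1 H2] [K1 K2]; split; now apply asum_minus. Qed.

Lemma Zsum_shift u : Zsummable u -> Zsummable (fun k => u (k + 1)%Z) /\ Zsum (fun k => u (k + 1)%Z) = Zsum u.
Proof.
intros [H1 H2].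
assert (E1 : forall n, u (zpos n + 1)%Z = u (zpos (S n))) by (intros n; f_equal; unfold zpos; lia).
assert (E2 : forall n, u (zneg (S n) + 1)%Z = u (zneg n)) by (intros n; f_equal; unfold zneg; lia).
assert (E3 : u (zneg 0 + 1)%Z = u (zpos 0)) by (f_equal).
assert (A1 : asum (fun n => u (zpos n + 1)%Z)).
{ apply asum_ext with (fun n => u (zpos (S n))); [intros n; now rewrite E1 | now apply (asum_incr (fun n => u (zpos n)))]. }
assert (A2 : asum (fun n => u (zneg n + 1)%Z)).
{ apply asum_incr; apply asum_ext with (2 := H2); intros n; now rewrite E2. }
split; [split; assumption|]. unfold Zsum.
rewrite (CSeries_incr (fun n => u (zneg n + 1)%Z)) by exact A2.
rewrite (CSeries_incr (fun n => u (zpos n))) by exact H1.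
rewrite E3, (CSeries_ext _ _ E1), (CSeries_ext _ _ E2); ring.
Qed.

Lemma Zsum_opp u : Zsummable u -> Zsummable (fun k => u (- k)%Z) /\ Zsum (fun k => u (- k)%Z) = Zsum u.
Proof.
intros [H1 H2].
assert (E1 : forall n, u (- zpos (S n))%Z = u (zneg n)) by (intros n; f_equal).
assert (E2 : forall n, u (- zneg n)%Z = u (zpos (S n))) by (intros n; f_equal; unfold zneg, zpos; lia).
assert (A1 : asum (fun n => u (- zpos n)%Z)).
{ apply asum_incr; apply asum_ext with (2 := H2); intros n; now rewrite E1. }
assert (A2 : asum (fun n => u (- zneg n)%Z)).
{ apply asum_ext with (fun n => u (zpos (S n))); [intros n; now rewrite E2 | now apply (asum_incr (fun n => u (zpos n)))]. }
split; [split; assumption|]. unfold Zsum.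
rewrite (CSeries_incr (fun n => u (- zpos n)%Z)) by exact A1.
rewrite (CSeries_incr (fun n => u (zpos n))) by exact H1.
rewrite (CSeries_ext _ _ E1), (CSeries_ext _ _ E2). change (- zpos 0)%Z with (zpos 0); ring.
Qed.

Lemma CSeries_even_odd u : asum u -> asum (fun n => u (2 * n)%nat) /\ asum (fun n => u (2 * n + 1)%nat) /\
  CSeries u = CSeries (fun n => u (2 * n)%nat) + CSeries (fun n => u (2 * n + 1)%nat).
Proof.
intros H.
assert (Es : forall (v : nat -> R) N, sum_n v (2 * N + 1) = sum_n (fun n => (v (2 * n)%nat + v (2 * n + 1)%nat)%R) N).
{ intros v N; induction N as [|N IH].
  - replace (2 * 0 + 1)%nat with 1%nat by lia; rewrite sum_Sn, !sum_O; reflexivity.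
  - replace (2 * S N + 1)%nat with (S (S (2 * N + 1))) by lia; rewrite !sum_Sn, IH.
    replace (S (2 * N + 1)) with (2 * S N)%nat by lia. replace (S (2 * S N)) with (2 * S N + 1)%nat by lia.
    change plus with Rplus; match goal with |- ?a = ?b => change (@eq R a b) end; ring. }
assert (Hev : ex_series (fun n => (Cmod (u (2 * n)%nat) + Cmod (u (2 * n + 1)%nat))%R)).
{ apply ex_series_bounded with (Series (fun n => Cmod (u n))).
  - intros k; pose proof (Cmod_ge_0 (u (2 * k)%nat)); pose proof (Cmod_ge_0 (u (2 * k + 1)%nat)); lra.
  - intros n; rewrite <- (Es (fun n => Cmod (u n))); apply sum_n_le_Series; [intros; apply Cmod_ge_0 | exact H]. }
assert (A1 : asum (fun n => u (2 * n)%nat)).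
{ apply asum_le with (2 := Hev); intros n; pose proof (Cmod_ge_0 (u (2 * n + 1)%nat)); lra. }
assert (A2 : asum (fun n => u (2 * n + 1)%nat)).
{ apply asum_le with (2 := Hev); intros n; pose proof (Cmod_ge_0 (u (2 * n)%nat)); lra. }
split; [exact A1|]; split; [exact A2|].
apply Cseq_unique with (fun N => sum_n u (2 * N + 1)).
- intros eps He; destruct (proj1 (is_Cseries_lim _ _) (asum_is u H) eps He) as [N HN].
  exists N; intros n Hn; apply HN; lia.
- intros eps He; destruct (proj1 (is_Cseries_lim _ _) (is_Cseries_plus _ _ _ _ (asum_is _ A1) (asum_is _ A2)) eps He) as [N HN].
  exists N; intros n Hn.
  replace (sum_n u (2 * n + 1)) with (sum_n (fun n => u (2 * n)%nat + u (2 * n + 1)%nat) n); [now apply HN|].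
  apply C_ext; rewrite ?re_sum_n, ?im_sum_n, Es; reflexivity.
Qed.

(** The parity of the index is reversed on the negative side, since [zneg n] is [- (n + 1)]. *)
Lemma Zsum_even_odd u : Zsummable u -> Zsum u = Zsum (fun k => u (2 * k)%Z) + Zsum (fun k => u (2 * k + 1)%Z).
Proof.
intros [H1 H2]; unfold Zsum.
destruct (CSeries_even_odd _ H1) as [_ [_ ->]], (CSeries_even_odd _ H2) as [_ [_ ->]].
rewrite (CSeries_ext (fun n => u (zpos (2 * n))) (fun n => u (2 * zpos n)%Z)) by (intros; f_equal; unfold zpos; lia).
rewrite (CSeries_ext (fun n => u (zpos (2 * n + 1))) (fun n => u (2 * zpos n + 1)%Z)) by (intros; f_equal; unfold zpos; lia).
rewrite (CSeries_ext (fun n => u (zneg (2 * n))) (fun n => u (2 * zneg n + 1)%Z)) by (intros; f_equal; unfold zneg; lia).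
rewrite (CSeries_ext (fun n => u (zneg (2 * n + 1))) (fun n => u (2 * zneg n)%Z)) by (intros; f_equal; unfold zneg; lia).
ring.
Qed.

Lemma ZFubini (u : Z -> Z -> C) (a b : nat -> R) : ex_series a -> ex_series b ->
  (forall n m, (Cmod (u n m) <= a (Z.abs_nat n) * b (Z.abs_nat m))%R) ->
  Zsum (fun n => Zsum (fun m => u n m)) = Zsum (fun m => Zsum (fun n => u n m)).
Proof.
intros Ha Hb H.
assert (Ha' := proj1 (ex_series_incr_1 a) Ha); assert (Hb' := proj1 (ex_series_incr_1 b) Hb).
assert (E1 : forall n, Z.abs_nat (zpos n) = n) by (intros; unfold zpos; lia).
assert (E2 : forall n, Z.abs_nat (zneg n) = S n) by (intros; unfold zneg; lia).
assert (Dpp : dsum (fun n m => u (zpos n) (zpos m))).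
{ apply (dsum_prod _ a b); auto; intros n m; specialize (H (zpos n) (zpos m)); now rewrite !E1 in H. }
assert (Dpn : dsum (fun n m => u (zpos n) (zneg m))).
{ apply (dsum_prod _ a (fun m => b (S m))); auto; intros n m; specialize (H (zpos n) (zneg m)); now rewrite E1, E2 in H. }
assert (Dnp : dsum (fun n m => u (zneg n) (zpos m))).
{ apply (dsum_prod _ (fun n => a (S n)) b); auto; intros n m; specialize (H (zneg n) (zpos m)); now rewrite E1, E2 in H. }
assert (Dnn : dsum (fun n m => u (zneg n) (zneg m))).
{ apply (dsum_prod _ (fun n => a (S n)) (fun m => b (S m))); auto; intros n m; specialize (H (zneg n) (zneg m)); now rewrite !E2 in H. }
unfold Zsum.
rewrite !CSeries_plus by first [apply (dsum_rows _ Dpp) | apply (dsum_rows _ Dpn) | apply (dsum_rows _ Dnp) | apply (dsum_rows _ Dnn)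
  | apply (dsum_rows _ (dsum_swap _ Dpp)) | apply (dsum_rows _ (dsum_swap _ Dpn)) | apply (dsum_rows _ (dsum_swap _ Dnp)) | apply (dsum_rows _ (dsum_swap _ Dnn))].
rewrite (Fubini _ Dpp), (Fubini _ Dpn), (Fubini _ Dnp), (Fubini _ Dnn); ring.
Qed.

(** Cubic decay over a lattice will be bounded by a product of two powers with exponent [- 3/2];
    this sums one factor, by comparison with the telescoping [5 - 4 / sqrt n]. *)
Lemma inv_three_halves_summable : ex_series (fun n => / (INR (S n) * sqrt (INR (S n))))%R.
Proof.
apply ex_series_bounded with 5%R.
- intros k; pose proof (INR_S_ge_1 k); left; apply Rinv_0_lt_compat, Rmult_lt_0_compat; [lra | apply sqrt_lt_R0; lra].
- intros n; apply Rle_trans with (5 - 4 / sqrt (INR (S n)))%R.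
  + induction n as [|n IH]; [rewrite sum_O; simpl INR; rewrite sqrt_1; lra|].
    rewrite sum_Sn; change (sum_n (fun n => / (INR (S n) * sqrt (INR (S n)))) n + / (INR (S (S n)) * sqrt (INR (S (S n)))) <= 5 - 4 / sqrt (INR (S (S n))))%R.
    pose proof (INR_S_ge_1 n) as Hn; rewrite (S_INR (S n)); set (x := INR (S n)) in *.
    set (s := sqrt x) in *; set (t := sqrt (x + 1)).
    assert (Hs : (1 <= s)%R) by (unfold s; rewrite <- sqrt_1; apply sqrt_le_1_alt; exact Hn).
    assert (Hst : (s <= t)%R) by (apply sqrt_le_1_alt; lra).
    assert (Es : (s * s = x)%R) by (apply sqrt_sqrt; lra).
    assert (Et : (t * t = x + 1)%R) by (apply sqrt_sqrt; lra).
    assert (Hts : (t - s = / (t + s))%R) by (field_simplify_eq; [nra | lra]).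
    assert (K : (/ ((x + 1) * t) <= 4 / s - 4 / t)%R).
    { replace (4 / s - 4 / t)%R with (4 * (t - s) / (s * t))%R by (field; lra).
      rewrite Hts, <- Et. unfold Rdiv.
      replace (4 * / (t + s) * / (s * t))%R with (/ ((t + s) * (s * t) / 4))%R by (field; lra).
      apply Rinv_le_contravar; [apply Rmult_lt_0_compat; [repeat apply Rmult_lt_0_compat|]; lra|].
      assert (s * t <= t * t)%R by (apply Rmult_le_compat_r; lra).
      assert (0 < t * t)%R by nra. nra. }
    lra.
  + assert (0 < sqrt (INR (S n)))%R by (apply sqrt_lt_R0; pose proof (INR_S_ge_1 n); lra).
    assert (0 < 4 / sqrt (INR (S n)))%R by (apply Rdiv_lt_0_compat; lra). lra.
Qed.

(** * Distances from integers and lattice points *)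

Definition in_lattice (t z : C) : Prop := exists m n : Z, z = ZC m + ZC n * t.

Lemma Z_dist (x : R) : (forall k : Z, x <> IZR k) -> exists d, (0 < d)%R /\ forall k : Z, (d <= Rabs (x + IZR k))%R.
Proof.
intros H.
set (k0 := up x). destruct (archimed x) as [A1 A2]; fold k0 in A1, A2.
assert (A3 : (IZR k0 - 1 < x)%R).
{ destruct (Rle_lt_or_eq_dec (IZR k0 - 1) x) as [|E]; [lra | assumption|].
  exfalso; apply (H (k0 - 1)%Z); rewrite minus_IZR; lra. }
exists (Rmin (IZR k0 - x) (x - (IZR k0 - 1))); split; [apply Rmin_pos; lra|]; intros k.
destruct (Z_le_dec k0 (- k)) as [Hk|Hk].
- apply IZR_le in Hk; rewrite opp_IZR in Hk. eapply Rle_trans; [apply Rmin_l|].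
  rewrite Rabs_left1; lra.
- assert (Hk' : (- k <= k0 - 1)%Z) by lia. apply IZR_le in Hk'; rewrite minus_IZR, opp_IZR in Hk'.
  eapply Rle_trans; [apply Rmin_r|]. rewrite Rabs_pos_eq; lra.
Qed.

Lemma lattice_coord_bound (t : C) : (0 < Im t)%R -> exists c, (0 < c)%R /\
  forall x y : R, (c * (Rabs x + Rabs y) <= Cmod (RtoC x * t + RtoC y))%R.
Proof.
intros Ht.
set (A := (1 + (1 + Rabs (Re t)) / Im t)%R).
assert (HA : (1 <= A)%R).
{ unfold A; assert (0 <= (1 + Rabs (Re t)) / Im t)%R; [|lra].
  apply Rmult_le_pos; [pose proof (Rabs_pos (Re t)); lra | left; now apply Rinv_0_lt_compat]. }
exists (/ A)%R; split; [apply Rinv_0_lt_compat; lra|]; intros x y.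
set (w := RtoC x * t + RtoC y).
assert (Ei : Im w = (x * Im t)%R) by (unfold w; destruct t; simpl; ring).
assert (Er : Re w = (x * Re t + y)%R) by (unfold w; destruct t; simpl; ring).
pose proof (im_le_Cmod w) as Hi; pose proof (re_le_Cmod w) as Hr; rewrite Ei in Hi; rewrite Er in Hr.
rewrite Rabs_mult, (Rabs_pos_eq (Im t)) in Hi by lra.
assert (Hx : (Rabs x <= Cmod w / Im t)%R).
{ apply (Rmult_le_reg_r (Im t)); [exact Ht|]. unfold Rdiv; rewrite Rmult_assoc, Rinv_l; lra. }
assert (Hy : (Rabs y <= Cmod w + Rabs x * Rabs (Re t))%R).
{ replace y with ((x * Re t + y) - x * Re t)%R by ring.
  eapply Rle_trans; [apply Rabs_triang|]; rewrite Rabs_Ropp, Rabs_mult; lra. }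
apply (Rmult_le_reg_l A); [lra|]. rewrite <- Rmult_assoc, Rinv_r, Rmult_1_l by lra.
replace (A * Cmod w)%R with (Cmod w + Cmod w / Im t + (Cmod w / Im t) * Rabs (Re t))%R by (unfold A; field; lra).
pose proof (Rabs_pos (Re t)). nra.
Qed.

Lemma lattice_coords (t z : C) : (0 < Im t)%R -> exists a b : R, z = RtoC a * t + RtoC b.
Proof.
intros Ht; exists (Im z / Im t)%R, (Re z - Im z / Im t * Re t)%R.
apply C_ext; destruct t, z; simpl in *; field; lra.
Qed.

(** One of the two real coordinates of [z] is not an integer, which bounds the distance from below;
    far out, linear growth takes over. *)
Lemma lattice_lower_bound (t z : C) : (0 < Im t)%R -> ~ in_lattice t z -> exists c, (0 < c)%R /\
  forall n m : Z, (c * (1 + Rabs (IZR n) + Rabs (IZR m)) <= Cmod (z + ZC n * t + ZC m))%R.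
Proof.
intros Ht Hz; destruct (lattice_coord_bound t Ht) as [c0 [Hc0 K]], (lattice_coords t z Ht) as [a [b E]].
assert (E' : forall n m, z + ZC n * t + ZC m = RtoC (a + IZR n) * t + RtoC (b + IZR m)).
{ intros n m; rewrite E; unfold ZC; rewrite !RtoC_plus; ring. }
assert (Hd : exists d, (0 < d)%R /\ forall n m : Z, (d <= Rabs (a + IZR n) + Rabs (b + IZR m))%R).
{ destruct (classic (exists k : Z, a = IZR k)) as [[k Hk]|Hn].
  - destruct (Z_dist b) as [d [Hd Kd]].
    + intros j Hj; apply Hz; exists j, k; rewrite E, Hk, Hj; unfold ZC; ring.
    + exists d; split; [exact Hd|]; intros n m; specialize (Kd m); pose proof (Rabs_pos (a + IZR n)); lra.
  - destruct (Z_dist a) as [d [Hd Kd]].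
    + intros j Hj; apply Hn; now exists j.
    + exists d; split; [exact Hd|]; intros n m; specialize (Kd n); pose proof (Rabs_pos (b + IZR m)); lra. }
destruct Hd as [d [Hd Kd]].
set (A := (Rabs a + Rabs b)%R). assert (HA : (0 <= A)%R) by (pose proof (Rabs_pos a); pose proof (Rabs_pos b); unfold A; lra).
(* For [s >= 2 + 2 A] the linear growth gives at least [(1 + s) / 4]; otherwise [1 + s] is less than
   [3 + 2 A] and the distance [d] suffices. *)
exists (c0 * Rmin (/ 4) (d / (3 + 2 * A)))%R.
assert (Hm : (0 < Rmin (/ 4) (d / (3 + 2 * A)))%R) by (apply Rmin_pos; [lra | apply Rdiv_lt_0_compat; lra]).
split; [now apply Rmult_lt_0_compat|]; intros n m; rewrite E'.
eapply Rle_trans; [|apply K]; rewrite Rmult_assoc; apply Rmult_le_compat_l; [lra|].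
set (s := (Rabs (IZR n) + Rabs (IZR m))%R).
assert (Hs : (0 <= s)%R) by (unfold s; pose proof (Rabs_pos (IZR n)); pose proof (Rabs_pos (IZR m)); lra).
assert (Hl : (s - A <= Rabs (a + IZR n) + Rabs (b + IZR m))%R).
{ pose proof (Rabs_triang (a + IZR n) (- a)) as T1; pose proof (Rabs_triang (b + IZR m) (- b)) as T2.
  replace (a + IZR n + - a)%R with (IZR n) in T1 by ring; replace (b + IZR m + - b)%R with (IZR m) in T2 by ring.
  rewrite Rabs_Ropp in T1, T2; unfold s, A; lra. }
specialize (Kd n m). replace (1 + Rabs (IZR n) + Rabs (IZR m))%R with (1 + s)%R by (unfold s; ring).
destruct (Rle_lt_dec (2 + 2 * A) s) as [Hb|Hb].
- apply Rle_trans with (/ 4 * (1 + s))%R; [apply Rmult_le_compat_r; [lra | apply Rmin_l] | lra].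
- apply Rle_trans with (d / (3 + 2 * A) * (1 + s))%R; [apply Rmult_le_compat_r; [lra | apply Rmin_r]|].
  apply Rle_trans with (d / (3 + 2 * A) * (3 + 2 * A))%R.
  + apply Rmult_le_compat_l; [left; apply Rdiv_lt_0_compat|]; lra.
  + unfold Rdiv; rewrite Rmult_assoc, Rinv_l by lra; lra.
Qed.

(** The integers are embedded in a lattice with the imaginary period [T Ci], where [T] exceeds
    [2 |Im w|] so that [w] stays off it. *)
Lemma Z_lower_bound (w : C) : (forall k : Z, w <> RtoC (IZR k)) -> exists c, (0 < c)%R /\
  forall m : Z, (c * (1 + Rabs (IZR m)) <= Cmod (w + ZC m))%R.
Proof.
intros H.
set (T := (2 * Rabs (Im w) + 1)%R). assert (HT : (0 < T)%R) by (pose proof (Rabs_pos (Im w)); unfold T; lra).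
set (t := RtoC T * Ci).
assert (Et : Im t = T) by (unfold t; simpl; ring).
destruct (lattice_lower_bound t w) as [c [Hc K]].
- rewrite Et; exact HT.
- intros [m [n E]].
  assert (Ei : Im w = (IZR n * T)%R) by (rewrite E; unfold ZC, t; simpl; ring).
  destruct (Z.eq_dec n 0) as [->|Hn].
  + apply (H m); rewrite E; unfold ZC; ring.
  + assert (Hn1 : (1 <= Rabs (IZR n))%R) by (rewrite <- abs_IZR; apply IZR_le; lia).
    pose proof (f_equal Rabs Ei) as Ea; rewrite Rabs_mult, (Rabs_pos_eq T) in Ea by lra.
    pose proof (Rabs_pos (Im w)); unfold T in *; nra.
- exists c; split; [exact Hc|]; intros m; specialize (K 0%Z m).
  replace (w + ZC 0 * t + ZC m) with (w + ZC m) in K by (unfold ZC; ring).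
  rewrite Rabs_R0, Rplus_0_r in K; exact K.
Qed.

(** * Partial fractions *)

Definition notZ (w : C) : Prop := forall k : Z, w <> RtoC (IZR k).

(** This is [- 1 / (4 sin^2 (pi w))]; [S2] is its partial fraction series up to the factor
    [twopi_i ^ 2]. *)
Definition li3_D4 (w : C) : C := e2pi w / (1 - e2pi w) ^ 2.

Definition S2 (w : C) : C := Zsum (fun m => / (w + ZC m) ^ 2).

Lemma ZC_bound_pos n : (1 + Rabs (IZR (zpos n)))%R = INR (S n).
Proof. unfold zpos; rewrite <- INR_IZR_INZ, Rabs_pos_eq, S_INR by apply pos_INR; ring. Qed.

Lemma ZC_bound_neg n : (1 + Rabs (IZR (zneg n)))%R = (INR (S n) + 1)%R.
Proof. unfold zneg; rewrite opp_IZR, Rabs_Ropp, <- INR_IZR_INZ, Rabs_pos_eq by apply pos_INR; ring. Qed.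

Lemma Zsummable_inv_sq (u : Z -> C) (c M : R) : (0 < c)%R ->
  (forall m, (Cmod (u m) <= M * / (c * (1 + Rabs (IZR m))) ^ 2)%R) -> Zsummable u.
Proof.
intros Hc H.
assert (HM : (0 <= M)%R).
{ specialize (H 0%Z); rewrite Rabs_R0, Rplus_0_r, Rmult_1_r in H. pose proof (Cmod_ge_0 (u 0%Z)).
  assert (0 < / c ^ 2)%R by (apply Rinv_0_lt_compat, pow_lt; lra).
  apply (Rmult_le_reg_r (/ c ^ 2)); lra. }
assert (K : forall n (x : R), (INR (S n) <= x)%R -> (M * / (c * x) ^ 2 <= M / c ^ 2 * / INR (S n) ^ 2)%R).
{ intros n x Hx; pose proof (INR_S_ge_1 n).
  replace (M / c ^ 2 * / INR (S n) ^ 2)%R with (M * / (c * INR (S n)) ^ 2)%R by (field; lra).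
  apply Rmult_le_compat_l; [exact HM|]. apply Rinv_le_contravar; [apply pow_lt, Rmult_lt_0_compat; lra|].
  apply pow_incr; split; [apply Rmult_le_pos; lra | apply Rmult_le_compat_l; lra]. }
split; apply asum_le with (fun n => (M / c ^ 2 * / INR (S n) ^ 2)%R).
- intros n; eapply Rle_trans; [apply H|]; apply K; rewrite ZC_bound_pos; lra.
- apply exR_scal, inv_sq_summable.
- intros n; eapply Rle_trans; [apply H|]; apply K; rewrite ZC_bound_neg; lra.
- apply exR_scal, inv_sq_summable.
Qed.

Lemma Cmod_inv_sq_le (x : C) (r : R) : (0 < r <= Cmod x)%R -> (Cmod (/ x ^ 2) <= / r ^ 2)%R.
Proof.
intros H; assert (Hx : x <> 0) by (apply (proj2 (Cmod_gt_0 x)); lra).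
rewrite Cmod_inv, Cmod_pow by now apply Cpow_nz.
apply Rinv_le_contravar; [apply pow_lt; lra | apply pow_incr; lra].
Qed.

Lemma S2_Zsummable w : notZ w -> Zsummable (fun m => / (w + ZC m) ^ 2).
Proof.
intros H; destruct (Z_lower_bound w H) as [c [Hc K]].
apply Zsummable_inv_sq with c 1%R; [exact Hc|]; intros m; rewrite Rmult_1_l.
apply Cmod_inv_sq_le; split; [|apply K]. pose proof (Rabs_pos (IZR m)); apply Rmult_lt_0_compat; lra.
Qed.

Lemma notZ_add w (k : Z) : notZ w -> notZ (w + ZC k).
Proof.
intros H j E; apply (H (j - k)%Z). rewrite minus_IZR, RtoC_minus; change (RtoC (IZR k)) with (ZC k); rewrite <- E; ring.
Qed.

Lemma notZ_half w : notZ w -> notZ (w / 2) /\ notZ ((w + 1) / 2).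
Proof.
intros H; split; intros k E.
- apply (H (2 * k)%Z); rewrite mult_IZR, RtoC_mult, <- E; field.
- apply (H (2 * k - 1)%Z); rewrite minus_IZR, mult_IZR, RtoC_minus, RtoC_mult, <- E; field.
Qed.

Lemma notZ_neq w m : notZ w -> w + ZC m <> 0.
Proof. intros H; apply (notZ_add w m) in H; apply (H 0%Z). Qed.

Lemma S2_shift w : notZ w -> S2 (w + 1) = S2 w.
Proof.
intros H; unfold S2; rewrite <- (proj2 (Zsum_shift _ (S2_Zsummable w H))).
apply Zsum_ext; intros k; do 2 f_equal; unfold ZC; rewrite plus_IZR, RtoC_plus; ring.
Qed.

(** The two terms collect the even and the odd integers. With [li3_D4_dup], both sides of the
    partial fraction identity satisfy one duplication formula. *)
Lemma S2_dup w : notZ w -> S2 (w / 2) + S2 ((w + 1) / 2) = 4 * S2 w.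
Proof.
intros H; destruct (notZ_half w H) as [H1 H2]; unfold S2.
rewrite <- (Zsum_scal 4 _ (S2_Zsummable w H)), (Zsum_even_odd _ (Zsummable_scal 4 _ (S2_Zsummable w H))).
assert (K : forall y : C, y <> 0 -> / (y / 2) ^ 2 = 4 * / y ^ 2) by (intros y Hy; field; exact Hy).
f_equal; apply Zsum_ext; intros k; rewrite <- K by (now apply notZ_neq); do 2 f_equal;
  unfold ZC; rewrite ?plus_IZR, mult_IZR, ?RtoC_plus, RtoC_mult; field.
Qed.

Lemma li3_D4_dup w : notZ w -> li3_D4 (w / 2) + li3_D4 ((w + 1) / 2) = 4 * li3_D4 w.
Proof.
intros H; destruct (notZ_half w H) as [H1 H2].
assert (E2 : e2pi ((w + 1) / 2) = - e2pi (w / 2)).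
{ replace ((w + 1) / 2) with (w / 2 + / 2) by field. rewrite e2pi_add.
  replace (e2pi (/ 2)) with (- (1)); [ring|].
  unfold e2pi, Cexp, twopi_i, Ci; apply C_ext; simpl.
  - replace ((2 * PI - 0 * 0) * 0 - (2 * 0 + 0 * PI) * 1)%R with 0%R by ring.
    replace ((2 * PI - 0 * 0) * 1 + (2 * 0 + 0 * PI) * 0)%R with (2 * PI)%R by ring.
    replace (0 * (2 / (2 * (2 * 1) + 0 * (0 * 1))) - 2 * PI * (- 0 / (2 * (2 * 1) + 0 * (0 * 1))))%R with 0%R by field.
    replace (0 * (- 0 / (2 * (2 * 1) + 0 * (0 * 1))) + 2 * PI * (2 / (2 * (2 * 1) + 0 * (0 * 1))))%R with PI by field.
    rewrite exp_0, cos_PI; ring.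
  - replace ((2 * PI - 0 * 0) * 0 - (2 * 0 + 0 * PI) * 1)%R with 0%R by ring.
    replace ((2 * PI - 0 * 0) * 1 + (2 * 0 + 0 * PI) * 0)%R with (2 * PI)%R by ring.
    replace (0 * (2 / (2 * (2 * 1) + 0 * (0 * 1))) - 2 * PI * (- 0 / (2 * (2 * 1) + 0 * (0 * 1))))%R with 0%R by field.
    replace (0 * (- 0 / (2 * (2 * 1) + 0 * (0 * 1))) + 2 * PI * (2 / (2 * (2 * 1) + 0 * (0 * 1))))%R with PI by field.
    rewrite exp_0, sin_PI; ring. }
assert (E1 : e2pi w = e2pi (w / 2) ^ 2) by (simpl; rewrite Cmult_1_r, <- e2pi_add; f_equal; field).
pose proof (one_sub_e2pi_neq_0 _ H1) as N1; pose proof (one_sub_e2pi_neq_0 _ H2) as N2; pose proof (one_sub_e2pi_neq_0 _ H) as N3.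
unfold li3_D4; rewrite E1, E2 in *; set (x := e2pi (w / 2)) in *.
field; repeat split; assumption.
Qed.

Lemma exp_sub_exp_opp (t : R) : (Rabs (exp t - exp (- t)) >= 2 * Rabs t)%R.
Proof.
assert (K : forall t, (0 <= t)%R -> (exp t - exp (- t) >= 2 * t)%R).
{ intros s Hs.
  destruct (MVT_gen (fun t => exp t - exp (- t))%R 0 s (fun t => exp t + exp (- t))%R) as [c [_ E]].
  - intros x _; auto_derive; [exact I | ring].
  - intros x _; apply continuity_pt_filterlim, (ex_derive_continuous (K := R_AbsRing) (V := R_NormedModule) (fun t => exp t - exp (- t))%R).
    auto_derive; exact I.
  - rewrite Ropp_0, Rminus_diag in E; rewrite !Rminus_0_r in E; rewrite E.
    assert (2 <= exp c + exp (- c))%R; [|nra].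
    pose proof (exp_ineq1_le c); pose proof (exp_ineq1_le (- c)); lra. }
destruct (Rle_lt_dec 0 t) as [H|H].
- specialize (K t H); rewrite !Rabs_pos_eq; lra.
- specialize (K (- t)%R ltac:(lra)); rewrite Ropp_involutive in K; rewrite !Rabs_left; lra.
Qed.

(** [2 sinh (u / 2)], the symmetric form of [e^u - 1]; [li3_D4] is an inverse square of it. *)
Definition sh (u : C) : C := Cexp (u / 2) - Cexp (- (u / 2)).

(** Oddness removes the quadratic term. A quadratic error would leave a simple pole in the
    difference of the inverse squares. *)
Lemma sh_near_0 : exists c, (0 < c)%R /\ forall u, (Cmod u <= 1)%R -> (Cmod (sh u - u) <= c * Cmod u ^ 3)%R.
Proof.
set (b := fun n => expc (S (S (S n)))).
assert (Hb : cvr b 2) by (unfold b; do 3 apply (cvr_unshift (fun n => _)); apply expc_cvr).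
set (M := Series (fun n => (Cmod (b n) * 1 ^ n)%R)).
assert (Hx : ex_series (fun n => (Cmod (b n) * 1 ^ n)%R)) by (apply Hb; lra).
assert (HM : (0 <= M)%R).
{ apply Series_nonneg; [intros n; rewrite pow1, Rmult_1_r; apply Cmod_ge_0 | exact Hx]. }
assert (K : forall v, (Cmod v <= 1)%R -> (Cmod (Cexp v - (1 + v + v ^ 2 / 2)) <= M * Cmod v ^ 3)%R).
{ intros v Hv.
  replace (Cexp v - (1 + v + v ^ 2 / 2)) with (v ^ 3 * Pser b v).
  - rewrite Cmod_mult, Cmod_pow, Rmult_comm; apply Rmult_le_compat_r; [apply pow_le, Cmod_ge_0|].
    apply CSeries_le; [|exact Hx]. intros n; rewrite Cmod_mult, Cmod_pow; apply Rmult_le_compat_l; [apply Cmod_ge_0|].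
    apply pow_incr; split; [apply Cmod_ge_0 | exact Hv].
  - rewrite Cexp_Pser.
    rewrite (Pser_incr expc 2) by (apply expc_cvr || lra).
    rewrite (Pser_incr (fun n => expc (S n)) 2) by ((do 1 apply (cvr_unshift (fun n => _)); apply expc_cvr) || lra).
    rewrite (Pser_incr (fun n => expc (S (S n))) 2) by ((do 2 apply (cvr_unshift (fun n => _)); apply expc_cvr) || lra).
    fold b. unfold expc, factC, natC; simpl fact; rewrite !INR_IZR_INZ; simpl Z.of_nat. field. }
exists (M + 1)%R; split; [lra|]; intros u Hu.
assert (Hh : Cmod (u / 2) = (Cmod u / 2)%R).
{ rewrite Cmod_div by (intros E; apply RtoC_inj in E; lra). rewrite Cmod_R, Rabs_pos_eq; lra. }
pose proof (Cmod_ge_0 u) as H0.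
pose proof (K (u / 2) ltac:(lra)) as K1. pose proof (K (- (u / 2)) ltac:(rewrite Cmod_opp; lra)) as K2.
rewrite Cmod_opp in K2. rewrite Hh in K1, K2.
replace (sh u - u) with ((Cexp (u / 2) - (1 + u / 2 + (u / 2) ^ 2 / 2)) - (Cexp (- (u / 2)) - (1 + - (u / 2) + (- (u / 2)) ^ 2 / 2)))
  by (unfold sh; field).
eapply Rle_trans; [apply Cmod_triangle|]; rewrite Cmod_opp.
assert (0 <= Cmod u ^ 3)%R by (apply pow_le; lra).
replace ((Cmod u / 2) ^ 3)%R with (Cmod u ^ 3 / 8)%R in * by field. nra.
Qed.

(** A large real part makes the two exponentials differ in modulus. Otherwise the imaginary part is
    away from [0] and at most [PI], and the imaginary part of [sh u] contains the sine of its
    half. *)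
Lemma sh_lower (u : C) (r : R) : (0 < r <= PI)%R -> (Rabs (Im u) <= PI)%R -> (r <= Rabs (Re u) + Rabs (Im u))%R ->
  (Rmin (r / 2) (2 * sin (r / 4)) <= Cmod (sh u))%R.
Proof.
intros Hr Hi Hs.
assert (ER : Re (u / 2) = (Re u / 2)%R) by (destruct u; simpl; field).
assert (EI : Im (u / 2) = (Im u / 2)%R) by (destruct u; simpl; field).
destruct (Rle_lt_dec (r / 2) (Rabs (Re u))) as [Ha|Ha].
- eapply Rle_trans; [apply Rmin_l|].
  assert (K : (Rabs (exp (Re u / 2) - exp (- (Re u / 2))) <= Cmod (sh u))%R).
  { unfold sh.
    pose proof (Cmod_triangle_rev (Cexp (u / 2)) (Cexp (- (u / 2)))) as T1.
    pose proof (Cmod_triangle_rev (Cexp (- (u / 2))) (Cexp (u / 2))) as T2. rewrite (Cmod_sub_sym (Cexp (- (u / 2)))) in T2.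
    rewrite !Cmod_Cexp in T1, T2. change (Re (- (u / 2))) with (- Re (u / 2))%R in T1, T2. rewrite ER in T1, T2.
    apply Rabs_le; lra. }
  pose proof (exp_sub_exp_opp (Re u / 2)) as K2.
  unfold Rdiv in K2 at 3; rewrite Rabs_mult, (Rabs_pos_eq (/ 2)) in K2 by lra. lra.
- eapply Rle_trans; [apply Rmin_r|].
  eapply Rle_trans; [|apply im_le_Cmod].
  assert (E : Im (sh u) = ((exp (Re u / 2) + exp (- (Re u / 2))) * sin (Im u / 2))%R).
  { unfold sh. change (Im (Cexp (u / 2) - Cexp (- (u / 2)))) with (Im (Cexp (u / 2)) - Im (Cexp (- (u / 2))))%R.
    unfold Cexp; cbn [Im snd]. change (Im (- (u / 2))) with (- Im (u / 2))%R. change (Re (- (u / 2))) with (- Re (u / 2))%R.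
    rewrite sin_neg, ER, EI; ring. }
  rewrite E, Rabs_mult.
  assert (K1 : (2 <= exp (Re u / 2) + exp (- (Re u / 2)))%R).
  { pose proof (exp_ineq1_le (Re u / 2)); pose proof (exp_ineq1_le (- (Re u / 2))); lra. }
  rewrite (Rabs_pos_eq (exp _ + _)) by lra.
  assert (K2 : (sin (r / 4) <= Rabs (sin (Im u / 2)))%R).
  { assert (Hb : (r / 4 <= Rabs (Im u / 2))%R) by (unfold Rdiv at 2; rewrite Rabs_mult, (Rabs_pos_eq (/ 2)) by lra; lra).
    assert (Hb2 : (Rabs (Im u / 2) <= PI / 2)%R) by (unfold Rdiv at 1; rewrite Rabs_mult, (Rabs_pos_eq (/ 2)) by lra; lra).
    assert (K3 : (sin (r / 4) <= sin (Rabs (Im u / 2)))%R) by (apply sin_incr_1; lra).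
    eapply Rle_trans; [exact K3|].
    unfold Rabs at 1; destruct (Rcase_abs (Im u / 2)); [rewrite sin_neg, <- Rabs_Ropp|]; apply Rle_abs. }
  assert (K4 : (0 <= sin (r / 4))%R) by (apply sin_ge_0; lra).
  apply Rmult_le_compat; lra.
Qed.

Lemma li3_D4_sh w : notZ w -> li3_D4 w = / sh (twopi_i * w) ^ 2 /\ sh (twopi_i * w) <> 0.
Proof.
intros H; pose proof (one_sub_e2pi_neq_0 w H) as N.
set (y := Cexp (twopi_i * w / 2)).
assert (Ey : e2pi w = y ^ 2) by (unfold y, e2pi; simpl; rewrite Cmult_1_r, <- Cexp_add; f_equal; field).
pose proof (Cexp_neq_0 (twopi_i * w / 2)) as Hy; fold y in Hy.
assert (Es : sh (twopi_i * w) = - (1 - e2pi w) / y).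
{ unfold sh; rewrite Cexp_opp; fold y; rewrite Ey; field; exact Hy. }
assert (Hs : sh (twopi_i * w) <> 0).
{ rewrite Es; intros E; apply N.
  transitivity (- (- (1 - e2pi w) / y) * y); [field; exact Hy | rewrite E; ring]. }
split; [|exact Hs].
rewrite Es; unfold li3_D4; rewrite Ey in *. field; repeat split; try assumption.
Qed.

Lemma li3_D4_bounded : exists M, forall w, notZ w -> (Rabs (Re w) <= / 2)%R ->
  (Cmod (twopi_i ^ 2 * li3_D4 w - / w ^ 2) <= M)%R.
Proof.
destruct sh_near_0 as [c [Hc Hsh]].
pose proof PI_RGT_0 as HPI; pose proof PI2_1 as HP2; unfold PI2 in HP2.
(* Within radius [r] the error [c |u|^3] is at most [|u| / 2], so [sh u] is comparable to [u];
   outside, [s0] bounds [sh u] from below. *)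
set (r := Rmin (/ 2) (/ (2 * (c + 1)))).
assert (Hr0 : (0 < r)%R) by (apply Rmin_pos; [lra | apply Rinv_0_lt_compat; lra]).
assert (Hr1 : (r <= / 2)%R) by apply Rmin_l.
assert (Hr2 : (c * r <= / 2)%R).
{ apply Rle_trans with (c * / (2 * (c + 1)))%R; [apply Rmult_le_compat_l; [lra | apply Rmin_r]|].
  apply (Rmult_le_reg_r (2 * (c + 1))); [lra|]. rewrite Rmult_assoc, Rinv_l by lra. lra. }
set (s0 := Rmin (r / 2) (2 * sin (r / 4))).
assert (Hs0 : (0 < s0)%R).
{ apply Rmin_pos; [lra|]. assert (0 < sin (r / 4))%R by (apply sin_gt_0; lra). lra. }
set (p2 := (Cmod twopi_i ^ 2)%R).
exists (p2 * (12 * c + / s0 ^ 2 + / r ^ 2))%R.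
intros w Hw Hre; destruct (li3_D4_sh w Hw) as [Eg Hs]; set (u := twopi_i * w) in *.
pose proof twopi_i_neq_0 as Hp.
assert (Hw0 : w <> 0) by (apply (Hw 0%Z)).
assert (Hu0 : u <> 0) by (now apply Cmult_neq_0).
assert (HIu : (Rabs (Im u) <= PI)%R).
{ assert (E : Im u = (2 * PI * Re w)%R) by (unfold u, twopi_i, Ci; destruct w; simpl; ring).
  rewrite E, !Rabs_mult, (Rabs_pos_eq 2), (Rabs_pos_eq PI) by lra. nra. }
replace (twopi_i ^ 2 * li3_D4 w - / w ^ 2) with (twopi_i ^ 2 * (/ sh u ^ 2 - / u ^ 2)).
2: { rewrite Eg; unfold u; field; repeat split; assumption. }
rewrite Cmod_mult, Cmod_pow; fold p2; apply Rmult_le_compat_l; [apply pow2_ge_0|].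
assert (P1 : (0 < / s0 ^ 2)%R) by (apply Rinv_0_lt_compat, pow_lt; lra).
assert (P2 : (0 < / r ^ 2)%R) by (apply Rinv_0_lt_compat, pow_lt; lra).
destruct (Rle_lt_dec (Cmod u) r) as [Hsm|Hbig].
- specialize (Hsh u ltac:(lra)). set (m := Cmod u) in *.
  assert (Hm : (0 < m)%R) by (now apply (proj1 (Cmod_gt_0 u))).
  assert (Hd : (Cmod (sh u - u) <= m / 2)%R).
  { eapply Rle_trans; [exact Hsh|]. replace (c * m ^ 3)%R with ((c * m) * (m * m))%R by ring.
    assert (c * m <= / 2)%R by nra. assert (m * m <= m)%R by nra. assert (0 <= m * m)%R by nra. nra. }
  assert (Hlo : (m / 2 <= Cmod (sh u))%R).
  { pose proof (Cmod_triangle_rev u (u - sh u)) as T. replace (u - (u - sh u)) with (sh u) in T by ring.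
    rewrite (Cmod_sub_sym u) in T. fold m in T; lra. }
  assert (Hhi : (Cmod (u + sh u) <= 3 * m)%R).
  { replace (u + sh u) with (2 * u + (sh u - u)) by ring. eapply Rle_trans; [apply Cmod_triangle|].
    rewrite Cmod_mult, Cmod_R, (Rabs_pos_eq 2) by lra; fold m; lra. }
  replace (/ sh u ^ 2 - / u ^ 2) with ((u + sh u) * (- (sh u - u)) / (sh u ^ 2 * u ^ 2)) by (field; split; assumption).
  rewrite Cmod_div by (apply Cmult_neq_0; now apply Cpow_nz).
  rewrite !Cmod_mult, Cmod_opp, !Cmod_pow; fold m.
  apply Rle_trans with ((3 * m) * (c * m ^ 3) / ((m / 2) ^ 2 * m ^ 2))%R.
  + unfold Rdiv at 1 2. apply Rmult_le_compat; [apply Rmult_le_pos; apply Cmod_ge_0 | | |].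
    * left; apply Rinv_0_lt_compat, Rmult_lt_0_compat; apply pow_lt; lra.
    * apply Rmult_le_compat; try apply Cmod_ge_0; assumption.
    * apply Rinv_le_contravar; [apply Rmult_lt_0_compat; apply pow_lt; lra|].
      apply Rmult_le_compat_r; [apply pow2_ge_0 | apply pow_incr; lra].
  + replace (3 * m * (c * m ^ 3) / ((m / 2) ^ 2 * m ^ 2))%R with (12 * c)%R by (field; lra). lra.
- assert (Hlo : (s0 <= Cmod (sh u))%R).
  { apply sh_lower; [lra | exact HIu|]. pose proof (Cmod_le_add u); lra. }
  eapply Rle_trans; [apply Cmod_triangle|]; rewrite Cmod_opp.
  pose proof (Cmod_inv_sq_le (sh u) s0 ltac:(lra)); pose proof (Cmod_inv_sq_le u r ltac:(lra)).
  assert (0 < 12 * c)%R by lra. lra.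
Qed.

(** For [m <> 0] the real part of [w + m] is at least [|m| / 2] in modulus, so the remaining terms
    are bounded uniformly in the imaginary part of [w]. *)
Lemma S2_bounded : exists M, forall w, notZ w -> (Rabs (Re w) <= / 2)%R -> (Cmod (S2 w - / w ^ 2) <= M)%R.
Proof.
set (b := fun n => (4 * / INR (S n) ^ 2)%R).
assert (Hb : ex_series b) by apply exR_scal, inv_sq_summable.
exists (Series b + Series b)%R; intros w Hw Hre.
destruct (S2_Zsummable w Hw) as [A1 A2]; unfold S2, Zsum.
rewrite (CSeries_incr (fun n => / (w + ZC (zpos n)) ^ 2)) by exact A1.
replace (w + ZC (zpos 0)) with w by (unfold ZC, zpos; simpl; ring).
replace (/ w ^ 2 + CSeries (fun n => / (w + ZC (zpos (S n))) ^ 2) + CSeries (fun n => / (w + ZC (zneg n)) ^ 2) - / w ^ 2)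
  with (CSeries (fun n => / (w + ZC (zpos (S n))) ^ 2) + CSeries (fun n => / (w + ZC (zneg n)) ^ 2)) by ring.
assert (K : forall n m, (Rabs (IZR m) = INR (S n))%R -> (Cmod (/ (w + ZC m) ^ 2) <= b n)%R).
{ intros n m Hm; pose proof (INR_S_ge_1 n) as Hn.
  unfold b; replace (4 * / INR (S n) ^ 2)%R with (/ (INR (S n) / 2) ^ 2)%R by (field; lra).
  apply Cmod_inv_sq_le; split; [lra|].
  eapply Rle_trans; [|apply re_le_Cmod].
  change (Re (w + ZC m)) with (Re w + IZR m)%R.
  pose proof (Rabs_triang (Re w + IZR m) (- Re w)) as T; replace (Re w + IZR m + - Re w)%R with (IZR m) in T by ring.
  rewrite Rabs_Ropp, Hm in T; lra. }
eapply Rle_trans; [apply Cmod_triangle|]; apply Rplus_le_compat; apply CSeries_le; try exact Hb; intros n; apply K.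
- unfold zpos; rewrite <- INR_IZR_INZ; apply Rabs_pos_eq, pos_INR.
- unfold zneg; rewrite opp_IZR, Rabs_Ropp, <- INR_IZR_INZ; apply Rabs_pos_eq, pos_INR.
Qed.

Lemma Re_reduce (w : C) : exists k : Z, (Rabs (Re (w + ZC k)) <= / 2)%R.
Proof.
destruct (archimed (Re w + / 2)) as [A1 A2].
exists (1 - up (Re w + / 2))%Z. change (Re (w + ZC (1 - up (Re w + / 2)))) with (Re w + IZR (1 - up (Re w + / 2)))%R.
rewrite minus_IZR; apply Rabs_le; lra.
Qed.

Lemma periodic_Z (f : C -> C) : (forall w, notZ w -> f (w + 1) = f w) -> forall k w, notZ w -> f (w + ZC k) = f w.
Proof.
intros H.
assert (Hn : forall n w, notZ w -> f (w + natC n) = f w).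
{ induction n as [|n IH]; intros w Hw.
  - f_equal; unfold natC; simpl; ring.
  - rewrite <- (IH w Hw), natC_S, Cplus_assoc; apply H; rewrite natC_IZR; now apply notZ_add. }
intros k w Hw; destruct (Z_le_dec 0 k) as [Hk|Hk].
- rewrite <- (Hn (Z.to_nat k) w Hw), natC_IZR, Z2Nat.id by exact Hk; reflexivity.
- rewrite <- (Hn (Z.to_nat (- k)) (w + ZC k)) by now apply notZ_add.
  f_equal; rewrite natC_IZR, Z2Nat.id by lia; unfold ZC; rewrite opp_IZR, RtoC_opp; ring.
Qed.

(** The difference [d] of the two sides is bounded and satisfies
    [d (w/2) + d ((w+1)/2) = 4 d w], so its bound can be halved indefinitely. *)
Lemma li3_D4_S2 w : notZ w -> twopi_i ^ 2 * li3_D4 w = S2 w.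
Proof.
set (d := fun w => twopi_i ^ 2 * li3_D4 w - S2 w).
assert (Dp : forall w, notZ w -> d (w + 1) = d w).
{ intros v Hv; unfold d; rewrite S2_shift by exact Hv; unfold li3_D4; now rewrite e2pi_add, e2pi_1, Cmult_1_r. }
assert (DB : exists M, forall w, notZ w -> (Cmod (d w) <= M)%R).
{ destruct li3_D4_bounded as [M1 H1], S2_bounded as [M2 H2]; exists (M1 + M2)%R; intros v Hv.
  destruct (Re_reduce v) as [k Hk]; rewrite <- (periodic_Z d Dp k v Hv).
  pose proof (notZ_add v k Hv) as Hv'; set (x := v + ZC k) in *.
  unfold d; replace (twopi_i ^ 2 * li3_D4 x - S2 x) with ((twopi_i ^ 2 * li3_D4 x - / x ^ 2) + - (S2 x - / x ^ 2)) by ring.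
  eapply Rle_trans; [apply Cmod_triangle|]; rewrite Cmod_opp; apply Rplus_le_compat; auto. }
destruct DB as [M HM].
assert (Hhalf : forall n v, notZ v -> (Cmod (d v) <= M * (/ 2) ^ n)%R).
{ induction n as [|n IH]; intros v Hv; [rewrite pow_O, Rmult_1_r; now apply HM|].
  destruct (notZ_half v Hv) as [H1 H2].
  assert (E : 4 * d v = d (v / 2) + d ((v + 1) / 2)).
  { unfold d.
    replace (4 * (twopi_i ^ 2 * li3_D4 v - S2 v)) with (twopi_i ^ 2 * (4 * li3_D4 v) - 4 * S2 v) by ring.
    rewrite <- li3_D4_dup, <- S2_dup by exact Hv; ring. }
  assert (E2 : (4 * Cmod (d v) <= 2 * (M * (/ 2) ^ n))%R).
  { apply (f_equal Cmod) in E; rewrite Cmod_mult, Cmod_R, Rabs_pos_eq in E by lra; rewrite E.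
    eapply Rle_trans; [apply Cmod_triangle|]. pose proof (IH _ H1); pose proof (IH _ H2); lra. }
  simpl; lra. }
intros Hw.
assert (E : d w = 0).
{ apply Cmod_eq_0, Rle_antisym; [|apply Cmod_ge_0].
  apply le_epsilon; intros eps He; rewrite Rplus_0_l.
  destruct (pow_lt_1_zero (/ 2) ltac:(rewrite Rabs_pos_eq; lra) (eps / (Rabs M + 1))) as [N HN].
  { apply Rdiv_lt_0_compat; [exact He | pose proof (Rabs_pos M); lra]. }
  specialize (HN N (le_n N)); rewrite Rabs_pos_eq in HN by (apply pow_le; lra).
  eapply Rle_trans; [apply (Hhalf N w Hw)|].
  pose proof (Rabs_pos M); pose proof (Rle_abs M); pose proof (pow_le (/ 2) N ltac:(lra)).
  apply Rle_trans with ((Rabs M + 1) * (/ 2) ^ N)%R; [nra|].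
  apply (Rmult_lt_compat_l (Rabs M + 1)) in HN; [|lra].
  replace ((Rabs M + 1) * (eps / (Rabs M + 1)))%R with eps in HN by (field; lra). lra. }
unfold d in E; replace (twopi_i ^ 2 * li3_D4 w) with ((twopi_i ^ 2 * li3_D4 w - S2 w) + S2 w) by ring; rewrite E; ring.
Qed.

Lemma Cder_li3_D3 w : notZ w -> Cder li3_D3 w (twopi_i * li3_D4 w).
Proof.
intros H; pose proof (one_sub_e2pi_neq_0 w H) as N.
apply Cder_eq with ((twopi_i * e2pi w) * / (1 - e2pi w) + e2pi w * (- / ((1 - e2pi w) * (1 - e2pi w)) * (0 - twopi_i * e2pi w))).
- apply (Cder_mult e2pi (fun w => / (1 - e2pi w))); [apply Cder_e2pi|].
  apply (Cder_comp (fun w => 1 - e2pi w) (fun x => / x)); [|now apply Cder_inv].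
  apply Cder_minus; [apply Cder_const | apply Cder_e2pi].
- unfold li3_D4; field; exact N.
Qed.

(** * The derivative of [f_zzz] as a sum over a lattice *)

Lemma li3_D4_CSeries w : (0 < Im w)%R ->
  asum (fun m => natC (S m) * e2pi w ^ S m) /\ li3_D4 w = CSeries (fun m => natC (S m) * e2pi w ^ S m).
Proof.
intros H; pose proof (Cmod_e2pi_lt_1 w H) as Hx; set (x := e2pi w) in *.
assert (Hc : cvr (fun _ => RtoC 1) 1).
{ apply cvr_bounded with 1%R; intros n; rewrite pow1, Cmod_1; lra. }
assert (A : asum (fun m => der (fun _ => RtoC 1) m * x ^ m)) by (apply (cvr_asum _ 1); [now apply cvr_der | exact Hx]).
assert (E : forall m, x * (der (fun _ => RtoC 1) m * x ^ m) = natC (S m) * x ^ S m) by (intros m; unfold der; simpl; ring).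
split; [apply asum_ext with (1 := E), asum_scal, A|].
rewrite <- (CSeries_ext _ _ E), CSeries_scal by exact A.
change (CSeries (fun n => der (fun _ => RtoC 1) n * x ^ n)) with (Pser (der (fun _ => RtoC 1)) x).
replace (Pser (der (fun _ => RtoC 1)) x) with (/ (1 - x) ^ 2).
{ unfold li3_D4; fold x; unfold Cdiv; ring. }
apply Cder_unique with (fun y => / (1 - y)) x.
- pose proof (one_sub_neq_0 x Hx) as N.
  apply Cder_eq with (- / ((1 - x) * (1 - x)) * (0 - 1)); [|field; exact N].
  apply (Cder_comp (fun y => 1 - y) (fun y => / y)); [|now apply Cder_inv].
  apply Cder_minus; [apply Cder_const | apply Cder_id].
- apply Cder_ext with (Pser (fun _ => RtoC 1)) (1 - Cmod x)%R; [lra | | now apply Pser_Cder with 1%R].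
  intros y Hy; apply Pser_onec_shift. pose proof (Cmod_triangle_rev y x); lra.
Qed.

Lemma Lambert_li3_D4 (t w : C) : (0 < Im t)%R -> (0 < Im w)%R ->
  asum (fun n => li3_D4 (w + natC n * t)) /\
  asum (fun m => natC (S m) * (e2pi w ^ S m / (1 - e2pi t ^ S m))) /\
  CSeries (fun n => li3_D4 (w + natC n * t)) = CSeries (fun m => natC (S m) * (e2pi w ^ S m / (1 - e2pi t ^ S m))).
Proof.
intros Ht Hw; pose proof (Cmod_e2pi_lt_1 t Ht) as H1.
destruct (Lambert (fun m => natC (S m)) (e2pi t) (e2pi w) H1 (proj1 (li3_D4_CSeries w Hw))) as [_ [L2 [L3 L4]]].
assert (E : forall n, li3_D4 (w + natC n * t) = CSeries (fun m => natC (S m) * (e2pi t ^ n * e2pi w) ^ S m)).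
{ intros n; rewrite (proj2 (li3_D4_CSeries (w + natC n * t) ltac:(destruct w, t; unfold natC; simpl in *; pose proof (pos_INR n); nra))).
  apply CSeries_ext; intros m; rewrite e2pi_add, e2pi_nat, (Cmult_comm (e2pi w)); reflexivity. }
split; [|split].
- apply asum_ext with (2 := L2); intros n; now rewrite E.
- exact L3.
- now rewrite (CSeries_ext _ _ E), L4.
Qed.

Lemma exists_shift_up (t w : C) : (0 < Im t)%R -> exists N, (0 < Im (w + natC N * t))%R.
Proof.
intros Ht; destruct (INR_unbounded (Rabs (Im w) / Im t)) as [N HN]; exists N.
apply (Rmult_lt_compat_r (Im t)) in HN; [|exact Ht].
unfold Rdiv in HN; rewrite Rmult_assoc, Rinv_l, Rmult_1_r in HN by lra.
pose proof (Rle_abs (- Im w)) as K; rewrite Rabs_Ropp in K.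
destruct w, t; unfold natC; simpl in *; lra.
Qed.

Lemma asum_li3_D4 (t w : C) : (0 < Im t)%R -> asum (fun n => li3_D4 (w + natC n * t)).
Proof.
intros Ht; destruct (exists_shift_up t w Ht) as [N H]; apply (asum_incr_n _ N).
apply asum_ext with (2 := proj1 (Lambert_li3_D4 t _ Ht H)); intros n; f_equal.
unfold natC; rewrite plus_INR, RtoC_plus; ring.
Qed.

Lemma tail_Cder (t w : C) : (0 < Im t)%R -> (0 < Im w)%R ->
  Cder (fun w => CSeries (fun n => li3_D3 (w + natC n * t))) w (twopi_i * CSeries (fun n => li3_D4 (w + natC n * t))).
Proof.
intros Ht Hw; pose proof (Cmod_e2pi_lt_1 t Ht) as Hq; pose proof (Cmod_e2pi_lt_1 w Hw) as Hx.
set (a := fun n => match n with O => RtoC 0 | S _ => / (1 - e2pi t ^ n) end).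
assert (K : forall v, (0 < Im v)%R -> is_Cseries (fun n => a n * e2pi v ^ n) (CSeries (fun n => li3_D3 (v + natC n * t)))).
{ intros v Hv; destruct (Lambert_li3_D3 t v Ht Hv) as [_ [L1 ->]].
  replace (CSeries _) with (a 0%nat * e2pi v ^ 0 + CSeries (fun m => e2pi v ^ S m / (1 - e2pi t ^ S m))) by (simpl; ring).
  apply (is_Cseries_incr (fun n => a n * e2pi v ^ n)).
  apply is_Cseries_ext with (2 := asum_is _ L1); intros n; unfold a, Cdiv; ring. }
assert (Ha : cvr a 1).
{ set (B := (/ (1 - Cmod (e2pi t)))%R).
  assert (HB : (0 < B)%R) by (apply Rinv_0_lt_compat; lra).
  apply cvr_bounded with B; intros [|n]; rewrite pow1, Rmult_1_r; unfold a; [rewrite Cmod_0; lra|].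
  rewrite Cmod_inv by now apply one_sub_neq_0, Cmod_pow_S_lt_1.
  apply Rinv_le_contravar; [lra|].
  pose proof (Cmod_triangle_rev 1 (e2pi t ^ S n)) as T; rewrite Cmod_1, Cmod_pow in T.
  pose proof (pow_S_le_1 (Cmod (e2pi t)) n ltac:(pose proof (Cmod_ge_0 (e2pi t)); lra)).
  pose proof (Cmod_ge_0 (e2pi t)). simpl pow in T; nra. }
apply Cder_ext with (fun v => Pser a (e2pi v)) (Im w); [exact Hw | |].
- intros v Hv. apply is_Cseries_unique, K.
  pose proof (im_le_Cmod (v - w)) as H1; change (Im (v - w)) with (Im v - Im w)%R in H1.
  apply Rle_lt_trans with (2 := Hv), Rabs_def2 in H1; lra.
- apply Cder_eq with (Pser (der a) (e2pi w) * (twopi_i * e2pi w)).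
  + apply (Cder_comp e2pi (Pser a)); [apply Cder_e2pi | now apply Pser_Cder with 1%R].
  + destruct (Lambert_li3_D4 t w Ht Hw) as [_ [_ ->]].
    replace (Pser (der a) (e2pi w) * (twopi_i * e2pi w)) with (twopi_i * (e2pi w * Pser (der a) (e2pi w))) by ring.
    f_equal; unfold Pser; rewrite <- CSeries_scal by (apply (cvr_asum _ 1); [now apply cvr_der | exact Hx]).
    apply CSeries_ext; intros m; unfold der, a; cbn [Cpow]; unfold Cdiv; ring.
Qed.

(** Induction on the number of terms whose argument need not yet lie in the upper half plane. *)
Lemma series_Cder (al t z : C) : (0 < Im t)%R -> forall N (c : C),
  (0 < Im (al * z + c + natC N * t))%R ->
  (forall n, notZ (al * z + c + natC n * t)) ->
  Cder (fun z => CSeries (fun n => li3_D3 (al * z + c + natC n * t))) z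
    (al * (twopi_i * CSeries (fun n => li3_D4 (al * z + c + natC n * t)))).
Proof.
intros Ht N; induction N as [|N IH]; intros c HI HZ.
- replace (al * z + c + natC 0 * t) with (al * z + c) in HI by (unfold natC; simpl INR; ring).
  apply Cder_eq with ((twopi_i * CSeries (fun n => li3_D4 (al * z + c + natC n * t))) * al); [|ring].
  apply (Cder_comp (fun z => al * z + c) (fun w => CSeries (fun n => li3_D3 (w + natC n * t))));
    [apply Cder_affine | now apply tail_Cder].
- assert (Eq : forall z n, al * z + (c + t) + natC n * t = al * z + c + natC (S n) * t)
    by (intros v n; rewrite natC_S; ring).
  assert (E0 : forall z, al * z + c + natC 0 * t = al * z + c) by (intros; unfold natC; simpl INR; ring).
  apply Cder_ext_all with (fun z => li3_D3 (al * z + c) + CSeries (fun n => li3_D3 (al * z + (c + t) + natC n * t))).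
  { intros v; rewrite (CSeries_incr (fun n => li3_D3 (al * v + c + natC n * t))) by now apply asum_li3_D3.
    rewrite E0, (CSeries_ext _ (fun n => li3_D3 (al * v + c + natC (S n) * t))) by (intros n; now rewrite Eq). reflexivity. }
  apply Cder_eq with ((twopi_i * li3_D4 (al * z + c)) * al + al * (twopi_i * CSeries (fun n => li3_D4 (al * z + (c + t) + natC n * t)))).
  + apply Cder_plus.
    * apply (Cder_comp (fun z => al * z + c) li3_D3); [apply Cder_affine | apply Cder_li3_D3].
      rewrite <- E0; apply HZ.
    * apply IH; [now rewrite Eq | intros n; rewrite Eq; apply HZ].
  + rewrite (CSeries_incr (fun n => li3_D4 (al * z + c + natC n * t))) by now apply asum_li3_D4.
    rewrite E0, (CSeries_ext _ (fun n => li3_D4 (al * z + c + natC (S n) * t))) by (intros n; now rewrite Eq). ring.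
Qed.

Definition off_lattice (t z : C) : Prop := ~ in_lattice t z.

Lemma off_lattice_notZ t z (n : Z) : off_lattice t z -> notZ (z + ZC n * t) /\ notZ (- z + ZC n * t).
Proof.
intros H; split; intros k E; apply H.
- exists k, (- n)%Z; unfold ZC; rewrite opp_IZR, RtoC_opp, <- E; unfold ZC; ring.
- exists (- k)%Z, n; unfold ZC; rewrite opp_IZR, RtoC_opp, <- E; unfold ZC; ring.
Qed.

Lemma off_lattice_add t z (m n : Z) : off_lattice t z -> off_lattice t (z + ZC m + ZC n * t).
Proof.
intros H [m' [n' E]]; apply H; exists (m' - m)%Z, (n' - n)%Z.
unfold ZC in *; rewrite !minus_IZR, !RtoC_minus.
replace z with (z + IZR m + IZR n * t - (IZR m + IZR n * t)) by ring; rewrite E; ring.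
Qed.

Lemma off_lattice_opp t z : off_lattice t z -> off_lattice t (- z).
Proof.
intros H [m [n E]]; apply H; exists (- m)%Z, (- n)%Z; unfold ZC in *; rewrite !opp_IZR, !RtoC_opp.
replace z with (- - z) by ring; rewrite E; ring.
Qed.

Lemma li3_D4_opp w : notZ w -> li3_D4 (- w) = li3_D4 w.
Proof.
intros H; pose proof (one_sub_e2pi_neq_0 w H) as H1; pose proof (e2pi_neq_0 w) as H2.
unfold li3_D4; rewrite e2pi_opp; field; repeat split; try assumption.
intros E; apply H1; replace (1 - e2pi w) with (- (e2pi w - 1)) by ring; rewrite E; ring.
Qed.

Lemma ZC_zpos n : ZC (zpos n) = natC n.
Proof. unfold ZC, zpos; now rewrite natC_IZR. Qed.

Lemma ZC_zneg n : ZC (zneg n) = - natC (S n).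
Proof. unfold ZC, zneg; now rewrite natC_IZR, opp_IZR, RtoC_opp. Qed.

(** The second sum supplies the negative indices, because [li3_D4] is even. *)
Lemma f_zzz_Cder (t z : C) : (0 < Im t)%R -> off_lattice t z ->
  Cder (fun z => f_zzz z t) z (twopi_i * Zsum (fun n => li3_D4 (z + ZC n * t))).
Proof.
intros Ht Hz.
assert (Z1 : forall n, notZ (z + natC n * t)) by (intros n; rewrite <- ZC_zpos; now apply off_lattice_notZ).
assert (Z2 : forall n, notZ (- z + t + natC n * t)).
{ intros n; replace (- z + t + natC n * t) with (- z + natC (S n) * t) by (rewrite natC_S; ring).
  rewrite <- ZC_zpos; now apply off_lattice_notZ. }
destruct (exists_shift_up t (1 * z + 0) Ht) as [N1 HN1], (exists_shift_up t (- (1) * z + t) Ht) as [N2 HN2].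
assert (E1 : forall z n, 1 * z + 0 + natC n * t = z + natC n * t) by (intros; ring).
assert (E2 : forall z n, - (1) * z + t + natC n * t = - z + t + natC n * t) by (intros; ring).
apply Cder_ext_all with (fun z => / 2 + CSeries (fun n => li3_D3 (1 * z + 0 + natC n * t))
  - CSeries (fun n => li3_D3 (- (1) * z + t + natC n * t))).
{ intros v; unfold f_zzz; rewrite (CSeries_ext _ (fun n => li3_D3 (v + natC n * t))) by (intros; now rewrite E1).
  now rewrite (CSeries_ext (fun n => li3_D3 (- (1) * v + t + natC n * t)) (fun n => li3_D3 (- v + t + natC n * t))) by (intros; now rewrite E2). }
apply Cder_eq with (0 + 1 * (twopi_i * CSeries (fun n => li3_D4 (1 * z + 0 + natC n * t)))
  - (- (1)) * (twopi_i * CSeries (fun n => li3_D4 (- (1) * z + t + natC n * t)))).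
- apply Cder_minus; [apply Cder_plus; [apply Cder_const|]|].
  + apply series_Cder with N1; [exact Ht | exact HN1 | intros n; rewrite E1; apply Z1].
  + apply series_Cder with N2; [exact Ht | exact HN2 | intros n; rewrite E2; apply Z2].
- unfold Zsum.
  rewrite (CSeries_ext (fun n => li3_D4 (1 * z + 0 + natC n * t)) (fun n => li3_D4 (z + ZC (zpos n) * t)))
    by (intros n; rewrite E1, ZC_zpos; reflexivity).
  rewrite (CSeries_ext (fun n => li3_D4 (- (1) * z + t + natC n * t)) (fun n => li3_D4 (z + ZC (zneg n) * t))).
  + ring.
  + intros n; rewrite E2, <- li3_D4_opp by apply Z2; f_equal; rewrite ZC_zneg, natC_S; ring.
Qed.

Lemma li3_D4_Zsummable (t z : C) : (0 < Im t)%R -> off_lattice t z -> Zsummable (fun n => li3_D4 (z + ZC n * t)).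
Proof.
intros Ht Hz; split.
- apply asum_ext with (2 := asum_li3_D4 t z Ht); intros n; now rewrite ZC_zpos.
- apply asum_ext with (2 := asum_li3_D4 t (- z + t) Ht); intros n; rewrite ZC_zneg.
  replace (- z + t + natC n * t) with (- z + natC (S n) * t) by (rewrite natC_S; ring).
  rewrite <- li3_D4_opp by (rewrite <- ZC_zpos; now apply off_lattice_notZ); f_equal; ring.
Qed.

Lemma S2_Zsummable_lat (t z : C) : (0 < Im t)%R -> off_lattice t z -> Zsummable (fun n => S2 (z + ZC n * t)).
Proof.
intros Ht Hz; apply Zsummable_ext with (2 := Zsummable_scal (twopi_i ^ 2) _ (li3_D4_Zsummable t z Ht Hz)).
intros n; apply li3_D4_S2; now apply off_lattice_notZ.
Qed.

(** The difference of two inverse squares decays like the cube of the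
    distance, so the order of summation over the lattice is irrelevant. *)
Lemma lattice_swap (t z z' : C) : (0 < Im t)%R -> off_lattice t z -> off_lattice t z' ->
  Zsum (fun n => S2 (z + ZC n * t)) - Zsum (fun n => S2 (z' + ZC n * t)) =
  Zsum (fun m => Zsum (fun n => / (z + ZC n * t + ZC m) ^ 2 - / (z' + ZC n * t + ZC m) ^ 2)).
Proof.
intros Ht Hz Hz'.
rewrite <- Zsum_minus by now apply S2_Zsummable_lat.
rewrite (Zsum_ext _ (fun n => Zsum (fun m => / (z + ZC n * t + ZC m) ^ 2 - / (z' + ZC n * t + ZC m) ^ 2))).
2: { intros n; unfold S2; rewrite Zsum_minus; [reflexivity | | ]; apply S2_Zsummable; now apply off_lattice_notZ. }
destruct (lattice_lower_bound t z Ht Hz) as [c [Hc K]], (lattice_lower_bound t z' Ht Hz') as [c' [Hc' K']].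
set (d := Rmin c c'). assert (Hd : (0 < d)%R) by now apply Rmin_pos.
(* From [1/x^2 - 1/y^2 = - (x - y) (1 / (x y^2) + 1 / (x^2 y))], each triple product being at least
   [(d s)^3] in modulus. *)
set (B := (2 * Cmod (z - z') * / d ^ 3)%R).
assert (HB : (0 <= B)%R).
{ unfold B; apply Rmult_le_pos; [pose proof (Cmod_ge_0 (z - z')); lra | left; apply Rinv_0_lt_compat, pow_lt, Hd]. }
apply (ZFubini _ (fun n => (B * / (INR (S n) * sqrt (INR (S n))))%R) (fun n => (/ (INR (S n) * sqrt (INR (S n))))%R)).
- apply exR_scal, inv_three_halves_summable.
- apply inv_three_halves_summable.
- intros n m.
  assert (En : forall k, Rabs (IZR k) = INR (Z.abs_nat k)).
  { intros k; rewrite <- abs_IZR, INR_IZR_INZ; f_equal; lia. }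
  set (x := z + ZC n * t + ZC m). set (y := z' + ZC n * t + ZC m).
  set (a := INR (S (Z.abs_nat n))). set (b := INR (S (Z.abs_nat m))).
  assert (Ha : (1 <= a)%R) by apply INR_S_ge_1. assert (Hb : (1 <= b)%R) by apply INR_S_ge_1.
  set (s := (a + b - 1)%R).
  assert (Es : (1 + Rabs (IZR n) + Rabs (IZR m) = s)%R) by (rewrite !En; unfold s, a, b; rewrite !S_INR; ring).
  specialize (K n m); specialize (K' n m); fold x in K; fold y in K'; rewrite Es in K, K'.
  assert (Hs : (1 <= s)%R) by (unfold s; lra).
  assert (Hx : (d * s <= Cmod x)%R) by (eapply Rle_trans; [|exact K]; apply Rmult_le_compat_r; [lra | apply Rmin_l]).
  assert (Hy : (d * s <= Cmod y)%R) by (eapply Rle_trans; [|exact K']; apply Rmult_le_compat_r; [lra | apply Rmin_r]).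
  assert (Hds : (0 < d * s)%R) by (apply Rmult_lt_0_compat; lra).
  assert (Hx0 : x <> 0) by (apply (proj2 (Cmod_gt_0 x)); lra). assert (Hy0 : y <> 0) by (apply (proj2 (Cmod_gt_0 y)); lra).
  replace (/ x ^ 2 - / y ^ 2) with (- (z - z') * (/ (x * y ^ 2) + / (x ^ 2 * y))).
  2: { replace (z - z') with (x - y) by (unfold x, y; ring). field; split; assumption. }
  rewrite Cmod_mult, Cmod_opp.
  assert (K3 : forall u v w : C, (d * s <= Cmod u)%R -> (d * s <= Cmod v)%R -> (d * s <= Cmod w)%R ->
    (Cmod (/ (u * v * w)) <= / (d * s) ^ 3)%R).
  { intros u v w Hu Hv Hw. rewrite Cmod_inv.
    - rewrite !Cmod_mult. apply Rinv_le_contravar; [apply pow_lt; lra|].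
      replace ((d * s) ^ 3)%R with ((d * s) * (d * s) * (d * s))%R by ring.
      apply Rmult_le_compat; try lra; [apply Rmult_le_pos; lra | apply Rmult_le_compat; lra].
    - repeat apply Cmult_neq_0; apply (proj2 (Cmod_gt_0 _)); lra. }
  assert (K4 : (Cmod (/ (x * y ^ 2) + / (x ^ 2 * y)) <= 2 * / (d * s) ^ 3)%R).
  { eapply Rle_trans; [apply Cmod_triangle|].
    pose proof (K3 x y y Hx Hy Hy) as T1; pose proof (K3 x x y Hx Hx Hy) as T2.
    replace (x * y ^ 2) with (x * y * y) by ring; replace (x ^ 2 * y) with (x * x * y) by ring; lra. }
  apply Rle_trans with (Cmod (z - z') * (2 * / (d * s) ^ 3))%R; [apply Rmult_le_compat_l; [apply Cmod_ge_0 | exact K4]|].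
  replace (Cmod (z - z') * (2 * / (d * s) ^ 3))%R with (B * / s ^ 3)%R by (unfold B; field; lra).
  replace (B * / (a * sqrt a) * / (b * sqrt b))%R with (B * / ((a * b) * sqrt (a * b)))%R.
  2: { rewrite sqrt_mult by lra. pose proof (sqrt_lt_R0 a ltac:(lra)); pose proof (sqrt_lt_R0 b ltac:(lra)). field; lra. }
  (* [(a b)^(3/2) <= s^3] because [a b <= s^2]: the bound splits into one factor for each index. *)
  apply Rmult_le_compat_l; [exact HB|].
  assert (Hab : (0 < a * b)%R) by nra. assert (Hab2 : (a * b <= s ^ 2)%R) by (unfold s; nra).
  pose proof (sqrt_lt_R0 _ Hab) as Hsq.
  assert (Hsq2 : (sqrt (a * b) <= s)%R) by (rewrite <- (sqrt_pow2 s) by lra; now apply sqrt_le_1_alt).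
  apply Rinv_le_contravar; [now apply Rmult_lt_0_compat|].
  replace (s ^ 3)%R with (s ^ 2 * s)%R by ring. apply Rmult_le_compat; lra.
Qed.

Lemma Im_inv_neg (t : C) : (0 < Im t)%R -> t <> 0 /\ (0 < Im (- (1) / t))%R.
Proof.
intros H; destruct t as [a b]; simpl in H.
assert (Hn : (0 < a * (a * 1) + b * (b * 1))%R) by nra.
split.
- intros E; injection E as _ E; lra.
- simpl. replace (- (1) * (- b / (a * (a * 1) + b * (b * 1))) + - 0 * (a / (a * (a * 1) + b * (b * 1))))%R
    with (b / (a * (a * 1) + b * (b * 1)))%R by (field; lra).
  now apply Rdiv_lt_0_compat.
Qed.

Lemma off_lattice_inv (t z : C) : (0 < Im t)%R -> off_lattice t z -> off_lattice (- (1) / t) (z / t).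
Proof.
intros Ht Hz [m [n E]]; destruct (Im_inv_neg t Ht) as [Ht0 _]; apply Hz.
exists (- n)%Z, m; unfold ZC in *; rewrite opp_IZR, RtoC_opp.
transitivity ((z / t) * t); [field; exact Ht0 | rewrite E; field; exact Ht0].
Qed.

(** Division by [t] maps the lattice of [t] to that of [- 1 / t] and exchanges the two directions of
    summation. The order matters for a single sum, so the homogeneous law is stated for the
    difference at two points. *)
Lemma S2_inv_sum (t z z' : C) : (0 < Im t)%R -> off_lattice t z -> off_lattice t z' ->
  Zsum (fun n => S2 (z / t + ZC n * (- (1) / t))) - Zsum (fun n => S2 (z' / t + ZC n * (- (1) / t))) =
  t ^ 2 * (Zsum (fun n => S2 (z + ZC n * t)) - Zsum (fun n => S2 (z' + ZC n * t))).
Proof.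
intros Ht Hz Hz'; destruct (Im_inv_neg t Ht) as [Ht0 Hy].
pose proof (off_lattice_inv t z Ht Hz) as Nx; pose proof (off_lattice_inv t z' Ht Hz') as Nx'.
assert (F1 : forall w n m, off_lattice t w -> / (w / t + ZC n * (- (1) / t) + ZC m) ^ 2 = t ^ 2 * / (w + ZC m * t + ZC (- n)) ^ 2).
{ intros w n m Hw.
  assert (Hne : w + ZC m * t + ZC (- n) <> 0) by (apply notZ_neq; now apply off_lattice_notZ).
  replace (w / t + ZC n * (- (1) / t) + ZC m) with ((w + ZC m * t + ZC (- n)) / t).
  - field; split; assumption.
  - unfold ZC; rewrite opp_IZR, RtoC_opp; field; exact Ht0. }
rewrite <- Zsum_minus by now apply S2_Zsummable_lat.
rewrite (lattice_swap t z z' Ht Hz Hz').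
set (h := fun m => Zsum (fun n => / (z + ZC n * t + ZC m) ^ 2 - / (z' + ZC n * t + ZC m) ^ 2)).
assert (Ein : forall n, S2 (z / t + ZC n * (- (1) / t)) - S2 (z' / t + ZC n * (- (1) / t)) = t ^ 2 * h (- n)%Z).
{ intros n. unfold S2.
  assert (A1 := S2_Zsummable _ (proj1 (off_lattice_notZ _ _ n Nx))). assert (A2 := S2_Zsummable _ (proj1 (off_lattice_notZ _ _ n Nx'))).
  rewrite <- Zsum_minus by assumption; unfold h.
  rewrite <- Zsum_scal.
  - apply Zsum_ext; intros m; rewrite !F1 by assumption; ring.
  - apply Zsummable_ext with (fun m => / t ^ 2 * (/ (z / t + ZC n * (- (1) / t) + ZC m) ^ 2 - / (z' / t + ZC n * (- (1) / t) + ZC m) ^ 2)).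
    + intros m; rewrite !F1 by assumption.
      assert (Es : forall p r : C, / t ^ 2 * (t ^ 2 * p - t ^ 2 * r) = p - r) by (intros; field; exact Ht0).
      apply Es.
    + now apply Zsummable_scal, Zsummable_minus. }
assert (Zh : Zsummable h).
{ apply Zsummable_ext with (fun k => (fun n => / t ^ 2 * (S2 (z / t + ZC n * (- (1) / t)) - S2 (z' / t + ZC n * (- (1) / t)))) (- k)%Z).
  - intros k; cbv beta; rewrite Ein, Z.opp_involutive; field; exact Ht0.
  - apply (Zsum_opp (fun n => / t ^ 2 * (S2 (z / t + ZC n * (- (1) / t)) - S2 (z' / t + ZC n * (- (1) / t))))).
    apply Zsummable_scal, Zsummable_minus; now apply S2_Zsummable_lat. }
rewrite (Zsum_ext _ _ Ein), (Zsum_scal (t ^ 2) (fun n => h (- n)%Z)) by now apply (Zsum_opp h).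
f_equal; apply (Zsum_opp h), Zh.
Qed.

(** * Modularity of the third derivative *)

Lemma li3_D3_add_1 w : li3_D3 (w + 1) = li3_D3 w.
Proof. unfold li3_D3; now rewrite e2pi_add, e2pi_1, Cmult_1_r. Qed.

Lemma li3_D3_sub_1 w : li3_D3 (w - 1) = li3_D3 w.
Proof. rewrite <- (li3_D3_add_1 (w - 1)); f_equal; ring. Qed.

Lemma f_zzz_add_1 t z : f_zzz (z + 1) t = f_zzz z t.
Proof.
unfold f_zzz.
rewrite (CSeries_ext (fun n => li3_D3 (z + 1 + natC n * t)) (fun n => li3_D3 (z + natC n * t))).
2: { intros n; rewrite <- (li3_D3_add_1 (z + natC n * t)); f_equal; ring. }
rewrite (CSeries_ext (fun n => li3_D3 (- (z + 1) + t + natC n * t)) (fun n => li3_D3 (- z + t + natC n * t))); [reflexivity|].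
intros n; rewrite <- (li3_D3_sub_1 (- z + t + natC n * t)); f_equal; ring.
Qed.

Lemma off_lattice_not_Z t z : off_lattice t z -> notZ z.
Proof. intros H; replace z with (z + ZC 0 * t) by (unfold ZC; ring); now apply off_lattice_notZ. Qed.

Lemma f_zzz_split t z : (0 < Im t)%R ->
  f_zzz z t = / 2 + li3_D3 z + CSeries (fun n => li3_D3 (z + t + natC n * t)) - CSeries (fun n => li3_D3 (- z + t + natC n * t)).
Proof.
intros Ht; unfold f_zzz; rewrite (CSeries_incr (fun n => li3_D3 (z + natC n * t))) by now apply asum_li3_D3.
replace (z + natC 0 * t) with z by (unfold natC; simpl INR; ring).
rewrite (CSeries_ext (fun n => li3_D3 (z + natC (S n) * t)) (fun n => li3_D3 (z + t + natC n * t))); [ring|].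
intros n; f_equal; rewrite natC_S; ring.
Qed.

Lemma f_zzz_opp t z : (0 < Im t)%R -> off_lattice t z -> f_zzz (- z) t = - f_zzz z t.
Proof.
intros Ht Hz; rewrite !f_zzz_split, li3_D3_opp by (assumption || now apply off_lattice_not_Z with t).
replace (- - z) with z by ring; field.
Qed.

(** One summand passes between the two sums with its argument reflected, and the reflection leaves
    the constant [1]. *)
Lemma f_zzz_add_tau t z : (0 < Im t)%R -> off_lattice t z -> f_zzz (z + t) t = f_zzz z t + 1.
Proof.
intros Ht Hz; rewrite (f_zzz_split t z Ht); unfold f_zzz.
rewrite (CSeries_ext (fun n => li3_D3 (- (z + t) + t + natC n * t)) (fun n => li3_D3 (- z + natC n * t)))
  by (intros n; f_equal; ring).
rewrite (CSeries_incr (fun n => li3_D3 (- z + natC n * t))) by now apply asum_li3_D3.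
replace (- z + natC 0 * t) with (- z) by (unfold natC; simpl INR; ring).
rewrite (CSeries_ext (fun n => li3_D3 (- z + natC (S n) * t)) (fun n => li3_D3 (- z + t + natC n * t)))
  by (intros n; f_equal; rewrite natC_S; ring).
rewrite li3_D3_opp by now apply off_lattice_not_Z with t. ring.
Qed.

Definition f_zzz_defect (t z : C) : C := f_zzz (z / t) (- (1) / t) - t * f_zzz z t + z.

Lemma off_lattice_add_1 t z : off_lattice t z -> off_lattice t (z + 1).
Proof. intros H; replace (z + 1) with (z + ZC 1 + ZC 0 * t) by (unfold ZC; ring); now apply off_lattice_add. Qed.

Lemma f_zzz_defect_add_1 t z : (0 < Im t)%R -> off_lattice t z -> f_zzz_defect t (z + 1) = f_zzz_defect t z.
Proof.
intros Ht Hz; destruct (Im_inv_neg t Ht) as [Ht0 Hy]; unfold f_zzz_defect; rewrite f_zzz_add_1.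
assert (E : f_zzz (z / t) (- (1) / t) = f_zzz ((z + 1) / t) (- (1) / t) + 1).
{ replace (z / t) with ((z + 1) / t + - (1) / t) by (field; exact Ht0).
  apply f_zzz_add_tau; [exact Hy|]; now apply off_lattice_inv, off_lattice_add_1. }
rewrite E; ring.
Qed.

Lemma f_zzz_defect_add_tau t z : (0 < Im t)%R -> off_lattice t z -> f_zzz_defect t (z + t) = f_zzz_defect t z.
Proof.
intros Ht Hz; destruct (Im_inv_neg t Ht) as [Ht0 Hy]; unfold f_zzz_defect; rewrite f_zzz_add_tau by assumption.
replace ((z + t) / t) with (z / t + 1) by (field; exact Ht0). rewrite f_zzz_add_1; ring.
Qed.

Lemma f_zzz_defect_opp t z : (0 < Im t)%R -> off_lattice t z -> f_zzz_defect t (- z) = - f_zzz_defect t z.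
Proof.
intros Ht Hz; destruct (Im_inv_neg t Ht) as [Ht0 Hy]; unfold f_zzz_defect.
replace (- z / t) with (- (z / t)) by (field; exact Ht0).
rewrite !f_zzz_opp by (assumption || now apply off_lattice_inv). ring.
Qed.

Lemma nat_periodic (f : C -> C) (Q : C -> Prop) (t : C) : (forall z, Q z -> f (z + t) = f z) ->
  (forall z (k : Z), Q z -> Q (z + ZC k * t)) -> forall k z, Q z -> f (z + ZC k * t) = f z.
Proof.
intros H HQ.
assert (Hn : forall n z, Q z -> f (z + natC n * t) = f z).
{ induction n as [|n IH]; intros z Hz.
  - f_equal; unfold natC; simpl INR; ring.
  - rewrite <- (IH z Hz), natC_S. replace (z + (natC n + 1) * t) with (z + natC n * t + t) by ring.
    apply H; rewrite natC_IZR; now apply HQ. }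
intros k z Hz; destruct (Z_le_dec 0 k) as [Hk|Hk].
- rewrite <- (Hn (Z.to_nat k) z Hz), natC_IZR, Z2Nat.id by exact Hk; reflexivity.
- rewrite <- (Hn (Z.to_nat (- k)) (z + ZC k * t)) by now apply HQ.
  f_equal; rewrite natC_IZR, Z2Nat.id by lia; unfold ZC; rewrite opp_IZR, RtoC_opp; ring.
Qed.

Lemma f_zzz_defect_Cder t z : (0 < Im t)%R -> off_lattice t z -> Cder (f_zzz_defect t) z
  (/ t * (/ twopi_i * Zsum (fun n => S2 (z / t + ZC n * (- (1) / t)))) - t * (/ twopi_i * Zsum (fun n => S2 (z + ZC n * t))) + 1).
Proof.
intros Ht Hz; destruct (Im_inv_neg t Ht) as [Ht0 Hy]; pose proof (off_lattice_inv t z Ht Hz) as Hx.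
pose proof twopi_i_neq_0 as Hp.
assert (E : forall t z, (0 < Im t)%R -> off_lattice t z ->
  twopi_i * Zsum (fun n => li3_D4 (z + ZC n * t)) = / twopi_i * Zsum (fun n => S2 (z + ZC n * t))).
{ intros s w Hs Hw. rewrite (Zsum_ext (fun n => S2 (w + ZC n * s)) (fun n => twopi_i ^ 2 * li3_D4 (w + ZC n * s))).
  - rewrite Zsum_scal by now apply li3_D4_Zsummable. field; exact Hp.
  - intros n; rewrite li3_D4_S2; [reflexivity | now apply off_lattice_notZ]. }
rewrite <- !E by assumption.
apply Cder_plus; [apply Cder_minus | apply Cder_id].
- apply Cder_eq with ((twopi_i * Zsum (fun n => li3_D4 (z / t + ZC n * (- (1) / t)))) * / t); [|ring].
  apply (Cder_comp (fun z => z / t) (fun x => f_zzz x (- (1) / t))).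
  + apply Cder_ext_all with (fun z => / t * z); [intros; unfold Cdiv; ring|].
    apply Cder_eq with (/ t * 1); [apply Cder_scal, Cder_id | ring].
  + now apply f_zzz_Cder.
- now apply Cder_scal, f_zzz_Cder.
Qed.

Lemma off_lattice_strip t z : (0 < Im z < Im t)%R -> off_lattice t z.
Proof.
intros H [m [n E]]. assert (Ei : Im z = (IZR n * Im t)%R) by (rewrite E; unfold ZC; destruct t; simpl; ring).
assert (Ht : (0 < Im t)%R) by lra.
assert (H1 : (0 < IZR n)%R) by nra. assert (H2 : (IZR n < 1)%R) by nra.
apply lt_IZR in H1; apply lt_IZR in H2; lia.
Qed.

Lemma f_zzz_defect_strip t z : (0 < Im z < Im t)%R -> f_zzz_defect t z = 0.
Proof.
intros Hz; assert (Ht : (0 < Im t)%R) by lra.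
destruct (Im_inv_neg t Ht) as [Ht0 Hy].
set (U := fun v : C => (0 < Im v < Im t)%R).
assert (HU : Cconvex U).
{ intros a b s Ha Hb Hs; unfold U in *.
  replace (Im (a + RtoC s * (b - a))) with ((1 - s) * Im a + s * Im b)%R by (destruct a, b; simpl; ring).
  split; [|replace (Im t) with ((1 - s) * Im t + s * Im t)%R by ring].
  - destruct (Req_dec s 0) as [->|]; [lra|]. assert (0 < s * Im b)%R by (apply Rmult_lt_0_compat; lra).
    assert (0 <= (1 - s) * Im a)%R by (apply Rmult_le_pos; lra). lra.
  - destruct (Req_dec s 0) as [->|]; [lra|]. assert (s * Im b < s * Im t)%R by (apply Rmult_lt_compat_l; lra).
    assert ((1 - s) * Im a <= (1 - s) * Im t)%R by (apply Rmult_le_compat_l; lra). lra. }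
set (ZSx := fun v => Zsum (fun n => S2 (v / t + ZC n * (- (1) / t)))).
set (ZSz := fun v => Zsum (fun n => S2 (v + ZC n * t))).
(* The unknown slope: differences of the lattice sums cancel, so the derivative is the same at all
   points of the strip. *)
set (e := / t * (/ twopi_i * ZSx z) - t * (/ twopi_i * ZSz z) + 1).
assert (He : forall v, U v -> Cder (f_zzz_defect t) v e).
{ intros v Hv; apply Cder_eq with (1 := f_zzz_defect_Cder t v Ht (off_lattice_strip t v Hv)).
  pose proof (S2_inv_sum t v z Ht (off_lattice_strip t v Hv) (off_lattice_strip t z Hz)) as K.
  fold (ZSx v) (ZSx z) (ZSz v) (ZSz z) in *; unfold e.
  replace (ZSx v) with ((ZSx v - ZSx z) + ZSx z) by ring; rewrite K; field; split; [apply twopi_i_neq_0 | exact Ht0]. }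
assert (Hc : forall v, U v -> f_zzz_defect t v - e * v = f_zzz_defect t z - e * z).
{ intros v Hv; apply (Cder_zero_const U (fun v => f_zzz_defect t v - e * v) HU); auto; intros w Hw.
  apply Cder_eq with (e - e * 1); [apply Cder_minus; [now apply He | apply Cder_scal, Cder_id] | ring]. }
assert (Hz1 : U (z + 1)) by (unfold U; destruct z; simpl in *; lra).
(* Translation by [1] stays in the strip, and an affine function with that period has slope zero. *)
assert (E0 : e = 0).
{ specialize (Hc _ Hz1). rewrite f_zzz_defect_add_1 in Hc by (assumption || now apply off_lattice_strip).
  replace e with (- ((f_zzz_defect t z - e * (z + 1)) - (f_zzz_defect t z - e * z))) by ring; rewrite Hc; ring. }
(* The reflection [t - z] preserves the strip; oddness and the period [t] then show that the defect
   equals its opposite. *)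
assert (Hz2 : U (- z + t)) by (unfold U; destruct z, t; simpl in *; lra).
specialize (Hc _ Hz2); rewrite E0 in Hc.
rewrite f_zzz_defect_add_tau, f_zzz_defect_opp in Hc by (try apply off_lattice_opp; assumption || now apply off_lattice_strip).
assert (E : - f_zzz_defect t z = f_zzz_defect t z).
{ transitivity (- f_zzz_defect t z - 0 * (- z + t)); [ring | rewrite Hc; ring]. }
transitivity (/ 2 * (f_zzz_defect t z - - f_zzz_defect t z)); [field | rewrite E; ring].
Qed.

Lemma strip_or_line t z : (0 < Im t)%R ->
  (exists k : Z, (0 < Im (z + ZC k * t) < Im t)%R) \/ (exists k : Z, Im z = (IZR k * Im t)%R).
Proof.
intros Ht; set (x := (Im z / Im t)%R).
assert (Ex : (Im z = x * Im t)%R) by (unfold x; field; lra).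
destruct (archimed x) as [A1 A2].
destruct (Req_dec x (IZR (up x) - 1)) as [E|E].
- right; exists (up x - 1)%Z; rewrite Ex, minus_IZR; now f_equal.
- left; exists (1 - up x)%Z.
  replace (Im (z + ZC (1 - up x) * t)) with ((x + 1 - IZR (up x)) * Im t)%R
    by (unfold ZC; rewrite minus_IZR; change (Im (z + _)) with (Im z + Im (RtoC (1 - IZR (up x)) * t))%R; rewrite Ex; destruct t; simpl; ring).
  nra.
Qed.

Lemma f_zzz_defect_off_line t z : (0 < Im t)%R -> off_lattice t z -> (forall k : Z, Im z <> (IZR k * Im t)%R) -> f_zzz_defect t z = 0.
Proof.
intros Ht Hz Hk; destruct (strip_or_line t z Ht) as [[k K]|[k K]]; [|exfalso; now apply (Hk k)].
rewrite <- (nat_periodic (f_zzz_defect t) (off_lattice t) t) with (k := k); [now apply f_zzz_defect_strip | | | exact Hz].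
- intros v Hv; now apply f_zzz_defect_add_tau.
- intros v j Hv; replace (v + ZC j * t) with (v + ZC 0 + ZC j * t) by (unfold ZC; ring); now apply off_lattice_add.
Qed.

(** The translates of the open strip miss the lines through lattice points in the direction of the
    period [1]. On these the law for [- 1 / t] in place of [t] applies: a point missed by both
    families of strips would be a lattice point. *)
Lemma f_zzz_modular t z : (0 < Im t)%R -> off_lattice t z -> f_zzz (z / t) (- (1) / t) = t * f_zzz z t - z.
Proof.
intros Ht Hz; destruct (Im_inv_neg t Ht) as [Ht0 Hy].
enough (E : f_zzz_defect t z = 0).
{ unfold f_zzz_defect in E. replace (f_zzz (z / t) (- (1) / t)) with ((f_zzz (z / t) (- (1) / t) - t * f_zzz z t + z) + (t * f_zzz z t - z)) by ring.
  rewrite E; ring. }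
destruct (classic (exists k : Z, Im z = (IZR k * Im t)%R)) as [[k K]|Hn].
- (* exchange the roles of the two periods *)
  assert (E : f_zzz_defect (- (1) / t) (z / t) = / t * f_zzz_defect t z).
  { unfold f_zzz_defect. replace (z / t / (- (1) / t)) with (- z) by (field; exact Ht0).
    replace (- (1) / (- (1) / t)) with t by (field; exact Ht0).
    rewrite f_zzz_opp by assumption; field; exact Ht0. }
  transitivity (t * (/ t * f_zzz_defect t z)); [field; exact Ht0|]. rewrite <- E, f_zzz_defect_off_line; [ring | exact Hy | now apply off_lattice_inv|].
  destruct (lattice_coords t z Ht) as [a [b Eab]].
  assert (Ea : a = IZR k).
  { assert (Ei : Im z = (a * Im t)%R) by (rewrite Eab; destruct t; simpl; ring).
    apply (Rmult_eq_reg_r (Im t)); lra. }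
  intros j Ej.
  assert (Eb : (- b)%R = IZR j).
  { assert (Ei : Im (z / t) = (- b * Im (- (1) / t))%R).
    { rewrite Eab. replace ((RtoC a * t + RtoC b) / t) with (RtoC a + RtoC (- b) * (- (1) / t)) by (rewrite RtoC_opp; field; exact Ht0).
      set (y := - (1) / t); destruct y; simpl; ring. }
    apply (Rmult_eq_reg_r (Im (- (1) / t))); lra. }
  apply Hz; exists (- j)%Z, k; rewrite Eab, Ea; unfold ZC; rewrite opp_IZR, <- Eb, Ropp_involutive; ring.
- apply f_zzz_defect_off_line; [exact Ht | exact Hz|]. intros k K; apply Hn; now exists k.
Qed.

(** * The branch on the strip *)

Definition seq_lim (u : nat -> C) (l : C) : Prop :=
  forall eps, (0 < eps)%R -> eventually (fun n => (Cmod (u n - l) < eps)%R).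

Lemma seq_lim_const c : seq_lim (fun _ => c) c.
Proof. intros eps He; exists 0%nat; intros n _; replace (c - c) with (RtoC 0) by ring; now rewrite Cmod_0. Qed.

Lemma seq_lim_plus u v a b : seq_lim u a -> seq_lim v b -> seq_lim (fun n => u n + v n) (a + b).
Proof.
intros H K eps He; generalize (filter_and (F := eventually) _ _ (H (eps / 2)%R ltac:(lra)) (K (eps / 2)%R ltac:(lra))).
apply filter_imp; intros n [H1 H2].
replace (u n + v n - (a + b)) with ((u n - a) + (v n - b)) by ring.
eapply Rle_lt_trans; [apply Cmod_triangle | lra].
Qed.

Lemma seq_lim_cont (f : C -> C) (u : nat -> C) (l : C) : Ccont f l -> seq_lim u l -> seq_lim (fun n => f (u n)) (f l).
Proof.
intros Hf Hu eps He; destruct (Hf eps He) as [d [Hd K]].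
generalize (Hu d Hd); apply filter_imp; intros n; apply K.
Qed.

Lemma seq_lim_scal c u a : seq_lim u a -> seq_lim (fun n => c * u n) (c * a).
Proof.
intros H; apply (seq_lim_cont (fun x => c * x)); [|exact H].
apply Cder_cont with (c * 1); apply Cder_scal, Cder_id.
Qed.

Lemma seq_lim_minus u v a b : seq_lim u a -> seq_lim v b -> seq_lim (fun n => u n - v n) (a - b).
Proof.
intros H K; apply (seq_lim_plus u (fun n => - v n)); [exact H|].
apply (seq_lim_cont (fun x => - x)); [|exact K]. apply Cder_cont with (- (1)); apply Cder_opp, Cder_id.
Qed.

Lemma seq_lim_pow u a k : seq_lim u a -> seq_lim (fun n => u n ^ S k) (a ^ S k).
Proof. intros H; apply (seq_lim_cont (fun x => x ^ S k)); [eapply Cder_cont, Cder_pow | exact H]. Qed.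

Lemma seq_lim_ext u v l : (forall n, u n = v n) -> seq_lim u l -> seq_lim v l.
Proof. intros E H eps He; generalize (H eps He); apply filter_imp; intros n; now rewrite E. Qed.

Lemma seq_lim_unique u a b : seq_lim u a -> seq_lim u b -> a = b.
Proof. apply Cseq_unique. Qed.

(** Continuity up to the unit circle, thanks to the uniform majorant [B / m^2]; corners of the
    parallelogram give arguments on that circle. *)
Lemma lambert3_seq_lim (q : C) (Y : nat -> C) (l : C) : (Cmod q < 1)%R -> (forall n, (Cmod (Y n) <= 1)%R) -> (Cmod l <= 1)%R ->
  seq_lim Y l -> seq_lim (fun n => lambert3 q (Y n)) (lambert3 q l).
Proof.
intros Hq HY Hl H.
set (B := (/ (1 - Cmod q))%R). assert (HB : (0 < B)%R) by (apply Rinv_0_lt_compat; lra).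
assert (Hb : forall y m, (Cmod y <= 1)%R -> (Cmod (y ^ S m / (1 - q ^ S m) / natC (S m) ^ 3) <= B * / INR (S m) ^ 2)%R).
{ intros y m Hy.
  pose proof (one_sub_neq_0 _ (Cmod_pow_S_lt_1 q m Hq)) as N.
  replace (y ^ S m / (1 - q ^ S m) / natC (S m) ^ 3) with (/ (1 - q ^ S m) * (y ^ S m / natC (S m) ^ 3)) by (unfold Cdiv; ring).
  rewrite Cmod_mult; apply Rmult_le_compat; try apply Cmod_ge_0; [|now apply li3c_bound].
  rewrite Cmod_inv by exact N. apply Rinv_le_contravar; [lra|].
  pose proof (Cmod_triangle_rev 1 (q ^ S m)) as T; rewrite Cmod_1, Cmod_pow in T.
  pose proof (pow_S_le_1 (Cmod q) m ltac:(pose proof (Cmod_ge_0 q); lra)).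
  pose proof (Cmod_ge_0 q). simpl pow in T; nra. }
refine (Tannery eventually (fun n m => Y n ^ S m / (1 - q ^ S m) / natC (S m) ^ 3)
  (fun m => l ^ S m / (1 - q ^ S m) / natC (S m) ^ 3) (fun m => (B * / INR (S m) ^ 2)%R) _ _ _ _).
- apply exR_scal, inv_sq_summable.
- exists 0%nat; intros n _ m; now apply Hb.
- intros m; now apply Hb.
- intros m.
  apply (seq_lim_ext (fun n => (/ (1 - q ^ S m) / natC (S m) ^ 3) * Y n ^ S m)); [intros n; unfold Cdiv; ring|].
  replace (l ^ S m / (1 - q ^ S m) / natC (S m) ^ 3) with ((/ (1 - q ^ S m) / natC (S m) ^ 3) * l ^ S m) by (unfold Cdiv; ring).
  now apply seq_lim_scal, seq_lim_pow.
Qed.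

(** The branch given by the series of [Li3] on the closed strip [0 <= Im z <= Im t]. *)
Definition f_strip (z t : C) : C :=
  / twopi_i ^ 3 * (lambert3 (e2pi t) (e2pi z) + lambert3 (e2pi t) (e2pi (t - z)) - lambert3 (e2pi t) 1 - lambert3 (e2pi t) (e2pi t))
  + / 12 * z ^ 3 - / 24 * z ^ 2 * t.

Lemma f_strip_0 t : f_strip 0 t = 0.
Proof. unfold f_strip; rewrite e2pi_0; replace (t - 0) with t by ring; ring. Qed.

Lemma f_strip_add_1 z t : f_strip (z + 1) t = f_strip z t + / 12 * (3 * z ^ 2 + 3 * z + 1) - / 24 * (2 * z + 1) * t.
Proof.
unfold f_strip.
assert (E1 : e2pi (z + 1) = e2pi z) by (rewrite e2pi_add, e2pi_1; ring).
assert (E2 : e2pi (t - (z + 1)) = e2pi (t - z)).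
{ replace (t - z) with (t - (z + 1) + 1) by ring; rewrite (e2pi_add (t - (z + 1))), e2pi_1; ring. }
rewrite E1, E2; ring.
Qed.

(** At [z = t] the two arguments exchange the values [1] and [q] they have at [z = 0], so the series
    cancel and the cubic remains. *)
Lemma f_strip_tau t : f_strip t t = / 24 * t ^ 3.
Proof. unfold f_strip; replace (t - t) with (RtoC 0) by ring; rewrite e2pi_0; field; apply twopi_i_neq_0. Qed.

Lemma f_strip_seq_lim (t l : C) (u : nat -> C) : (0 < Im t)%R -> (forall n, (0 <= Im (u n) <= Im t)%R) -> (0 <= Im l <= Im t)%R ->
  seq_lim u l -> seq_lim (fun n => f_strip (u n) t) (f_strip l t).
Proof.
intros Ht Hu Hl H; pose proof (Cmod_e2pi_lt_1 t Ht) as Hq.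
assert (Hs : forall z, Im (t - z) = (Im t - Im z)%R) by (intros z; destruct t, z; simpl; ring).
assert (He : forall v m, seq_lim v m -> seq_lim (fun n => e2pi (v n)) (e2pi m)).
{ intros v m Hv; apply (seq_lim_cont e2pi); [eapply Cder_cont, Cder_e2pi | exact Hv]. }
unfold f_strip; apply seq_lim_minus; [apply seq_lim_plus|].
- apply seq_lim_scal; repeat apply seq_lim_minus; try apply seq_lim_const; apply seq_lim_plus; apply lambert3_seq_lim; try exact Hq.
  + intros n; apply Cmod_e2pi_le_1, Hu.
  + apply Cmod_e2pi_le_1, Hl.
  + now apply He.
  + intros n; apply Cmod_e2pi_le_1; rewrite Hs; specialize (Hu n); lra.
  + apply Cmod_e2pi_le_1; rewrite Hs; lra.
  + apply (He (fun n => t - u n)), seq_lim_minus; [apply seq_lim_const | exact H].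
- now apply seq_lim_scal, seq_lim_pow.
- apply (seq_lim_ext (fun n => (/ 24 * t) * u n ^ 2)); [intros; ring|].
  replace (/ 24 * l ^ 2 * t) with ((/ 24 * t) * l ^ 2) by ring. now apply seq_lim_scal, seq_lim_pow.
Qed.

Definition strip (p : C * C) : Prop := (0 < Im (fst p) < Im (snd p))%R.

Lemma Im_cont (z w : C) : (Rabs (Im w - Im z) <= Cmod (w - z))%R.
Proof. apply (im_le_Cmod (w - z)). Qed.

Lemma strip_open : open strip.
Proof.
apply open_of_pdisc; intros p [H1 H2].
set (d := Rmin (Im (fst p)) ((Im (snd p) - Im (fst p)) / 2)).
assert (Hd : (0 < d)%R) by (apply Rmin_pos; lra).
assert (D1 : (d <= Im (fst p))%R) by apply Rmin_l. assert (D2 : (d <= (Im (snd p) - Im (fst p)) / 2)%R) by apply Rmin_r.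
exists d; split; [exact Hd|]; intros q [K1 K2]; unfold disc in *.
pose proof (Im_cont (fst p) (fst q)) as I1; pose proof (Im_cont (snd p) (snd q)) as I2.
apply Rle_lt_trans with (2 := K1), Rabs_def2 in I1; apply Rle_lt_trans with (2 := K2), Rabs_def2 in I2.
unfold strip; lra.
Qed.

Lemma f_strip_branch : f_branch strip (fun p => f_strip (fst p) (snd p)).
Proof.
exists (fun n p => / twopi_i ^ 3 * Li3_disc (e2pi (W n p))), (fun n p => / twopi_i ^ 3 * Li3_disc (e2pi (V n p))).
split; [|split].
- intros n; apply (li3_branch_disc 1 (natC n) 0); intros p [H1 H2]; unfold natC; rewrite Im_aff_1.
  pose proof (pos_INR n); nra.
- intros n; apply (li3_branch_disc (- (1)) (natC (S n)) 0); intros p [H1 H2]; unfold natC; rewrite Im_aff_m1.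
  pose proof (INR_S_ge_1 n); nra.
- intros p [H1 H2].
  assert (Hq : (Cmod (e2pi (snd p)) < 1)%R) by (apply Cmod_e2pi_lt_1; lra).
  destruct (Lambert_Li3 (e2pi (snd p)) (e2pi (fst p)) Hq) as [L1 [_ L3]]; [apply Cmod_e2pi_le_1; lra|].
  destruct (Lambert_Li3 (e2pi (snd p)) (e2pi (snd p - fst p)) Hq) as [M1 [_ M3]].
  { apply Cmod_e2pi_le_1; change (Im (snd p - fst p)) with (Im (snd p) - Im (fst p))%R; lra. }
  destruct (Lambert_Li3 (e2pi (snd p)) 1 Hq) as [N1 [_ N3]]; [rewrite Cmod_1; lra|].
  destruct (Lambert_Li3 (e2pi (snd p)) (e2pi (snd p)) Hq) as [O1 [_ O3]]; [lra|].
  exists (/ twopi_i ^ 3 * lambert3 (e2pi (snd p)) (e2pi (fst p))), (/ twopi_i ^ 3 * lambert3 (e2pi (snd p)) (e2pi (snd p - fst p))).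
  split; [|split].
  + apply is_Cseries_scal; rewrite <- L3; apply is_Cseries_ext with (2 := asum_is _ L1); intros n; now rewrite e2pi_W.
  + apply is_Cseries_scal; rewrite <- M3; apply is_Cseries_ext with (2 := asum_is _ M1); intros n.
    rewrite e2pi_V; f_equal. unfold Cminus; rewrite e2pi_add, e2pi_opp; simpl; ring.
  + unfold li3_one.
    rewrite (CSeries_ext (fun n => Li3_disc (e2pi (snd p) ^ n)) (fun n => Li3_disc (e2pi (snd p) ^ n * 1))) by (intros; f_equal; ring).
    rewrite (CSeries_ext (fun n => Li3_disc (e2pi (snd p) ^ S n)) (fun n => Li3_disc (e2pi (snd p) ^ n * e2pi (snd p)))) by (intros; f_equal; simpl; ring).
    rewrite N3, O3; unfold f_strip; ring.
Qed.

(** The open parallelogram of the points [a t - b] with [a] and [b] between [0] and [1], described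
    without coordinates. *)
Definition both_strips (t z : C) : Prop := (0 < Im z < Im t)%R /\ (0 < Im (z / t) < Im (- (1) / t))%R.

Lemma both_strips_coords t a b : (0 < Im t)%R -> (0 < a < 1)%R -> (0 < b < 1)%R -> both_strips t (RtoC a * t - RtoC b).
Proof.
intros Ht Ha Hb; destruct (Im_inv_neg t Ht) as [Ht0 Hy]; split.
- replace (Im (RtoC a * t - RtoC b)) with (a * Im t)%R by (destruct t; simpl; ring). nra.
- replace ((RtoC a * t - RtoC b) / t) with (RtoC a + RtoC b * (- (1) / t)) by (field; exact Ht0).
  replace (Im (RtoC a + RtoC b * (- (1) / t))) with (b * Im (- (1) / t))%R by (set (y := - (1) / t); destruct y; simpl; ring).
  nra.
Qed.

Lemma Im_segment (a b : C) (s : R) : Im (a + RtoC s * (b - a)) = ((1 - s) * Im a + s * Im b)%R.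
Proof. destruct a, b; simpl; ring. Qed.

Lemma segment_between (lo hi x y s : R) : (lo < x < hi)%R -> (lo < y < hi)%R -> (0 <= s <= 1)%R -> (lo < (1 - s) * x + s * y < hi)%R.
Proof.
intros Hx Hy Hs; destruct (Req_dec s 0) as [->|Hs0]; [lra|].
assert (0 < s * (y - lo))%R by (apply Rmult_lt_0_compat; lra).
assert (0 < s * (hi - y))%R by (apply Rmult_lt_0_compat; lra).
assert (0 <= (1 - s) * (x - lo))%R by (apply Rmult_le_pos; lra).
assert (0 <= (1 - s) * (hi - x))%R by (apply Rmult_le_pos; lra).
lra.
Qed.

Lemma both_strips_convex t : Cconvex (both_strips t).
Proof.
intros a b s [A1 A2] [B1 B2] Hs; split.
- rewrite Im_segment; now apply segment_between.
- replace ((a + RtoC s * (b - a)) / t) with (a / t + RtoC s * (b / t - a / t)) by (unfold Cdiv; ring).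
  rewrite Im_segment; now apply segment_between.
Qed.

Lemma f_strip_D3 t : (0 < Im t)%R -> D3on (fun z => (0 < Im z < Im t)%R) (fun z => f_strip z t) (fun z => f_zzz z t).
Proof.
intros Ht; apply (f_branch_D3 strip (fun p => f_strip (fst p) (snd p)) _ t strip_open).
- intros p [H1 H2]; lra.
- intros z Hz; exact Hz.
- exact f_strip_branch.
Qed.

Lemma Cder_pow4 (k x : C) : D3on (fun _ => True) (fun z => k * z ^ 4) (fun z => 24 * k * z).
Proof.
exists (fun z => k * (4 * z ^ 3)), (fun z => k * (12 * z ^ 2)); intros w _; repeat split.
- apply Cder_scal, Cder_eq with (1 := Cder_pow 3 w); unfold natC; rewrite !INR_IZR_INZ; simpl; ring.
- apply Cder_scal, Cder_eq with (4 * (natC 3 * w ^ 2)); [apply Cder_scal, (Cder_pow 2)|].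
  unfold natC; rewrite !INR_IZR_INZ; simpl; ring.
- apply Cder_eq with (k * (12 * (natC 2 * w ^ 1))); [apply Cder_scal, Cder_scal, (Cder_pow 1)|].
  unfold natC; rewrite !INR_IZR_INZ; simpl; ring.
Qed.

(** The cube of [/ t] from the chain rule, the factor [t ^ 2] and the factor [t] of modularity
    cancel. The remaining [- z / t] is the third derivative of [- z^4 / (24 t)]. *)
Lemma inv_third_derivative (U : C -> Prop) (t : C) (f h : C -> C) : (0 < Im t)%R -> (forall z, U z -> off_lattice t z) ->
  D3on U f (fun z => f_zzz z t) -> D3on (fun x => U (x * t)) h (fun x => f_zzz x (- (1) / t)) ->
  D3on U (fun z => t ^ 2 * h (z / t) - f z + / (24 * t) * z ^ 4) (fun _ => 0).
Proof.
intros Ht HU Hf Hh; destruct (Im_inv_neg t Ht) as [Ht0 _].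
apply (D3on_affine _ (/ t) 0), (D3on_scal _ (t ^ 2)) in Hh.
assert (E : forall z, / t * z + 0 = z / t) by (intros; unfold Cdiv; ring).
assert (H4 : D3on U (fun z => / (24 * t) * z ^ 4) (fun z => 24 * / (24 * t) * z)).
{ apply D3on_mono with (2 := Cder_pow4 _ 0); auto. }
assert (Hh' : D3on U (fun z => t ^ 2 * h (/ t * z + 0)) (fun z => t ^ 2 * ((/ t) ^ 3 * f_zzz (/ t * z + 0) (- (1) / t)))).
{ apply D3on_mono with (2 := Hh); intros z Hz; rewrite E; replace (z / t * t) with z by (field; exact Ht0); exact Hz. }
destruct (D3on_plus _ _ _ _ _ (D3on_minus _ _ _ _ _ Hh' Hf) H4) as [f1 [f2 K]].
exists f1, f2; intros w Hw; destruct (K w Hw) as [K1 [K2 K3]]; repeat split; [|exact K2|].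
- apply Cder_ext_all with (2 := K1); intros z; now rewrite E.
- apply Cder_eq with (1 := K3); rewrite E, f_zzz_modular by auto; field; exact Ht0.
Qed.

Lemma seq_lim_corner (c p : C) : seq_lim (fun n => c + RtoC (/ INR (S n)) * (p - c)) c.
Proof.
intros eps He.
set (m := (Cmod (p - c) + 1)%R). assert (Hm : (0 < m)%R) by (pose proof (Cmod_ge_0 (p - c)); unfold m; lra).
destruct (INR_unbounded (m / eps)) as [N HN]; exists N; intros n Hn.
replace (c + RtoC (/ INR (S n)) * (p - c) - c) with (RtoC (/ INR (S n)) * (p - c)) by ring.
pose proof (INR_S_ge_1 n) as H1.
rewrite Cmod_mult, Cmod_R, Rabs_pos_eq by (left; apply Rinv_0_lt_compat; lra).
apply (Rmult_lt_reg_l (INR (S n))); [lra|]. rewrite <- Rmult_assoc, Rinv_r, Rmult_1_l by lra.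
apply Rlt_trans with m; [unfold m; lra|].
apply (Rmult_lt_compat_r eps) in HN; [|exact He]. unfold Rdiv in HN; rewrite Rmult_assoc, Rinv_l, Rmult_1_r in HN by lra.
assert (INR N <= INR (S n))%R by (apply le_INR; lia). nra.
Qed.

(** The quadratic polynomial is found from its values at the three corners
    [0], [-1], [t] of the parallelogram, where the series still converge. *)
Lemma f_strip_inversion t z : (0 < Im t)%R -> both_strips t z ->
  t ^ 2 * f_strip (z / t) (- (1) / t) - f_strip z t + / (24 * t) * z ^ 4 = / 8 * z ^ 2 + / 24 * (1 - t) * z.
Proof.
intros Ht Hz; destruct (Im_inv_neg t Ht) as [Ht0 Hy].
set (y := - (1) / t) in *.
set (D := fun z => t ^ 2 * f_strip (z / t) y - f_strip z t + / (24 * t) * z ^ 4).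
destruct (D3on_zero (both_strips t) D (both_strips_convex t)) as [a [b [c Habc]]].
{ apply (inv_third_derivative (both_strips t) t (fun z => f_strip z t) (fun x => f_strip x y)); [exact Ht | | |].
  - intros v [Hv _]; now apply off_lattice_strip.
  - apply D3on_mono with (2 := f_strip_D3 t Ht); intros v [Hv _]; exact Hv.
  - apply D3on_mono with (2 := f_strip_D3 y Hy); intros v [_ Hv].
    replace (v * t / t) with v in Hv by (field; exact Ht0); exact Hv. }
set (p := RtoC (/ 2) * t - RtoC (/ 2)).
assert (Hp : both_strips t p) by (apply both_strips_coords; [exact Ht | lra | lra]).
(* Boundary points are limits of interior points along segments towards [p], and both sides are
   continuous there. *)
assert (Hlim : forall c0 : C, (0 <= Im c0 <= Im t)%R -> (0 <= Im (c0 / t) <= Im y)%R -> D c0 = a + b * c0 + c * c0 ^ 2).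
{ intros c0 H1 H2.
  set (u := fun n => c0 + RtoC (/ INR (S n)) * (p - c0)).
  assert (Hs : forall n, (0 < / INR (S n) <= 1)%R).
  { intros n; pose proof (INR_S_ge_1 n); split; [apply Rinv_0_lt_compat; lra|].
    rewrite <- Rinv_1; apply Rinv_le_contravar; lra. }
  assert (Hu : forall n, both_strips t (u n)).
  { intros n; specialize (Hs n); destruct Hp as [P1 P2]; fold y in P2; unfold u; split.
    - rewrite Im_segment; split; nra.
    - replace ((c0 + RtoC (/ INR (S n)) * (p - c0)) / t) with (c0 / t + RtoC (/ INR (S n)) * (p / t - c0 / t)) by (unfold Cdiv; ring).
      fold y; rewrite Im_segment; split; nra. }
  assert (Lu : seq_lim u c0) by apply seq_lim_corner.
  assert (Lx : seq_lim (fun n => u n / t) (c0 / t)).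
  { apply (seq_lim_ext (fun n => / t * u n)); [intros; unfold Cdiv; ring|].
    replace (c0 / t) with (/ t * c0) by (unfold Cdiv; ring). now apply seq_lim_scal. }
  apply seq_lim_unique with (fun n => D (u n)).
  - unfold D; apply seq_lim_plus; [apply seq_lim_minus|].
    + apply seq_lim_scal, f_strip_seq_lim; [exact Hy | | exact H2 | exact Lx].
      intros n; destruct (Hu n) as [_ K]; fold y in K; lra.
    + apply f_strip_seq_lim; [exact Ht | | exact H1 | exact Lu].
      intros n; destruct (Hu n) as [K _]; lra.
    + now apply seq_lim_scal, seq_lim_pow.
  - apply (seq_lim_ext (fun n => a + b * u n + c * u n ^ 2)); [intros n; symmetry; apply Habc, Hu|].
    apply seq_lim_plus; [apply seq_lim_plus; [apply seq_lim_const | now apply seq_lim_scal] | now apply seq_lim_scal, seq_lim_pow]. }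
assert (I0 : forall w, Im (0 / w) = 0%R) by (intros w; unfold Cdiv; rewrite Cmult_0_l; reflexivity).
pose proof (Hlim 0) as C0. rewrite I0 in C0; change (Im (RtoC 0)) with 0%R in C0; specialize (C0 ltac:(lra) ltac:(lra)).
pose proof (Hlim (- (1))) as C1.
assert (Im1 : Im (- (1)) = 0%R) by (simpl; ring).
rewrite Im1 in C1; fold y in C1; specialize (C1 ltac:(lra) ltac:(lra)).
pose proof (Hlim t) as C2. replace (t / t) with (RtoC 1) in C2 by (field; exact Ht0); change (Im (RtoC 1)) with 0%R in C2.
specialize (C2 ltac:(lra) ltac:(lra)).
unfold D in C0, C1, C2.
replace (0 / t) with (RtoC 0) in C0 by (unfold Cdiv; ring). rewrite !f_strip_0 in C0.
fold y in C1.
assert (Em1 : f_strip (- (1)) t = - (/ 12 + / 24 * t)).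
{ pose proof (f_strip_add_1 (- (1)) t) as K. replace (- (1) + 1) with (RtoC 0) in K by ring. rewrite f_strip_0 in K.
  transitivity (0 - (/ 12 * (3 * (- (1)) ^ 2 + 3 * - (1) + 1) - / 24 * (2 * - (1) + 1) * t)); [rewrite K; ring | ring]. }
rewrite f_strip_tau, Em1 in C1. rewrite f_strip_tau in C2.
replace (t / t) with (0 + 1) in C2 by (field; exact Ht0). rewrite f_strip_add_1, f_strip_0 in C2.
assert (Ea : a = 0) by (transitivity (a + b * 0 + c * 0 ^ 2); [ring | rewrite <- C0; ring]).
(* Up to sign, [t (t + 1)] is the determinant of the two equations for [b] and [c] from the corners
   [- 1] and [t]. *)
assert (Ht1 : t + 1 <> 0).
{ intros E; apply (f_equal Im) in E; destruct t; simpl in *; lra. }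
assert (Ec : c = / 8).
{ assert (K1 : c - b = / 12 + / 24 * t).
  { transitivity (a + b * - (1) + c * (- (1)) ^ 2 - a); [ring|]. rewrite <- C1, Ea; unfold y; field; exact Ht0. }
  assert (K2 : b * t + c * t ^ 2 = / 12 * t ^ 2 + / 24 * t).
  { transitivity (a + b * t + c * t ^ 2 - a); [ring|]. rewrite <- C2, Ea; unfold y; field; exact Ht0. }
  transitivity (((c - b) * t + (b * t + c * t ^ 2)) / (t * (t + 1))); [field; split; assumption|].
  rewrite K1, K2; field; split; assumption. }
assert (Eb : b = / 24 - / 24 * t).
{ transitivity (c + a - (a + b * - (1) + c * (- (1)) ^ 2)); [ring|]. rewrite <- C1, Ea, Ec; unfold y; field; exact Ht0. }
change (D z = / 8 * z ^ 2 + / 24 * (1 - t) * z).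
rewrite Habc by exact Hz. rewrite Ea, Eb, Ec; ring.
Qed.

(** * Inversion *)

Definition sub (s k l : C) (p : C * C) : C * C := (aff s k l p, snd p).

Lemma sub_pdisc s k l p d : (0 < d)%R -> exists e, (0 < e)%R /\ forall q, pdisc p e q -> pdisc (sub s k l p) d (sub s k l q).
Proof.
intros Hd; destruct (aff_cont s k l p d Hd) as [e [He K]].
exists (Rmin e d); split; [now apply Rmin_pos|]; intros q Hq; split; cbn [sub fst snd].
- apply K, pdisc_mono with (2 := Hq), Rmin_l.
- apply (pdisc_mono _ _ d _ (Rmin_r e d) Hq).
Qed.

Lemma sub_open s k l (Om : C * C -> Prop) : open Om -> open (fun p => Om (sub s k l p)).
Proof.
intros HO; apply open_of_pdisc; intros p Hp; destruct (open_pdisc Om _ HO Hp) as [d [Hd K]].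
destruct (sub_pdisc s k l p d Hd) as [e [He K']]; exists e; split; auto.
Qed.

Lemma quad_sub s k l P : quad P -> quad (fun p => P (sub s k l p)).
Proof.
intros [a [b [c [d [e [f H]]]]]].
exists (a + b * l + d * l ^ 2), (b * s + 2 * d * s * l), (b * k + c + 2 * d * k * l + e * l),
  (d * s ^ 2), (2 * d * s * k + e * s), (d * k ^ 2 + e * k + f).
intros p; rewrite H; unfold sub, aff; cbn [fst snd]; ring.
Qed.

Lemma li3_branch_sub_pullback w Om L s k l : li3_branch w Om L ->
  li3_branch (fun p => w (sub s k l p)) (fun p => Om (sub s k l p)) (fun p => L (sub s k l p)).
Proof.
intros H p Hp; destruct (H _ Hp) as [e [d [f [P [He [Hd [HP [HD K]]]]]]]].
destruct (sub_pdisc s k l p e He) as [e' [He' K']].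
exists e', d, f, (fun p => P (sub s k l p)).
split; [exact He'|]; split; [exact Hd|]; split; [now apply quad_sub|]; split; [exact HD|].
intros q Hq; apply K, K', Hq.
Qed.

(** [li3_D3] has period [1], so an integer added to the argument is immaterial. *)
Lemma li3_branch_int w Om L (k : Z) : li3_branch w Om L -> li3_branch (fun p => w p + ZC k) Om L.
Proof.
intros H p Hp; destruct (H _ Hp) as [e [d [f [P [He [Hd [HP [HD K]]]]]]]].
exists e, d, (fun x => f (1 * x + - ZC k)), P.
split; [exact He|]; split; [exact Hd|]; split; [exact HP|]; split.
- destruct (D3on_affine _ 1 (- ZC k) _ _ HD) as [f1 [f2 K']]; exists f1, f2; intros x Hx.
  destruct (K' x) as [K1 [K2 K3]].
  + unfold disc in *; replace (1 * x + - ZC k - w p) with (x - (w p + ZC k)) by ring; exact Hx.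
  + repeat split; try assumption. apply Cder_eq with (1 := K3).
    replace (li3_D3 x) with (li3_D3 (1 * x + - ZC k)); [ring|].
    unfold li3_D3; replace (e2pi (1 * x + - ZC k)) with (e2pi x); [reflexivity|].
    rewrite e2pi_add, e2pi_opp; unfold ZC; rewrite e2pi_Z, Cmult_1_l; field.
- intros q Hq; destruct (K q Hq) as [K1 K2]; split.
  + unfold disc in *; replace (w q + ZC k - (w p + ZC k)) with (w q - w p) by ring; exact K1.
  + rewrite K2; f_equal; f_equal; ring.
Qed.

Lemma branch_series_sub w v Om S0 s k l : branch_series w v Om S0 ->
  branch_series (fun n p => w n (sub s k l p)) (fun n p => v n (sub s k l p)) (fun p => Om (sub s k l p)) (fun p => S0 (sub s k l p)).
Proof.
intros [L [M [TL [TM H]]]]; exists (fun n p => L n (sub s k l p)), (fun n p => M n (sub s k l p)).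
split; [|split].
- intros n; apply (li3_branch_sub_pullback _ _ _ s k l (TL n)).
- intros n; apply (li3_branch_sub_pullback _ _ _ s k l (TM n)).
- intros p Hp; apply H, Hp.
Qed.

Lemma f_branch_shift_int (Om : C * C -> Prop) (F : C * C -> C) (l : Z) : open Om -> f_branch Om F ->
  f_branch (fun p => Om (fst p - ZC l, snd p)) (fun p => F (fst p - ZC l, snd p)).
Proof.
intros HO HF.
assert (E : forall p, sub 1 0 (- ZC l) p = (fst p - ZC l, snd p)) by (intros p; unfold sub, aff; f_equal; ring).
apply (branch_series_sub _ _ _ _ 1 0 (- ZC l)) in HF.
destruct HF as [L [M [TL [TM H]]]].
set (Om' := fun p : C * C => Om (fst p - ZC l, snd p)).
assert (HO' : open Om').
{ apply open_ext with (2 := sub_open 1 0 (- ZC l) Om HO); intros p; now rewrite E. }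
assert (HS : forall p, Om' p -> Om (sub 1 0 (- ZC l) p)) by (intros p Hp; now rewrite E).
set (P := fun p : C * C => / 12 * (fst p ^ 3 - (fst p - ZC l) ^ 3) - / 24 * (fst p ^ 2 - (fst p - ZC l) ^ 2) * snd p).
assert (G' : f_branch Om' (fun p => F (fst p - ZC l, snd p) + P p)).
{ exists L, M; split; [|split].
  - intros n; apply li3_branch_ext with (fun p => W n (sub 1 0 (- ZC l) p) + ZC l) (L n); auto.
    + intros p; rewrite E; unfold W, aff; cbn [fst snd]; ring.
    + apply li3_branch_int; apply li3_branch_sub with (2 := TL n); exact HS.
  - intros n; apply li3_branch_ext with (fun p => V n (sub 1 0 (- ZC l) p) + ZC (- l)) (M n); auto.
    + intros p; rewrite E; unfold V, aff, ZC; rewrite opp_IZR, RtoC_opp; cbn [fst snd]; ring.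
    + apply li3_branch_int; apply li3_branch_sub with (2 := TM n); exact HS.
  - intros p Hp; destruct (H p (HS p Hp)) as [SL [SM [H1 [H2 H3]]]]; exists SL, SM; repeat split; try assumption.
    rewrite E in H3; rewrite <- H3; unfold P; cbn [fst snd]; ring. }
apply f_branch_ext with (fun p => (F (fst p - ZC l, snd p) + P p) + - P p); [intros p _; ring|].
apply f_branch_quad; [|exact G']. apply quad_opp; unfold P.
exists (/ 12 * ZC l ^ 3), (- (/ 12 * 3 * ZC l ^ 2)), (/ 24 * ZC l ^ 2), (/ 12 * 3 * ZC l), (- (/ 24 * 2 * ZC l)), 0; intros p; ring.
Qed.

(** The cubic of the translation law is written as the increment of [z^4 / (24 tau)] from [z] to
    [z + tau], so that iterated translations telescope. *)
Lemma f_branch_add_tau (Om : C * C -> Prop) (F : C * C -> C) : open Om -> (forall p, Om p -> regular_point p) -> f_branch Om F ->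
  f_branch (fun p => Om (fst p + snd p, snd p)) (fun p => F (fst p + snd p, snd p) - / (24 * snd p) * ((fst p + snd p) ^ 4 - fst p ^ 4)).
Proof.
intros HO HR HF.
assert (E : forall p, sub 1 1 0 p = (fst p + snd p, snd p)) by (intros p; unfold sub, aff; f_equal; ring).
set (Om' := fun p : C * C => Om (fst p + snd p, snd p)).
assert (HO' : open Om') by (apply open_ext with (2 := sub_open 1 1 0 Om HO); intros p; now rewrite E).
apply (branch_series_sub _ _ _ _ 1 1 0) in HF.
assert (HF' : branch_series (fun n p => W n (sub 1 1 0 p)) (fun n p => V n (sub 1 1 0 p)) Om'
  (fun p => F (fst p + snd p, snd p) - (/ 12 * (fst p + snd p) ^ 3 - / 24 * (fst p + snd p) ^ 2 * snd p - li3_one (snd p)))).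
{ destruct HF as [L [M [TL [TM H]]]]; exists L, M; split; [|split].
  - intros n; apply li3_branch_sub with (2 := TL n); intros p Hp; now rewrite E.
  - intros n; apply li3_branch_sub with (2 := TM n); intros p Hp; now rewrite E.
  - intros p Hp; specialize (H p); rewrite E in H; now apply H. }
apply branch_series_move in HF'; [| exact HO' | | | |].
- apply branch_series_ext with (2 := HF'); intros p Hp; destruct (HR _ Hp) as [Ht _]; cbn [snd] in Ht.
  destruct (Im_inv_neg _ Ht) as [Ht0 _]; field; exact Ht0.
- intros p Hp; destruct (HR _ Hp) as [Ht Hn]; cbn [fst snd] in *; split; [exact Ht|]; intros m n En.
  apply (Hn m (n + 1)%Z); rewrite plus_IZR, RtoC_plus, En; ring.
- intros p; rewrite E; unfold V, W, aff, natC; simpl INR; cbn [fst snd]; ring.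
- intros n p; rewrite E; unfold W, aff; rewrite natC_S; cbn [fst snd]; ring.
- intros n p; rewrite E; unfold V, aff; rewrite (natC_S (S n)); cbn [fst snd]; ring.
Qed.

Lemma f_branch_opp (Om : C * C -> Prop) (F : C * C -> C) : open Om -> (forall p, Om p -> regular_point p) -> f_branch Om F ->
  f_branch (fun p => Om (- fst p, snd p)) (fun p => F (- fst p, snd p)).
Proof.
intros HO HR HF.
assert (E : forall p, sub (- (1)) 0 0 p = (- fst p, snd p)) by (intros p; unfold sub, aff; f_equal; ring).
set (Om' := fun p : C * C => Om (- fst p, snd p)).
assert (HO' : open Om') by (apply open_ext with (2 := sub_open (- (1)) 0 0 Om HO); intros p; now rewrite E).
apply (branch_series_sub _ _ _ _ (- (1)) 0 0), branch_series_swap in HF.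
assert (HF' : branch_series (fun n p => V n (sub (- (1)) 0 0 p)) (fun n p => W n (sub (- (1)) 0 0 p)) Om'
  (fun p => F (- fst p, snd p) - (- / 12 * fst p ^ 3 - / 24 * fst p ^ 2 * snd p - li3_one (snd p)))).
{ destruct HF as [L [M [TL [TM H]]]]; exists L, M; split; [|split].
  - intros n; apply li3_branch_sub with (2 := TL n); intros p Hp; now rewrite E.
  - intros n; apply li3_branch_sub with (2 := TM n); intros p Hp; now rewrite E.
  - intros p Hp; specialize (H p); rewrite E in H; cbn [fst snd] in H.
    destruct (H Hp) as [SL [SM [H1 [H2 H3]]]]; exists SL, SM; repeat split; try assumption; rewrite <- H3; ring. }
apply branch_series_move in HF'; [| exact HO' | | | |].
- apply branch_series_ext with (2 := HF'); intros p Hp; field.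
- intros p Hp; destruct (HR _ Hp) as [Ht Hn]; cbn [fst snd] in *; split; [exact Ht|]; intros m n En.
  apply (Hn (- m)%Z (- n)%Z); rewrite !opp_IZR, !RtoC_opp, En; ring.
- intros p; rewrite E; unfold W, aff, natC; simpl INR; cbn [fst snd]; ring.
- intros n p; rewrite E; unfold V, W, aff; cbn [fst snd]; ring.
- intros n p; rewrite E; unfold V, W, aff; cbn [fst snd]; ring.
Qed.

Lemma regular_off_lattice p : regular_point p <-> (0 < Im (snd p))%R /\ off_lattice (snd p) (fst p).
Proof.
split; intros [H1 H2]; split; try exact H1.
- intros [m [n E]]; exact (H2 m n E).
- intros m n E; apply H2; now exists m, n.
Qed.

Lemma open_shift (Om : C * C -> Prop) (k : C) : open Om -> open (fun p => Om (fst p - k * snd p, snd p)).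
Proof.
intros HO; apply open_ext with (2 := sub_open 1 (- k) 0 Om HO); intros [a b].
unfold sub, aff; cbn [fst snd]; replace (1 * a + - k * b + 0) with (a - k * b) by ring; reflexivity.
Qed.

Lemma regular_shift (Om : C * C -> Prop) (k : Z) : (forall p, Om p -> regular_point p) ->
  forall p, Om (fst p - ZC k * snd p, snd p) -> regular_point p.
Proof.
intros HR p Hp; destruct (HR _ Hp) as [Ht Hn]; cbn [fst snd] in *; split; [exact Ht|]; intros m n En.
apply (Hn m (n - k)%Z); rewrite minus_IZR, RtoC_minus, En; unfold ZC; ring.
Qed.

Definition shifted (k : C) (F : C * C -> C) (p : C * C) : C :=
  F (fst p - k * snd p, snd p) + / (24 * snd p) * (fst p ^ 4 - (fst p - k * snd p) ^ 4).

Lemma f_branch_ext_dom (Om Om' : C * C -> Prop) (F G : C * C -> C) : (forall p, Om' p -> Om p) ->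
  (forall p, Om' p -> F p = G p) -> f_branch Om F -> f_branch Om' G.
Proof. intros H1 H2 H; apply f_branch_ext with F; [exact H2 | now apply f_branch_sub with Om]. Qed.

Lemma f_branch_shift_minus (Om : C * C -> Prop) (F : C * C -> C) : open Om -> (forall p, Om p -> regular_point p) -> forall n, f_branch Om F ->
  f_branch (fun p => Om (fst p - - natC n * snd p, snd p)) (shifted (- natC n) F).
Proof.
intros HO HR n HF; induction n as [|n IH].
- assert (E : forall p : C * C, (fst p - - natC 0 * snd p, snd p) = p).
  { intros [a b]; unfold natC; simpl INR; cbn [fst snd]; f_equal; ring. }
  apply f_branch_ext_dom with (3 := HF); intros p Hp; [now rewrite E in Hp|].
  unfold shifted; rewrite E; unfold natC; simpl INR; ring.
- assert (HO' : open (fun p => Om (fst p - - natC n * snd p, snd p))) by now apply open_shift.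
  apply f_branch_add_tau in IH; [| exact HO' |].
  + assert (E : forall p : C * C, (fst p + snd p - - natC n * snd p, snd p) = (fst p - - natC (S n) * snd p, snd p)).
    { intros p; rewrite natC_S; f_equal; ring. }
    apply f_branch_ext_dom with (3 := IH); intros p Hp; unfold shifted; cbn [fst snd] in *.
    * now rewrite E.
    * rewrite E, natC_S; ring.
  + intros p Hp; apply (regular_shift Om (- Z.of_nat n) HR p).
    unfold ZC; rewrite opp_IZR, RtoC_opp, <- natC_IZR; exact Hp.
Qed.

(** Nonnegative multiples are reduced to nonpositive ones by a reflection before and after the
    translation. *)
Lemma f_branch_shift_tau (Om : C * C -> Prop) (F : C * C -> C) (k : Z) : open Om -> (forall p, Om p -> regular_point p) -> f_branch Om F ->
  f_branch (fun p => Om (fst p - ZC k * snd p, snd p)) (shifted (ZC k) F).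
Proof.
intros HO HR HF; destruct (Z_le_dec 0 k) as [Hk|Hk].
- assert (HOo : open (fun p => Om (- fst p, snd p))).
  { apply open_ext with (2 := sub_open (- (1)) 0 0 Om HO); intros [a b]; unfold sub, aff; cbn [fst snd].
    replace (- (1) * a + 0 * b + 0) with (- a) by ring; reflexivity. }
  assert (HRo : forall p, Om (- fst p, snd p) -> regular_point p).
  { intros p Hp; apply regular_off_lattice; destruct (proj1 (regular_off_lattice _) (HR _ Hp)) as [H1 H2]; cbn [fst snd] in *.
    split; [exact H1|]. replace (fst p) with (- - fst p) by ring; now apply off_lattice_opp. }
  pose proof (f_branch_shift_minus _ _ HOo HRo (Z.to_nat k) (f_branch_opp Om F HO HR HF)) as H.
  assert (Ek : natC (Z.to_nat k) = ZC k) by (rewrite natC_IZR, Z2Nat.id by exact Hk; reflexivity).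
  rewrite Ek in H.
  apply f_branch_opp in H.
  + assert (E : forall p : C * C, (- (- fst p - - ZC k * snd p), snd p) = (fst p - ZC k * snd p, snd p)) by (intros p; f_equal; ring).
    apply f_branch_ext_dom with (3 := H); intros p Hp; unfold shifted; cbn [fst snd] in *.
    * now rewrite E.
    * rewrite E; ring.
  + now apply (open_shift (fun p => Om (- fst p, snd p))).
  + intros p Hp; apply (regular_shift (fun p => Om (- fst p, snd p)) (- k)%Z HRo p).
    unfold ZC in *; rewrite opp_IZR, RtoC_opp; exact Hp.
- pose proof (f_branch_shift_minus _ _ HO HR (Z.to_nat (- k)) HF) as H.
  assert (Ek : - natC (Z.to_nat (- k)) = ZC k) by (rewrite natC_IZR, Z2Nat.id by lia; unfold ZC; rewrite opp_IZR, RtoC_opp; ring).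
  rewrite Ek in H; exact H.
Qed.

Lemma strip_regular p : strip p -> regular_point p.
Proof. intros H; apply regular_off_lattice; split; [unfold strip in H; lra | now apply off_lattice_strip]. Qed.

(** A branch of [f] where [k tau + l] is subtracted from [z] to reach the strip. *)
Definition f_shifted (k l : Z) (p : C * C) : C :=
  f_strip (fst p - ZC l - ZC k * snd p) (snd p)
  + / (24 * snd p) * ((fst p - ZC l) ^ 4 - (fst p - ZC l - ZC k * snd p) ^ 4).

Lemma f_shifted_f_branch k l : f_branch (fun p => strip (fst p - ZC l - ZC k * snd p, snd p)) (f_shifted k l).
Proof.
pose proof (f_branch_shift_tau strip (fun p => f_strip (fst p) (snd p)) k strip_open strip_regular f_strip_branch) as H.
apply (f_branch_shift_int _ _ l) in H; [exact H|].
apply (open_shift strip), strip_open.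
Qed.

Lemma inv_pdisc (p : C * C) (d : R) : snd p <> 0 -> (0 < d)%R -> exists e, (0 < e)%R /\
  forall q, pdisc p e q -> snd q <> 0 /\ disc (fst p / snd p) d (fst q / snd q) /\ disc (- (1) / snd p) d (- (1) / snd q).
Proof.
intros Hp Hd; set (m := Cmod (snd p)). assert (Hm : (0 < m)%R) by now apply (proj1 (Cmod_gt_0 _)).
set (A := (Cmod (fst p) + m + 1)%R). assert (HA : (0 < A)%R) by (pose proof (Cmod_ge_0 (fst p)); unfold A; lra).
set (e := Rmin (m / 2) (d * m ^ 2 / (2 * A))).
assert (He : (0 < e)%R) by (apply Rmin_pos; [lra | apply Rdiv_lt_0_compat; [apply Rmult_lt_0_compat; [exact Hd | now apply pow_lt] | lra]]).
assert (E1 : (e <= m / 2)%R) by apply Rmin_l.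
assert (E2 : (e * A * 2 <= d * m ^ 2)%R).
{ apply Rle_trans with (d * m ^ 2 / (2 * A) * A * 2)%R; [|right; field; lra].
  apply Rmult_le_compat_r; [lra|]; apply Rmult_le_compat_r; [lra | apply Rmin_r]. }
exists e; split; [exact He|]; intros q [K1 K2]; unfold disc in *.
assert (Hq : (m / 2 < Cmod (snd q))%R).
{ pose proof (Cmod_triangle_rev (snd p) (snd p - snd q)) as T; replace (snd p - (snd p - snd q)) with (snd q) in T by ring.
  rewrite (Cmod_sub_sym (snd p)) in T; fold m in T; lra. }
assert (Hq0 : snd q <> 0) by (apply (proj2 (Cmod_gt_0 _)); lra).
split; [exact Hq0|].
assert (Hden : (m ^ 2 / 2 < m * Cmod (snd q))%R) by nra.
assert (K : forall N : C, (Cmod N < e * A)%R -> (Cmod (N / (snd p * snd q)) < d)%R).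
{ intros N HN; rewrite Cmod_div by now apply Cmult_neq_0. rewrite Cmod_mult; fold m.
  apply (Rmult_lt_reg_r (m * Cmod (snd q))); [nra|]. unfold Rdiv; rewrite Rmult_assoc, Rinv_l, Rmult_1_r by nra.
  apply Rlt_le_trans with (1 := HN). nra. }
split.
- replace (fst q / snd q - fst p / snd p) with ((snd p * (fst q - fst p) - fst p * (snd q - snd p)) / (snd p * snd q)) by (field; split; assumption).
  apply K. eapply Rle_lt_trans; [apply Cmod_triangle|]; rewrite Cmod_opp, !Cmod_mult; fold m.
  pose proof (Cmod_ge_0 (fst p)). unfold A; nra.
- replace (- (1) / snd q - - (1) / snd p) with ((snd q - snd p) / (snd p * snd q)) by (field; split; assumption).
  apply K; pose proof (Cmod_ge_0 (fst p)); unfold A; nra.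
Qed.

(** Applying [invt] twice gives [(- z, tau)], so its inverse [invt'] carries a sign. *)
Definition invt (p : C * C) : C * C := (fst p / snd p, - (1) / snd p).
Definition invt' (p : C * C) : C * C := (- (fst p / snd p), - (1) / snd p).

Lemma invt'_invt (p : C * C) : snd p <> 0 -> invt' (invt p) = p.
Proof. destruct p as [z t]; cbn [snd]; intros H; unfold invt, invt'; cbn [fst snd]; f_equal; field; exact H. Qed.

Lemma invt_invt' (p : C * C) : snd p <> 0 -> invt (invt' p) = p.
Proof. destruct p as [z t]; cbn [snd]; intros H; unfold invt, invt'; cbn [fst snd]; f_equal; field; exact H. Qed.

Lemma invt_pdisc (p : C * C) (d : R) : snd p <> 0 -> (0 < d)%R -> exists e, (0 < e)%R /\
  forall q, pdisc p e q -> snd q <> 0 /\ pdisc (invt p) d (invt q).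
Proof.
intros Hp Hd; destruct (inv_pdisc p d Hp Hd) as [e [He K]]; exists e; split; [exact He|]; intros q Hq.
destruct (K q Hq) as [K1 [K2 K3]]; split; [exact K1 | split; assumption].
Qed.

Lemma invt'_pdisc (p : C * C) (d : R) : snd p <> 0 -> (0 < d)%R -> exists e, (0 < e)%R /\
  forall q, pdisc p e q -> snd q <> 0 /\ pdisc (invt' p) d (invt' q).
Proof.
intros Hp Hd; destruct (inv_pdisc p d Hp Hd) as [e [He K]]; exists e; split; [exact He|]; intros q Hq.
destruct (K q Hq) as [K1 [K2 K3]]; split; [exact K1 | split; [|exact K3]].
unfold disc, invt' in *; cbn [fst snd].
rewrite <- Cmod_opp; replace (- (- (fst q / snd q) - - (fst p / snd p))) with (fst q / snd q - fst p / snd p) by ring; exact K2.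
Qed.

Lemma regular_snd (p : C * C) : regular_point p -> snd p <> 0.
Proof. intros [H _]; apply (Im_inv_neg _ H). Qed.

Lemma regular_invt p : regular_point p -> regular_point (invt p).
Proof.
intros H; apply regular_off_lattice in H; destruct H as [H1 H2]; apply regular_off_lattice; split; cbn [invt fst snd].
- now apply Im_inv_neg.
- now apply off_lattice_inv.
Qed.

(** The image under [invt] of the points of [Om] with nonzero [tau]. *)
Definition inv_dom (Om : C * C -> Prop) (p : C * C) : Prop := snd p <> 0 /\ Om (invt' p).

Lemma inv_dom_open (Om : C * C -> Prop) : open Om -> open (inv_dom Om).
Proof.
intros HO; apply open_of_pdisc; intros p [Hp HOp].
destruct (open_pdisc Om _ HO HOp) as [d [Hd K]]; destruct (invt'_pdisc p d Hp Hd) as [e [He K']].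
exists e; split; [exact He|]; intros q Hq; destruct (K' q Hq); split; auto.
Qed.

Lemma inv_dom_regular (Om : C * C -> Prop) : (forall p, Om p -> regular_point p) -> forall p, inv_dom Om p -> regular_point p.
Proof.
intros HR p [Hp HO]; rewrite <- (invt_invt' p Hp); now apply regular_invt, HR.
Qed.

Lemma mv_Li3_inv (h h' : C * C -> C) (Om : C * C -> Prop) (L : C * C -> C) :
  (forall p : C * C, snd p <> 0 -> h (invt' p) = h' p) -> mv_Li3 h Om L -> mv_Li3 h' (inv_dom Om) (fun p => L (invt' p)).
Proof.
intros E H p [Hp HO]; destruct (H _ HO) as [c [r [g [Hg [Hr HL]]]]].
exists c, r, g; split; [exact Hg|]; split; [now rewrite <- E|].
apply locally_pdisc in HL; destruct HL as [d [Hd K]]; apply locally_pdisc.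
destruct (invt'_pdisc p d Hp Hd) as [e [He K']]; exists e; split; [exact He|]; intros q Hq.
destruct (K' q Hq) as [K1 K2]; rewrite (K _ K2), E by exact K1; reflexivity.
Qed.

(** Read in the inverted coordinates, a branch of the transformed function is a branch of [f]
    itself, so the results on [f_branch] apply to it. *)
Lemma mv_f_inv (Om : C * C -> Prop) (F : C * C -> C) :
  mv_f (fun p => fst p / snd p) (fun p => - (1) / snd p) Om F ->
  mv_f (fun p => fst p) (fun p => snd p) (inv_dom Om) (fun p => F (invt' p)).
Proof.
assert (Ez : forall p : C * C, snd p <> 0 -> fst (invt' p) / snd (invt' p) = fst p).
{ intros p Hp; unfold invt'; cbn [fst snd]; field; exact Hp. }
assert (Et : forall p : C * C, snd p <> 0 -> - (1) / snd (invt' p) = snd p).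
{ intros p Hp; unfold invt'; cbn [fst snd]; field; exact Hp. }
intros [G [[L [M [TL [TM HG]]]] HF]].
exists (fun p => G (invt' p)); split.
- exists (fun n p => L n (invt' p)), (fun n p => M n (invt' p)); split; [|split].
  + intros n; apply mv_Li3_inv with (2 := TL n); intros p Hp; now rewrite Ez, Et.
  + intros n; apply mv_Li3_inv with (2 := TM n); intros p Hp; now rewrite Ez, Et.
  + intros p [Hp HO]; destruct (HG _ HO) as [SL [SM [H1 [H2 H3]]]]; exists SL, SM; repeat split; try assumption.
    rewrite Ez, Et in H3 by exact Hp; exact H3.
- intros p [Hp HO]; rewrite (HF _ HO), Et by exact Hp; reflexivity.
Qed.

Lemma quad_poly_zero (a b c c0 : C) (r : R) : (0 < r)%R -> (forall z, disc c0 r z -> a + b * z + c * z ^ 2 = 0) ->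
  forall z : C, a + b * z + c * z ^ 2 = 0.
Proof.
intros Hr H z; set (h := RtoC (r / 2)).
assert (Hh : h <> 0) by (intros E; apply RtoC_inj in E; lra).
assert (Ch : Cmod h = (r / 2)%R) by (unfold h; rewrite Cmod_R, Rabs_pos_eq; lra).
set (f := fun z => a + b * z + c * z ^ 2).
assert (H0 : f c0 = 0) by (apply H, disc_center, Hr).
assert (H1 : f (c0 + h) = 0) by (apply H; unfold disc; replace (c0 + h - c0) with h by ring; lra).
assert (H2 : f (c0 - h) = 0) by (apply H; unfold disc; replace (c0 - h - c0) with (- h) by ring; rewrite Cmod_opp; lra).
change (f z = 0).
transitivity (f c0 + (z - c0) / h * ((f (c0 + h) - f (c0 - h)) / 2) + ((z - c0) / h) ^ 2 / 2 * (f (c0 + h) + f (c0 - h) - 2 * f c0)).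
- unfold f; field; exact Hh.
- rewrite H0, H1, H2; field; exact Hh.
Qed.

(** The factor [tau^2] clears the denominators of all six monomials and permutes them up to sign. *)
Lemma quad_inv P : quad P -> exists P', quad P' /\ forall p : C * C, snd p <> 0 -> snd p ^ 2 * P (invt p) = P' p.
Proof.
intros [a [b [c [d [e [f H]]]]]].
exists (fun p => f + - e * fst p + - c * snd p + d * fst p ^ 2 + b * fst p * snd p + a * snd p ^ 2); split.
- now exists f, (- e), (- c), d, b, a.
- intros p Hp; rewrite H; unfold invt; cbn [fst snd]; field; exact Hp.
Qed.

(** A small translation along [t + 1] makes both real coordinates nonintegral; subtracting a lattice
    point then lands in the open parallelogram. *)
Lemma generic_point t z e : (0 < Im t)%R -> (0 < e)%R -> exists (z1 : C) (k l : Z), disc z e z1 /\ both_strips t (z1 - ZC l - ZC k * t).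
Proof.
intros Ht He; destruct (lattice_coords t z Ht) as [a [b E]].
destruct (archimed a) as [A1 A2], (archimed b) as [B1 B2].
set (m := (Cmod t + 1)%R). assert (Hm : (0 < m)%R) by (pose proof (Cmod_ge_0 t); unfold m; lra).
set (d := (Rmin (e / m) (Rmin (IZR (up a) - a) (IZR (up b) - b)) / 2)%R).
assert (Hem : (0 < e / m)%R) by now apply Rdiv_lt_0_compat.
assert (H1 : (0 < Rmin (IZR (up a) - a) (IZR (up b) - b))%R) by (apply Rmin_pos; lra).
assert (Hd : (0 < d)%R) by (unfold d; pose proof (Rmin_pos _ _ Hem H1); lra).
assert (Hd1 : (d < e / m)%R) by (unfold d in *; pose proof (Rmin_l (e / m) (Rmin (IZR (up a) - a) (IZR (up b) - b))); lra).
assert (Hd2 : (d < IZR (up a) - a /\ d < IZR (up b) - b)%R).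
{ pose proof (Rmin_r (e / m) (Rmin (IZR (up a) - a) (IZR (up b) - b))).
  pose proof (Rmin_l (IZR (up a) - a) (IZR (up b) - b)); pose proof (Rmin_r (IZR (up a) - a) (IZR (up b) - b)).
  unfold d in *; lra. }
exists (z + RtoC d * (t + 1)), (up a - 1)%Z, (up b); split.
- unfold disc; replace (z + RtoC d * (t + 1) - z) with (RtoC d * (t + 1)) by ring.
  rewrite Cmod_mult, Cmod_R, Rabs_pos_eq by lra.
  apply Rle_lt_trans with (d * m)%R.
  + apply Rmult_le_compat_l; [lra|]. eapply Rle_trans; [apply Cmod_triangle|]; rewrite Cmod_1; unfold m; lra.
  + apply (Rmult_lt_compat_r m) in Hd1; [|exact Hm]. replace (e / m * m)%R with e in Hd1 by (field; lra). exact Hd1.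
- replace (z + RtoC d * (t + 1) - ZC (up b) - ZC (up a - 1) * t)
    with (RtoC (a + d - (IZR (up a) - 1)) * t - RtoC (IZR (up b) - (b + d))).
  + apply both_strips_coords; [exact Ht | lra | lra].
  + rewrite E; unfold ZC; rewrite minus_IZR, !RtoC_minus, !RtoC_plus; ring.
Qed.

Lemma f_inversion : differ_by_quadratic (fun p => fst p / snd p) (fun p => - (1) / snd p)
  (mv_f (fun p => fst p / snd p) (fun p => - (1) / snd p))
  (mv_map (fun p w => / snd p ^ 2 * w - / snd p ^ 3 * (fst p ^ 4 / factC 4))
    (mv_f (fun p => fst p) (fun p => snd p))).
Proof.
intros Om HO HC HR F G HF [G0 [HG EG]].
(* After multiplication by [tau^2] the defect is to be quadratic in [z] and [tau]; division then
   gives the coefficients in the inverted coordinates, permuted up to sign. *)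
set (D := fun p => snd p ^ 2 * F p - G0 p + / (24 * snd p) * fst p ^ 4).
enough (HD : exists P, quad P /\ forall p, Om p -> D p = P p).
{ destruct HD as [P [[a [b [c [d [e [f HP]]]]]] ED]].
  exists f, e, (- c), d, (- b), a; intros p Hp; pose proof (regular_snd p (HR p Hp)) as Ht.
  rewrite EG by exact Hp.
  assert (E24 : factC 4 = 24) by (unfold factC, natC; rewrite INR_IZR_INZ; reflexivity).
  transitivity (/ snd p ^ 2 * D p); [unfold D; rewrite E24; field; exact Ht|].
  rewrite ED, HP by exact Hp; field; exact Ht. }
assert (HFi : f_branch (inv_dom Om) (fun p => F (invt' p))).
{ apply mv_f_f_branch_id; [now apply inv_dom_regular | now apply mv_f_inv]. }
apply mv_f_f_branch_id in HG; [|exact HR].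
apply quad_local_global; [exact HO | exact HC|]; intros [z0 t0] Hp0.
assert (Ht0 : (0 < Im t0)%R) by apply (HR _ Hp0).
destruct (open_pdisc Om _ HO Hp0) as [e [He Ke]].
(* The explicit branches are available only off the boundaries of the parallelograms, so the
   computation is made at a point [z1] near [z0]. *)
destruct (generic_point t0 z0 e Ht0 He) as [z1 [k [l [Hz1 Hpara]]]].
assert (Hp1 : Om (z1, t0)) by (apply Ke; split; cbn [fst snd]; [exact Hz1 | now apply disc_center]).
assert (Hs1 : snd (z1, t0) <> 0) by now apply regular_snd, HR.
destruct (Im_inv_neg t0 Ht0) as [Ht00 _].
(* a neighbourhood of the transformed point where the explicit branch is available *)
set (N2 := fun p => inv_dom Om p /\ strip (fst p - ZC k - ZC (- l) * snd p, snd p)).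
assert (HN2o : open N2).
{ apply open_and; [now apply inv_dom_open|].
  apply open_ext with (2 := sub_open 1 (- ZC (- l)) (- ZC k) strip strip_open); intros [a b]; unfold sub, aff; cbn [fst snd].
  replace (1 * a + - ZC (- l) * b + - ZC k) with (a - ZC k - ZC (- l) * b) by ring; reflexivity. }
assert (HN1o : open (fun p => strip (fst p - ZC l - ZC k * snd p, snd p))).
{ apply open_ext with (2 := sub_open 1 (- ZC k) (- ZC l) strip strip_open); intros [a b]; unfold sub, aff; cbn [fst snd].
  replace (1 * a + - ZC k * b + - ZC l) with (a - ZC l - ZC k * b) by ring; reflexivity. }
assert (Hx : forall z t : C, t <> 0 -> z / t - ZC k - ZC (- l) * (- (1) / t) = (z - ZC l - ZC k * t) / t).
{ intros z t Ht; unfold ZC; rewrite opp_IZR, RtoC_opp; field; exact Ht. }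
assert (H2 : N2 (invt (z1, t0))).
{ split; [split; [|now rewrite invt'_invt] | unfold invt, strip; cbn [fst snd]; rewrite Hx by exact Ht00; apply Hpara].
  unfold invt; cbn [snd]; intros E0.
  assert (K : - (1) = 0) by (transitivity (- (1) / t0 * t0); [field; exact Ht00 | rewrite E0; ring]).
  apply (f_equal Re) in K; simpl in K; lra. }
destruct (open_pdisc _ _ HN2o H2) as [d2 [Hd2 K2]].
destruct (invt_pdisc (z1, t0) d2 Hs1 Hd2) as [e2 [He2 Ki]].
destruct (open_pdisc _ (z1, t0) HN1o) as [e1 [He1 K1]]; [apply Hpara|].
destruct (disc_open _ _ _ Hz1) as [e3 [He3 K3]].
set (s := Rmin (Rmin e1 e2) (Rmin e3 e)).
assert (Hs : (0 < s)%R) by (repeat apply Rmin_pos; assumption).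
assert (S1 : (s <= e1)%R) by (eapply Rle_trans; apply Rmin_l). assert (S2' : (s <= e2)%R) by (eapply Rle_trans; [apply Rmin_l | apply Rmin_r]).
assert (S3 : (s <= e3)%R) by (eapply Rle_trans; [apply Rmin_r | apply Rmin_l]). assert (S4 : (s <= e)%R) by (eapply Rle_trans; apply Rmin_r).
set (R1 := rect z1 s t0 s).
assert (HR1 : forall p, R1 p -> Om p /\ strip (fst p - ZC l - ZC k * snd p, snd p) /\ snd p <> 0 /\
  pdisc (invt (z1, t0)) d2 (invt p)).
{ intros p [P1 P2].
  assert (Pd : pdisc (z1, t0) s p) by (split; assumption).
  split; [|split; [|apply Ki, pdisc_mono with (2 := Pd), S2']].
  - apply Ke; split; cbn [fst snd]; [apply K3; unfold disc in *; lra | unfold disc in *; lra].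
  - apply (K1 p), pdisc_mono with (2 := Pd), S1. }
destruct (f_branch_unique R1 G0 (f_shifted k l) (rect_open _ _ _ _) (rect_connected _ _ _ _)) as [P1 [HP1 EP1]].
{ apply f_branch_sub with (2 := HG); intros p Hp; now apply HR1. }
{ apply f_branch_sub with (2 := f_shifted_f_branch k l); intros p Hp; now apply HR1. }
set (x1 := z1 / t0). set (y1 := - (1) / t0).
destruct (f_branch_unique (rect x1 d2 y1 d2) (fun p => F (invt' p)) (f_shifted (- l) k) (rect_open _ _ _ _) (rect_connected _ _ _ _)) as [P2 [HP2 EP2]].
{ apply f_branch_sub with (2 := HFi); intros p Hp; apply (K2 p), Hp. }
{ apply f_branch_sub with (2 := f_shifted_f_branch (- l) k); intros p Hp; apply (K2 p), Hp. }
destruct (quad_inv P2 HP2) as [P2' [HP2' EP2']].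
(* The fourth powers form the second difference of [z^4] with steps [k tau] and [l]. It is divisible
   by [k l tau], which removes the denominator and leaves [kl / 24] times a quadratic polynomial. *)
set (kl := ZC k * ZC l).
set (Q := fun p => (/ 8 * (fst p - ZC l - ZC k * snd p) ^ 2 + / 24 * (1 - snd p) * (fst p - ZC l - ZC k * snd p))
  + kl / 24 * (12 * fst p ^ 2 - 12 * fst p * (ZC k * snd p + ZC l) + 4 * ZC k ^ 2 * snd p ^ 2 + 6 * kl * snd p + 4 * ZC l ^ 2)
  + P2' p - P1 p).
assert (HQ : quad Q).
{ apply quad_minus; [apply quad_plus; [apply quad_plus|]|]; try assumption.
  - exists (/ 8 * ZC l ^ 2 - / 24 * ZC l), (- (/ 4 * ZC l) + / 24), (/ 4 * ZC l * ZC k + / 24 * (ZC l - ZC k)), (/ 8),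
      (- (/ 4 * ZC k) - / 24), (/ 8 * ZC k ^ 2 + / 24 * ZC k); intros p; field.
  - exists (kl / 24 * 4 * ZC l ^ 2), (- (kl / 24 * 12 * ZC l)), (kl / 24 * 6 * kl), (kl / 24 * 12), (- (kl / 24 * 12 * ZC k)), (kl / 24 * 4 * ZC k ^ 2).
    intros p; field. }
assert (EQ : forall p, R1 p -> D p = Q p).
{ intros p Hp; destruct (HR1 p Hp) as [Q1 [Q2 [Q3 Q4]]].
  specialize (EP1 p Hp); specialize (EP2 (invt p) Q4); rewrite invt'_invt in EP2 by exact Q3.
  assert (EF : F p = f_shifted (- l) k (invt p) + P2 (invt p)) by (rewrite <- EP2; ring).
  assert (EG0 : G0 p = f_shifted k l p + P1 p) by (rewrite <- EP1; ring).
  unfold D, Q; rewrite EF, EG0, <- EP2' by exact Q3.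
  pose proof (HR p Q1) as Hreg; destruct Hreg as [Hti _].
  assert (Hpa : both_strips (snd p) (fst p - ZC l - ZC k * snd p)).
  { split; [exact Q2|]. destruct (K2 _ Q4) as [_ Q5]; unfold invt, strip in Q5; cbn [fst snd] in Q5.
    rewrite Hx in Q5 by exact Q3; exact Q5. }
  pose proof (f_strip_inversion _ _ Hti Hpa) as K.
  unfold f_shifted, invt; cbn [fst snd]; rewrite Hx by exact Q3.
  rewrite <- K; unfold kl; field; exact Q3. }
(* For fixed [tau], [D] is quadratic in [z] on the disc around [z0], so its agreement with [Q] near
   [z1] extends to points near [z0]. *)
exists s, Q; split; [exact Hs|]; split; [exact HQ|]; intros [z t] [Z1 Z2]; cbn [fst snd] in Z1, Z2.
assert (Hdom : forall v, disc z0 e v -> Om (v, t)).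
{ intros v Hv; apply Ke; split; cbn [fst snd]; unfold disc in *; lra. }
assert (Hti : (0 < Im t)%R) by apply (HR _ (Hdom z ltac:(unfold disc in *; lra))).
destruct (Im_inv_neg t Hti) as [Htn _].
assert (Dz : D3on (disc z0 e) (fun v => t ^ 2 * F (invt' (v / t, - (1) / t)) - G0 (v, t) + / (24 * t) * v ^ 4) (fun _ => 0)).
{ apply (inv_third_derivative (disc z0 e) t (fun v => G0 (v, t)) (fun x => F (invt' (x, - (1) / t)))); [exact Hti | | |].
  - intros v Hv; apply (proj1 (regular_off_lattice (v, t))), HR, Hdom, Hv.
  - apply (f_branch_D3 Om G0); [exact HO | intros p Hp; apply (HR p Hp) | exact Hdom | exact HG].
  - apply (f_branch_D3 (inv_dom Om) (fun p => F (invt' p))); [now apply inv_dom_open | | | exact HFi].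
    + intros p Hp; apply (inv_dom_regular Om HR p Hp).
    + intros x Hxx; assert (Ei : (x, - (1) / t) = invt (x * t, t)) by (unfold invt; cbn [fst snd]; f_equal; field; exact Htn).
      rewrite Ei; split; [|rewrite invt'_invt by exact Htn; now apply Hdom].
      destruct (Im_inv_neg t Hti) as [_ Hy]; unfold invt; cbn [snd]; intros E0; rewrite E0 in Hy; simpl in Hy; lra. }
destruct (D3on_zero _ _ (disc_convex z0 e) Dz) as [a [b [c Habc]]].
assert (HDabc : forall v, disc z0 e v -> D (v, t) = a + b * v + c * v ^ 2).
{ intros v Hv; rewrite <- (Habc v Hv); unfold D; cbn [fst snd].
  change (v / t, - (1) / t) with (invt (v, t)); rewrite invt'_invt by exact Htn; reflexivity. }
destruct HQ as [q00 [q10 [q01 [q20 [q11 [q02 HQ]]]]]].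
assert (Zr : forall v : C, (a - (q00 + q01 * t + q02 * t ^ 2)) + (b - (q10 + q11 * t)) * v + (c - q20) * v ^ 2 = 0).
{ apply (quad_poly_zero _ _ _ z1 s Hs); intros v Hv.
  assert (Hv0 : disc z0 e v) by (apply K3; unfold disc in *; lra).
  transitivity (D (v, t) - Q (v, t)).
  - rewrite HDabc, HQ by exact Hv0; cbn [fst snd]; ring.
  - rewrite EQ by (split; assumption); ring. }
rewrite HDabc, HQ by (unfold disc in *; lra); cbn [fst snd].
replace (a + b * z + c * z ^ 2) with (((a - (q00 + q01 * t + q02 * t ^ 2)) + (b - (q10 + q11 * t)) * z + (c - q20) * z ^ 2)
  + (q00 + q01 * t + q02 * t ^ 2) + (q10 + q11 * t) * z + q20 * z ^ 2) by ring.
rewrite Zr; ring.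
Qed.

(** * Power series of x / (1 - x) *)

Definition int (a : nat -> C) (n : nat) : C := match n with O => 0 | S m => a m / natC (S m) end.
Definition int3 (a : nat -> C) : nat -> C := int (int (int a)).

Lemma der_int a : der (int a) = a.
Proof. apply functional_extensionality; intros n; unfold der, int; field; apply natC_S_neq_0. Qed.

Lemma cvr_int a r : cvr a r -> cvr (int a) r.
Proof.
intros H; apply cvr_shift, cvr_le with (2 := H); intros n; cbn [int]; pose proof (INR_S_ge_1 n).
rewrite Cmod_div by apply natC_S_neq_0; unfold natC; rewrite Cmod_R, Rabs_pos_eq by lra.
apply (Rmult_le_reg_r (INR (S n))); [lra|]; unfold Rdiv; rewrite Rmult_assoc, Rinv_l by lra.
pose proof (Cmod_ge_0 (a n)); nra.
Qed.

Lemma Pser_int_Cder a r u : cvr a r -> (Cmod u < r)%R -> Cder (Pser (int a)) u (Pser a u).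
Proof. intros H Hu; rewrite <- (der_int a) at 2; apply Pser_Cder with r; [now apply cvr_int | exact Hu]. Qed.

Lemma cvr_int3 a r : cvr a r -> cvr (int3 a) r.
Proof. intros H; now do 3 apply cvr_int. Qed.

Lemma Pser_int3_D3 a r : cvr a r -> D3on (disc 0 r) (Pser (int3 a)) (Pser a).
Proof.
intros H; exists (Pser (int (int a))), (Pser (int a)); intros w Hw.
unfold disc in Hw; replace (w - 0) with w in Hw by ring.
repeat split; apply Pser_int_Cder with r; try assumption; now repeat apply cvr_int.
Qed.

Lemma pow_opp_1 k : (- (1)) ^ k = RtoC ((-1) ^ k).
Proof. rewrite <- RtoC_opp; replace (Ropp 1) with (-1)%R by ring; now rewrite RtoC_pow. Qed.

Lemma Cmod_pow_opp_1 k : Cmod ((- (1)) ^ k) = 1%R.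
Proof. rewrite Cmod_pow, Cmod_opp, Cmod_1; apply pow1. Qed.

(** [1 / (x + u) ^ 2 = sum_k (-1)^k (k + 1) u^k / x^(k+2)] *)
Definition inv_sq_coef (k : nat) : C := (- (1)) ^ k * natC (S k).

Lemma cvr_inv_sq_coef : cvr inv_sq_coef 1.
Proof.
replace inv_sq_coef with (der (fun k => match k with O => 0 | S k => (- (1)) ^ k end)) by (apply functional_extensionality; intros k; unfold der, inv_sq_coef; ring).
apply cvr_der, cvr_shift, cvr_bounded with 1%R; intros k; rewrite Cmod_pow_opp_1, pow1; lra.
Qed.

Lemma Pser_inv_sq_coef (v : C) : (Cmod v < 1)%R -> Pser inv_sq_coef v = / (1 + v) ^ 2.
Proof.
intros Hv.
assert (N : forall w : C, (Cmod w < 1)%R -> 1 + w <> 0).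
{ intros w Hw; replace (1 + w) with (1 - - w) by ring; apply one_sub_neq_0; now rewrite Cmod_opp. }
assert (E : forall w : C, (Cmod w < 1)%R -> Pser (fun k => - (- (1)) ^ k) w = - / (1 + w)).
{ intros w Hw; unfold Pser; rewrite (CSeries_ext _ (fun k => - (1) * (- w) ^ k)).
  - rewrite CSeries_scal, CSeries_geom by (try apply asum_geom; now rewrite Cmod_opp).
    replace (1 - - w) with (1 + w) by ring; ring.
  - intros k; replace (- w) with (- (1) * w) by ring; rewrite Cpow_mult_l; ring. }
apply (Cder_unique (Pser (fun k => - (- (1)) ^ k)) v).
- apply Cder_eq with (Pser (der (fun k => - (- (1)) ^ k)) v).
  + apply Pser_Cder with 1%R; [|exact Hv].
    apply cvr_bounded with 1%R; intros k; rewrite Cmod_opp, Cmod_pow_opp_1, pow1; lra.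
  + unfold Pser; apply CSeries_ext; intros k; unfold der, inv_sq_coef; simpl Cpow; ring.
- apply Cder_ext with (f := fun w => - / (1 + w)) (d := (1 - Cmod v)%R); [lra | |].
  + intros w Hw; symmetry; apply E; pose proof (Cmod_sub_triangle w v 0).
    replace (w - 0) with w in * by ring; replace (v - 0) with v in * by ring; lra.
  + apply Cder_eq with (- (- / ((1 + v) * (1 + v)) * (0 + 1))); [|field; now apply N].
    apply Cder_opp, (Cder_comp (fun w => 1 + w) Cinv); [apply Cder_plus; [apply Cder_const | apply Cder_id]|].
    apply Cder_inv; now apply N.
Qed.

(** Each inverse square is expanded in powers of [u / x n]. Since all poles have modulus at least
    [r], the double series is dominated by a product and may be summed over [n] first. *)
Lemma inv_sq_expansion (x : nat -> C) (r : R) : (0 < r)%R -> (forall n, (r <= Cmod (x n))%R) ->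
  asum (fun n => / x n ^ 2) ->
  let a := fun k => inv_sq_coef k * CSeries (fun n => / x n ^ (k + 2)) in
  cvr a r /\ forall u, (Cmod u < r)%R -> asum (fun n => / (x n + u) ^ 2) /\ CSeries (fun n => / (x n + u) ^ 2) = Pser a u.
Proof.
intros Hr Hx Hs a.
assert (N : forall n, x n <> 0) by (intros n; apply (proj2 (Cmod_gt_0 _)); specialize (Hx n); lra).
assert (Hq : forall (u : C) n, (Cmod u < r)%R -> (Cmod (u / x n) <= Cmod u / r /\ Cmod u / r < 1)%R).
{ intros u n Hu; rewrite Cmod_div by apply N; split.
  - apply Rmult_le_compat_l; [apply Cmod_ge_0|]; apply Rinv_le_contravar; [exact Hr | apply Hx].
  - apply (Rmult_lt_reg_r r); [exact Hr|]; unfold Rdiv; rewrite Rmult_assoc, Rinv_l; lra. }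
assert (D : forall u, (Cmod u < r)%R -> dsum (fun n k => / x n ^ 2 * (inv_sq_coef k * (u / x n) ^ k))).
{ intros u Hu; destruct (Hq u 0%nat Hu) as [_ Hlt].
  apply dsum_prod with (fun n => Cmod (/ x n ^ 2)) (fun k => Cmod (inv_sq_coef k) * (Cmod u / r) ^ k)%R.
  - intros n k; rewrite !Cmod_mult, !Cmod_pow; apply Rmult_le_compat_l; [apply Cmod_ge_0|].
    apply Rmult_le_compat_l; [apply Cmod_ge_0|]; apply pow_incr; split; [apply Cmod_ge_0 | now apply Hq].
  - exact Hs.
  - apply cvr_inv_sq_coef; split; [|exact Hlt]. apply Rmult_le_pos; [apply Cmod_ge_0 | left; now apply Rinv_0_lt_compat]. }
assert (E : forall u n, (Cmod u < r)%R -> CSeries (fun k => / x n ^ 2 * (inv_sq_coef k * (u / x n) ^ k)) = / (x n + u) ^ 2).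
{ intros u n Hu; destruct (Hq u n Hu) as [H1 H2].
  rewrite CSeries_scal by (apply cvr_asum with 1%R; [apply cvr_inv_sq_coef | lra]).
  fold (Pser inv_sq_coef (u / x n)); rewrite Pser_inv_sq_coef by lra.
  assert (x n + u <> 0).
  { replace (x n + u) with (x n * (1 - - (u / x n))) by (field; apply N).
    apply Cmult_neq_0; [apply N | apply one_sub_neq_0; rewrite Cmod_opp; lra]. }
  field; repeat split; try assumption; apply N. }
assert (Ea : forall u k, (Cmod u < r)%R -> asum (fun n => / x n ^ 2 * (inv_sq_coef k * (u / x n) ^ k)) ->
   CSeries (fun n => / x n ^ 2 * (inv_sq_coef k * (u / x n) ^ k)) = a k * u ^ k).
{ intros u k Hu K.
  rewrite (CSeries_ext _ (fun n => (inv_sq_coef k * u ^ k) * / x n ^ (k + 2))).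
  2: { intros n; rewrite Cpow_add_r; unfold Cdiv; rewrite Cpow_mult_l, Cpow_inv by apply N.
       field; repeat split; try apply N; apply Cpow_nz, N. }
  unfold a; rewrite CSeries_scal; [ring|].
  apply asum_le with (fun n => Cmod (/ x n ^ 2) * / r ^ k)%R.
  - intros n; rewrite Cpow_add_r.
    replace (/ (x n ^ k * x n ^ 2)) with (/ x n ^ 2 * / x n ^ k) by (field; repeat split; try apply Cpow_nz; apply N).
    rewrite Cmod_mult; apply Rmult_le_compat_l; [apply Cmod_ge_0|].
    rewrite Cmod_inv, Cmod_pow by apply Cpow_nz, N; apply Rinv_le_contravar; [now apply pow_lt|]. apply pow_incr; split; [lra | apply Hx].
  - apply exR_ext with (fun n => / r ^ k * Cmod (/ x n ^ 2))%R; [intros; apply Rmult_comm | now apply exR_scal]. }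
assert (P1 : forall u, (Cmod u < r)%R -> asum (fun n => / (x n + u) ^ 2) /\ asum (fun k => a k * u ^ k) /\
   CSeries (fun n => / (x n + u) ^ 2) = Pser a u).
{ intros u Hu; specialize (D u Hu).
  assert (Ec : forall k, CSeries (fun n => / x n ^ 2 * (inv_sq_coef k * (u / x n) ^ k)) = a k * u ^ k)
    by (intros k; apply Ea; [exact Hu | exact (dsum_col _ k D)]).
  split; [|split].
  - apply asum_ext with (2 := dsum_rows _ D); intros n; now apply E.
  - apply asum_ext with (2 := dsum_rows _ (dsum_swap _ D)); exact Ec.
  - rewrite (CSeries_ext _ _ (fun n => eq_sym (E u n Hu))), (Fubini _ D); now apply CSeries_ext. }
split; [apply cvr_conv; intros u Hu; apply asum_ex; now apply P1|].
intros u Hu; destruct (P1 u Hu) as [H1 [_ H2]]; now split.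
Qed.

Lemma cvr_ext a b r : (forall n, a n = b n) -> cvr a r -> cvr b r.
Proof. intros H; apply cvr_le; intros n; rewrite H; lra. Qed.

Lemma Cder_primitive_Pser (f : C -> C) (a : nat -> C) (r : R) : cvr a r ->
  (forall u, disc 0 r u -> Cder f u (Pser a u)) ->
  exists b, cvr b r /\ (forall k, b (S k) = a k / natC (S k)) /\ forall u, (Cmod u < r)%R -> f u = Pser b u.
Proof.
intros Ha Hf; exists (fun k => f 0 * onec k + int a k); split; [|split].
- apply cvr_plus; [apply cvr_scal, cvr_onec | now apply cvr_int].
- intros k; unfold onec, int; ring.
- intros u Hu; assert (H0 : (0 < r)%R) by (pose proof (Cmod_ge_0 u); lra).
  assert (E0 : forall v : C, (Cmod v < r)%R -> disc 0 r v) by (intros v Hv; unfold disc; now replace (v - 0) with v by ring).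
  rewrite (Pser_plus _ _ r), (Pser_scal _ _ r), Pser_onec by (try assumption; try apply cvr_scal; try apply cvr_onec; now apply cvr_int).
  assert (E : f u - Pser (int a) u = f 0 - Pser (int a) 0).
  { apply (Cder_zero_const (disc 0 r) (fun u => f u - Pser (int a) u)); [apply disc_convex | | | now apply E0].
    - intros w Hw; apply Cder_eq with (Pser a w - Pser a w); [|ring].
      apply Cder_minus; [now apply Hf|]. apply Pser_int_Cder with r; [exact Ha|].
      unfold disc in Hw; now replace (w - 0) with w in Hw by ring.
    - apply E0; now rewrite Cmod_0. }
  rewrite Pser_0 in E; cbn [int] in E. replace (f u) with (f u - Pser (int a) u + Pser (int a) u) by ring; rewrite E; ring.
Qed.

(** The partial fractions of the derivative give a power series valid up to the nearest pole, and a
    primitive keeps this radius. *)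
Lemma li3_D3_Pser (c : C) (r : R) : (0 < r)%R -> (forall m : Z, (r <= Cmod (c + ZC m))%R) ->
  exists a, cvr a r /\ forall u, (Cmod u < r)%R -> li3_D3 (c + u) = Pser a u.
Proof.
intros Hr Hc.
assert (HZ : forall u : C, (Cmod u < r)%R -> notZ (c + u)).
{ intros u Hu k E; specialize (Hc (- k)%Z); unfold ZC in Hc; rewrite opp_IZR, RtoC_opp, <- E in Hc.
  replace (c + - (c + u)) with (- u) in Hc by ring; rewrite Cmod_opp in Hc; lra. }
destruct (S2_Zsummable c) as [Z1 Z2]; [replace c with (c + 0) by ring; apply HZ; now rewrite Cmod_0|].
destruct (inv_sq_expansion (fun n => c + ZC (zpos n)) r Hr (fun n => Hc _) Z1) as [A1 B1].
destruct (inv_sq_expansion (fun n => c + ZC (zneg n)) r Hr (fun n => Hc _) Z2) as [A2 B2].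
set (a1 := fun k => inv_sq_coef k * _) in A1, B1; set (a2 := fun k => inv_sq_coef k * _) in A2, B2.
destruct (Cder_primitive_Pser (fun u => li3_D3 (c + u)) (fun k => / twopi_i * (a1 k + a2 k)) r) as [b [Hb [_ E]]].
- apply cvr_scal; now apply cvr_plus.
- intros u Hu; unfold disc in Hu; replace (u - 0) with u in Hu by ring.
  rewrite (Pser_scal _ _ r), (Pser_plus _ _ r) by (assumption || now apply cvr_plus).
  rewrite <- (proj2 (B1 u Hu)), <- (proj2 (B2 u Hu)).
  apply Cder_eq with (twopi_i * li3_D4 (c + u) * (0 + 1)).
  + apply (Cder_comp (fun u => c + u)); [apply Cder_plus; [apply Cder_const | apply Cder_id] | now apply Cder_li3_D3, HZ].
  + assert (E : twopi_i * li3_D4 (c + u) = / twopi_i * S2 (c + u)) by (rewrite <- li3_D4_S2 by (now apply HZ); field; apply twopi_i_neq_0).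
    rewrite E; unfold S2, Zsum.
    rewrite (CSeries_ext (fun n => / (c + u + ZC (zpos n)) ^ 2) (fun n => / (c + ZC (zpos n) + u) ^ 2)) by (intros; do 2 f_equal; ring).
    rewrite (CSeries_ext (fun n => / (c + u + ZC (zneg n)) ^ 2) (fun n => / (c + ZC (zneg n) + u) ^ 2)) by (intros; do 2 f_equal; ring).
    ring.
- now exists b.
Qed.

(** * The Laurent expansion of [li3_D3] at the origin and the Bernoulli numbers *)

Lemma notZ_punctured (u : C) : (0 < Cmod u < 1)%R -> notZ u.
Proof.
intros Hu k ->; rewrite Cmod_R in Hu.
assert (Hk : (Z.abs k < 1)%Z) by (apply lt_IZR; rewrite abs_IZR; lra).
replace k with 0%Z in Hu by lia; rewrite Rabs_R0 in Hu; lra.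
Qed.

(** The sum of [m^-(k+2)] over the nonzero integers [m]. *)
Definition zetac (k : nat) : C := CSeries (fun n => / natC (S n) ^ (k + 2)) + CSeries (fun n => / (- natC (S n)) ^ (k + 2)).

Lemma S2_punctured : cvr (fun k => inv_sq_coef k * zetac k) 1 /\
  forall u, (0 < Cmod u < 1)%R -> S2 u = / u ^ 2 + Pser (fun k => inv_sq_coef k * zetac k) u.
Proof.
assert (B : forall n, (1 <= Cmod (natC (S n)))%R).
{ intros n; pose proof (INR_S_ge_1 n); unfold natC; rewrite Cmod_R, Rabs_pos_eq; lra. }
assert (Sq : asum (fun n => / natC (S n) ^ 2)).
{ apply exR_ext with (2 := inv_sq_summable); intros n; pose proof (INR_S_ge_1 n).
  rewrite Cmod_inv, Cmod_pow by (apply Cpow_nz, natC_S_neq_0); unfold natC; rewrite Cmod_R, Rabs_pos_eq; lra. }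
destruct (inv_sq_expansion (fun n => natC (S n)) 1 ltac:(lra) B Sq) as [A1 B1].
destruct (inv_sq_expansion (fun n => - natC (S n)) 1 ltac:(lra)) as [A2 B2].
{ intros n; rewrite Cmod_opp; apply B. }
{ apply asum_ext with (2 := Sq); intros n; f_equal; ring. }
assert (Ez : forall k, inv_sq_coef k * CSeries (fun n => / natC (S n) ^ (k + 2)) + inv_sq_coef k * CSeries (fun n => / (- natC (S n)) ^ (k + 2)) = inv_sq_coef k * zetac k)
  by (intros k; unfold zetac; ring).
pose proof (cvr_plus _ _ _ A1 A2) as A3.
split; [apply cvr_ext with (2 := A3); exact Ez|].
intros u Hu; destruct (B1 u) as [C1 D1], (B2 u) as [C2 D2]; try apply Hu.
unfold Pser; rewrite <- (CSeries_ext _ _ (fun k => f_equal (fun x => x * u ^ k) (Ez k))); fold (Pser (fun k => inv_sq_coef k * CSeries (fun n => / natC (S n) ^ (k + 2)) + inv_sq_coef k * CSeries (fun n => / (- natC (S n)) ^ (k + 2))) u).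
rewrite (Pser_plus _ _ 1) by (assumption || apply Hu). rewrite <- D1, <- D2; unfold S2, Zsum.
rewrite (CSeries_incr (fun n => / (u + ZC (zpos n)) ^ 2)).
- rewrite ZC_zpos; unfold natC at 1; simpl INR.
  rewrite (CSeries_ext (fun n => / (u + ZC (zpos (S n))) ^ 2) (fun n => / (natC (S n) + u) ^ 2)) by (intros n; rewrite ZC_zpos; do 2 f_equal; ring).
  rewrite (CSeries_ext (fun n => / (u + ZC (zneg n)) ^ 2) (fun n => / (- natC (S n) + u) ^ 2)) by (intros n; rewrite ZC_zneg; do 2 f_equal; ring).
  replace (u + 0) with u by ring; ring.
- apply (S2_Zsummable u (notZ_punctured u Hu)).
Qed.

Lemma punctured_const (f : C -> C) : (forall u, (0 < Cmod u < 1)%R -> Cder f u 0) ->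
  forall u v, (0 < Cmod u < 1)%R -> (0 < Cmod v < 1)%R -> f u = f v.
Proof.
intros H.
assert (Seg : forall u v, (Cmod u < 1)%R -> (Cmod v < 1)%R ->
   (forall t : R, (0 <= t <= 1)%R -> u + RtoC t * (v - u) <> 0) -> f u = f v).
{ intros u v Hu Hv Hn; symmetry; apply Cder_zero_segment; intros t Ht; apply H; split.
  - now apply (proj1 (Cmod_gt_0 _)), Hn.
  - assert (K := disc_convex 0 1 u v t); unfold disc in K.
    replace (u - 0) with u in K by ring; replace (v - 0) with v in K by ring.
    replace (u + RtoC t * (v - u)) with (u + RtoC t * (v - u) - 0) by ring; now apply K. }
assert (Nz : forall u : C, (0 < Cmod u < 1)%R -> u <> 0) by (intros u Hu; apply (proj2 (Cmod_gt_0 u)); lra).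
intros u v Hu Hv; pose proof (Nz u Hu) as Nu; pose proof (Nz v Hv) as Nv.
set (w := v / u). assert (Ev : v = u * w) by (unfold w; field; exact Nu).
assert (Nw : w <> 0) by (intros E; apply Nv; rewrite Ev, E; ring).
clearbody w.
(* a segment to [v] avoids the origin unless [v] is a negative multiple of [u], when [Ci * u] is an intermediate point *)
destruct (Req_dec (Im w) 0) as [Hw|Hw].
- assert (HCi : (Cmod (Ci * u) < 1)%R) by (rewrite Cmod_mult, Cmod_Ci; lra).
  transitivity (f (Ci * u)).
  + apply Seg; [lra | exact HCi |]; intros t Ht.
    replace (u + RtoC t * (Ci * u - u)) with (u * (1 - RtoC t + RtoC t * Ci)) by ring.
    apply Cmult_neq_0; [exact Nu|]; intros E.
    assert (E1 := f_equal Re E); assert (E2 := f_equal Im E); simpl in E1, E2; lra.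
  + apply Seg; [exact HCi | lra |]; intros t Ht.
    replace (Ci * u + RtoC t * (v - Ci * u)) with (u * ((1 - RtoC t) * Ci + RtoC t * w)) by (rewrite Ev; ring).
    apply Cmult_neq_0; [exact Nu|]; intros E.
    assert (E1 := f_equal Re E); assert (E2 := f_equal Im E); simpl in E1, E2.
    assert (Et : t = 1%R) by (unfold Im in Hw; rewrite Hw in E2; lra).
    apply Nw, C_ext; [rewrite Et in E1; unfold Re; simpl; lra | exact Hw].
- apply Seg; try lra; intros t Ht.
  replace (u + RtoC t * (v - u)) with (u * (1 - RtoC t + RtoC t * w)) by (rewrite Ev; ring).
  apply Cmult_neq_0; [exact Nu|]; intros E.
  assert (E1 := f_equal Re E); assert (E2 := f_equal Im E); simpl in E1, E2.
  assert (Et : (t * Im w = 0)%R) by (unfold Im; lra).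
  apply Rmult_integral in Et; destruct Et as [Et|Et]; [|contradiction]. rewrite Et in E1; lra.
Qed.

(** The term [m = 0] of the partial fractions integrates to the pole. The constant of integration
    [b 0] is not determined here. *)
Lemma li3_D3_polar : exists b, cvr b 1 /\ (forall k, b (S k) = / twopi_i * (inv_sq_coef k * zetac k) / natC (S k)) /\
  forall u, (0 < Cmod u < 1)%R -> li3_D3 u = - / (twopi_i * u) + Pser b u.
Proof.
destruct S2_punctured as [A1 A2]; pose proof twopi_i_neq_0 as Hp.
set (a := fun k => / twopi_i * (inv_sq_coef k * zetac k)).
assert (Ha : cvr a 1) by now apply cvr_scal.
set (f := fun u => li3_D3 u + / (twopi_i * u) - Pser (int a) u).
assert (Hf : forall u v, (0 < Cmod u < 1)%R -> (0 < Cmod v < 1)%R -> f u = f v).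
{ apply punctured_const; intros u Hu; assert (Nu : u <> 0) by (apply (proj2 (Cmod_gt_0 u)); lra).
  assert (Np : twopi_i * u <> 0) by now apply Cmult_neq_0.
  apply Cder_eq with (twopi_i * li3_D4 u + - / ((twopi_i * u) * (twopi_i * u)) * (twopi_i * 1) - Pser a u).
  - apply Cder_minus; [apply Cder_plus|].
    + now apply Cder_li3_D3, notZ_punctured.
    + apply (Cder_comp (fun u => twopi_i * u) Cinv); [apply Cder_scal, Cder_id | now apply Cder_inv].
    + apply Pser_int_Cder with 1%R; [exact Ha | apply Hu].
  - assert (E : twopi_i * li3_D4 u = / twopi_i * S2 u) by (rewrite <- li3_D4_S2 by (now apply notZ_punctured); field; exact Hp).
    unfold a; rewrite E, A2, (Pser_scal _ _ 1) by (assumption || apply Hu); field; now split. }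
set (h := RtoC (/ 2)). assert (Hh : (0 < Cmod h < 1)%R) by (unfold h; rewrite Cmod_R, Rabs_pos_eq; lra).
exists (fun k => f h * onec k + int a k); split; [|split].
- apply cvr_plus; [apply cvr_scal, cvr_onec | now apply cvr_int].
- intros k; unfold onec, int, a; ring.
- intros u Hu; rewrite (Pser_plus _ _ 1), (Pser_scal _ _ 1), Pser_onec
    by (try apply Hu; try apply cvr_scal; try apply cvr_onec; now apply cvr_int).
  rewrite (Hf h u Hh Hu); unfold f; ring.
Qed.

(** With [x = - 2 pi i u], [li3_D3 u] is [1 / (e^x - 1)]; these are the coefficients of its regular
    part, from the generating function of the Bernoulli numbers. *)
Definition gpolar (k : nat) : C := RtoC (bern_coef (S k)) * (- twopi_i) ^ k.

Lemma is_Cseries_RtoC (u : nat -> R) (l : R) : is_series u l -> is_Cseries (fun n => RtoC (u n)) (RtoC l).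
Proof.
intros H; apply is_Cseries_iff; split; [exact H|].
apply (proj2 (proj1 (is_Cseries_iff (fun _ => 0) 0) is_Cseries_zero)).
Qed.

Lemma cvr_gpolar_aux : cvr gpolar (/ (2 * PI)).
Proof.
pose proof PI_RGT_0; apply cvr_bounded with 1%R; intros n; unfold gpolar.
assert (E : Cmod twopi_i = (2 * PI)%R).
{ unfold twopi_i; rewrite !Cmod_mult, Cmod_Ci, !Cmod_R, !Rabs_pos_eq by lra; ring. }
rewrite Cmod_mult, Cmod_pow, Cmod_opp, E, Cmod_R, Rmult_assoc, <- Rpow_mult_distr, Rinv_r, pow1, Rmult_1_r by lra.
apply bern_coef_bound.
Qed.

Lemma gpolar_sum (x : R) : (0 < x < 1)%R -> Pser gpolar (- RtoC x / twopi_i) = RtoC (/ (exp x - 1) - / x).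
Proof.
intros Hx; pose proof twopi_i_neq_0 as Hp.
assert (He : (exp x - 1 <> 0)%R) by (pose proof (exp_ineq1 x ltac:(lra)); lra).
assert (Hx0 : RtoC x <> 0) by (intros E; apply RtoC_inj in E; lra).
assert (H := bernoulli_generating_function x ltac:(rewrite Rabs_pos_eq; lra)); apply is_pseries_R in H.
apply is_Cseries_RtoC, is_Cseries_tail, (is_Cseries_scal (/ x)) in H.
apply is_Cseries_unique.
replace (RtoC (/ (exp x - 1) - / x)) with
  (/ x * (RtoC (x / (exp x - 1)) - RtoC (bernoulli 0 / INR (fact 0) * x ^ 0))).
2: { rewrite <- RtoC_minus, <- RtoC_inv, <- RtoC_mult by lra; f_equal.
     unfold bernoulli, bern_coef; simpl; field; lra. }
apply is_Cseries_ext with (2 := H); intros n; unfold gpolar, bernoulli.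
replace (INR (fact (S n)) * bern_coef (S n) / INR (fact (S n)))%R with (bern_coef (S n)) by (field; apply INR_fact_neq_0).
rewrite RtoC_mult, <- Cmult_assoc, <- Cpow_mult_l.
replace (- twopi_i * (- x / twopi_i)) with (RtoC x) by (field; exact Hp).
rewrite RtoC_pow; simpl Cpow; field; exact Hx0.
Qed.

Lemma li3_D3_real (x : R) : (0 < x)%R -> li3_D3 (- RtoC x / twopi_i) = RtoC (/ (exp x - 1)).
Proof.
intros Hx; pose proof (exp_ineq1 x ltac:(lra)) as He; unfold li3_D3.
replace (e2pi (- RtoC x / twopi_i)) with (RtoC (exp (- x))).
- rewrite <- RtoC_minus. pose proof (exp_pos x).
  assert (exp (- x) < 1)%R by (rewrite <- exp_0; apply exp_increasing; lra).
  rewrite <- RtoC_div by lra; f_equal; rewrite exp_Ropp; field; split; [|lra]. lra.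
- unfold e2pi; replace (twopi_i * (- RtoC x / twopi_i)) with (RtoC (- x)) by (rewrite RtoC_opp; field; apply twopi_i_neq_0).
  unfold Cexp; apply C_ext; simpl; [rewrite cos_0 | rewrite sin_0]; ring.
Qed.

(** The generating function is used for real [x], that is at points [u] of a line accumulating at
    the origin, which determines all coefficients. Equality with the zeta sums is Euler's evaluation
    of the zeta function at even integers. *)
Lemma gpolar_spec : cvr gpolar 1 /\
  (forall k, gpolar (S k) = / twopi_i * (inv_sq_coef k * zetac k) / natC (S k)) /\
  forall u, (0 < Cmod u < 1)%R -> li3_D3 u = - / (twopi_i * u) + Pser gpolar u.
Proof.
destruct li3_D3_polar as [b [Hb [Eb Hg]]]; pose proof PI_RGT_0 as HP; pose proof twopi_i_neq_0 as Hp.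
enough (E : forall k, gpolar k = b k).
{ split; [apply cvr_ext with (2 := Hb); intros; now rewrite E|]; split; [intros k; now rewrite E|].
  intros u Hu; rewrite Hg by exact Hu; f_equal; apply CSeries_ext; intros k; now rewrite E. }
assert (Hr : (0 < / (2 * PI) < 1)%R).
{ split; [apply Rinv_0_lt_compat; lra|]. rewrite <- Rinv_1; apply Rinv_lt_contravar; pose proof PI2_1; unfold PI2 in *; lra. }
assert (Hb' : cvr b (/ (2 * PI))) by (apply cvr_mono with 1%R; [lra | exact Hb]).
intros k.
enough (Z : gpolar k + - (1) * b k = 0) by (replace (gpolar k) with (gpolar k + - (1) * b k + b k) by ring; rewrite Z; ring).
revert k; apply Pser_zero_accum with (/ (2 * PI))%R; [apply Hr | apply cvr_plus; [apply cvr_gpolar_aux | now apply cvr_scal]|].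
intros d Hd; set (x := (Rmin d 1 / 2)%R).
assert (Hm : (0 < Rmin d 1)%R) by (apply Rmin_pos; lra); pose proof (Rmin_l d 1); pose proof (Rmin_r d 1).
assert (Hx : (0 < x < 1)%R) by (unfold x; lra).
set (u := - RtoC x / twopi_i).
assert (Eu : Cmod u = (x * / (2 * PI))%R).
{ unfold u; rewrite Cmod_div, Cmod_opp, Cmod_R, Rabs_pos_eq by (assumption || lra).
  unfold twopi_i; rewrite !Cmod_mult, Cmod_Ci, !Cmod_R, !Rabs_pos_eq by lra; unfold Rdiv; now rewrite Rmult_1_r. }
exists u; rewrite Eu; split; [split; [nra | unfold x in *; nra]|].
rewrite (Pser_plus _ _ (/ (2 * PI))), (Pser_scal _ _ (/ (2 * PI))) by (try apply cvr_scal; try apply cvr_gpolar_aux; try assumption; rewrite Eu; nra).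
assert (Hu : (0 < Cmod u < 1)%R) by (rewrite Eu; nra).
assert (E := Hg u Hu); unfold u in E at 1; rewrite li3_D3_real in E by lra.
unfold u at 1; rewrite gpolar_sum, RtoC_minus, E, RtoC_inv by lra; unfold u.
assert (Hx0 : RtoC x <> 0) by (intros E0; apply RtoC_inj in E0; lra).
field; now split.
Qed.

(** For odd exponents the positive and negative integers cancel in [zetac]. *)
Lemma bern_coef_odd n : bern_coef (2 * n + 3) = 0%R.
Proof.
destruct gpolar_spec as [_ [E _]]; specialize (E (2 * n + 1)%nat); unfold gpolar in E.
assert (Z : zetac (2 * n + 1) = 0).
{ unfold zetac; rewrite (CSeries_ext (fun m => / (- natC (S m)) ^ (2 * n + 1 + 2)) (fun m => - / natC (S m) ^ (2 * n + 1 + 2))).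
  - rewrite CSeries_opp; [ring|].
    apply asum_le with (2 := inv_sq_summable); intros m; pose proof (INR_S_ge_1 m).
    rewrite Cmod_inv, Cmod_pow by (apply Cpow_nz, natC_S_neq_0); unfold natC; rewrite Cmod_R, Rabs_pos_eq by lra.
    apply Rinv_le_contravar; [apply pow_lt; lra | apply Rle_pow; [lra | lia]].
  - intros m; replace (- natC (S m)) with (- (1) * natC (S m)) by ring; rewrite Cpow_mult_l, pow_opp_1.
    replace (2 * n + 1 + 2)%nat with (S (2 * (n + 1))) by lia; rewrite pow_1_odd.
    replace (RtoC (-1)) with (- (1)) by (rewrite <- RtoC_opp; f_equal; ring).
    field; apply Cpow_nz, natC_S_neq_0. }
rewrite Z in E; replace (2 * n + 3)%nat with (S (S (2 * n + 1))) by lia.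
apply RtoC_inj. apply NNPP; intros Hn; apply (Cmult_neq_0 _ ((- twopi_i) ^ S (2 * n + 1))) in Hn.
- apply Hn; rewrite E; unfold Cdiv; ring.
- apply Cpow_nz; intros E0; apply twopi_i_neq_0; replace twopi_i with (- - twopi_i) by ring; rewrite E0; ring.
Qed.

(** The zeta value is at least [1]. Nonvanishing matters because [Eisenstein] divides by the
    Bernoulli number. *)
Lemma bern_coef_even n : bern_coef (2 * n + 2) <> 0%R.
Proof.
destruct gpolar_spec as [_ [E _]]; specialize (E (2 * n)%nat); unfold gpolar in E.
replace (2 * n + 2)%nat with (S (S (2 * n))) by lia; intros H0; rewrite H0, Cmult_0_l in E.
assert (Z : zetac (2 * n) <> 0).
{ unfold zetac; rewrite (CSeries_ext (fun m => / (- natC (S m)) ^ (2 * n + 2)) (fun m => / natC (S m) ^ (2 * n + 2))).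
  - assert (Ec : CSeries (fun m => / natC (S m) ^ (2 * n + 2)) = RtoC (Series (fun m => / INR (S m) ^ (2 * n + 2))%R)).
    + apply is_Cseries_unique.
      apply is_Cseries_ext with (fun m => RtoC (/ INR (S m) ^ (2 * n + 2))).
      * intros m; unfold natC; rewrite RtoC_inv, RtoC_pow by (apply pow_nonzero, not_0_INR; lia); reflexivity.
      * apply is_Cseries_RtoC, Series_correct.
        apply ex_series_eventually_le with (N := 0%nat) (2 := inv_sq_summable); intros m _; pose proof (INR_S_ge_1 m).
        split; [left; apply Rinv_0_lt_compat, pow_lt; lra|].
        apply Rinv_le_contravar; [apply pow_lt; lra | apply Rle_pow; [lra | lia]].
    + rewrite Ec, <- RtoC_plus; intros Z; apply RtoC_inj in Z.
      assert (1 <= Series (fun m => / INR (S m) ^ (2 * n + 2)))%R; [|lra].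
      eapply Rle_trans; [|apply (sum_n_le_Series _ 0)].
      * rewrite sum_O; simpl INR; rewrite pow1; lra.
      * intros m; pose proof (INR_S_ge_1 m); left; apply Rinv_0_lt_compat, pow_lt; lra.
      * apply ex_series_eventually_le with (N := 0%nat) (2 := inv_sq_summable); intros m _; pose proof (INR_S_ge_1 m).
        split; [left; apply Rinv_0_lt_compat, pow_lt; lra|].
        apply Rinv_le_contravar; [apply pow_lt; lra | apply Rle_pow; [lra | lia]].
  - intros m; replace (- natC (S m)) with (- (1) * natC (S m)) by ring; rewrite Cpow_mult_l, pow_opp_1.
    replace (2 * n + 2)%nat with (2 * (n + 1))%nat by lia; rewrite pow_1_even; f_equal; ring. }
assert (Hq : inv_sq_coef (2 * n) <> 0) by (unfold inv_sq_coef; rewrite pow_opp_1, pow_1_even, Cmult_1_l; apply natC_S_neq_0).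
apply (Cmult_neq_0 _ _ Hq Z).
transitivity (twopi_i * natC (S (2 * n)) * (/ twopi_i * (inv_sq_coef (2 * n) * zetac (2 * n)) / natC (S (2 * n)))).
- field; split; [apply twopi_i_neq_0 | apply natC_S_neq_0].
- rewrite <- E; ring.
Qed.

(** * Lambert series *)

Definition moment (c : nat -> C) (k : nat) : C := CSeries (fun m => c m * natC (S m) ^ k).

(** Taylor coefficients at [z = 0] of [sum_m c_m exp (2 pi i (m + 1) z)]. *)
Definition expsum (c : nat -> C) (k : nat) : C := expc k * twopi_i ^ k * moment c k.

Definition exp_summable (c : nat -> C) (r : R) : Prop :=
  ex_series (fun m => Cmod (c m) * exp (INR (S m) * (2 * PI * r)))%R.

Lemma expc_neq_0 k : expc k <> 0.
Proof.
intros E; apply C1_nz; transitivity (factC k * expc k); [|rewrite E; ring].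
unfold expc; field; apply factC_neq_0.
Qed.

Lemma Cmod_twopi_i : Cmod twopi_i = (2 * PI)%R.
Proof.
pose proof PI_RGT_0; unfold twopi_i; rewrite !Cmod_mult, Cmod_Ci, !Cmod_R, !Rabs_pos_eq by lra; ring.
Qed.

(** Each exponential is expanded and the sums are exchanged; [exp_summable] is the summability of
    the double series of moduli on the circle of radius [r]. *)
Lemma expsum_Pser (c : nat -> C) (r : R) : (0 < r)%R -> exp_summable c r ->
  (forall k, asum (fun m => c m * natC (S m) ^ k)) /\ cvr (expsum c) r /\
  forall z, (Cmod z <= r)%R -> CSeries (fun m => c m * e2pi z ^ S m) = Pser (expsum c) z.
Proof.
intros Hr Hc; pose proof PI_RGT_0 as HP.
set (u := fun (z : C) m k => c m * (expc k * (natC (S m) * (twopi_i * z)) ^ k)).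
assert (D : forall z, (Cmod z <= r)%R -> dsum (u z)).
{ intros z Hz; apply dsum_le with (fun m k => Cmod (c m) * (/ INR (fact k) * (INR (S m) * (2 * PI * r)) ^ k))%R.
  - intros m k; pose proof (INR_S_ge_1 m); unfold u, expc, factC, natC.
    rewrite !Cmod_mult, Cmod_pow, !Cmod_mult, Cmod_twopi_i, Cmod_inv, !Cmod_R, !Rabs_pos_eq by (try apply factC_neq_0; try apply pos_INR).
    apply Rmult_le_compat_l; [apply Cmod_ge_0|].
    apply Rmult_le_compat_l; [left; apply Rinv_0_lt_compat, INR_fact_lt_0|].
    pose proof (Cmod_ge_0 z).
    assert (0 <= 2 * PI * Cmod z)%R by (apply Rmult_le_pos; lra).
    apply pow_incr; split; [apply Rmult_le_pos; lra|].
    apply Rmult_le_compat_l; [lra|]; apply Rmult_le_compat_l; lra.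
  - intros m; apply exR_scal. pose proof (is_exp_Reals (INR (S m) * (2 * PI * r))) as K; apply is_pseries_R in K; now eexists; exact K.
  - apply exR_ext with (2 := Hc); intros m; rewrite Series_scal_l; f_equal; symmetry.
    pose proof (is_exp_Reals (INR (S m) * (2 * PI * r))) as K; apply is_pseries_R in K; now apply is_series_unique. }
assert (Hm : forall k, asum (fun m => c m * natC (S m) ^ k)).
{ intros k; assert (Er : Cmod (RtoC r) = r) by (rewrite Cmod_R, Rabs_pos_eq; lra).
  assert (Nr : twopi_i * RtoC r <> 0) by (apply Cmult_neq_0; [apply twopi_i_neq_0 | apply (proj2 (Cmod_gt_0 _)); lra]).
  apply asum_ext with (fun m => / (expc k * (twopi_i * RtoC r) ^ k) * u (RtoC r) m k).
  - intros m; unfold u; rewrite (Cpow_mult_l (natC (S m))).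
    assert (N1 := Cpow_nz _ k Nr); pose proof (expc_neq_0 k) as N2.
    field; now split.
  - apply asum_scal, (dsum_col _ k (D (RtoC r) ltac:(lra))). }
assert (Ec : forall z k, CSeries (fun m => u z m k) = expsum c k * z ^ k).
{ intros z k; rewrite (CSeries_ext _ (fun m => (expc k * twopi_i ^ k * z ^ k) * (c m * natC (S m) ^ k))).
  - rewrite CSeries_scal by apply Hm; unfold expsum, moment; ring.
  - intros m; unfold u; rewrite !Cpow_mult_l; ring. }
split; [exact Hm|]; split.
- apply cvr_conv; intros z Hz; apply asum_ex.
  apply asum_ext with (2 := dsum_rows _ (dsum_swap _ (D z ltac:(lra)))); intros k; apply Ec.
- intros z Hz; unfold Pser; rewrite <- (CSeries_ext _ _ (Ec z)), <- (Fubini _ (D z Hz)).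
  apply CSeries_ext; intros m; rewrite <- e2pi_nat; unfold e2pi, u.
  replace (twopi_i * (natC (S m) * z)) with (natC (S m) * (twopi_i * z)) by ring.
  rewrite Cexp_Pser, CSeries_scal; [reflexivity|].
  apply cvr_asum with (Cmod (natC (S m) * (twopi_i * z)) + 1)%R; [apply expc_cvr | lra].
Qed.

(** [tailc N t] are the coefficients of [lambert3 q (q ^ N * zeta)] as a series in [zeta]. *)
Definition tailc (N : nat) (t : C) (m : nat) : C := (e2pi t ^ N) ^ S m / (1 - e2pi t ^ S m) / natC (S m) ^ 3.

(** The hypothesis gives [|q|^N e^(2 pi r) <= 1], and even at modulus one the cubes in the
    denominators ensure convergence. *)
Lemma tailc_summable (N : nat) (t : C) (r : R) : (0 < Im t)%R -> (r <= INR N * Im t)%R -> exp_summable (tailc N t) r.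
Proof.
intros Ht Hr; pose proof (Cmod_e2pi_lt_1 t Ht) as Hq; pose proof PI_RGT_0.
set (Y := RtoC (Cmod (e2pi t ^ N) * exp (2 * PI * r))).
assert (EY : Cmod Y = (Cmod (e2pi t ^ N) * exp (2 * PI * r))%R).
{ unfold Y; rewrite Cmod_R, Rabs_pos_eq; [reflexivity|]; apply Rmult_le_pos; [apply Cmod_ge_0 | left; apply exp_pos]. }
destruct (Lambert_Li3 (e2pi t) Y Hq) as [_ [H2 _]].
{ rewrite EY, <- e2pi_nat, Cmod_e2pi, <- exp_plus, <- exp_0.
  replace (Im (natC N * t)) with (INR N * Im t)%R by (unfold natC; destruct t; simpl; ring).
  assert (K : (- (2 * PI * (INR N * Im t)) + 2 * PI * r <= 0)%R) by nra.
  destruct K as [K|K]; [left; now apply exp_increasing | right; now rewrite K]. }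
apply exR_ext with (2 := H2); intros m.
assert (N1 : 1 - e2pi t ^ S m <> 0) by now apply one_sub_neq_0, Cmod_pow_S_lt_1.
assert (N2 : natC (S m) ^ 3 <> 0) by apply Cpow_nz, natC_S_neq_0.
unfold tailc; rewrite !Cmod_div, !(Cmod_pow _ (S m)), EY by assumption.
replace (exp (INR (S m) * (2 * PI * r))) with (exp (2 * PI * r) ^ S m)%R.
- rewrite Rpow_mult_distr; unfold Rdiv; ring.
- generalize (2 * PI * r)%R as x; intros x; clear N1 N2; induction (S m) as [|j IH]; [simpl; now rewrite Rmult_0_l, exp_0|].
  rewrite S_INR, Rmult_plus_distr_r, exp_plus, <- IH, Rmult_1_l; apply Rmult_comm.
Qed.

Lemma lambert3_tailc (N : nat) (t z : C) : lambert3 (e2pi t) (e2pi t ^ N * e2pi z) = CSeries (fun m => tailc N t m * e2pi z ^ S m).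
Proof. unfold lambert3, tailc; apply CSeries_ext; intros m; rewrite Cpow_mult_l; unfold Cdiv; ring. Qed.

(** * Divisor sums as Lambert series *)

Definition divides_ind (d n : nat) : C := if Nat.eqb (n mod d) 0 then 1 else 0.

(** Divisibility by [d = m + 1] has period [d], so the sum [s] satisfies [s = q^d + q^d s]. *)
Lemma divides_sum (q : C) (m : nat) : (Cmod q < 1)%R ->
  is_Cseries (fun n => divides_ind (S m) (S n) * q ^ S n) (q ^ S m / (1 - q ^ S m)).
Proof.
intros Hq; set (u := fun n => divides_ind (S m) (S n) * q ^ S n).
assert (Hu : asum u).
{ apply asum_le with (fun n => Cmod (q * q ^ n)).
  - intros n; unfold u, divides_ind; destruct (_ =? _)%nat; rewrite ?Cmult_1_l, ?Cmult_0_l, ?Cmod_0; [apply Rle_refl | apply Cmod_ge_0].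
  - now apply asum_scal, asum_geom. }
assert (E : is_Cseries u (sum_n u m + q ^ S m * CSeries u)).
{ apply is_Cseries_incr_n, is_Cseries_ext with (2 := is_Cseries_scal (q ^ S m) _ _ (asum_is _ Hu)); intros n.
  unfold u, divides_ind; replace (S (n + S m)) with (S n + 1 * S m)%nat by lia.
  rewrite Nat.Div0.mod_add, Cpow_add_r, Nat.mul_1_l; ring. }
assert (Es : sum_n u m = q ^ S m).
{ assert (Z : forall j, (j < m)%nat -> u j = 0).
  { intros j Hj; unfold u, divides_ind; rewrite Nat.mod_small by lia; cbn [Nat.eqb]; ring. }
  assert (El : u m = q ^ S m) by (unfold u, divides_ind; rewrite Nat.Div0.mod_same; cbn [Nat.eqb]; ring).
  destruct m as [|m']; [now rewrite sum_O|].
  rewrite sum_Sn, El, (sum_n_ext_loc u (fun _ => zero)) by (intros j Hj; apply Z; lia).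
  unfold sum_n; rewrite (sum_n_m_const_zero (G := C_AbelianMonoid)); apply Cplus_0_l. }
rewrite Es in E; apply is_Cseries_unique in E.
assert (N : 1 - q ^ S m <> 0) by now apply one_sub_neq_0, Cmod_pow_S_lt_1.
replace (q ^ S m / (1 - q ^ S m)) with (CSeries u); [now apply asum_is|].
transitivity ((CSeries u - q ^ S m * CSeries u) / (1 - q ^ S m)); [field; exact N|].
rewrite E at 1; field; exact N.
Qed.

Lemma sigma_sum (k N : nat) : is_Cseries (fun m => natC (S m) ^ k * divides_ind (S m) (S N)) (natC (sigma k (S N))).
Proof.
set (u := fun m => _).
assert (E : forall j, sum_n u j = natC (list_sum (map (fun d => Nat.pow d k) (filter (fun d => Nat.eqb (Nat.modulo (S N) d) 0) (seq 1 (S j)))))).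
{ assert (Eu : forall j, u j = natC (list_sum (map (fun d => Nat.pow d k) (filter (fun d => Nat.eqb (Nat.modulo (S N) d) 0) (S j :: nil))))).
  { intros j; unfold u, divides_ind; cbn [filter]; destruct (_ =? _)%nat; cbn [map list_sum fold_right]; unfold natC.
    - rewrite Nat.add_0_r, pow_INR, RtoC_pow; ring.
    - simpl; ring. }
  induction j as [|j IH]; [now rewrite sum_O|].
  rewrite sum_Sn, IH, Eu, (seq_S (S j)), filter_app, map_app, list_sum_app.
  unfold natC at 3; rewrite plus_INR, RtoC_plus; reflexivity. }
unfold sigma; rewrite <- E. replace (sum_n u N) with (sum_n u N + 0) by ring.
apply is_Cseries_incr_n, is_Cseries_ext with (2 := is_Cseries_zero); intros n.
unfold u, divides_ind; rewrite Nat.mod_small by lia; cbn [Nat.eqb]; ring.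
Qed.

(** Each [sigma] is a sum over divisors, and exchanging it with the sum over [N] gives a Lambert
    series. The exponent is [k + 3] because [tailc] carries [1 / m^3]. *)
Lemma sigma_Lambert (k : nat) (t : C) : (0 < Im t)%R ->
  CSeries (fun N => natC (sigma k (S N)) * e2pi t ^ S N) = moment (tailc 1 t) (k + 3).
Proof.
intros Ht; set (q := e2pi t); assert (Hq : (Cmod q < 1)%R) by now apply Cmod_e2pi_lt_1.
set (u := fun m N => natC (S m) ^ k * (divides_ind (S m) (S N) * q ^ S N)).
assert (Eind : forall d n, Cmod (divides_ind d n) = Re (divides_ind d n)).
{ intros d n; unfold divides_ind; destruct (_ =? _)%nat; [apply Cmod_1 | apply Cmod_0]. }
assert (D : dsum u).
{ set (x := RtoC (Cmod q)).
  assert (Hx : (Cmod x < 1)%R) by (unfold x; rewrite Cmod_R, Rabs_pos_eq; [exact Hq | apply Cmod_ge_0]).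
  assert (H : forall m, is_series (fun N => Cmod (divides_ind (S m) (S N) * q ^ S N)) (Re (x ^ S m / (1 - x ^ S m)))).
  { intros m; destruct (proj1 (is_Cseries_iff _ _) (divides_sum x m Hx)) as [K _].
    apply is_series_ext with (2 := K); intros N; rewrite Cmod_mult, Cmod_pow, Eind.
    unfold x; rewrite <- RtoC_pow; unfold divides_ind; destruct (_ =? _)%nat; simpl; ring. }
  assert (Tx : exists t' : C, (0 < Im t')%R /\ e2pi t' = x).
  { exists (Ci * RtoC (Im t)); split; [simpl; unfold Im in *; lra|]. unfold x, q; rewrite Cmod_e2pi; unfold e2pi, Cexp, twopi_i, Ci; simpl.
    apply C_ext; simpl; match goal with |- context [exp ?a] => replace a with (- (2 * PI * Im t))%R by ring end.
    - match goal with |- context [cos ?a] => replace a with 0%R by ring end; rewrite cos_0; ring.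
    - match goal with |- context [sin ?a] => replace a with 0%R by ring end; rewrite sin_0; ring. }
  destruct Tx as [t' [Ht' Et']].
  destruct (expsum_Pser (tailc 1 t') (Im t') Ht') as [Hm _]; [apply tailc_summable; [exact Ht' | rewrite Rmult_1_l; lra]|].
  split.
  - intros m; apply asum_scal; eexists; apply H.
  - apply ex_series_eventually_le with (N := 0%nat) (2 := Hm (k + 3)%nat); intros m _.
    assert (E : Series (fun N => Cmod (u m N)) = (Cmod (natC (S m) ^ k) * Re (x ^ S m / (1 - x ^ S m)))%R).
    { unfold u; rewrite (Series_ext _ (fun N => Cmod (natC (S m) ^ k) * Cmod (divides_ind (S m) (S N) * q ^ S N))%R) by (intros; apply Cmod_mult).
      rewrite Series_scal_l; f_equal; now apply is_series_unique. }
    split; [apply Series_nonneg; [intros; apply Cmod_ge_0 | apply (asum_scal (natC (S m) ^ k)); eexists; apply H]|].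
    change (Series (fun N => Cmod (u m N)) <= Cmod (tailc 1 t' m * natC (S m) ^ (k + 3)))%R.
    rewrite E; unfold tailc; rewrite Et'.
    replace ((x ^ 1) ^ S m / (1 - x ^ S m) / natC (S m) ^ 3 * natC (S m) ^ (k + 3)) with (natC (S m) ^ k * (x ^ S m / (1 - x ^ S m))).
    + rewrite Cmod_mult; apply Rmult_le_compat_l; [apply Cmod_ge_0|]. eapply Rle_trans; [apply Rle_abs | apply re_le_Cmod].
    + rewrite Cpow_add_r; replace (x ^ 1) with x by (simpl; ring); field; split; [now apply one_sub_neq_0, Cmod_pow_S_lt_1 | apply natC_S_neq_0]. }
transitivity (CSeries (fun N => CSeries (fun m => u m N))).
- apply CSeries_ext; intros N; symmetry; apply is_Cseries_unique; unfold u.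
  rewrite Cmult_comm; apply is_Cseries_ext with (2 := is_Cseries_scal (q ^ S N) _ _ (sigma_sum k N)); intros m; ring.
- rewrite <- (Fubini _ D); apply CSeries_ext; intros m; unfold u.
  apply is_Cseries_unique; unfold tailc; fold q.
  replace ((q ^ 1) ^ S m / (1 - q ^ S m) / natC (S m) ^ 3 * natC (S m) ^ (k + 3)) with (natC (S m) ^ k * (q ^ S m / (1 - q ^ S m))).
  + now apply is_Cseries_scal, divides_sum.
  + rewrite Cpow_add_r; replace (q ^ 1) with q by (simpl; ring); field; split; [now apply one_sub_neq_0, Cmod_pow_S_lt_1 | apply natC_S_neq_0].
Qed.

(** * Logarithms and the eta function *)

(** The principal logarithm on the unit disc around [1]. *)
Definition log1 (v : C) : C := Pser (int (fun n => (- (1)) ^ n)) (v - 1).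

Lemma cvr_alt : cvr (fun n => (- (1)) ^ n) 1.
Proof. apply cvr_bounded with 1%R; intros n; rewrite Cmod_pow_opp_1, pow1; lra. Qed.

Lemma disc_1_neq_0 v : disc 1 1 v -> v <> 0.
Proof. unfold disc; intros H ->; replace (0 - 1) with (- (1)) in H by ring; rewrite Cmod_opp, Cmod_1 in H; lra. Qed.

Lemma Cder_log1 v : disc 1 1 v -> Cder log1 v (/ v).
Proof.
intros Hv; apply Cder_eq with (Pser (fun n => (- (1)) ^ n) (v - 1) * (1 - 0)).
- apply (Cder_comp (fun v => v - 1) (Pser (int (fun n => (- (1)) ^ n)))).
  + apply Cder_minus; [apply Cder_id | apply Cder_const].
  + apply Pser_int_Cder with 1%R; [apply cvr_alt | exact Hv].
- assert (H : (Cmod (- (v - 1)) < 1)%R) by (rewrite Cmod_opp; exact Hv).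
  unfold Pser; rewrite (CSeries_ext _ (fun n => (- (v - 1)) ^ n)).
  + rewrite CSeries_geom by exact H; replace (1 - - (v - 1)) with v by ring; ring.
  + intros n; rewrite <- Cpow_mult_l; f_equal; ring.
Qed.

Lemma Cexp_log1 v : disc 1 1 v -> Cexp (log1 v) = v.
Proof.
intros Hv; assert (H1 : disc 1 1 1) by (apply disc_center; lra).
assert (E : Cexp (log1 v) * / v = Cexp (log1 1) * / 1).
{ apply (Cder_zero_const (disc 1 1) (fun v => Cexp (log1 v) * / v)); [apply disc_convex | | exact H1 | exact Hv].
  intros w Hw; pose proof (disc_1_neq_0 w Hw) as Nw.
  apply Cder_eq with ((Cexp (log1 w) * / w) * / w + Cexp (log1 w) * (- / (w * w))); [|field; exact Nw].
  apply (Cder_mult (fun v => Cexp (log1 v)) Cinv); [apply (Cder_comp log1 Cexp); [now apply Cder_log1 | apply Cder_Cexp] | now apply Cder_inv]. }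
assert (E1 : log1 1 = 0) by (unfold log1; replace (1 - 1) with (RtoC 0) by ring; apply Pser_0).
rewrite E1, Cexp_0 in E; pose proof (disc_1_neq_0 v Hv).
transitivity (Cexp (log1 v) * / v * v); [field; assumption | rewrite E; field].
Qed.

Lemma log1_one_sub x : (Cmod x < 1)%R -> asum (fun m => / natC (S m) * x ^ S m) /\
  log1 (1 - x) = - CSeries (fun m => / natC (S m) * x ^ S m).
Proof.
intros Hx; assert (Hx' : (Cmod (1 - x - 1) < 1)%R) by (replace (1 - x - 1) with (- x) by ring; now rewrite Cmod_opp).
assert (K := cvr_asum _ _ _ (cvr_int _ _ cvr_alt) Hx'); apply asum_incr in K.
assert (Et : forall m, int (fun n => (- (1)) ^ n) (S m) * (1 - x - 1) ^ S m = - (/ natC (S m) * x ^ S m)).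
{ intros m; cbn [int]; replace (1 - x - 1) with (- (1) * x) by ring; rewrite Cpow_mult_l.
  assert (E : (- (1)) ^ m * (- (1)) ^ S m = - (1)).
  { rewrite <- Cpow_add_r; replace (m + S m)%nat with (S (2 * m)) by lia; rewrite pow_opp_1, pow_1_odd, <- RtoC_opp; f_equal; ring. }
  transitivity (((- (1)) ^ m * (- (1)) ^ S m) * (/ natC (S m) * x ^ S m)); [unfold Cdiv; ring | rewrite E; ring]. }
assert (As : asum (fun m => / natC (S m) * x ^ S m)).
{ apply asum_ext with (2 := asum_opp _ K); intros m; rewrite Et; ring. }
split; [exact As|]. unfold log1; rewrite (Pser_incr _ 1) by (exact Hx' || apply cvr_int, cvr_alt).
cbn [int]; rewrite <- CSeries_opp by exact As; rewrite Cplus_0_l; unfold Pser.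
rewrite <- CSeries_scal.
- apply CSeries_ext; intros m; rewrite <- Et; simpl Cpow; cbn [int]; ring.
- apply (cvr_asum (fun n => int (fun n => (- (1)) ^ n) (S n)) 1); [apply (cvr_unshift (int _)), cvr_int, cvr_alt | exact Hx'].
Qed.

Lemma CLim_unique (u : nat -> C) (l : C) :
  (forall eps, (0 < eps)%R -> eventually (fun n => (Cmod (u n - l) < eps)%R)) -> CLim u = l.
Proof.
intros H.
assert (K : forall (f : C -> R), (forall x, (Rabs (f x) <= Cmod x)%R) -> (forall x y, f (x - y) = (f x - f y)%R) ->
   Lim_seq (fun n => f (u n)) = f l).
{ intros f Hf Hm; apply is_lim_seq_unique, is_lim_seq_spec; intros eps.
  generalize (H eps (cond_pos eps)); apply filter_imp; intros n Hn.
  rewrite <- Hm; eapply Rle_lt_trans; [apply Hf | exact Hn]. }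
unfold CLim; apply C_ext; cbn [Re Im fst snd].
- now rewrite (K Re re_le_Cmod).
- now rewrite (K Im im_le_Cmod).
Qed.

(** [logeta0 t] is the logarithm of [eta t] given by
    [log eta = 2 pi i t / 24 + sum_n log (1 - q ^ n)]. *)
Definition logeta0 (t : C) : C := twopi_i * t / 24 - moment (tailc 1 t) 2.

(** The partial products are exponentials of the partial sums of [log (1 - q^n)]. The Lambert
    rearrangement turns their limit into minus the sum of [q^m / (m (1 - q^m))], the moment of order
    [2]. *)
Lemma Cexp_logeta0 t : (0 < Im t)%R -> Cexp (logeta0 t) = eta t.
Proof.
intros Ht; pose proof (Cmod_e2pi_lt_1 t Ht) as Hq; set (q := e2pi t) in *.
assert (Hqn : forall n, (Cmod (q ^ S n) < 1)%R) by (intros n; now apply Cmod_pow_S_lt_1).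
destruct (Lambert (fun m => / natC (S m)) q q Hq (proj1 (log1_one_sub q Hq))) as [_ [H2 [_ H4]]].
set (u := fun n => log1 (1 - q ^ S n)).
assert (Eu : forall n, u n = - CSeries (fun m => / natC (S m) * (q ^ n * q) ^ S m)).
{ intros n; unfold u; rewrite (proj2 (log1_one_sub _ (Hqn n))).
  do 2 f_equal; apply functional_extensionality; intros m; replace (q ^ n * q) with (q ^ S n) by (simpl; ring); reflexivity. }
assert (Hu : is_Cseries u (- moment (tailc 1 t) 2)).
{ replace (moment (tailc 1 t) 2) with (CSeries (fun n => CSeries (fun m => / natC (S m) * (q ^ n * q) ^ S m))).
  - apply is_Cseries_ext with (1 := fun n => eq_sym (Eu n)). apply is_Cseries_opp, asum_is, H2.
  - rewrite H4; apply CSeries_ext; intros m; unfold tailc; fold q; replace (q ^ 1) with q by (simpl; ring).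
    field; split; [now apply one_sub_neq_0 | apply natC_S_neq_0]. }
assert (Ep : forall n, eta_prod q (S n) = Cexp (sum_n u n)).
{ assert (El : forall n, Cexp (u n) = 1 - q ^ S n).
  { intros n; apply Cexp_log1; unfold disc; replace (1 - q ^ S n - 1) with (- q ^ S n) by ring; now rewrite Cmod_opp. }
  induction n as [|n IH].
  - rewrite sum_O, El; cbn [eta_prod]; ring.
  - rewrite sum_Sn; change (plus (sum_n u n) (u (S n))) with (sum_n u n + u (S n)).
    rewrite Cexp_add, El, <- IH; reflexivity. }
unfold eta; fold q; unfold logeta0.
replace (twopi_i * t / 24 - moment (tailc 1 t) 2) with (twopi_i * (t / 24) + - moment (tailc 1 t) 2) by (unfold Cdiv; ring).
rewrite Cexp_add; f_equal; symmetry; apply CLim_unique; intros eps He.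
destruct (Cder_cont _ _ _ (Cder_Cexp (- moment (tailc 1 t) 2)) eps He) as [d [Hd K]].
destruct (proj1 (is_Cseries_lim _ _) Hu d Hd) as [N HN].
exists (S N); intros n Hn; destruct n as [|n]; [lia|]. rewrite Ep; apply K, HN; lia.
Qed.

Lemma locally_disc (x : C) (P : C -> Prop) :
  locally x P <-> exists e, (0 < e)%R /\ forall y, (Cmod (y - x) < e)%R -> P y.
Proof.
split; intros [e He].
- exists e; split; [apply cond_pos|]; intros y Hy; now apply He, ball_Cmod.
- destruct He as [He K]; exists (mkposreal (e / 2) ltac:(lra)); intros y Hy; apply K.
  apply Cmod_ball in Hy; simpl in Hy; lra.
Qed.

(** Dominated convergence on [Im t > Im t0 / 2] with a geometric majorant. Continuity is what makes
    [logeta0] comparable with the branches of [mv_log]. *)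
Lemma logeta0_cont t0 : (0 < Im t0)%R -> Ccont logeta0 t0.
Proof.
intros Ht0; pose proof PI_RGT_0 as HP.
set (x := exp (- (2 * PI * (Im t0 / 2)))).
assert (Hx : (0 < x < 1)%R).
{ split; [apply exp_pos|]; unfold x; rewrite <- exp_0; apply exp_increasing; nra. }
set (g := fun (t : C) (m : nat) => li3_D3 (natC (S m) * t) / natC (S m)).
assert (Im_nat : forall m t, Im (natC (S m) * t) = (INR (S m) * Im t)%R) by (intros m [a b]; unfold natC; simpl Im; simpl; ring).
assert (Eg : forall t, moment (tailc 1 t) 2 = CSeries (g t)).
{ intros t; apply CSeries_ext; intros m; unfold tailc, g, li3_D3; rewrite e2pi_nat.
  replace (e2pi t ^ 1) with (e2pi t) by (simpl; ring).
  unfold Cdiv; pose proof (natC_S_neq_0 m). generalize (/ (1 - e2pi t ^ S m)) as y; intros y; field; assumption. }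
assert (Hnear : forall t, (Cmod (t - t0) < Im t0 / 2)%R -> (Im t0 / 2 < Im t)%R).
{ intros t H; pose proof (im_le_Cmod (t - t0)) as K; change (Im (t - t0)) with (Im t - Im t0)%R in K.
  apply Rle_lt_trans with (2 := H), Rabs_def2 in K; lra. }
assert (Hb : forall t, (Im t0 / 2 < Im t)%R -> forall m, (Cmod (g t m) <= / (1 - x) * (x * x ^ m))%R).
{ intros t Ht m; unfold g, li3_D3; rewrite e2pi_nat.
  assert (Hq : (Cmod (e2pi t) <= x)%R) by (rewrite Cmod_e2pi; unfold x; left; apply exp_increasing; nra).
  assert (Hqm : (Cmod (e2pi t ^ S m) <= x ^ S m)%R) by (rewrite Cmod_pow; apply pow_incr; split; [apply Cmod_ge_0 | exact Hq]).
  assert (Hxm : (x ^ S m <= x)%R) by (simpl; pose proof (pow_S_le_1 x m ltac:(lra)); nra).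
  assert (H1 : (1 - x <= Cmod (1 - e2pi t ^ S m))%R).
  { pose proof (Cmod_triangle (1 - e2pi t ^ S m) (e2pi t ^ S m)) as T.
    replace (1 - e2pi t ^ S m + e2pi t ^ S m) with (RtoC 1) in T by ring; rewrite Cmod_1 in T; lra. }
  assert (N1 : 1 - e2pi t ^ S m <> 0) by (apply (proj2 (Cmod_gt_0 _)); lra).
  pose proof (INR_S_ge_1 m).
  rewrite Cmod_div, Cmod_div by (assumption || apply natC_S_neq_0). unfold natC; rewrite Cmod_R, Rabs_pos_eq by lra.
  unfold Rdiv; rewrite (Rmult_comm (/ (1 - x))), <- (Rmult_1_r (x * x ^ m * / (1 - x))).
  pose proof (Cmod_ge_0 (e2pi t ^ S m)).
  assert (0 < / Cmod (1 - e2pi t ^ S m))%R by (apply Rinv_0_lt_compat; lra).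
  apply Rmult_le_compat; [apply Rmult_le_pos; lra | left; apply Rinv_0_lt_compat; lra | |].
  - apply Rmult_le_compat; [assumption | lra | exact Hqm | apply Rinv_le_contravar; lra].
  - rewrite <- Rinv_1; apply Rinv_le_contravar; lra. }
assert (Hbs : ex_series (fun m => / (1 - x) * (x * x ^ m))%R).
{ apply exR_scal, exR_scal, ex_series_geom; rewrite Rabs_pos_eq; lra. }
intros eps He.
assert (C1 : exists d, (0 < d)%R /\ forall t, (Cmod (t - t0) < d)%R -> (Cmod (CSeries (g t) - CSeries (g t0)) < eps / 2)%R).
{ apply locally_disc; apply (Tannery (locally t0) g (g t0) _ Hbs).
  - apply locally_disc; exists (Im t0 / 2)%R; split; [lra|]; intros t Ht; now apply Hb, Hnear.
  - apply Hb; lra.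
  - intros m e Hem; apply locally_disc.
    assert (D : Cder (fun t => g t m) t0 (/ natC (S m) * (twopi_i * li3_D4 (natC (S m) * t0) * (natC (S m) * 1)))).
    { apply Cder_ext_all with (fun t => / natC (S m) * li3_D3 (natC (S m) * t)); [intros t; unfold g, Cdiv; ring|].
      apply Cder_scal, (Cder_comp (fun t => natC (S m) * t) li3_D3); [apply Cder_scal, Cder_id|].
      apply Cder_li3_D3; intros k Ek; apply (f_equal Im) in Ek; rewrite Im_nat in Ek; simpl (Im (RtoC _)) in Ek.
      pose proof (INR_S_ge_1 m); nra. }
    destruct (Cder_cont _ _ _ D e Hem) as [d Hd]; now exists d.
  - lra. }
destruct C1 as [d1 [Hd1 K1]].
assert (D2 : Cder (fun t => twopi_i * t / 24) t0 (twopi_i / 24)).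
{ apply Cder_ext_all with (fun t => (twopi_i / 24) * t + 0); [intros t; unfold Cdiv; ring | apply Cder_affine]. }
destruct (Cder_cont _ _ _ D2 (eps / 2)%R ltac:(lra)) as [d2 [Hd2 K2]].
exists (Rmin d1 d2); split; [now apply Rmin_pos|]; intros t Ht.
pose proof (Rmin_l d1 d2); pose proof (Rmin_r d1 d2).
unfold logeta0; rewrite !Eg.
replace (twopi_i * t / 24 - CSeries (g t) - (twopi_i * t0 / 24 - CSeries (g t0)))
  with ((twopi_i * t / 24 - twopi_i * t0 / 24) + - (CSeries (g t) - CSeries (g t0))) by ring.
eapply Rle_lt_trans; [apply Cmod_triangle|]; rewrite Cmod_opp.
specialize (K1 t ltac:(lra)); specialize (K2 t ltac:(lra)); cbv beta in K2; lra.
Qed.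

(** Two logarithms differ by [2 pi i k]. Near [p] this difference moves by less than [2], which is
    below [2 pi], so the integer is constant. *)
Lemma log_locally_unique (l l' : C * C -> C) (p : C * C) (e : R) : (0 < e)%R ->
  (forall eps, (0 < eps)%R -> exists d, (0 < d)%R /\ forall q, pdisc p d q -> (Cmod (l q - l p) < eps)%R) ->
  (forall eps, (0 < eps)%R -> exists d, (0 < d)%R /\ forall q, pdisc p d q -> (Cmod (l' q - l' p) < eps)%R) ->
  (forall q, pdisc p e q -> Cexp (l q) = Cexp (l' q)) ->
  exists d, (0 < d)%R /\ forall q, pdisc p d q -> l q = l' q + (l p - l' p).
Proof.
intros He H H' HE; pose proof PI_RGT_0 as HP.
destruct (H 1%R ltac:(lra)) as [d1 [Hd1 K1]], (H' 1%R ltac:(lra)) as [d2 [Hd2 K2]].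
exists (Rmin e (Rmin d1 d2)); split; [repeat apply Rmin_pos; assumption|]; intros q Hq.
pose proof (Rmin_l e (Rmin d1 d2)); pose proof (Rmin_r e (Rmin d1 d2)); pose proof (Rmin_l d1 d2); pose proof (Rmin_r d1 d2).
assert (EZ : forall q, pdisc p e q -> exists k : Z, l q - l' q = twopi_i * RtoC (IZR k)).
{ intros q' Hq'; apply Cexp_eq_1; unfold Cminus; rewrite Cexp_add, Cexp_opp, (HE _ Hq'); field; apply Cexp_neq_0. }
destruct (EZ p (pdisc_center p e He)) as [k Ek], (EZ q) as [j Ej]; [apply pdisc_mono with (2 := Hq); lra|].
specialize (K1 q); specialize (K2 q).
assert (B1 : (Cmod (l q - l p) < 1)%R) by (apply K1, pdisc_mono with (2 := Hq); lra).
assert (B2 : (Cmod (l' q - l' p) < 1)%R) by (apply K2, pdisc_mono with (2 := Hq); lra).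
assert (Ejk : j = k).
{ assert (B : (Cmod (twopi_i * RtoC (IZR (j - k))) < 2)%R).
  { rewrite minus_IZR, RtoC_minus.
    replace (twopi_i * (IZR j - IZR k)) with ((l q - l p) + - (l' q - l' p)) by (transitivity ((l q - l' q) - (l p - l' p)); [ring | rewrite Ej, Ek; ring]).
    eapply Rle_lt_trans; [apply Cmod_triangle|]; rewrite Cmod_opp; lra. }
  rewrite Cmod_mult, Cmod_twopi_i, Cmod_R, <- abs_IZR in B.
  assert (Hz : (Z.abs (j - k) < 1)%Z) by (apply lt_IZR; pose proof PI2_1; unfold PI2 in *; apply Rnot_le_lt; intros Hle; nra).
  lia. }
subst j; replace (l q) with ((l q - l' q) + l' q) by ring; rewrite Ej, Ek; ring.
Qed.

Lemma continuous_pdisc (l : C * C -> C) (p : C * C) : continuous l p ->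
  forall eps, (0 < eps)%R -> exists d, (0 < d)%R /\ forall q, pdisc p d q -> (Cmod (l q - l p) < eps)%R.
Proof.
intros H eps He; apply locally_pdisc, (H (fun y => (Cmod (y - l p) < eps)%R)).
apply locally_disc; now exists eps.
Qed.

(** * Continuation near the origin *)

Lemma li3_branch_comp (al be ga : C) (Om : C * C -> Prop) (U : C -> Prop) (l : C -> C) : Copen U -> D3on U l li3_D3 ->
  (forall p, Om p -> U (aff al be ga p)) -> li3_branch (aff al be ga) Om (fun p => l (aff al be ga p)).
Proof.
intros HU Hl H p Hp; destruct (HU _ (H p Hp)) as [d [Hd Kd]].
destruct (aff_cont al be ga p d Hd) as [e [He Ke]].
exists e, d, l, (fun _ => 0); split; [exact He|]; split; [exact Hd|]; split; [apply quad_zero|]; split.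
- now apply D3on_mono with (2 := Hl).
- intros q Hq; split; [now apply Ke | ring].
Qed.

Lemma aff_fst (p : C * C) : aff 1 0 0 p = fst p.
Proof. unfold aff; ring. Qed.

Fixpoint psum (u : nat -> C) (N : nat) : C := match N with O => 0 | S n => psum u n + u n end.

Lemma psum_ext u v N : (forall n, (n < N)%nat -> u n = v n) -> psum u N = psum v N.
Proof. intros H; induction N as [|N IH]; [reflexivity|]; cbn [psum]; rewrite IH, H by auto; reflexivity. Qed.

Lemma is_Cseries_psum u N T : is_Cseries (fun n => u (n + N)%nat) T -> is_Cseries u (psum u N + T).
Proof.
revert T; induction N as [|N IH]; intros T H; cbn [psum].
- rewrite Cplus_0_l; apply is_Cseries_ext with (2 := H); intros n; f_equal; lia.
- replace (psum u N + u N + T) with (psum u N + (u N + T)) by ring; apply IH.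
  apply (is_Cseries_incr (fun n => u (n + N)%nat)), is_Cseries_ext with (2 := H); intros n; f_equal; lia.
Qed.

Lemma Pser_psum (c : nat -> nat -> C) (r : R) N : (forall n, (n < N)%nat -> cvr (c n) r) ->
  cvr (fun k => psum (fun n => c n k) N) r /\
  forall z, (Cmod z < r)%R -> Pser (fun k => psum (fun n => c n k) N) z = psum (fun n => Pser (c n) z) N.
Proof.
intros H; induction N as [|N IH]; cbn [psum].
- split; [|intros; now apply Pser_all0].
  apply cvr_ext with (fun k => 0 * onec k); [intros; ring | apply cvr_scal, cvr_onec].
- destruct IH as [I1 I2]; [auto|]. assert (HN : cvr (c N) r) by auto.
  split; [now apply cvr_plus|]; intros z Hz.
  now rewrite (Pser_plus _ _ r), I2 by assumption.
Qed.

Lemma cvr_sgn (sg : C) a r : Cmod sg = 1%R -> cvr a r -> cvr (fun k => sg ^ k * a k) r.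
Proof. intros H; apply cvr_le; intros k; rewrite Cmod_mult, Cmod_pow, H, pow1; lra. Qed.

Lemma Pser_sgn (sg : C) a z : Pser (fun k => sg ^ k * a k) z = Pser a (sg * z).
Proof. apply CSeries_ext; intros k; rewrite Cpow_mult_l; ring. Qed.

(** The first disc has the origin on its boundary. It avoids the origin, so [log (z / z0)] is
    defined, yet it contains points arbitrarily near the origin, from which coefficients can be read
    off. *)
Definition cone (z0 : C) (r : R) (t0 : C) (s : R) (p : C * C) : Prop :=
  disc z0 (Cmod z0) (fst p) /\ disc 0 r (fst p) /\ disc t0 s (snd p).

Lemma disc_0 r z : disc 0 r z <-> (Cmod z < r)%R.
Proof. unfold disc; now replace (z - 0) with z by ring. Qed.

Lemma cone_open z0 r t0 s : open (cone z0 r t0 s).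
Proof.
apply open_and; [|apply open_and]; apply open_of_pdisc; intros p Hp.
all: destruct (disc_open _ _ _ Hp) as [d [Hd Kd]]; exists d; split; [exact Hd|]; intros q Hq; apply Kd, Hq.
Qed.

Lemma cone_connected z0 r t0 s : connected_set (cone z0 r t0 s).
Proof.
apply convex_connected; [apply cone_open|].
intros p q t [H1 [H2 H3]] [K1 [K2 K3]] Ht; repeat split; cbn [fst snd]; now apply disc_convex.
Qed.

Lemma Im_disc t0 t s : (s <= Im t0 / 2)%R -> disc t0 s t -> (Im t0 / 2 < Im t)%R.
Proof.
intros Hs H; unfold disc in H; pose proof (im_le_Cmod (t - t0)) as K.
change (Im (t - t0)) with (Im t - Im t0)%R in K.
apply Rle_lt_trans with (2 := H), Rabs_def2 in K; lra.
Qed.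

Section Model.

Variables (t0 z0 : C) (N : nat) (rho r s : R).
Hypotheses (Ht0 : (0 < Im t0)%R) (Hr : (0 < r)%R) (Hs : (0 < s <= Im t0 / 2)%R)
  (Hrs : (r + INR N * s <= rho)%R) (Htail : (r <= INR (S N) * (Im t0 / 2))%R)
  (Hlat : forall n, (n < N)%nat -> forall m : Z, (rho <= Cmod (natC (S n) * t0 + ZC m))%R).

(** The first [N] summands may become singular nearby; they are replaced by threefold primitives of
    the expansion of [li3_D3] around [(n + 1) t0], recentred as [t] moves. The others stay in the
    unit disc and form a Lambert tail. The two values of [sg] serve the two sums. *)
Lemma one_side (sg : C) : sg = 1 \/ sg = - (1) ->
  exists (B : nat -> C * C -> C) (g : C -> nat -> C),
    (forall n, li3_branch (aff sg (natC (S n)) 0) (cone z0 r t0 s) (B n)) /\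
    forall t, disc t0 s t -> cvr (g t) r /\ (N = 0%nat -> forall k, g t k = 0) /\
      forall z, (Cmod z < r)%R -> is_Cseries (fun n => B n (z, t))
        (Pser (g t) z + / twopi_i ^ 3 * lambert3 (e2pi t) (e2pi t ^ S N * e2pi (sg * z))).
Proof.
intros Hsg; assert (Hsg1 : Cmod sg = 1%R) by (destruct Hsg as [-> | ->]; rewrite ?Cmod_opp; apply Cmod_1).
set (Q := fun n (a : nat -> C) => (n < N)%nat -> cvr a rho /\ forall u, (Cmod u < rho)%R -> li3_D3 (natC (S n) * t0 + u) = Pser a u).
set (a := fun n => epsilon (inhabits (fun _ => RtoC 0)) (Q n)).
assert (Ha : forall n, Q n (a n)).
{ intros n; apply epsilon_spec; destruct (lt_dec n N) as [Hn|Hn].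
  - destruct (li3_D3_Pser (natC (S n) * t0) rho) as [b Hb]; [pose proof (pos_INR N); nra | now apply Hlat | now exists b].
  - exists (fun _ => 0); intros H; contradiction. }
set (B := fun n p => if (n <? N)%nat then Pser (int3 (a n)) (aff sg (natC (S n)) 0 p - natC (S n) * t0)
   else / twopi_i ^ 3 * Li3_disc (e2pi (aff sg (natC (S n)) 0 p))).
set (g := fun t k => psum (fun n => sg ^ k * recenter (int3 (a n)) (natC (S n) * (t - t0)) k) N).
assert (Hsmall : forall n t, (n < N)%nat -> disc t0 s t -> (Cmod (natC (S n) * (t - t0)) <= rho - r)%R).
{ intros n t Hn Ht; unfold disc in Ht; rewrite Cmod_mult; unfold natC; rewrite Cmod_R, Rabs_pos_eq by apply pos_INR.
  apply Rle_trans with (INR N * s)%R; [|lra].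
  apply Rmult_le_compat; [apply pos_INR | apply Cmod_ge_0 | apply le_INR; lia | lra]. }
assert (Hw : forall n z t, aff sg (natC (S n)) 0 (z, t) - natC (S n) * t0 = natC (S n) * (t - t0) + sg * z)
  by (intros; unfold aff; cbn [fst snd]; ring).
assert (HIm : forall n z t, (N <= n)%nat -> disc t0 s t -> (Cmod z < r)%R -> (0 < Im (aff sg (natC (S n)) 0 (z, t)))%R).
{ intros n z t Hn Ht Hz; apply Im_disc in Ht; [|apply Hs].
  assert (Hz' : (Rabs (Im z) < r)%R) by (eapply Rle_lt_trans; [apply im_le_Cmod | exact Hz]).
  apply Rabs_def2 in Hz'.
  assert (INR (S N) * (Im t0 / 2) <= INR (S n) * Im t)%R.
  { apply Rmult_le_compat; [apply pos_INR | lra | apply le_INR; lia | lra]. }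
  destruct Hsg as [-> | ->]; unfold natC; [rewrite Im_aff_1 | rewrite Im_aff_m1]; cbn [fst snd]; lra. }
exists B, g; split.
- intros n; unfold B; destruct (Nat.ltb_spec n N) as [Hn|Hn].
  + destruct (Ha n Hn) as [A1 A2].
    apply (li3_branch_comp sg (natC (S n)) 0 _ (disc (natC (S n) * t0) rho) (fun w => Pser (int3 (a n)) (w - natC (S n) * t0))); [apply disc_open | |].
    * apply D3on_ext with (fun w => Pser (int3 (a n)) (1 * w + - (natC (S n) * t0))) (fun w => 1 ^ 3 * Pser (a n) (1 * w + - (natC (S n) * t0))); [apply disc_open | | |].
      -- intros w _; f_equal; ring.
      -- intros w Hw'; unfold disc in Hw'.
         replace (1 * w + - (natC (S n) * t0)) with (w - natC (S n) * t0) by ring; rewrite <- A2 by exact Hw'.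
         replace (natC (S n) * t0 + (w - natC (S n) * t0)) with w by ring; ring.
      -- apply D3on_mono with (2 := D3on_affine _ 1 (- (natC (S n) * t0)) _ _ (Pser_int3_D3 _ _ A1)).
         intros w Hw'; apply disc_0; unfold disc in Hw'; now replace (1 * w + - (natC (S n) * t0)) with (w - natC (S n) * t0) by ring.
    * intros [z t] [_ [H2 H3]]; cbn [fst snd] in *; unfold disc; rewrite Hw; apply -> disc_0 in H2.
      eapply Rle_lt_trans; [apply Cmod_triangle|]; rewrite (Cmod_mult sg), Hsg1.
      specialize (Hsmall n t Hn H3); lra.
  + apply li3_branch_disc; intros [z t] [_ [H2 H3]]; cbn [fst snd] in *; apply HIm; [exact Hn | exact H3 | now apply disc_0].
- intros t Ht.
  destruct (Pser_psum (fun n k => sg ^ k * recenter (int3 (a n)) (natC (S n) * (t - t0)) k) r N) as [P1 P2].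
  { intros n Hn; apply cvr_sgn; [exact Hsg1|]; specialize (Hsmall n t Hn Ht).
    apply cvr_mono with (rho - Cmod (natC (S n) * (t - t0)))%R; [lra|].
    apply recenter_cvr; [apply cvr_int3, Ha, Hn | lra]. }
  split; [exact P1|]; split; [intros HN k; unfold g; now rewrite HN|].
  intros z Hz; unfold g; rewrite P2 by exact Hz.
  rewrite (psum_ext _ (fun n => B n (z, t))).
  + apply is_Cseries_psum.
    assert (Ht' : (0 < Im t)%R) by (apply Im_disc in Ht; [lra | apply Hs]).
    destruct (Lambert_Li3 (e2pi t) (e2pi t ^ S N * e2pi (sg * z)) (Cmod_e2pi_lt_1 _ Ht')) as [K1 [_ K2]].
    { rewrite <- e2pi_nat, <- e2pi_add; apply Cmod_e2pi_le_1; left.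
      replace (natC (S N) * t + sg * z) with (aff sg (natC (S N)) 0 (z, t)) by (unfold aff; cbn [fst snd]; ring).
      apply HIm; auto. }
    rewrite <- K2; apply is_Cseries_ext with (2 := is_Cseries_scal (/ twopi_i ^ 3) _ _ (asum_is _ K1)).
    intros n; unfold B; destruct (Nat.ltb_spec (n + N) N); [lia|]; do 2 f_equal.
    unfold aff; cbn [fst snd]; rewrite <- !e2pi_nat, <- !e2pi_add; f_equal.
    unfold natC; replace (S (n + N)) with (n + S N)%nat by lia; rewrite plus_INR, RtoC_plus; ring.
  + intros n Hn; unfold B; destruct (Nat.ltb_spec n N); [|lia]. rewrite Pser_sgn, Hw.
    specialize (Hsmall n t Hn Ht).
    symmetry; apply Pser_recenter with rho; [apply cvr_int3, Ha, Hn | lra |].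
    rewrite (Cmod_mult sg), Hsg1; lra.
Qed.

End Model.

Definition cubic_coef (t : C) : nat -> C := ccons (- li3_one t) (ccons 0 (ccons (- / 24 * t) (ccons (/ 12) (fun _ => 0)))).

Lemma Pser_ccons c a r z : cvr a r -> (Cmod z < r)%R -> Pser (ccons c a) z = c + z * Pser a z.
Proof. intros Ha Hz; apply (Pser_incr (ccons c a) r); [now apply cvr_shift | exact Hz]. Qed.

Lemma cvr_ccons c a r : cvr a r -> cvr (ccons c a) r.
Proof. intros H; now apply cvr_shift. Qed.

Lemma cvr_0 r : cvr (fun _ => 0) r.
Proof. apply cvr_ext with (fun k => 0 * onec k); [intros; ring | apply cvr_scal, cvr_onec]. Qed.

Lemma cubic_coef_Pser t r : cvr (cubic_coef t) r /\ forall z, Pser (cubic_coef t) z = / 12 * z ^ 3 - / 24 * z ^ 2 * t - li3_one t.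
Proof.
split; [repeat apply cvr_ccons; apply cvr_0|]; intros z; unfold cubic_coef.
rewrite !(Pser_ccons _ _ (Cmod z + 1)), (Pser_all0 (fun _ => 0)) by (try lra; try reflexivity; repeat apply cvr_ccons; apply cvr_0).
ring.
Qed.

(** Coefficients of [(2 pi i)^-3 (lambert3 q (q ^ N * zeta) + lambert3 q (q ^ N / zeta))]. *)
Definition tail_coef (N : nat) (t : C) (k : nat) : C := / twopi_i ^ 3 * ((1 + (- (1)) ^ k) * expsum (tailc N t) k).

Lemma tail_coef_Pser (N : nat) (t : C) (r : R) : (0 < Im t)%R -> (0 < r <= INR N * Im t)%R -> cvr (tail_coef N t) r /\
  forall z, (Cmod z < r)%R -> Pser (tail_coef N t) z =
    / twopi_i ^ 3 * (lambert3 (e2pi t) (e2pi t ^ N * e2pi z) + lambert3 (e2pi t) (e2pi t ^ N * e2pi (- z))).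
Proof.
intros Ht Hr; destruct (expsum_Pser (tailc N t) r ltac:(lra)) as [_ [E1 E2]]; [apply tailc_summable; lra|].
assert (E3 : cvr (fun k => (- (1)) ^ k * expsum (tailc N t) k) r) by (apply cvr_sgn; [now rewrite Cmod_opp, Cmod_1 | exact E1]).
assert (Ek : forall k, / twopi_i ^ 3 * (expsum (tailc N t) k + (- (1)) ^ k * expsum (tailc N t) k) = tail_coef N t k)
  by (intros k; unfold tail_coef; ring).
split; [apply cvr_ext with (1 := Ek); now apply cvr_scal, cvr_plus|]; intros z Hz.
unfold Pser; rewrite <- (CSeries_ext _ _ (fun k => f_equal (fun x => x * z ^ k) (Ek k))).
fold (Pser (fun k => / twopi_i ^ 3 * (expsum (tailc N t) k + (- (1)) ^ k * expsum (tailc N t) k)) z).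
rewrite (Pser_scal _ _ r), (Pser_plus _ _ r), Pser_sgn by (assumption || now apply cvr_plus).
replace (- (1) * z) with (- z) by ring.
rewrite <- !E2, <- !lambert3_tailc by (rewrite ?Cmod_opp; lra); reflexivity.
Qed.

(** A threefold primitive of [- 1 / (2 pi i z)], with the logarithm normalised to vanish at [z0]. *)
Definition log_part (z0 z : C) : C := - / twopi_i * (/ 2 * z ^ 2 * log1 (z / z0)).

Lemma disc_cone_1 (z0 z : C) : z0 <> 0 -> disc z0 (Cmod z0) z -> disc 1 1 (z / z0).
Proof.
intros Hz0 Hz; assert (H0 : (0 < Cmod z0)%R) by (apply (proj1 (Cmod_gt_0 z0)); exact Hz0).
unfold disc in *; replace (z / z0 - 1) with ((z - z0) / z0) by (field; exact Hz0).
rewrite Cmod_div by exact Hz0; apply (Rmult_lt_reg_r (Cmod z0)); [exact H0|].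
unfold Rdiv; rewrite Rmult_assoc, Rinv_l by lra; lra.
Qed.

Lemma log_part_D3 (z0 : C) : z0 <> 0 -> D3on (disc z0 (Cmod z0)) (log_part z0) (fun z => - / (twopi_i * z)).
Proof.
intros Hz0; exists (fun z => - / twopi_i * (z * log1 (z / z0) + / 2 * z)), (fun z => - / twopi_i * (log1 (z / z0) + 3 * / 2)).
intros z Hz; pose proof twopi_i_neq_0 as Hp.
assert (Nz : z <> 0).
{ intros ->; unfold disc in Hz; replace (0 - z0) with (- z0) in Hz by ring; rewrite Cmod_opp in Hz; lra. }
assert (Dl : Cder (fun z => log1 (z / z0)) z (/ z)).
{ apply Cder_eq with (/ (z / z0) * / z0); [|field; now split].
  apply (Cder_comp (fun z => z / z0) log1); [|apply Cder_log1; now apply disc_cone_1].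
  apply Cder_ext_all with (fun z => / z0 * z + 0); [intros; unfold Cdiv; ring | apply Cder_affine]. }
repeat split.
- apply Cder_scal, Cder_eq with ((/ 2 * (natC 2 * z ^ 1)) * log1 (z / z0) + (/ 2 * z ^ 2) * / z).
  + apply (Cder_mult (fun z => / 2 * z ^ 2) (fun z => log1 (z / z0))); [apply Cder_scal, Cder_pow | exact Dl].
  + unfold natC; simpl INR; rewrite RtoC_plus; field; exact Nz.
- apply Cder_scal, Cder_eq with ((1 * log1 (z / z0) + z * / z) + / 2 * 1); [|field; exact Nz].
  apply Cder_plus; [|apply Cder_scal, Cder_id].
  apply (Cder_mult (fun z => z) (fun z => log1 (z / z0))); [apply Cder_id | exact Dl].
- apply Cder_eq with (- / twopi_i * (/ z + 0)); [|field; now split].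
  apply Cder_scal, Cder_plus; [exact Dl | apply Cder_const].
Qed.

(** For [N = 1], the coefficients of the expansion of [f] at [z = 0] apart from the
    logarithm; see [taylor_Pser]. *)
Definition f_coef (N : nat) (t : C) (k : nat) : C := int3 gpolar k + tail_coef N t k + cubic_coef t k.

(** The number [N] governs a trade-off: for [N = 0] the coefficients are explicit but [r] is at most
    [Im t0 / 2], while a large [N] allows a large radius with coefficients that are not explicit. *)
Lemma f_branch_model (t0 z0 : C) (N : nat) (rho r s : R) : (0 < Im t0)%R -> z0 <> 0 -> (0 < r)%R -> (0 < s <= Im t0 / 2)%R ->
  (r + INR N * s <= rho)%R -> (rho <= 1)%R -> (r <= INR (S N) * (Im t0 / 2))%R ->
  (forall n, (n < N)%nat -> forall m : Z, (rho <= Cmod (natC (S n) * t0 + ZC m))%R) ->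
  exists h : C -> nat -> C, f_branch (cone z0 r t0 s) (fun p => log_part z0 (fst p) + Pser (h (snd p)) (fst p)) /\
    forall t, disc t0 s t -> cvr (h t) r /\ (N = 0%nat -> forall k, h t k = f_coef 1 t k).
Proof.
intros Ht0 Hz0 Hr Hs Hrs Hrho Htail Hlat.
destruct (one_side t0 z0 N rho r s Ht0 Hr Hs Hrs Htail Hlat 1 ltac:(now left)) as [B [g [TB Hg]]].
destruct (one_side t0 z0 N rho r s Ht0 Hr Hs Hrs Htail Hlat (- (1)) ltac:(now right)) as [B' [g' [TB' Hg']]].
destruct gpolar_spec as [G1 [_ G2]].
assert (Hr1 : (r <= 1)%R) by (pose proof (pos_INR N); nra).
assert (Hgr : cvr (int3 gpolar) r) by (apply cvr_mono with 1%R; [exact Hr1 | now apply cvr_int3]).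
exists (fun t k => f_coef (S N) t k + g t k + g' t k).
assert (Hh : forall t, disc t0 s t -> cvr (f_coef (S N) t) r /\ cvr (g t) r /\ cvr (g' t) r /\ cvr (tail_coef (S N) t) r /\ (0 < r <= INR (S N) * Im t)%R /\ (0 < Im t)%R).
{ intros t Ht; assert (HI := Im_disc _ _ _ (proj2 Hs) Ht).
  assert (Hrt : (0 < r <= INR (S N) * Im t)%R).
  { split; [exact Hr|]; apply Rle_trans with (1 := Htail), Rmult_le_compat_l; [apply pos_INR | lra]. }
  assert (Htl := proj1 (tail_coef_Pser (S N) t r ltac:(lra) Hrt)).
  repeat split; try lra; try exact Htl; [|now apply Hg | now apply Hg'].
  apply cvr_plus; [now apply cvr_plus | apply cubic_coef_Pser]. }
split.
- set (L := fun n => match n with O => fun p => log_part z0 (fst p) + Pser (int3 gpolar) (fst p) | S n => B n end).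
  exists L, B'.
  split; [|split; [exact TB'|]].
  + intros [|n]; [|exact (TB n)].
    apply li3_branch_ext with (w := aff 1 0 0) (L := fun p => (fun w => log_part z0 w + Pser (int3 gpolar) w) (aff 1 0 0 p)); [apply cone_open | | |].
    * intros p; unfold W, aff, natC; simpl INR; ring.
    * intros p _; cbv beta; now rewrite aff_fst.
    * apply (li3_branch_comp 1 0 0 _ (fun w => disc z0 (Cmod z0) w /\ disc 0 1 w) (fun w => log_part z0 w + Pser (int3 gpolar) w)).
      -- intros w [W1 W2]; destruct (disc_open _ _ _ W1) as [d1 [Hd1 K1]], (disc_open _ _ _ W2) as [d2 [Hd2 K2]].
         exists (Rmin d1 d2); split; [now apply Rmin_pos|]; intros v Hv; unfold disc in Hv.
         pose proof (Rmin_l d1 d2); pose proof (Rmin_r d1 d2); split; [apply K1 | apply K2]; unfold disc; lra.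
      -- destruct (D3on_plus _ _ _ _ _ (D3on_mono _ _ _ _ (fun w (H : disc z0 (Cmod z0) w /\ disc 0 1 w) => proj1 H) (log_part_D3 z0 Hz0))
           (D3on_mono _ _ _ _ (fun w (H : disc z0 (Cmod z0) w /\ disc 0 1 w) => proj2 H) (Pser_int3_D3 _ _ G1))) as [f1 [f2 K]].
         exists f1, f2; intros w Hw; rewrite G2; [now apply K|].
         destruct Hw as [W1 W2]; apply -> disc_0 in W2; split; [|exact W2].
         apply (proj1 (Cmod_gt_0 w)); intros ->; unfold disc in W1; replace (0 - z0) with (- z0) in W1 by ring; rewrite Cmod_opp in W1; lra.
      -- intros p [P1 [P2 _]]; rewrite aff_fst.
         split; [exact P1|]; unfold disc in *; lra.
  + intros p [P1 [P2 P3]]; destruct p as [z t]; cbn [fst snd] in *; apply -> disc_0 in P2.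
    destruct (Hg t P3) as [C1 [_ S1]], (Hg' t P3) as [C2 [_ S2]], (Hh t P3) as [H1 [_ [_ [H2 [H3 H4]]]]].
    eexists; eexists; split; [|split; [exact (S2 z P2)|]].
    * exact (proj1 (is_Cseries_incr (fun n => L n (z, t)) _) (S1 z P2)).
    * cbn [fst snd].
      rewrite (Pser_plus _ _ r), (Pser_plus _ _ r) by (try assumption; now apply cvr_plus).
      unfold f_coef at 1; rewrite (Pser_plus _ _ r), (Pser_plus _ _ r) by (try assumption; try apply cubic_coef_Pser; now apply cvr_plus).
      rewrite (proj2 (tail_coef_Pser (S N) t r H4 H3)) by exact P2.
      rewrite (proj2 (cubic_coef_Pser t r)).
      assert (E1 : @eq C (- (1) * z) (- z)) by ring; rewrite E1, Cmult_1_l.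
      unfold L; cbn [fst snd]; match goal with |- ?a = ?b => change (@eq C a b) end; ring.
- intros t Ht; destruct (Hh t Ht) as [H1 [H2 [H3 _]]]; split; [apply cvr_plus; [now apply cvr_plus | exact H3]|].
  intros HN k; subst N; destruct (Hg t Ht) as [_ [Z1 _]], (Hg' t Ht) as [_ [Z2 _]].
  rewrite Z1, Z2 by reflexivity; ring.
Qed.

(** Agreement on a ray ending at the origin suffices to identify the coefficients. *)
Lemma quad_Pser_ray (P : C * C -> C) (t z0 : C) (a : nat -> C) (r e : R) : quad P -> z0 <> 0 -> (0 < r)%R -> (0 < e)%R -> cvr a r ->
  (forall x : R, (0 < x < e)%R -> (Cmod (RtoC x * z0) < r)%R -> Pser a (RtoC x * z0) = P (RtoC x * z0, t)) ->
  (forall k, a (3 + k)%nat = 0) /\ forall z, Pser a z = P (z, t).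
Proof.
intros [c00 [c10 [c01 [c20 [c11 [c02 HP]]]]]] Hz0 Hr He Ha H.
assert (H0 : (0 < Cmod z0)%R) by now apply (proj1 (Cmod_gt_0 z0)).
set (b := ccons (c00 + c01 * t + c02 * t ^ 2) (ccons (c10 + c11 * t) (ccons c20 (fun _ => 0)))).
assert (Hb : forall r, cvr b r) by (intros r'; repeat apply cvr_ccons; apply cvr_0).
assert (Eb : forall z, Pser b z = P (z, t)).
{ intros z; unfold b; rewrite !(Pser_ccons _ _ (Cmod z + 1)), (Pser_all0 (fun _ => 0)) by (try lra; try reflexivity; repeat apply cvr_ccons; apply cvr_0).
  rewrite HP; cbn [fst snd]; ring. }
assert (E : forall k, a k = b k).
{ intros k; enough (Z : a k + - (1) * b k = 0) by (replace (a k) with (a k + - (1) * b k + b k) by ring; rewrite Z; ring).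
  revert k; apply Pser_zero_accum with r; [exact Hr | apply cvr_plus; [exact Ha | now apply cvr_scal]|].
  intros d Hd; set (m := Rmin e (Rmin r d / Cmod z0)).
  assert (Hrd : (0 < Rmin r d)%R) by now apply Rmin_pos.
  assert (Hm : (0 < m)%R) by (apply Rmin_pos; [exact He | now apply Rdiv_lt_0_compat]).
  exists (RtoC (m / 2) * z0).
  assert (Em : Cmod (RtoC (m / 2) * z0) = (m / 2 * Cmod z0)%R) by (rewrite Cmod_mult, Cmod_R, Rabs_pos_eq by lra; reflexivity).
  assert (Hlt : (m / 2 * Cmod z0 < Rmin r d)%R).
  { assert (Hm2 : (m / 2 < Rmin r d / Cmod z0)%R) by (pose proof (Rmin_r e (Rmin r d / Cmod z0)); unfold m in *; lra).
    apply (Rmult_lt_compat_r (Cmod z0)) in Hm2; [|exact H0].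
    replace (Rmin r d / Cmod z0 * Cmod z0)%R with (Rmin r d) in Hm2 by (field; lra). exact Hm2. }
  pose proof (Rmin_l r d); pose proof (Rmin_r r d); rewrite Em; split; [split; [nra | lra]|].
  rewrite (Pser_plus _ _ r), (Pser_scal _ _ r), Eb, H by
    (try assumption; try apply cvr_scal; try apply Hb; try (rewrite Em; lra); pose proof (Rmin_l e (Rmin r d / Cmod z0)); unfold m in *; lra).
  ring. }
split; [intros k; now rewrite E|].
intros z; rewrite <- Eb; apply CSeries_ext; intros k; now rewrite E.
Qed.

(** The models for [N] and for [0] differ by a quadratic polynomial near the origin, so their
    coefficients agree from index [3] on. The explicit coefficients thereby inherit the large
    radius. *)
Lemma f_branch_base_aux (t0 z0 : C) (N : nat) (rho r s : R) : (0 < Im t0)%R -> z0 <> 0 -> (0 < r)%R -> (0 < s <= Im t0 / 2)%R ->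
  (r + INR N * s <= rho)%R -> (rho <= 1)%R -> (r <= INR (S N) * (Im t0 / 2))%R ->
  (forall n, (n < N)%nat -> forall m : Z, (rho <= Cmod (natC (S n) * t0 + ZC m))%R) ->
  f_branch (cone z0 r t0 s) (fun p => log_part z0 (fst p) + Pser (f_coef 1 (snd p)) (fst p)) /\
  forall t, disc t0 s t -> cvr (f_coef 1 t) r.
Proof.
intros Ht0 Hz0 Hr Hs Hrs Hrho Htail Hlat.
assert (H0 : (0 < Cmod z0)%R) by now apply (proj1 (Cmod_gt_0 z0)).
destruct (f_branch_model t0 z0 N rho r s Ht0 Hz0 Hr Hs Hrs Hrho Htail Hlat) as [h [Gh Hh]].
set (r1 := Rmin r (Rmin 1 (Im t0 / 2))).
assert (Hr1 : (0 < r1)%R) by (repeat apply Rmin_pos; lra).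
assert (Hr1r : (r1 <= r)%R) by apply Rmin_l.
assert (Hr11 : (r1 <= 1 /\ r1 <= Im t0 / 2)%R).
{ pose proof (Rmin_r r (Rmin 1 (Im t0 / 2))); pose proof (Rmin_l 1 (Im t0 / 2)); pose proof (Rmin_r 1 (Im t0 / 2)); unfold r1; lra. }
destruct (f_branch_model t0 z0 0 r1 r1 s Ht0 Hz0 Hr1 Hs) as [h1 [Gh1 Hh1]]; try (simpl INR; lra); [intros; lia|].
assert (Gh' : f_branch (cone z0 r1 t0 s) (fun p => log_part z0 (fst p) + Pser (h (snd p)) (fst p))).
{ apply f_branch_sub with (2 := Gh); intros p [P1 [P2 P3]]; repeat split; try assumption; unfold disc in *; lra. }
destruct (f_branch_unique _ _ _ (cone_open _ _ _ _) (cone_connected _ _ _ _) Gh' Gh1) as [P [HP EP]].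
assert (K : forall t, disc t0 s t -> cvr (f_coef 1 t) r /\ forall z, (Cmod z < r)%R -> Pser (h t) z - P (z, t) = Pser (f_coef 1 t) z).
{ intros t Ht; destruct (Hh t Ht) as [C1 _], (Hh1 t Ht) as [C2 C3].
  assert (Cb : cvr (f_coef 1 t) r1) by (apply cvr_ext with (2 := C2); now apply C3).
  assert (C1' : cvr (h t) r1) by (apply cvr_mono with (2 := C1); lra).
  set (a := fun k => h t k + - (1) * f_coef 1 t k).
  destruct (quad_Pser_ray P t z0 a r1 1 HP Hz0 Hr1 ltac:(lra)) as [Q1 Q2].
  - now apply cvr_plus; [|apply cvr_scal].
  - intros x Hx Hxr; unfold a; rewrite (Pser_plus _ _ r1), (Pser_scal _ _ r1) by (try assumption; now apply cvr_scal).
    rewrite <- EP; cbn [fst snd].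
    + assert (E1 : Pser (h1 t) (RtoC x * z0) = Pser (f_coef 1 t) (RtoC x * z0)) by (apply CSeries_ext; intros k; now rewrite C3).
      rewrite E1; ring.
    + split; [|split; [now apply disc_0 | exact Ht]]; unfold disc; cbn [fst snd].
      replace (RtoC x * z0 - z0) with (RtoC (x - 1) * z0) by (rewrite RtoC_minus; ring).
      rewrite Cmod_mult, Cmod_R, Rabs_left1 by lra; nra.
  - assert (Ca : forall r, cvr a r).
    { intros r'; do 3 apply cvr_shift; apply cvr_ext with (fun _ => 0); [intros k; symmetry; apply (Q1 k) | apply cvr_0]. }
    assert (Cb' : cvr (f_coef 1 t) r).
    { apply cvr_ext with (fun k => h t k + - (1) * a k); [intros k; unfold a; ring|].
      apply cvr_plus; [exact C1 | apply cvr_scal, Ca]. }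
    split; [exact Cb'|]; intros z Hz; rewrite <- Q2; unfold a.
    rewrite (Pser_plus _ _ r), (Pser_scal _ _ r) by (try assumption; now apply cvr_scal); ring. }
split; [|intros t Ht; now apply K].
apply f_branch_ext with (2 := f_branch_quad _ _ _ (quad_opp _ HP) Gh).
intros p [P1 [P2 P3]]; destruct p as [z t]; cbn [fst snd] in *; apply -> disc_0 in P2.
rewrite <- (proj2 (K t P3) z P2); unfold Cminus; match goal with |- ?a = ?b => change (@eq C a b) end; ring.
Qed.

(** * The radius of convergence and the nearest lattice point *)

Definition lat_free (t : C) (rho : R) : Prop :=
  forall m n : Z, (m <> 0 \/ n <> 0)%Z -> (rho <= Cmod (ZC n * t + ZC m))%R.

Lemma f_branch_base (t0 z0 : C) (rho r : R) : (0 < Im t0)%R -> z0 <> 0 -> (0 < r < rho)%R -> lat_free t0 rho ->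
  exists s, (0 < s)%R /\
    f_branch (cone z0 r t0 s) (fun p => log_part z0 (fst p) + Pser (f_coef 1 (snd p)) (fst p)) /\
    forall t, disc t0 s t -> (0 < Im t)%R /\ cvr (f_coef 1 t) r.
Proof.
intros Ht0 Hz0 Hr Hlat.
destruct (INR_unbounded (rho / (Im t0 / 2))) as [N HN].
apply (Rmult_lt_compat_r (Im t0 / 2)) in HN; [|lra].
replace (rho / (Im t0 / 2) * (Im t0 / 2))%R with rho in HN by (field; lra).
set (s := Rmin (Im t0 / 2) ((rho - r) / INR (S N))). pose proof (INR_S_ge_1 N) as HS.
assert (Hs : (0 < s)%R) by (apply Rmin_pos; [lra | apply Rdiv_lt_0_compat; lra]).
assert (Hs1 : (s <= Im t0 / 2)%R) by apply Rmin_l.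
assert (Hs2 : (INR (S N) * s <= rho - r)%R).
{ pose proof (Rmin_r (Im t0 / 2) ((rho - r) / INR (S N))) as K; fold s in K.
  apply (Rmult_le_compat_l (INR (S N))) in K; [|lra].
  replace (INR (S N) * ((rho - r) / INR (S N)))%R with (rho - r)%R in K by (field; lra). exact K. }
rewrite S_INR in *.
destruct (f_branch_base_aux t0 z0 N rho r s Ht0 Hz0) as [G1 G2]; try rewrite S_INR; try nra.
- specialize (Hlat 1%Z 0%Z ltac:(lia)); unfold ZC in Hlat.
  replace (0 * t0 + 1) with (RtoC 1) in Hlat by ring; rewrite Cmod_1 in Hlat; exact Hlat.
- intros n _ m; rewrite natC_IZR; apply Hlat; lia.
- exists s; split; [exact Hs|]; split; [exact G1|]; intros t Ht; split; [|now apply G2].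
  apply Im_disc in Ht; [lra | exact Hs1].
Qed.

Lemma D3on_det (U : C -> Prop) (f g g' : C -> C) : Copen U -> D3on U f g -> D3on U f g' -> forall w, U w -> g w = g' w.
Proof.
intros HU [f1 [f2 H]] [k1 [k2 H']].
assert (E1 : forall w, U w -> f1 w = k1 w) by (intros w Hw; apply (Cder_unique f w); [now apply H | now apply H']).
assert (T : forall (u v : C -> C) (w l l' : C), (forall w, U w -> u w = v w) -> U w -> Cder u w l -> Cder v w l' -> l = l').
{ intros u v w l l' E Hw D D'; destruct (HU w Hw) as [d [Hd K]].
  apply (Cder_unique v w); [|exact D']. apply Cder_ext with (3 := D) (d := d); [exact Hd|]; intros y Hy; apply E, K, Hy. }
assert (E2 : forall w, U w -> f2 w = k2 w) by (intros w Hw; apply (T f1 k1 w); [exact E1 | exact Hw | now apply H | now apply H']).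
intros w Hw; apply (T f2 k2 w); [exact E2 | exact Hw | now apply H | now apply H'].
Qed.

Lemma Pser_D3 a r : cvr a r -> D3on (disc 0 r) (Pser a) (Pser (der (der (der a)))).
Proof.
intros Ha; exists (Pser (der a)), (Pser (der (der a))); intros w Hw; apply -> disc_0 in Hw.
repeat split; apply Pser_Cder with r; try exact Hw; now repeat apply cvr_der.
Qed.

Lemma f_zzz_base (t z : C) (rho : R) : (0 < Im t)%R -> lat_free t rho -> (0 < Cmod z < rho)%R ->
  f_zzz z t = - / (twopi_i * z) + Pser (der (der (der (f_coef 1 t)))) z.
Proof.
intros Ht Hlat Hz; assert (Hz0 : z <> 0) by (apply (proj2 (Cmod_gt_0 z)); lra).
destruct (f_branch_base t z rho ((Cmod z + rho) / 2) Ht Hz0 ltac:(lra) Hlat) as [s [Hs [G HC]]].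
set (r := ((Cmod z + rho) / 2)%R) in *. assert (Hr : (Cmod z < r)%R) by (unfold r; lra).
set (U := fun w => disc z (Cmod z) w /\ disc 0 r w).
assert (HU : Copen U).
{ intros w [W1 W2]; destruct (disc_open _ _ _ W1) as [d1 [Hd1 K1]], (disc_open _ _ _ W2) as [d2 [Hd2 K2]].
  exists (Rmin d1 d2); split; [now apply Rmin_pos|]; intros v Hv; unfold disc in Hv.
  pose proof (Rmin_l d1 d2); pose proof (Rmin_r d1 d2); split; [apply K1 | apply K2]; unfold disc; lra. }
assert (Htt : disc t s t) by now apply disc_center.
assert (D1 := f_branch_D3 _ _ U t (cone_open _ _ _ _) (fun p H => proj1 (HC (snd p) (proj2 (proj2 H))))
   (fun w H => conj (proj1 H) (conj (proj2 H) Htt)) G).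
assert (D2 := D3on_plus U (log_part z) (Pser (f_coef 1 t)) _ _
   (D3on_mono _ _ _ _ (fun w (H : U w) => proj1 H) (log_part_D3 z Hz0))
   (D3on_mono _ _ _ _ (fun w (H : U w) => proj2 H) (Pser_D3 _ _ (proj2 (HC t Htt))))).
apply (D3on_det U _ _ _ HU D1 D2 z); split; [apply disc_center; lra | now apply disc_0].
Qed.

Lemma f_zzz_add_lattice (t z : C) (m n : Z) : (0 < Im t)%R -> off_lattice t z -> f_zzz (z + ZC m + ZC n * t) t = f_zzz z t + ZC n.
Proof.
intros Ht Hz.
rewrite <- (Cmult_1_r (ZC m)).
assert (E1 : f_zzz (z + ZC m * 1 + ZC n * t) t - ZC 0 = f_zzz (z + ZC m * 1) t + ZC n).
{ set (f := fun z => f_zzz z t - RtoC (Im z / Im t)).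
  assert (E : f (z + ZC m * 1 + ZC n * t) = f (z + ZC m * 1)).
  { apply (nat_periodic f (off_lattice t) t).
    - intros w Hw; unfold f; rewrite f_zzz_add_tau by assumption.
      replace (Im (w + t) / Im t)%R with (Im w / Im t + 1)%R by (change (Im (w + t)) with (Im w + Im t)%R; field; lra).
      rewrite RtoC_plus; ring.
    - intros w k Hw; replace (w + ZC k * t) with (w + ZC 0 + ZC k * t) by (unfold ZC; ring); now apply off_lattice_add.
    - replace (z + ZC m * 1) with (z + ZC m + ZC 0 * t) by (unfold ZC; ring); now apply off_lattice_add. }
  unfold f in E.
  assert (EI : (Im (z + ZC m * 1 + ZC n * t) / Im t = Im (z + ZC m * 1) / Im t + IZR n)%R).
  { destruct z as [a b], t as [c d]; unfold ZC; simpl in *; field; lra. }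
  rewrite EI, RtoC_plus in E; change (RtoC (IZR n)) with (ZC n) in E.
  replace (f_zzz (z + ZC m * 1 + ZC n * t) t) with
    (f_zzz (z + ZC m * 1 + ZC n * t) t - (RtoC (Im (z + ZC m * 1) / Im t) + ZC n) + (RtoC (Im (z + ZC m * 1) / Im t) + ZC n)) by ring.
  rewrite E; unfold ZC; ring. }
assert (E2 : f_zzz (z + ZC m * 1) t = f_zzz z t).
{ apply (nat_periodic (fun z => f_zzz z t) (fun _ => True) 1); try easy; intros w _; apply f_zzz_add_1. }
rewrite E2 in E1; rewrite <- E1; unfold ZC; ring.
Qed.

Lemma list_min {T : Type} (f : T -> R) (P : T -> Prop) (l : list T) : (exists x, In x l /\ P x) ->
  exists x, In x l /\ P x /\ forall y, In y l -> P y -> (f x <= f y)%R.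
Proof.
induction l as [|a l IH]; [intros [x [[] _]]|].
intros [x [Hx Px]].
destruct (classic (exists y, In y l /\ P y)) as [He|He].
- destruct (IH He) as [y [Hy [Py K]]].
  destruct (classic (P a /\ (f a <= f y)%R)) as [[Pa Ha]|Hn].
  + exists a; split; [now left|]; split; [exact Pa|]; intros w [->|Hw] Pw; [apply Rle_refl|].
    apply Rle_trans with (1 := Ha), K; assumption.
  + exists y; split; [now right|]; split; [exact Py|]; intros w [->|Hw] Pw; [|now apply K].
    apply Rnot_lt_le; intros Hlt; apply Hn; split; [exact Pw | lra].
- exists x; split; [exact Hx|]; split; [exact Px|]; intros w Hw Pw.
  assert (forall w, In w (a :: l) -> P w -> w = a) as Ea by (intros w' [->|Hw'] Pw'; [reflexivity | exfalso; apply He; now exists w']).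
  rewrite (Ea x Hx Px), (Ea w Hw Pw); apply Rle_refl.
Qed.

(** A disc contains finitely many lattice points, so there is a shortest nonzero one. *)
Lemma lattice_min (t : C) (rho : R) : (0 < Im t)%R -> ~ lat_free t rho ->
  exists m n : Z, (m <> 0 \/ n <> 0)%Z /\ (Cmod (ZC n * t + ZC m) < rho)%R /\ lat_free t (Cmod (ZC n * t + ZC m)).
Proof.
intros Ht Hn; destruct (lattice_coord_bound t Ht) as [c [Hc Kc]].
destruct (INR_unbounded (rho / c)) as [B HB].
apply (Rmult_lt_compat_r c) in HB; [|exact Hc]. replace (rho / c * c)%R with rho in HB by (field; lra).
set (zs := map (fun i => (Z.of_nat i - Z.of_nat B)%Z) (seq 0 (2 * B + 1))).
assert (Hzs : forall k, (Z.abs k <= Z.of_nat B)%Z -> In k zs).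
{ intros k Hk; apply in_map_iff; exists (Z.to_nat (k + Z.of_nat B)); split; [lia | apply in_seq; lia]. }
set (f := fun p : Z * Z => Cmod (ZC (snd p) * t + ZC (fst p))).
assert (Hbox : forall m n : Z, (f (m, n) < rho)%R -> In (m, n) (list_prod zs zs)).
{ intros m n H; unfold f, ZC in H; cbn [fst snd] in H; specialize (Kc (IZR n) (IZR m)).
  assert (Hs : (Rabs (IZR n) + Rabs (IZR m) < INR B)%R).
  { apply (Rmult_lt_reg_r c); [exact Hc|]; lra. }
  rewrite <- !abs_IZR, INR_IZR_INZ, <- plus_IZR in Hs; apply lt_IZR in Hs.
  apply in_prod; apply Hzs; lia. }
destruct (list_min f (fun p => (fst p <> 0 \/ snd p <> 0)%Z /\ (f p < rho)%R) (list_prod zs zs)) as [[m n] [_ [[H1 H2] H3]]].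
- apply NNPP; intros Hne; apply Hn; intros m n Hmn; apply Rnot_lt_le; intros Hlt; apply Hne.
  exists (m, n); split; [now apply Hbox | now split].
- exists m, n; split; [exact H1|]; split; [exact H2|]; intros m' n' H'.
  destruct (Rlt_le_dec (f (m', n')) rho) as [Hlt|Hle].
  + apply (H3 (m', n')); [now apply Hbox | now split].
  + unfold f in *; cbn [fst snd] in *; lra.
Qed.

(** [f_zzz] has poles at the lattice points, hence so does the third derivative of
    the sum of the series, which cannot converge beyond the nearest one. *)
Lemma lat_free_of_cvr (t : C) (R0 : R) : (0 < Im t)%R -> (0 < R0)%R -> cvr (f_coef 1 t) R0 -> lat_free t R0.
Proof.
intros Ht HR0 HC; apply NNPP; intros Hn.
destruct (lattice_min t R0 Ht Hn) as [m [n [Hmn [Hlt Hfree]]]].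
set (om := ZC n * t + ZC m) in *; set (D := Pser (der (der (der (f_coef 1 t))))).
pose proof twopi_i_neq_0 as Hp.
assert (Hom : (0 < Cmod om)%R).
{ destruct (lattice_coord_bound t Ht) as [c [Hc Kc]]; specialize (Kc (IZR n) (IZR m)).
  apply Rlt_le_trans with (2 := Kc), Rmult_lt_0_compat; [exact Hc|].
  pose proof (Rabs_pos (IZR n)); pose proof (Rabs_pos (IZR m)).
  assert (A : forall k : Z, (k <> 0)%Z -> (0 < Rabs (IZR k))%R) by (intros k Hk; apply Rabs_pos_lt; now apply not_0_IZR).
  destruct Hmn as [H1|H1]; apply A in H1; lra. }
assert (Nom : om <> 0) by (apply (proj2 (Cmod_gt_0 om)); exact Hom).
assert (HD : forall w : C, (Cmod w < R0)%R -> Cder D w (Pser (der (der (der (der (f_coef 1 t))))) w)).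
{ intros w Hw; apply Pser_Cder with R0; [now repeat apply cvr_der | exact Hw]. }
(* This is [- u] times the right side minus the left side of
   [f_zzz (om (1 - u)) = f_zzz (- om u) + n], with both values written as pole plus power series. It
   vanishes for real [u] between [0] and [1], but its value at [0] is [- / (twopi_i * om)]. *)
set (f := fun u : C => - / (twopi_i * om) - u * (D (- om * u) + ZC n + / (twopi_i * om) * / (1 - u) - D (om * (1 - u)))).
assert (Hf0 : f 0 = 0).
{ apply Ccont_zero.
  - eapply Cder_cont; unfold f.
    apply Cder_minus; [apply Cder_const|]. apply Cder_mult; [apply Cder_id|].
    apply Cder_minus; [apply Cder_plus; [apply Cder_plus; [|apply Cder_const]|]|].
    + apply (Cder_comp (fun u => - om * u) D); [apply Cder_scal, Cder_id|].
      apply HD; rewrite Cmult_0_r, Cmod_0; exact HR0.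
    + apply Cder_scal, (Cder_comp (fun u => 1 - u) Cinv); [apply Cder_minus; [apply Cder_const | apply Cder_id]|].
      apply Cder_inv; intros E; apply C1_nz; rewrite <- E; ring.
    + apply (Cder_comp (fun u => om * (1 - u)) D); [apply Cder_scal, Cder_minus; [apply Cder_const | apply Cder_id]|].
      apply HD; replace (om * (1 - 0)) with om by ring; exact Hlt.
  - intros d Hd; set (x := (Rmin d 1 / 2)%R).
    assert (Hm : (0 < Rmin d 1)%R) by (apply Rmin_pos; lra); pose proof (Rmin_l d 1); pose proof (Rmin_r d 1).
    assert (Hx : (0 < x < 1)%R) by (unfold x; lra).
    exists (RtoC x); split.
    + replace (RtoC x - 0) with (RtoC x) by ring; rewrite Cmod_R, Rabs_pos_eq by lra; unfold x; lra.
    + assert (Nx : RtoC x <> 0) by (intros E; apply RtoC_inj in E; lra).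
      assert (Nx1 : 1 - RtoC x <> 0) by (rewrite <- RtoC_minus; intros E; apply RtoC_inj in E; lra).
      assert (C1 : Cmod (- om * RtoC x) = (Cmod om * x)%R) by (rewrite Cmod_mult, Cmod_opp, Cmod_R, Rabs_pos_eq by lra; reflexivity).
      assert (C2 : Cmod (om * (1 - RtoC x)) = (Cmod om * (1 - x))%R) by (rewrite <- RtoC_minus, Cmod_mult, Cmod_R, Rabs_pos_eq by lra; reflexivity).
      assert (K1 := f_zzz_base t (- om * RtoC x) _ Ht Hfree ltac:(rewrite C1; nra)).
      assert (K2 := f_zzz_base t (om * (1 - RtoC x)) _ Ht Hfree ltac:(rewrite C2; nra)).
      assert (Hnl : off_lattice t (- om * RtoC x)).
      { intros [m' [n' E]]; destruct (classic (m' <> 0 \/ n' <> 0)%Z) as [Hnz|Hz].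
        - specialize (Hfree m' n' Hnz); rewrite Cplus_comm, <- E, C1 in Hfree; nra.
        - assert (m' = 0%Z /\ n' = 0%Z) as [-> ->] by lia. unfold ZC in E; rewrite Cmult_0_l, Cplus_0_l in E; rewrite E, Cmod_0 in C1; nra. }
      assert (K3 := f_zzz_add_lattice t _ m n Ht Hnl).
      replace (- om * RtoC x + ZC m + ZC n * t) with (om * (1 - RtoC x)) in K3 by (unfold om; ring).
      rewrite K1, K2 in K3; fold D in K3; unfold f.
      replace (D (- om * RtoC x)) with (- / (twopi_i * (om * (1 - RtoC x))) + D (om * (1 - RtoC x)) - ZC n + / (twopi_i * (- om * RtoC x)))
        by (rewrite K3; ring).
      field; repeat split; assumption. }
unfold f in Hf0; apply (C1_nz); transitivity (/ (twopi_i * om) * (twopi_i * om)); [field; now split|].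
replace (/ (twopi_i * om)) with (RtoC 0); [ring|].
transitivity (- (- / (twopi_i * om) - 0 * (D (- om * 0) + ZC n + / (twopi_i * om) * / (1 - 0) - D (om * (1 - 0))))); [rewrite Hf0; ring | ring].
Qed.

(** * The expansion at the origin *)

Lemma li3_one_lambert3 t : (0 < Im t)%R -> li3_one t = / twopi_i ^ 3 * (Li3_disc 1 + 2 * lambert3 (e2pi t) (e2pi t)).
Proof.
intros Ht; pose proof (Cmod_e2pi_lt_1 t Ht) as Hq; set (q := e2pi t) in *.
destruct (Lambert_Li3 q q Hq ltac:(lra)) as [H1 [_ H2]].
assert (E : forall n, q ^ n * q = q ^ S n) by (intros n; simpl; ring).
assert (H1' : asum (fun n => Li3_disc (q ^ S n))) by (apply asum_ext with (2 := H1); intros n; now rewrite E).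
unfold li3_one; fold q; rewrite (CSeries_incr (fun n => Li3_disc (q ^ n))) by now apply asum_incr.
rewrite (CSeries_ext (fun n => Li3_disc (q ^ S n)) (fun n => Li3_disc (q ^ n * q))) by (intros n; now rewrite E).
rewrite H2; simpl Cpow; ring.
Qed.

Lemma Ci_pow_even j : Ci ^ (2 * j) = (- (1)) ^ j.
Proof.
induction j as [|j IH]; [reflexivity|].
assert (E : Ci ^ 2 = - (1)) by (apply C_ext; simpl; ring).
replace (2 * S j)%nat with (2 + 2 * j)%nat by lia; rewrite Cpow_add_r, IH, E; reflexivity.
Qed.

Lemma pow_opp_1_even j : (- (1)) ^ (2 * j) = 1.
Proof. rewrite pow_opp_1; now rewrite pow_1_even. Qed.

Lemma pow_opp_1_odd j : (- (1)) ^ S (2 * j) = - (1).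
Proof. rewrite pow_opp_1, pow_1_odd, <- RtoC_opp; f_equal; ring. Qed.

Lemma f_coef_odd t m : f_coef 1 t (2 * m + 1 + 4) = 0.
Proof.
replace (2 * m + 1 + 4)%nat with (S (S (S (S (S (2 * m)))))) by lia.
unfold f_coef, tail_coef, int3; cbn [int cubic_coef ccons].
replace (S (S (S (S (S (2 * m)))))) with (S (2 * (m + 2))) by lia; rewrite pow_opp_1_odd.
unfold gpolar; replace (S (S (S (2 * m)))) with (2 * m + 3)%nat by lia; rewrite bern_coef_odd.
unfold Cdiv; ring.
Qed.

Lemma factC_S n : factC (S n) = natC (S n) * factC n.
Proof. unfold factC, natC; rewrite fact_simpl, mult_INR, RtoC_mult; reflexivity. Qed.

(** The Bernoulli number comes from the expansion of the summand with argument [z], the divisor sums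
    from the Lambert tail; together they form [B_(2n) E_(2n)] with [n = m + 1]. *)
Lemma f_coef_even t z m : (0 < Im t)%R -> f_coef 1 t (2 * m + 4) * z ^ (2 * m + 4) = / twopi_i ^ 3 * taylor_term z t m.
Proof.
intros Ht; pose proof twopi_i_neq_0 as Hp.
assert (Hb := bern_coef_even m).
assert (Nb : RtoC (bern_coef (2 * m + 2)) <> 0) by (intros E; apply RtoC_inj in E; contradiction).
assert (Em : moment (tailc 1 t) (2 * m + 4) = CSeries (fun N => natC (sigma (2 * S m - 1) (S N)) * e2pi t ^ S N)).
{ rewrite sigma_Lambert by exact Ht; f_equal; lia. }
unfold taylor_term, Eisenstein; rewrite <- Em; set (Mo := moment (tailc 1 t) (2 * m + 4)).
replace (2 * S m)%nat with (2 * m + 2)%nat by lia.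
assert (Eb : bernC (2 * m + 2) = factC (2 * m + 2) * RtoC (bern_coef (2 * m + 2))) by (unfold bernC, bernoulli; now rewrite RtoC_mult).
rewrite Eb.
assert (Ez : (- (1)) ^ S m * (2 * PI * z) ^ (2 * m + 2 + 2) = - (twopi_i ^ 3 * twopi_i ^ (2 * m + 1)) * z ^ (2 * m + 4)).
{ rewrite <- Cpow_add_r; replace (3 + (2 * m + 1))%nat with (2 * (m + 2))%nat by lia.
  replace (2 * m + 2 + 2)%nat with (2 * (m + 2))%nat by lia; replace (2 * m + 4)%nat with (2 * (m + 2))%nat by lia.
  unfold twopi_i; rewrite !(Cpow_mult_l _ _ (2 * (m + 2))), Ci_pow_even.
  replace (m + 2)%nat with (S (S m)) by lia; simpl ((- (1)) ^ S (S m)); simpl ((- (1)) ^ S m).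
  generalize ((- (1)) ^ m) as y; intros y; ring. }
set (Z := (2 * PI * z) ^ (2 * m + 2 + 2)) in *.
unfold f_coef, tail_coef, int3, expsum.
fold Mo.
assert (E1 : int (int (int gpolar)) (2 * m + 4) = - (RtoC (bern_coef (2 * m + 2)) * twopi_i ^ (2 * m + 1))
   / natC (2 * m + 2) / natC (2 * m + 3) / natC (2 * m + 4)).
{ replace (2 * m + 4)%nat with (S (S (S (S (2 * m))))) by lia; cbn [int]; unfold gpolar.
  replace (2 * m + 2)%nat with (S (S (2 * m))) by lia; replace (2 * m + 3)%nat with (S (S (S (2 * m)))) by lia.
  replace (2 * m + 1)%nat with (S (2 * m)) by lia.
  replace (- twopi_i) with (- (1) * twopi_i) by ring; rewrite Cpow_mult_l, pow_opp_1_odd; unfold Cdiv; ring. }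
assert (E2 : cubic_coef t (2 * m + 4) = 0) by (replace (2 * m + 4)%nat with (S (S (S (S (2 * m))))) by lia; reflexivity).
assert (E3 : (- (1)) ^ (2 * m + 4) = 1) by (replace (2 * m + 4)%nat with (2 * (m + 2))%nat by lia; apply pow_opp_1_even).
assert (E4 : expc (2 * m + 4) = / (natC (2 * m + 4) * natC (2 * m + 3) * factC (2 * m + 2))).
{ unfold expc; replace (2 * m + 4)%nat with (S (S (2 * m + 2))) by lia; rewrite !factC_S.
  replace (S (2 * m + 2)) with (2 * m + 3)%nat by lia; f_equal; ring. }
assert (E5 : factC (2 * m + 2 + 2) = natC (2 * m + 4) * natC (2 * m + 3) * factC (2 * m + 2)).
{ replace (2 * m + 2 + 2)%nat with (S (S (2 * m + 2))) by lia; rewrite !factC_S.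
  replace (S (S (2 * m + 2))) with (2 * m + 4)%nat by lia; replace (S (2 * m + 2)) with (2 * m + 3)%nat by lia; ring. }
assert (E6 : twopi_i ^ (2 * m + 4) = twopi_i ^ 3 * twopi_i ^ (2 * m + 1)) by (rewrite <- Cpow_add_r; f_equal; lia).
rewrite E1, E2, E3, E4, E5, E6.
assert (N1 : natC (2 * m + 2) <> 0) by (replace (2 * m + 2)%nat with (S (2 * m + 1)) by lia; apply natC_S_neq_0).
assert (N2 : natC (2 * m + 3) <> 0) by (replace (2 * m + 3)%nat with (S (2 * m + 2)) by lia; apply natC_S_neq_0).
assert (N3 : natC (2 * m + 4) <> 0) by (replace (2 * m + 4)%nat with (S (2 * m + 3)) by lia; apply natC_S_neq_0).
pose proof (factC_neq_0 (2 * m + 2)) as N4.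
set (b := RtoC (bern_coef (2 * m + 2))) in *; set (f := factC (2 * m + 2)) in *.
set (n0 := natC (2 * m + 2)) in *; set (n1 := natC (2 * m + 3)) in *; set (n2 := natC (2 * m + 4)) in *.
set (T := twopi_i ^ (2 * m + 1)) in *; set (zz := z ^ (2 * m + 4)) in *.
transitivity (/ twopi_i ^ 3 * (((- (1)) ^ S m * Z) * ((1 - 2 * n0 / (f * b) * Mo) * (f * b) / (n2 * n1 * f * n0)))).
- rewrite Ez; clearbody b f n0 n1 n2 T zz Mo; field; repeat split; assumption.
- unfold Cdiv; ring.
Qed.

(** The coefficient of [z^2] is where [log eta] enters. In that of [z^3], the [1/12] of the
    polynomial part cancels against the contribution [B_1 / 6]. *)
Lemma f_coef_low t : (0 < Im t)%R -> f_coef 1 t 0 = - (/ twopi_i ^ 3 * Li3_disc 1) /\ f_coef 1 t 1 = 0 /\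
  f_coef 1 t 2 = - / twopi_i * logeta0 t /\ f_coef 1 t 3 = 0.
Proof.
intros Ht; pose proof twopi_i_neq_0 as Hp.
assert (M0 : moment (tailc 1 t) 0 = lambert3 (e2pi t) (e2pi t)).
{ apply CSeries_ext; intros m; unfold tailc; replace (e2pi t ^ 1) with (e2pi t) by (simpl; ring); simpl (natC (S m) ^ 0); ring. }
unfold f_coef, tail_coef, int3, expsum, expc; cbn [int cubic_coef ccons].
rewrite M0, li3_one_lambert3 by exact Ht; unfold factC; repeat split.
- unfold natC; simpl; field; exact Hp.
- simpl; unfold Cdiv; ring.
- unfold logeta0, natC; simpl; rewrite !RtoC_plus; field; exact Hp.
- unfold gpolar; rewrite bern_coef_1; unfold natC; simpl.
  rewrite !RtoC_plus, RtoC_opp, RtoC_inv by lra; field; exact Hp.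
Qed.

Lemma taylor_Pser (t z : C) (r : R) : (0 < Im t)%R -> cvr (f_coef 1 t) r -> (Cmod z < r)%R ->
  exists s, is_Cseries (taylor_term z t) s /\
    Pser (f_coef 1 t) z = - (/ twopi_i ^ 3 * Li3_disc 1) - / twopi_i * (z ^ 2 * logeta0 t) + / twopi_i ^ 3 * s.
Proof.
intros Ht HC Hz; pose proof twopi_i_neq_0 as Hp; pose proof (Cpow_nz _ 3 Hp) as Hp3.
destruct (f_coef_low t Ht) as [L0 [L1 [L2 L3]]].
assert (H := cvr_asum _ _ _ HC Hz).
assert (H4 := proj2 (asum_incr_n (fun k => f_coef 1 t k * z ^ k) 4) H); cbv beta in H4.
destruct (CSeries_even_odd _ H4) as [He [_ E]].
set (s := twopi_i ^ 3 * CSeries (fun n => f_coef 1 t (2 * n + 4) * z ^ (2 * n + 4))).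
exists s; split.
- apply is_Cseries_ext with (2 := is_Cseries_scal (twopi_i ^ 3) _ _ (asum_is _ He)); intros m.
  rewrite f_coef_even by exact Ht; field; exact Hp.
- assert (S : is_Cseries (fun k => f_coef 1 t k * z ^ k) (psum (fun k => f_coef 1 t k * z ^ k) 4 + / twopi_i ^ 3 * s)).
  { apply is_Cseries_psum.
    replace (/ twopi_i ^ 3 * s) with (CSeries (fun k => f_coef 1 t (k + 4) * z ^ (k + 4))); [now apply asum_is|].
    rewrite E, (CSeries_ext (fun n => f_coef 1 t (2 * n + 1 + 4) * z ^ (2 * n + 1 + 4)) (fun _ => 0)), CSeries_zero.
    - unfold s; field; exact Hp.
    - intros n; rewrite f_coef_odd; ring. }
  unfold Pser; rewrite (is_Cseries_unique _ _ S); cbn [psum]; rewrite L0, L1, L2, L3; simpl Cpow; ring.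
Qed.

Lemma is_Cseries_bounded u l : is_Cseries u l -> exists M, forall n, (Cmod (u n) <= M)%R.
Proof.
intros H; destruct (is_Cseries_lim0 _ _ H 1%R ltac:(lra)) as [N HN].
exists (1 + sum_n (fun k => Cmod (u k)) N)%R.
assert (P0 : forall n, (0 <= sum_n (fun k => Cmod (u k)) n)%R).
{ induction n as [|n IH]; [rewrite sum_O | rewrite sum_Sn; apply Rplus_le_le_0_compat; [exact IH|]]; apply Cmod_ge_0. }
assert (P1 : forall n k, (k <= n)%nat -> (Cmod (u k) <= sum_n (fun k => Cmod (u k)) n)%R).
{ induction n as [|n IH]; intros k Hk.
  - rewrite sum_O; replace k with 0%nat by lia; apply Rle_refl.
  - rewrite sum_Sn; change (Cmod (u k) <= sum_n (fun k => Cmod (u k)) n + Cmod (u (S n)))%R.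
    destruct (Nat.eq_dec k (S n)) as [->|Hne]; [specialize (P0 n); lra|].
    specialize (IH k ltac:(lia)); pose proof (Cmod_ge_0 (u (S n))); lra. }
intros n; destruct (le_lt_dec N n) as [Hn|Hn].
- specialize (HN n Hn); specialize (P0 N); lra.
- specialize (P1 N n ltac:(lia)); lra.
Qed.

(** Convergence at the single point [z] bounds the even terms, and the odd ones vanish, so the whole
    power series has radius at least [Cmod z]. *)
Lemma taylor_cvr (t z s : C) : (0 < Im t)%R -> z <> 0 -> is_Cseries (taylor_term z t) s -> cvr (f_coef 1 t) (Cmod z).
Proof.
intros Ht Hz H; apply (is_Cseries_scal (/ twopi_i ^ 3)) in H.
destruct (is_Cseries_bounded _ _ H) as [M HM].
assert (Hz0 : (0 < Cmod z)%R) by now apply (proj1 (Cmod_gt_0 z)).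
assert (HM0 : (0 <= M)%R) by (eapply Rle_trans; [apply Cmod_ge_0 | apply (HM 0%nat)]).
do 4 apply cvr_shift; apply cvr_bounded with (M / Cmod z ^ 4)%R; intros k.
assert (E : (Cmod (f_coef 1 t (S (S (S (S k))))) * Cmod z ^ k = Cmod (f_coef 1 t (k + 4) * z ^ (k + 4)) / Cmod z ^ 4)%R).
{ rewrite Cmod_mult, Cmod_pow, pow_add; replace (k + 4)%nat with (S (S (S (S k)))) by lia; field; lra. }
rewrite E; apply Rmult_le_compat_r; [left; apply Rinv_0_lt_compat, pow_lt, Hz0|].
destruct (Nat.Even_or_Odd k) as [[j ->]|[j ->]].
- rewrite f_coef_even by exact Ht; apply HM.
- rewrite f_coef_odd, Cmult_0_l, Cmod_0; exact HM0.
Qed.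

Lemma taylor_converges (t : C) : (0 < Im t)%R -> exists r : R, (0 < r)%R /\
  forall x : C, (Cmod x < r)%R -> ex_Cseries (taylor_term x t).
Proof.
(* [1] is the radius for the expansion of [li3_D3] at its pole, [Im t] the range of the Lambert
   tail. *)
intros Ht; set (r := Rmin 1 (Im t)).
assert (Hr : (0 < r)%R) by (apply Rmin_pos; lra).
pose proof (Rmin_l 1 (Im t)) as R1; pose proof (Rmin_r 1 (Im t)) as R2; fold r in R1, R2.
exists r; split; [exact Hr|]; intros x Hx.
destruct (taylor_Pser t x r Ht) as [s [Hs _]]; [|exact Hx | now exists s].
apply cvr_plus; [apply cvr_plus|].
- apply cvr_mono with 1%R; [exact R1 | apply cvr_int3, gpolar_spec].
- apply tail_coef_Pser; [exact Ht | simpl INR; lra].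
- apply cubic_coef_Pser.
Qed.

Lemma f_taylor : differ_by_quadratic (fun p => fst p) (fun p => snd p)
  (mv_f (fun p => fst p) (fun p => snd p)) mv_taylor.
Proof.
apply differ_by_quadratic_intro; intros Om HO HC HR F G HF [logz [logeta [Hlz [Hle HG]]]].
apply mv_f_f_branch_id in HF; [|exact HR].
apply quad_local_global; [exact HO | exact HC |]; intros p0 Hp0.
destruct (open_pdisc Om p0 HO Hp0) as [e [He Ke]]; destruct p0 as [z0 t0].
change C in z0; change C in t0.
destruct (HR _ Hp0) as [Ht0 Hreg]; cbn [fst snd] in Ht0, Hreg.
assert (Hz0 : z0 <> 0) by (intros E; apply (Hreg 0%Z 0%Z); rewrite E; ring).
assert (Hm0 : (0 < Cmod z0)%R) by now apply (proj1 (Cmod_gt_0 z0)).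
(* a point of [Om] further from the origin shows that there are no lattice points in the closed disc of radius [Cmod z0] *)
set (dl := (e / (2 * Cmod z0))%R).
assert (Hdl : (0 < dl /\ dl * Cmod z0 < e)%R).
{ split; [unfold dl; apply Rdiv_lt_0_compat; lra|]. replace (dl * Cmod z0)%R with (e / 2)%R by (unfold dl; field; lra); lra. }
set (z1 := RtoC (1 + dl) * z0). set (rho := Cmod z1).
assert (Erho : rho = ((1 + dl) * Cmod z0)%R) by (unfold rho, z1; rewrite Cmod_mult, Cmod_R, Rabs_pos_eq by lra; reflexivity).
assert (Hrho : (Cmod z0 < rho)%R) by (rewrite Erho; nra).
assert (Hfree : lat_free t0 rho).
{ assert (H1 : Om (z1, t0)).
  { apply Ke; split; cbn [fst snd]; [|now apply disc_center]. unfold disc, z1.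
    replace (RtoC (1 + dl) * z0 - z0) with (RtoC dl * z0) by (rewrite RtoC_plus; ring).
    rewrite Cmod_mult, Cmod_R, Rabs_pos_eq by lra; lra. }
  specialize (HG _ H1); cbv beta iota in HG; destruct HG as [s [Hs _]].
  apply lat_free_of_cvr; [exact Ht0 | lra|]; apply (taylor_cvr t0 z1 s Ht0); [|exact Hs].
  apply (proj2 (Cmod_gt_0 z1)); fold rho; lra. }
set (r := ((Cmod z0 + rho) / 2)%R).
destruct (f_branch_base t0 z0 rho r Ht0 Hz0 ltac:(unfold r; lra) Hfree) as [s [Hs [GH HH]]].
set (d := Rmin (Rmin e s) (Rmin (Cmod z0) (r - Cmod z0))).
assert (Hd : (0 < d)%R) by (unfold r in d; repeat apply Rmin_pos; lra).
assert (Hdb : (d <= e /\ d <= s /\ d <= Cmod z0 /\ d <= r - Cmod z0)%R).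
{ pose proof (Rmin_l (Rmin e s) (Rmin (Cmod z0) (r - Cmod z0))); pose proof (Rmin_r (Rmin e s) (Rmin (Cmod z0) (r - Cmod z0))).
  pose proof (Rmin_l e s); pose proof (Rmin_r e s); pose proof (Rmin_l (Cmod z0) (r - Cmod z0)); pose proof (Rmin_r (Cmod z0) (r - Cmod z0)).
  unfold d; lra. }
assert (Hcone : forall q, rect z0 d t0 d q -> Om q /\ cone z0 r t0 s q).
{ intros q [Q1 Q2]; unfold disc in *; split; [apply Ke; split; cbn [fst snd]; unfold disc; lra|].
  split; [unfold disc; lra|]; split; [|unfold disc; lra].
  apply disc_0; pose proof (Cmod_triangle (fst q - z0) z0) as T; replace (fst q - z0 + z0) with (fst q) in T by ring; lra. }
destruct (f_branch_unique (rect z0 d t0 d) F (fun p => log_part z0 (fst p) + Pser (f_coef 1 (snd p)) (fst p))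
   (rect_open _ _ _ _) (rect_connected _ _ _ _)) as [P [HP EP]].
{ apply f_branch_sub with (2 := HF); intros q Hq; now apply Hcone. }
{ apply f_branch_sub with (2 := GH); intros q Hq; now apply Hcone. }
assert (Hdisc1 : forall q, rect z0 d t0 d q -> disc 1 1 (fst q / z0)) by (intros q Hq; apply disc_cone_1; [exact Hz0 | now apply Hcone]).
destruct (log_locally_unique logz (fun p => log1 (fst p / z0) + logz (z0, t0)) (z0, t0) d Hd) as [d1 [Hd1 K1]].
{ apply continuous_pdisc, Hlz, Hp0. }
{ intros eps Heps.
  assert (D : Cder (fun z => log1 (z / z0)) z0 (/ (z0 / z0) * / z0)).
  { apply (Cder_comp (fun z => z / z0) log1).
    - apply Cder_ext_all with (fun z => / z0 * z + 0); [intros; unfold Cdiv; ring | apply Cder_affine].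
    - apply Cder_log1, (Hdisc1 (z0, t0)); split; now apply disc_center. }
  destruct (Cder_cont _ _ _ D eps Heps) as [d' [Hd' K']]; exists d'; split; [exact Hd'|]; intros q [Q1 _]; cbn [fst snd] in *.
  replace (log1 (fst q / z0) + logz (z0, t0) - (log1 (z0 / z0) + logz (z0, t0))) with (log1 (fst q / z0) - log1 (z0 / z0)) by ring.
  now apply K'. }
{ intros q Hq; rewrite Cexp_add, Cexp_log1 by now apply Hdisc1.
  rewrite (proj2 (Hlz _ Hp0)), (proj2 (Hlz q (proj1 (Hcone q Hq)))); cbn [fst]; field; exact Hz0. }
destruct (log_locally_unique logeta (fun p => logeta0 (snd p)) (z0, t0) d Hd) as [d2 [Hd2 K2]].
{ apply continuous_pdisc, Hle, Hp0. }
{ intros eps Heps; destruct (logeta0_cont t0 Ht0 eps Heps) as [d' [Hd' K']]; exists d'; split; [exact Hd'|]; intros q [_ Q2]; now apply K'. }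
{ intros q Hq; destruct (Hcone q Hq) as [Q1 _]; rewrite (proj2 (Hle q Q1)), Cexp_logeta0; [reflexivity | now apply HR]. }
(* The given logarithms differ from the local ones by constants, which contribute only multiples of
   [z^2]. *)
set (kz := logz (z0, t0) + (logz (z0, t0) - (log1 (fst (z0, t0) / z0) + logz (z0, t0)))).
set (ke := logeta (z0, t0) - logeta0 (snd (z0, t0))).
set (Q := fun p : C * C => - (/ twopi_i ^ 3 * Li3_disc 1) + / twopi_i * (/ 2 * kz + ke) * fst p ^ 2).
exists (Rmin d (Rmin d1 d2)), (fun p => P p + Q p); split; [apply Rmin_pos; [exact Hd | now apply Rmin_pos]|]; split.
- apply quad_plus; [exact HP|].
  exists (- (/ twopi_i ^ 3 * Li3_disc 1)), 0, 0, (/ twopi_i * (/ 2 * kz + ke)), 0, 0; intros p; unfold Q; ring.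
- intros q Hq; pose proof (Rmin_l d (Rmin d1 d2)); pose proof (Rmin_r d (Rmin d1 d2)); pose proof (Rmin_l d1 d2); pose proof (Rmin_r d1 d2).
  assert (Hq0 : rect z0 d t0 d q) by (apply (pdisc_mono (z0, t0)) with (2 := Hq); lra).
  rewrite <- (EP q Hq0); destruct (Hcone q Hq0) as [O1 [C1 [C2 C3]]].
  specialize (K1 q ltac:(apply pdisc_mono with (2 := Hq); lra)); specialize (K2 q ltac:(apply pdisc_mono with (2 := Hq); lra)).
  specialize (HG q O1); destruct q as [z t]; cbn [fst snd] in *; destruct HG as [s' [Hs' EG]].
  apply -> disc_0 in C2; destruct (HH t C3) as [Ht Hcv].
  destruct (taylor_Pser t z r Ht Hcv C2) as [s2 [Hs2 EP2]].
  rewrite (is_Cseries_fun_unique _ _ _ Hs' Hs2) in EG.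
  rewrite EG, K1, K2, EP2; unfold Q, kz, ke, log_part; cbn [fst snd].
  match goal with |- ?a = ?b => change (@eq C a b) end; ring.
Qed.

Theorem proposition8 :
  let z : C * C -> C := fun p => fst p in
  let tau : C * C -> C := fun p => snd p in
  (* f(z+1,tau) ~ f(z,tau) *)
  differ_by_quadratic z tau (mv_f (fun p => z p + 1) tau) (mv_f z tau) /\
  (* f(z,tau+1) ~ f(z,tau) *)
  differ_by_quadratic z tau (mv_f z (fun p => tau p + 1)) (mv_f z tau) /\
  (* f(z+tau,tau) ~ f(z,tau) + cubic *)
  differ_by_quadratic z tau (mv_f (fun p => z p + tau p) tau)
    (mv_map (fun p w => w + (/ 6 * z p ^ 3 + / 4 * z p ^ 2 * tau p
                             + / 6 * z p * tau p ^ 2 + / 24 * tau p ^ 3))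
            (mv_f z tau)) /\
  (* f(-z,tau) ~ f(z,tau) *)
  differ_by_quadratic z tau (mv_f (fun p => - z p) tau) (mv_f z tau) /\
  (* expansion at z = 0: convergence for small z, and equivalence with f
     on every connected open set where it converges *)
  (forall t : C, (0 < Im t)%R ->
     exists r : R, (0 < r)%R /\
       forall x : C, (Cmod x < r)%R -> ex_Cseries (taylor_term x t)) /\
  differ_by_quadratic z tau (mv_f z tau) mv_taylor /\
  (* expansion in powers of q *)
  (forall x t : C, (Rabs (Im x) < Im t)%R -> ex_Cseries (fourier_term x t)) /\
  differ_by_quadratic z tau (mv_f z tau) mv_fourier /\
  (* inversion: quadratic in the arguments z/tau and -1/tau of the left side *)
  differ_by_quadratic (fun p => z p / tau p) (fun p => - (1) / tau p)
    (mv_f (fun p => z p / tau p) (fun p => - (1) / tau p))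
    (mv_map (fun p w => / tau p ^ 2 * w - / tau p ^ 3 * (z p ^ 4 / factC 4))
            (mv_f z tau)).
Proof.
cbv zeta; repeat match goal with |- _ /\ _ => split end.
- exact f_period_1.
- exact f_period_tau.
- exact f_shift_tau.
- exact f_even.
- exact taylor_converges.
- exact f_taylor.
- exact fourier_converges.
- exact f_fourier.
- exact f_inversion.
Qed.
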